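(* Let $K$ be a Lie group and $H\subset K$ a closed Lie subgroup such that $K$ acts effectively on $K/H$, and let $\mathfrak{k},\mathfrak{h}$ be the Lie algebras of $K$ and $H$. There is a 1:1 correspondence between $K$-invariant $GN$-structures $P\to K/H$ and $ad(H)$-invariant quadruples $(\mathfrak{a},\mathfrak{b},(\cdot,\cdot),\beta)$ on $\mathfrak{k}/\mathfrak{h}$; it sends $P$ to the quadruple obtained by restricting the null-quadruple of $P$ to the origin of $K/H$, as described in the context. Under this correspondence the $K$-invariant Kundt structures are given by exactly those $ad(H)$-invariant quadruples $(\mathfrak{a},\mathfrak{b},(\cdot,\cdot),\beta)$ such that: (i) $\mathfrak{b}$ is a Lie subalgebra of $\mathfrak{k}$; (ii) for all $a\in\mathfrak{a}$, the induced map $[a,-]\in \mathrm{End}(\mathfrak{b}/\mathfrak{a})$ is skew-adjoint with respect to the inner product $(\cdot,\cdot)$.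
   Context: **The group $GN$.** On $\mathbb{R}^n$ rename the standard basis $\{k,l,m_1,\dots,m_{n-2}\}$ and let $\eta$ be the Minkowski inner product with $\eta(k,l)=1$, $\eta(m_i,m_j)=\delta_{ij}$ and all other products of basis vectors zero. $GN\subset GL(n,\mathbb{R})$ is the Lie group of invertible linear maps $f$ with (1) $f(k)\in\mathbb{R}k$; (2) $\eta(f(w),f(\tilde w))=\eta(w,\tilde w)$ for all $w,\tilde w\in\{k\}^\perp$; (3) $\eta(f(k),f(z))=\eta(k,z)$ for all $z\in\mathbb{R}^n$. **$GN$-structures.** A $GN$-structure $P\to M$ on an $n$-manifold $M$ is a principal $GN$-subbundle of the frame bundle of $M$ (fibres over $x$ are subsets of $GL(\mathbb{R}^n,T_xM)$, with $GN$ acting on the right). A frame $u$ is written $(X,Y,Z_i)=(u(k),u(l),u(m_i))$, $1\le i\le n-2$. $P$ determines distributions $\lambda_x=u(\mathbb{R}k)$ and $\Lambda_x=u(\{k\}^\perp)$ ($u\in P_x$ arbitrary), of dimension $1$ and codimension $1$, with $\lambda\subset\Lambda$. **Null-quadruple of $P$.** This is $(\lambda,\Lambda,g^\perp,f)$ where $g^\perp$ is the positive definite symmetric bilinear form on $\Lambda/\lambda$ for which, for every $(X,Y,Z_i)\in P$, the classes $[Z_i]$ are orthonormal, and $f$ is the nowhere vanishing linear functional on the line bundle $\lambda\otimes TM/\Lambda$ with $f(X\otimes[Y])=1$ for every $(X,Y,Z_i)\in P$. These are well defined. **Automorphisms.** A diffeomorphism $\phi$ of $M$ is an automorphism of $P$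 if the action of its derivative on frames maps $P$ into itself. A (local) vector field is a (local) infinitesimal automorphism of $P$ if all its (local) flow maps preserve $P$. **Kundt structure.** A $GN$-structure $P\to M$ is a Kundt structure if $\Lambda$ is integrable and about each point of $M$ there exists a nowhere vanishing local vector field belonging to $\lambda$ which is an infinitesimal automorphism of $P$. **Homogeneous setting.** $n=\dim K/H$. $o\in K/H$ is the coset of the identity and $T_o(K/H)$ is identified with $\mathfrak{k}/\mathfrak{h}$ via the derivative of the projection $K\to K/H$ at the identity; $q:\mathfrak{k}\to\mathfrak{k}/\mathfrak{h}$ is the quotient map. A $GN$-structure on $K/H$ is $K$-invariant if left multiplication $L_a:K/H\to K/H$ is an automorphism of it for each $a\in K$. **$ad(H)$-invariant quadruples.** Here ''$ad(H)$-invariant'' means invariant under the adjoint action $\mathrm{Ad}(h)$, $h\in H$, of $H$ on $\mathfrak{k}$ and the induced maps on quotients. An $ad(H)$-invariant quadruple on $\mathfrak{k}/\mathfrak{h}$ is $(\mathfrak{a},\mathfrak{b},(\cdot,\cdot),\beta)$ where: $\mathfrak{h}\subset\mathfrak{a}\subset\mathfrak{b}\subset\mathfrak{k}$ with $\mathfrak{a},\mathfrak{b}$ $ad(H)$-invariant linear subspaces, $\mathfrak{h}$ of codimension $1$ in $\mathfrak{a}$ and $\mathfrak{b}$ of codimension $1$ in $\mathfrak{k}$; $(\cdot,\cdot)$ is a positive definite $ad(H)$-invariant inner product on $\mathfrak{b}/\mathfrak{a}$; $\beta:\mathfrak{a}/\mathfrak{h}\otimes\mathfrak{k}/\mathfrak{b}\to\mathbb{R}$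 is a non-zero $ad(H)$-invariant linear functional. **The correspondence.** A $K$-invariant $GN$-structure with null-quadruple $(\lambda,\Lambda,g^\perp,f)$ is sent to $\mathfrak{a}=q^{-1}(\lambda_o)$, $\mathfrak{b}=q^{-1}(\Lambda_o)$, with $(\cdot,\cdot)$ obtained from $g^\perp_o$ via $\mathfrak{b}/\mathfrak{a}\cong\Lambda_o/\lambda_o$ and $\beta$ obtained from $f_o$ via $\mathfrak{a}/\mathfrak{h}=\lambda_o$ and $\mathfrak{k}/\mathfrak{b}\cong(\mathfrak{k}/\mathfrak{h})/\Lambda_o$. *)

(* Defs.v *)
From HB Require Import structures.
From mathcomp Require Import all_boot all_order all_algebra.
From mathcomp Require Import all_classical reals topology normedtype derive.

Set Implicit Arguments.
Unset Strict Implicit.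
Unset Printing Implicit Defensive.

Import Order.TTheory GRing.Theory Num.Theory.
Import numFieldNormedType.Exports.

Local Open Scope classical_set_scope.
Local Open Scope ring_scope.

(* Smooth maps between normed spaces; only meaningful for U open and the
   source finite-dimensional. *)
Fixpoint Ck (R : realType) (E F : normedModType R) (k : nat) (U : set E)
    (f : E -> F) : Prop :=
  match k with
  | 0 => forall x, U x -> {for x, continuous f}
  | k'.+1 => (forall x, U x -> differentiable f x) /\
             forall v, Ck k' U (fun x => 'D_v f x : F)
  end.

Definition smooth_on (R : realType) (E F : normedModType R) (U : set E)
  (f : E -> F) : Prop := forall k, Ck k U f.

(* Charts are pairs of total maps, mutually inverse between cdom and cimg; their
   values outside these sets are irrelevant. *)
Record chart (R : realType) (n : nat) (T : Type) := Chart {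
  cdom : set T;
  cimg : set 'rV[R]_n;
  cphi : T -> 'rV[R]_n;
  cpsi : 'rV[R]_n -> T }.

Definition chart_ok (R : realType) (n : nat) (T : Type) (c : chart R n T) :=
  [/\ open (cimg c),
      forall x, cdom c x -> cimg c (cphi c x) /\ cpsi c (cphi c x) = x &
      forall y, cimg c y -> cdom c (cpsi c y) /\ cphi c (cpsi c y) = y].

Definition chart_compat (R : realType) (n : nat) (T : Type)
    (c d : chart R n T) :=
  let D := [set y | cimg c y /\ cdom d (cpsi c y)] in
  open D /\ smooth_on D (cphi d \o cpsi c).

(* The topology of a set with an atlas is the one induced by the charts. *)
Definition atlas_open (R : realType) (n : nat) (T : Type)
    (atl : set (chart R n T)) (U : set T) :=
  forall c, atl c -> open [set y | cimg c y /\ U (cpsi c y)].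

(* A structure of smooth n-manifold (Hausdorff, second countable, with a
   maximal atlas) on the set T. *)
Record manifold (R : realType) (n : nat) (T : Type) := Manifold {
  atlas : set (chart R n T);
  atlas_ok : forall c, atlas c -> chart_ok c;
  atlas_cover : forall x, exists2 c, atlas c & cdom c x;
  atlas_compat : forall c d, atlas c -> atlas d -> chart_compat c d;
  atlas_maximal : forall c, chart_ok c ->
    (forall d, atlas d -> chart_compat c d /\ chart_compat d c) -> atlas c;
  atlas_hausdorff : forall x y : T, x <> y -> exists U V : set T,
    [/\ atlas_open atlas U, atlas_open atlas V, U x, V y & U `&` V = set0];
  atlas_second_countable : exists B : nat -> set T,
    (forall i, atlas_open atlas (B i)) /\
    forall U x, atlas_open atlas U -> U x -> exists i, B i x /\ B i `<=` U }.

Definition mopen (R : realType) (n : nat) (T : Type) (mT : manifold R n T) :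
  set T -> Prop := atlas_open (atlas mT).

Definition smooth_map (R : realType) (n n' : nat) (T T' : Type)
    (mT : manifold R n T) (mT' : manifold R n' T') (phi : T -> T') :=
  forall c d, atlas mT c -> atlas mT' d ->
    let D := [set y | cimg c y /\ cdom d (phi (cpsi c y))] in
    open D /\ smooth_on D (cphi d \o phi \o cpsi c).

(* Smoothness of a map from the product manifold, in product charts. *)
Definition smooth_map2 (R : realType) (n n' n'' : nat) (T T' T'' : Type)
    (mT : manifold R n T) (mT' : manifold R n' T') (mT'' : manifold R n'' T'')
    (phi : T -> T' -> T'') :=
  forall c c' d, atlas mT c -> atlas mT' c' -> atlas mT'' d ->
    let F := fun p : 'rV[R]_n * 'rV[R]_n' => phi (cpsi c p.1) (cpsi c' p.2) in
    let D := [set p | [/\ cimg c p.1, cimg c' p.2 & cdom d (F p)]] in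
    open D /\ smooth_on D (cphi d \o F).

Definition smooth_fun (R : realType) (n : nat) (T : Type)
    (mT : manifold R n T) (U : set T) (f : T -> R) :=
  forall c, atlas mT c ->
    smooth_on [set y | cimg c y /\ U (cpsi c y)] (f \o cpsi c).

Definition smooth_near (R : realType) (n : nat) (T : Type)
    (mT : manifold R n T) (x : T) (f : T -> R) :=
  exists U, [/\ mopen mT U, U x & smooth_fun mT U f].

(* Tangent vectors at x are the derivations of the algebra of germs at x of
   smooth functions, extended by 0 to the functions that are not smooth near x. *)
Notation tvec R T := ((T -> R) -> R)%type.

Definition tangent (R : realType) (n : nat) (T : Type) (mT : manifold R n T)
    (x : T) : set (tvec R T) :=
  [set v | [/\ forall f, ~ smooth_near mT x f -> v f = 0,
    forall f g U, mopen mT U -> U x -> (forall y, U y -> f y = g y) ->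
      v f = v g,
    forall (t : R) f g, smooth_near mT x f -> smooth_near mT x g ->
      v (fun y => t * f y + g y) = t * v f + v g &
    forall f g, smooth_near mT x f -> smooth_near mT x g ->
      v (fun y => f y * g y) = v f * g x + f x * v g]].

(* The derivative at x of a map phi that is smooth near x. *)
Definition push (R : realType) (n' : nat) (T T' : Type)
    (mT' : manifold R n' T') (phi : T -> T') (x : T) (v : tvec R T) :
    tvec R T' :=
  fun f => if `[< smooth_near mT' (phi x) f >] then v (f \o phi) else 0.

Definition immersion (R : realType) (n n' : nat) (T T' : Type)
    (mT : manifold R n T) (mT' : manifold R n' T') (phi : T -> T') :=
  smooth_map mT mT' phi /\
  forall x v w, tangent mT x v -> tangent mT x w ->
    push mT' phi x v = push mT' phi x w -> v = w.

Definition submersion (R : realType) (n n' : nat) (T T' : Type)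
    (mT : manifold R n T) (mT' : manifold R n' T') (phi : T -> T') :=
  smooth_map mT mT' phi /\
  forall x w, tangent mT' (phi x) w ->
    exists2 v, tangent mT x v & push mT' phi x v = w.

Definition smooth_vfield (R : realType) (n : nat) (T : Type)
    (mT : manifold R n T) (U : set T) (X : T -> tvec R T) :=
  (forall x, U x -> tangent mT x (X x)) /\
  forall W f, mopen mT W -> W `<=` U -> smooth_fun mT W f ->
    smooth_fun mT W (fun x => X x f).

(* D is integrable if through each point there is an immersed submanifold S of
   dimension p whose tangent spaces are the spaces of D. *)
Definition integrable (R : realType) (n p : nat) (T : Type)
    (mT : manifold R n T) (D : T -> set (tvec R T)) :=
  forall x, exists (S : set T) (mS : manifold R p {y : T | S y}),
    [/\ S x, immersion mS mT sval &
        forall y, push mT sval y @` tangent mS y = D (sval y)].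

Definition local_flow (R : realType) (n : nat) (T : Type)
    (mT : manifold R n T) (U : set T) (X : T -> tvec R T)
    (e : R) (W : set T) (Phi : R -> T -> T) :=
  [/\ 0 < e, mopen mT W & W `<=` U] /\
  [/\ forall x, W x -> Phi 0 x = x,
      forall t x, `|t| < e -> W x -> U (Phi t x),
      forall t x f, `|t| < e -> W x -> smooth_near mT (Phi t x) f ->
        is_derive t 1 (fun s => f (Phi s x)) (X (Phi t x) f) &
      forall c d, atlas mT c -> atlas mT d ->
        let F := fun p : R * 'rV[R]_n => Phi p.1 (cpsi c p.2) in
        let D := [set p | [/\ `|p.1| < e, cimg c p.2, W (cpsi c p.2) &
                              cdom d (F p)]] in
        open D /\ smooth_on D (cphi d \o F)].

Definition is_linear (R : realType) (V W : lmodType R) (u : V -> W) :=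
  forall (t : R) a b, u (t *: a + b) = t *: u a + u b.

Definition subspace (R : realType) (V : lmodType R) (W : set V) :=
  W 0 /\ forall (t : R) v w, W v -> W w -> W (t *: v + w).

Definition codim1 (R : realType) (V : lmodType R) (W B : set V) :=
  W `<=` B /\ exists v, [/\ B v, ~ W v &
    forall w, B w -> exists t : R, W (w - t *: v)].

(* The class v + W; the quotient B/W is the set of classes of elements of B. *)
Definition cls (R : realType) (V : lmodType R) (W : set V) (v : V) : set V :=
  [set w | W (w - v)].

(* Functions on quotients are total on sets of vectors, and required to be 0 off
   the relevant quotients so that equality of forms is Leibniz equality. *)
Definition inner_product_quot (R : realType) (V : lmodType R) (B W : set V)
    (g : set V -> set V -> R) :=
  [/\ forall A A', ~ ((cls W @` B) A /\ (cls W @` B) A') -> g A A' = 0,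
    forall (t : R) v v' w, B v -> B v' -> B w ->
      g (cls W (t *: v + v')) (cls W w) =
      t * g (cls W v) (cls W w) + g (cls W v') (cls W w),
    forall v w, B v -> B w -> g (cls W v) (cls W w) = g (cls W w) (cls W v) &
    forall v, B v -> ~ W v -> 0 < g (cls W v) (cls W v)].

(* A non-zero linear functional on B/W (x) B'/W', as a bilinear map. *)
Definition tensor_functional (R : realType) (V : lmodType R)
    (B W B' W' : set V) (b : set V -> set V -> R) :=
  [/\ forall A A', ~ ((cls W @` B) A /\ (cls W' @` B') A') -> b A A' = 0,
    forall (t : R) v v' w, B v -> B v' -> B' w ->
      b (cls W (t *: v + v')) (cls W' w) =
      t * b (cls W v) (cls W' w) + b (cls W v') (cls W' w),
    forall (t : R) v w w', B v -> B' w -> B' w' ->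
      b (cls W v) (cls W' (t *: w + w')) =
      t * b (cls W v) (cls W' w) + b (cls W v) (cls W' w') &
    exists v w, [/\ B v, B' w & b (cls W v) (cls W' w) <> 0]].

Record quadruple (R : realType) (V : lmodType R) := Quadruple {
  qline : set V;
  qhyp : set V;
  qform : set V -> set V -> R;
  qfun : set V -> set V -> R }.

(* A quadruple on top/bot: bot < qline <= qhyp < top, an inner product on
   qhyp/qline, and a non-zero functional on qline/bot (x) top/qhyp. *)
Definition is_quadruple (R : realType) (V : lmodType R) (bot top : set V)
    (q : quadruple V) :=
  [/\ [/\ subspace (qline q), subspace (qhyp q) & qline q `<=` qhyp q],
      codim1 bot (qline q), codim1 (qhyp q) top,
      inner_product_quot (qhyp q) (qline q) (qform q) &
      tensor_functional (qline q) bot top (qhyp q) (qfun q)].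

(* The basis k, l, m_i of R^n, where n = m + 2 and i < m. *)
Definition ek (R : realType) (m : nat) : 'rV[R]_m.+2 := delta_mx 0 0.
Definition el (R : realType) (m : nat) : 'rV[R]_m.+2 := delta_mx 0 1.
Definition em (R : realType) (m : nat) (i : 'I_m) : 'rV[R]_m.+2 :=
  delta_mx 0 (lift ord0 (lift ord0 i)).

Definition eta (R : realType) (m : nat) (v w : 'rV[R]_m.+2) : R :=
  v 0 0 * w 0 1 + v 0 1 * w 0 0 +
  \sum_(i < m) v 0 (lift ord0 (lift ord0 i)) * w 0 (lift ord0 (lift ord0 i)).

Definition kperp (R : realType) (m : nat) : set 'rV[R]_m.+2 :=
  [set w | eta (ek R m) w = 0].

Definition GN (R : realType) (m : nat) : set ('rV[R]_m.+2 -> 'rV[R]_m.+2) :=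
  [set f | [/\ is_linear f, bijective f,
    exists t : R, f (ek R m) = t *: ek R m,
    forall w w', kperp w -> kperp w' -> eta (f w) (f w') = eta w w' &
    forall z, eta (f (ek R m)) (f z) = eta (ek R m) z]].

Definition frame (R : realType) (m : nat) (T : Type)
    (mT : manifold R m.+2 T) (x : T) (u : 'rV[R]_m.+2 -> tvec R T) :=
  [/\ is_linear u, injective u & u @` setT = tangent mT x].

(* A principal GN-subbundle of the frame bundle, given by its fibres: each fibre
   is an orbit of the right action of GN on frames, and there are smooth local
   sections about each point. *)
Definition GN_structure (R : realType) (m : nat) (T : Type)
    (mT : manifold R m.+2 T) (P : T -> set ('rV[R]_m.+2 -> tvec R T)) :=
  [/\ forall x u, P x u -> frame mT x u,
      forall x, P x !=set0,
      forall x u, P x u -> P x = [set u \o f | f in @GN R m] &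
      forall x, exists (U : set T) (s : T -> 'rV[R]_m.+2 -> tvec R T),
        [/\ mopen mT U, U x, forall y, U y -> P y (s y) &
            forall a, smooth_vfield mT U (fun y => s y a)]].

Definition null_quadruple (R : realType) (m : nat) (T : Type)
    (mT : manifold R m.+2 T) (P : T -> set ('rV[R]_m.+2 -> tvec R T))
    (N : T -> quadruple (tvec R T)) :=
  forall x, is_quadruple [set 0] (tangent mT x) (N x) /\
    forall u, P x u ->
      [/\ qline (N x) = [set u (t *: ek R m) | t in setT],
          qhyp (N x) = u @` @kperp R m,
          forall i j : 'I_m,
            qform (N x) (cls (qline (N x)) (u (em R i)))
                        (cls (qline (N x)) (u (em R j))) = (i == j)%:R &
          qfun (N x) (cls [set 0] (u (ek R m))) (cls (qhyp (N x)) (u (el R m)))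
          = 1].

Definition automorphism (R : realType) (m : nat) (T : Type)
    (mT : manifold R m.+2 T) (P : T -> set ('rV[R]_m.+2 -> tvec R T))
    (phi : T -> T) :=
  [/\ bijective phi, smooth_map mT mT phi,
      forall psi, cancel phi psi -> cancel psi phi -> smooth_map mT mT psi &
      forall x u, P x u -> P (phi x) (push mT phi x \o u)].

Definition infinitesimal_automorphism (R : realType) (m : nat) (T : Type)
    (mT : manifold R m.+2 T) (P : T -> set ('rV[R]_m.+2 -> tvec R T))
    (U : set T) (X : T -> tvec R T) :=
  smooth_vfield mT U X /\
  forall e W Phi, local_flow mT U X e W Phi ->
    forall t x u, `|t| < e -> W x -> P x u ->
      P (Phi t x) (push mT (Phi t) x \o u).

Definition Kundt_structure (R : realType) (m : nat) (T : Type)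
    (mT : manifold R m.+2 T) (P : T -> set ('rV[R]_m.+2 -> tvec R T)) :=
  GN_structure mT P /\
  exists2 N, null_quadruple mT P N &
    integrable m.+1 mT (fun x => qhyp (N x)) /\
    forall x, exists (U : set T) (X : T -> tvec R T),
      [/\ mopen mT U, U x, infinitesimal_automorphism mT P U X &
          forall y, U y -> X y <> 0 /\ qline (N y) (X y)].

Definition lie_group (R : realType) (N : nat) (K : groupType)
    (mK : manifold R N K) :=
  smooth_map2 mK mK mK (fun a b : K => (a * b)%g) /\
  smooth_map mK mK (fun a : K => a^-1%g).

Definition lie_algebra (R : realType) (N : nat) (K : groupType)
  (mK : manifold R N K) : set (tvec R K) := tangent mK 1%g.

(* The bracket of T_e K, from the commutator of left-invariant vector fields
   a |-> d(L_a) v, d(L_a) w. *)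
Definition lie_bracket (R : realType) (N : nat) (K : groupType)
    (mK : manifold R N K) (v w : tvec R K) : tvec R K :=
  fun f => if `[< smooth_near mK 1%g f >] then
    v (fun a => push mK (fun b => a * b)%g 1%g w f) -
    w (fun a => push mK (fun b => a * b)%g 1%g v f) else 0.

Definition Ad (R : realType) (N : nat) (K : groupType) (mK : manifold R N K)
    (h : K) : tvec R K -> tvec R K :=
  push mK (fun b => h * b * h^-1)%g 1%g.

(* H, with the manifold structure mH, is a Lie subgroup: a Lie group under the
   operations of K, immersed in K. *)
Definition lie_subgroup (R : realType) (N d : nat) (K : groupType)
    (mK : manifold R N K) (H : set K) (mH : manifold R d {a : K | H a}) :=
  [/\ H 1%g,
      exists2 mulH, forall a b, sval (mulH a b) = (sval a * sval b)%g &
        smooth_map2 mH mH mH mulH,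
      exists2 invH, forall a, sval (invH a) = ((sval a)^-1)%g &
        smooth_map mH mH invH &
      immersion mH mK sval].

(* The Lie algebra of H in that of K, i.e. the image of T_e H. *)
Definition sub_lie_algebra (R : realType) (N d : nat) (K : groupType)
    (mK : manifold R N K) (H : set K) (mH : manifold R d {a : K | H a}) :
    set (tvec R K) :=
  [set w | exists2 e : {a : K | H a}, sval e = 1%g &
     exists2 v, tangent mH e v & push mK sval e v = w].

(* The set K/H of left cosets aH. *)
Definition lcos (K : groupType) (H : set K) (a : K) : set K :=
  [set (a * h)%g | h in H].

Definition homspace (K : groupType) (H : set K) : Type :=
  {A : set K | exists a, A = lcos H a}.

Definition hproj (K : groupType) (H : set K) (a : K) : homspace H :=
  exist _ (lcos H a) (ex_intro _ a erefl).

Lemma ltrans_subproof (K : groupType) (H : set K) (a : K) (x : homspace H) :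
  exists b, [set (a * c)%g | c in sval x] = lcos H b.
Proof.
case: x => A /= [b ->]; exists (a * b)%g; apply/seteqP; split => c.
  by move=> [_ [h Hh <-] <-]; exists h => //; rewrite mulgA.
by move=> [h Hh <-]; exists (b * h)%g; [exists h|rewrite mulgA].
Qed.

Definition ltrans (K : groupType) (H : set K) (a : K) (x : homspace H) :
  homspace H := exist _ _ (ltrans_subproof a x).

Definition effective (K : groupType) (H : set K) :=
  forall a : K, (forall x : homspace H, ltrans a x = x) -> a = 1%g.

Definition invariant_GN (R : realType) (m : nat) (K : groupType) (H : set K)
    (mM : manifold R m.+2 (homspace H))
    (P : homspace H -> set ('rV[R]_m.+2 -> tvec R (homspace H))) :=
  GN_structure mM P /\ forall a : K, automorphism mM P (ltrans a).

Definition AdH_quadruple (R : realType) (N d : nat) (K : groupType)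
    (mK : manifold R N K) (H : set K) (mH : manifold R d {a : K | H a})
    (Q : quadruple (tvec R K)) :=
  let kk := lie_algebra mK in
  let hh := sub_lie_algebra mK mH in
  is_quadruple hh kk Q /\
  forall h, H h ->
    [/\ forall v, qline Q v -> qline Q (Ad mK h v),
        forall v, qhyp Q v -> qhyp Q (Ad mK h v),
        forall v w, qhyp Q v -> qhyp Q w ->
          qform Q (cls (qline Q) (Ad mK h v)) (cls (qline Q) (Ad mK h w)) =
          qform Q (cls (qline Q) v) (cls (qline Q) w) &
        forall v w, qline Q v -> kk w ->
          qfun Q (cls hh (Ad mK h v)) (cls (qhyp Q) (Ad mK h w)) =
          qfun Q (cls hh v) (cls (qhyp Q) w)].

(* Q is the restriction to the origin of the null-quadruple of P, pulled back by
   the derivative k -> T_o(K/H) of the projection, whose kernel is h. *)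
Definition restricts_to (R : realType) (N d m : nat) (K : groupType)
    (mK : manifold R N K) (H : set K) (mH : manifold R d {a : K | H a})
    (mM : manifold R m.+2 (homspace H))
    (P : homspace H -> set ('rV[R]_m.+2 -> tvec R (homspace H)))
    (Q : quadruple (tvec R K)) :=
  let kk := lie_algebra mK in
  let hh := sub_lie_algebra mK mH in
  let dpi := push mM (@hproj K H) 1%g in
  is_quadruple hh kk Q /\
  exists2 N, null_quadruple mM P N &
    let No := N (hproj H 1%g) in
    [/\ qline Q = kk `&` dpi @^-1` qline No,
        qhyp Q = kk `&` dpi @^-1` qhyp No,
        forall v w, qhyp Q v -> qhyp Q w ->
          qform Q (cls (qline Q) v) (cls (qline Q) w) =
          qform No (cls (qline No) (dpi v)) (cls (qline No) (dpi w)) &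
        forall v w, qline Q v -> kk w ->
          qfun Q (cls hh v) (cls (qhyp Q) w) =
          qfun No (cls [set 0] (dpi v)) (cls (qhyp No) (dpi w))].

Definition hyp_subalgebra (R : realType) (N : nat) (K : groupType)
    (mK : manifold R N K) (Q : quadruple (tvec R K)) :=
  forall v w, qhyp Q v -> qhyp Q w -> qhyp Q (lie_bracket mK v w).

Definition line_skew (R : realType) (N : nat) (K : groupType)
    (mK : manifold R N K) (Q : quadruple (tvec R K)) :=
  forall a v w, qline Q a -> qhyp Q v -> qhyp Q w ->
    qform Q (cls (qline Q) (lie_bracket mK a v)) (cls (qline Q) w) =
    - qform Q (cls (qline Q) v) (cls (qline Q) (lie_bracket mK a w)).

(* Main.v *)
(* A quadruple on k/h amounts to a linear map kap from k onto R^n with kernel h,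
   taken modulo composition with GN: the line, the hyperplane, the form and the
   functional are pulled back by kap from R k, k^perp and eta.  Since K acts
   transitively, an invariant GN-structure is determined by its frames u at the
   origin, with kap = u^-1 o d pi, and Ad(H)-invariance is what allows a frame at
   the origin to be spread over K/H by left translations; this uses that the
   kernel of d pi is h and that pi has smooth local sections.

   Near pi(a) use the coordinates t |-> pi(g(t)), where g(t) is a product of
   one-parameter curves exp(t_j v_j), starting with a and the lift of l and ending
   with the lift v0 of k.  In the frame dL_{g(t)} u the coordinate velocities are
   given by kap of the left logarithmic derivative of g, which is transported
   along the k-coordinate by -ad v0.  If b is a subalgebra it is preserved by
   Ad of these curves, hence the slices t_l = const are integral manifolds; if
   moreover ad a is skew on b/a, the field X = h d/dt_k, with 1/h the l-component
   of the l-velocity, has a flow that changes the frames by elements of GN.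

   Conversely, a function vanishing on an integral manifold through the origin is
   killed by all left-invariant fields of b along its preimage in K, whence
   [b, b] is contained in b.  For an infinitesimal automorphism X in the line
   field, straightening X yields a local flow; as it preserves the structure,
   eta(kap Ad(c(t)^-1) v, kap Ad(c(t)^-1) w) is constant along the curve c of v0,
   and its derivative at 0 is the skewness. *)
Require Import Defs.
From HB Require Import structures.
From mathcomp Require Import all_boot all_order all_algebra.
From mathcomp Require Import all_classical reals topology normedtype derive.
From mathcomp Require Import landau sequences constructive_ereal ereal realfun exp measure lebesgue_measure lebesgue_integral ftc interval_inference lra ring.
Import Order.TTheory GRing.Theory Num.Theory.
Import numFieldNormedType.Exports.

Set Implicit Arguments.
Unset Strict Implicit.
Unset Printing Implicit Defensive.

Local Open Scope classical_set_scope.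
Local Open Scope ring_scope.


(** The order of the factors of g is forced by theta (g h) = Ad (h^-1) theta g + theta h, where
    theta is the logarithmic derivative. With the factor of l leftmost, only curves with generator
    in b act by Ad on velocities without l-component, so these stay in b; with the factor of k
    rightmost, the velocity along t_k is v0 everywhere and t_k enters through a single Ad.

    The scaling of X answers to the functional: an element of GN that multiplies k by s must divide
    the l-component by s. If T is an antiderivative along t_k of the l-component of the l-velocity,
    the flow of X moves T at unit speed and fixes the other coordinates, which is this balance.

    Infinitesimal automorphisms quantify over local flows, so the converse must exhibit one. Since X
    is a multiple of d/dt_k, a quadrature and the inverse function theorem produce it, instead of
    smooth dependence of solutions on initial values.

    Tangent vectors are derivations, which Hadamard's lemma turns into velocities. H carries a
    manifold structure of its own, so that the kernel of d pi is h takes a countability argument. *)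

Lemma is_linear0 (R : realType) (V W : lmodType R) (u : V -> W) : is_linear u -> u 0 = 0.
Proof. by move=> ul; have := ul (-1) 0 0; rewrite scaler0 addr0 scaleN1r addNr. Qed.

(** * Smooth maps between normed spaces *)

Section Differential.
Context {R : realType}.
Implicit Types E F G : normedModType R.

(** The little-o characterization in epsilon form. Derivatives that come from an estimate rather
    than from a formula, such as those of a local inverse and of a parameter integral, are
    established through it. *)
Lemma diff_epsP E F (f : E -> F) (x : E) (L : {linear E -> F}) :
  continuous L ->
  (forall e, 0 < e -> \forall h \near (0 : E), `|f (x + h) - f x - L h| <= e * `|h|) ->
  differentiable f x /\ forall v, 'D_v f x = L v.
Proof.
move=> cL H.
have HE : f \o shift x = cst (f x) + L +o_ 0 id.
  apply/eqaddoP => e e0; near=> h.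
  rewrite /=; apply: le_trans (_ : e * `|h| <= _) => //.
  have <- : f (x + h) - f x - L h = (f \o shift x - (cst (f x) + L)) h.
    by rewrite /= !fctE /= [h + x]addrC opprD addrA.
  by near: h; exact: H.
have dE := diff_unique cL HE.
have df : differentiable f x by apply/diff_locallyP; rewrite dE.
by split=> // v; rewrite deriveE// dE.
Unshelve. all: by end_near. Qed.

Lemma diff_eps E F (f : E -> F) (x : E) : differentiable f x ->
  forall e, 0 < e -> \forall h \near (0 : E),
    `|f (x + h) - f x - 'D_h f x| <= e * `|h|.
Proof.
move=> df e e0; have [_ /eqaddoP H] := (diff_locallyP _ _).1 df.
near=> h.
have -> : f (x + h) - f x - 'D_h f x = (f \o shift x - (cst (f x) + 'd f x)) h.
  by rewrite deriveE // /= !fctE /= [h + x]addrC opprD addrA.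
by near: h; exact: H.
Unshelve. all: by end_near. Qed.

Lemma near_differentiable E F (f g : E -> F) x :
  (\forall y \near x, f y = g y) -> differentiable f x -> differentiable g x.
Proof.
move=> fg df.
have H e : 0 < e -> \forall h \near (0 : E), `|g (x + h) - g x - 'd f x h| <= e * `|h|.
  move=> e0; rewrite -(nbhs_singleton fg); near=> h; rewrite -deriveE//.
  have <- : f (x + h) = g (x + h).
    near: h; move: fg; rewrite (near_shift 0 x).
    by apply: filterS => y /=; rewrite subr0 addrC.
  by near: h; exact: diff_eps.
by apply: (proj1 (diff_epsP _ H)); exact: diff_continuous.
Unshelve. all: by end_near. Qed.

Lemma derive_lin E F (f : E -> F) (x : E) : differentiable f x ->
  linear (fun v => 'D_v f x).
Proof. by move=> df t v w; rewrite !deriveE// linearP. Qed.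

Lemma derive_comp E F G (f : E -> F) (g : F -> G) x v :
  differentiable f x -> differentiable g (f x) ->
  'D_v (g \o f) x = 'D_('D_v f x) g (f x).
Proof.
move=> df dg; have dgf := differentiable_comp df dg.
by rewrite (deriveE _ dgf) (deriveE _ df) (deriveE _ dg) diff_comp.
Qed.

Let scalev F (a : R) (v : F) := a *: v.

Let scalev_is_bilinear F : bilinear_for
    (GRing.Scale.Law.clone _ _ *:%R _) (GRing.Scale.Law.clone _ _ *:%R _)
  (@scalev F).
Proof.
split=> [v|a] t x y; rewrite /scalev /=; first by rewrite scalerDl scalerA.
by rewrite scalerDr !scalerA mulrC.
Qed.

Lemma diff_scalev E F (a : E -> R) (f : E -> F) x :
  differentiable a x -> differentiable f x ->
  differentiable (fun y => a y *: f y) x /\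
  forall v, 'D_v (fun y => a y *: f y) x = 'D_v a x *: f x + a x *: 'D_v f x.
Proof.
move=> da df.
pose bM := bilinear_isBilinear.Build R R F F _ _ _ (@scalev_is_bilinear F).
pose b : {bilinear R -> F -> F} := HB.pack (@scalev F) bM.
have cb : continuous (fun p : R * F => b p.1 p.2) by apply: scale_continuous.
have dp := differentiable_pair da df.
have db := @differentiable_bilin _ _ _ _ b (a x, f x) cb.
have -> : (fun y => a y *: f y) = (fun p : R * F => b p.1 p.2) \o (fun y => (a y, f y)) by [].
split; first exact: differentiable_comp.
move=> v; rewrite derive_comp// (deriveE _ dp) (deriveE _ db) diff_pair//.
by rewrite diff_bilin//= -(deriveE _ da) -(deriveE _ df) addrC.
Qed.

End Differential.

Section CkTheory.
Context {R : realType}.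
Implicit Types E F G : normedModType R.

Lemma Ck_sub k E F (U V : set E) (f : E -> F) : V `<=` U -> Ck k U f -> Ck k V f.
Proof.
move=> VU; elim: k f => [|k IH] f /=; first by move=> H x /VU/H.
by move=> [H1 H2]; split=> [x /VU/H1//|v]; exact: IH.
Qed.

Lemma CkS k E F (U : set E) (f : E -> F) : Ck k.+1 U f -> Ck k U f.
Proof.
elim: k f => [|k IH] f /= [H1 H2].
  by move=> x /H1; exact: differentiable_continuous.
by split=> // v; apply: IH; exact: H2.
Qed.

Lemma Ck_locally k E F (U : set E) (f : E -> F) :
  (forall x, U x -> exists2 V, V x & Ck k V f) -> Ck k U f.
Proof.
elim: k f => [|k IH] f /= H.
  by move=> x /H[V Vx]; exact.
split=> [x /H[V Vx [H1 _]]|v]; first exact: H1.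
by apply: IH => x /H[V Vx [_ H2]]; exists V.
Qed.

Lemma Ck_eq k E F (U : set E) (f g : E -> F) : open U ->
  (forall x, U x -> f x = g x) -> Ck k U f -> Ck k U g.
Proof.
move=> oU; elim: k f g => [|k IH] f g fg /=.
  move=> H x Ux; apply: cvg_trans (_ : f y @[y --> x] --> g x); last first.
    by rewrite -fg//; exact: H.
  apply: near_eq_cvg.
  by apply: filterS (open_nbhs_nbhs (conj oU Ux)) => y /fg.
move=> [H1 H2]; split=> [x Ux|v].
  apply: near_differentiable (H1 _ Ux).
  by apply: filterS (open_nbhs_nbhs (conj oU Ux)) => y /fg.
apply: IH (H2 v) => x Ux; apply: near_eq_derive.
by apply: filterS (open_nbhs_nbhs (conj oU Ux)) => y /fg.
Qed.

Lemma Ck_cst k E F (U : set E) (a : F) : Ck k U (fun _ : E => a).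
Proof.
elim: k a => [|k IH] a /=; first by move=> x _; exact: cst_continuous.
split=> [x _|v]; first exact: differentiable_cst.
suff -> : 'D_v (fun _ : E => a) = fun=> 0 by [].
by apply/funext => x; exact: derive_cst.
Qed.

Lemma Ck_postlin k E F G (U : set E) (L : {linear F -> G}) (f : E -> F) :
  open U -> continuous L -> Ck k U f -> Ck k U (fun x => L (f x)).
Proof.
move=> oU cL; elim: k f => [|k IH] f /=.
  by move=> H x Ux; apply: (@continuous_comp _ _ _ f L); [exact: H|exact: cL].
move=> [H1 H2]; have dL y : differentiable L y by exact: linear_differentiable.
split=> [x Ux|v]; first by apply: (@differentiable_comp _ _ _ _ f L); [exact: H1|].
apply: Ck_eq (IH _ (H2 v)) => // x Ux /=.
rewrite (@derive_comp _ _ _ _ f L)//; last exact: H1.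
by rewrite (@deriveE _ _ _ L)// diff_lin.
Qed.

Lemma Ck_add k E F (U : set E) (f g : E -> F) :
  open U -> Ck k U f -> Ck k U g -> Ck k U (fun x => f x + g x).
Proof.
move=> oU; elim: k f g => [|k IH] f g /=.
  by move=> H1 H2 x Ux; apply: continuousD; [exact: H1|exact: H2].
move=> [H1 H2] [H3 H4]; split=> [x Ux|v].
  by apply: differentiableD; [exact: H1|exact: H3].
apply: Ck_eq (IH _ _ (H2 v) (H4 v)) => // x Ux.
by rewrite -deriveD//; apply: diff_derivable; [exact: H1|exact: H3].
Qed.

Lemma Ck_sum k E F (U : set E) n (f : 'I_n -> E -> F) :
  open U -> (forall i, Ck k U (f i)) -> Ck k U (fun x => \sum_i f i x).
Proof.
move=> oU; elim: n f => [|n IH] f H.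
  rewrite (_ : (fun x => _) = fun=> 0); first exact: Ck_cst.
  by apply/funext => x; rewrite big_ord0.
rewrite (_ : (fun x => _) = fun x => (\sum_i f (widen_ord (leqnSn n) i) x) + f ord_max x).
  by apply: Ck_add => //; apply: IH.
by apply/funext => x; rewrite big_ord_recr.
Qed.

Lemma Ck_scale k E F (U : set E) (a : E -> R) (f : E -> F) :
  open U -> Ck k U a -> Ck k U f -> Ck k U (fun x => a x *: f x).
Proof.
move=> oU; elim: k a f => [|k IH] a f /=.
  by move=> H1 H2 x Ux; apply: continuousZ; [exact: H1|exact: H2].
move=> Ha Hf; have [H1 H2] := Ha; have [H3 H4] := Hf; split=> [x Ux|v].
  by apply: (diff_scalev _ _).1; [exact: H1|exact: H3].
have D : Ck k U (fun x => 'D_v a x *: f x + a x *: 'D_v f x).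
  apply: Ck_add => //; apply: IH => //; first exact: (@CkS k _ _ U f).
  exact: (@CkS k _ _ U a).
apply: Ck_eq D => // x Ux.
by rewrite (diff_scalev _ _).2//; [exact: H1|exact: H3].
Qed.

(** The derivative of [1/a] is [- a^-2] times that of [a], hence is expressed by [1/a] itself, to
    which the induction hypothesis applies one order below. *)
Lemma Ck_inv k E (U : set E) (a : E -> R) : open U ->
  (forall x, U x -> a x != 0) -> Ck k U a -> Ck k U (fun x => (a x)^-1).
Proof.
move=> oU nz; elim: k => [|k IH] /=.
  by move=> H x Ux; apply: continuousV; [exact: nz|exact: H].
move=> Ha; have [H1 H2] := Ha; split=> [x Ux|v].
  by apply: differentiableV; [exact: H1|exact: nz].
have ia := IH (CkS Ha).
have D : Ck k U (fun x => (- 1 : R) *: ((a x)^-1 *: ((a x)^-1 *: 'D_v a x))).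
  by apply: Ck_scale => //; [exact: Ck_cst|do 2 (apply: Ck_scale => //)].
apply: Ck_eq D => // x Ux; rewrite deriveV ?nz//; last exact/diff_derivable/H1.
by rewrite scaleN1r scalerA -scaleNr -invfM -expr2.
Qed.

(** A spanning family with continuous coordinate functionals: the encoding covers R, row vectors and
    products alike, and turns the chain rule into a finite sum. *)
Definition findim F := exists n (b : 'I_n -> F) (l : 'I_n -> {linear F -> R}),
  (forall i, continuous (l i)) /\ forall x, x = \sum_i l i x *: b i.

(** Expanding ['D_v f x] in the coordinates of [F] makes the derivative of the composite a finite
    sum of scalar functions times composites of ['D_(b i) g] with [f], one order lower. The
    induction therefore runs over all [g] at once. *)
Lemma Ck_comp k E F G (U : set E) (V : set F) (f : E -> F) (g : F -> G) :
  findim F -> open U -> (forall x, U x -> V (f x)) ->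
  Ck k U f -> Ck k V g -> Ck k U (fun x => g (f x)).
Proof.
move=> [n [b [l [cl bl]]]] oU UV; elim: k f g UV => [|k IH] f g UV /=.
  by move=> H1 H2 x Ux; apply: (@continuous_comp _ _ _ f g); [exact: H1|exact/H2/UV].
move=> Hf [G1 G2]; have [F1 F2] := Hf; split=> [x Ux|v].
  by apply: (@differentiable_comp _ _ _ _ f g); [exact: F1|exact/G1/UV].
have D : Ck k U (fun x => \sum_i (l i ('D_v f x) *: 'D_(b i) g (f x))).
  apply: Ck_sum => // i; apply: Ck_scale => //; first exact: Ck_postlin (F2 v).
  exact: (IH _ _ UV (CkS Hf) (G2 _)).
apply: Ck_eq D => // x Ux; have [dfx dgx] := (F1 _ Ux, G1 _ (UV _ Ux)).
rewrite (@derive_comp _ _ _ _ f g)// (deriveE _ dgx) [in RHS](bl ('D_v f x)) linear_sum.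
by apply: eq_bigr => i _; rewrite linearZ/= -deriveE.
Qed.

End CkTheory.

Section FinDim.
Context {R : realType}.

Lemma findimR : findim (R : normedModType R).
Proof.
exists 1%N, (fun=> 1), (fun=> idfun); split=> [_|x]; first by move=> y; exact: cvg_id.
by rewrite big_ord1 /= -[RHS]/(x * 1) mulr1.
Qed.

Definition coordf m n (i : 'I_m) (j : 'I_n) (A : 'M[R]_(m, n)) : R := A i j.
Lemma coordf_linear m n i j : linear (@coordf m n i j).
Proof. by move=> a u v; rewrite /coordf !mxE. Qed.
HB.instance Definition _ m n i j :=
  GRing.isLinear.Build R 'M[R]_(m, n) R _ _ (@coordf_linear m n i j).
Lemma coordf_continuous m n i j : continuous (@coordf m n i j).
Proof. exact: coord_continuous. Qed.

Lemma findim_rV n : findim 'rV[R]_n.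
Proof.
exists n, (fun i => delta_mx 0 i), (fun i => @coordf 1 n 0 i); split.
  by move=> i; exact: coordf_continuous.
by move=> x; rewrite /coordf; exact: row_sum_delta.
Qed.

Lemma findim_prod (E F : normedModType R) : findim E -> findim F -> findim (E * F)%type.
Proof.
move=> [n [b [l [cl bl]]]] [n' [b' [l' [cl' bl']]]].
pose L (i : 'I_(n + n')%N) : {linear (E * F)%type -> R} :=
  match fintype.split i with inl i => l i \o fst | inr j => l' j \o snd end.
exists (n + n')%N, (fun i : 'I_(n + n')%N => match fintype.split i with inl i => (b i, 0) | inr j => (0, b' j) end), L.
split=> [i|[x y]]; rewrite /L.
  case: (fintype.split i) => j z /=; apply: continuous_comp => //;
   [exact: cvg_fst| exact: cl|exact: cvg_snd|exact: cl'].
rewrite big_split_ord /=.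
under eq_bigr => i _ do rewrite -/(unsplit (inl i)) unsplitK /=.
under [X in _ + X]eq_bigr => i _ do rewrite -/(unsplit (inr i)) unsplitK /=.
rewrite [in LHS](bl x) [in LHS](bl' y).
apply/eqP; rewrite xpair_eqE /=; apply/andP; split; apply/eqP.
  rewrite (raddf_sum fst) (raddf_sum fst) /=.
  by rewrite [X in _ + X]big1 ?addr0// => i _; rewrite scaler0.
rewrite (raddf_sum snd) (raddf_sum snd) /=.
by rewrite [X in X + _]big1 ?add0r// => i _; rewrite scaler0.
Qed.

End FinDim.

(** * Smoothness at a point and its closure properties *)

Section SmoothAt.
Context {R : realType}.
Implicit Types E F G : normedModType R.

(** Hiding the open domain makes smoothness a property of germs, so that sums, products and
    composites need no bookkeeping of domains. *)
Definition smooth_at E F (f : E -> F) (x : E) :=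
  exists2 U, open_nbhs x U & smooth_on U f.

Lemma near_open_nbhs E (x : E) (A : set E) : nbhs x A ->
  exists2 U, open_nbhs x U & U `<=` A.
Proof. by rewrite nbhsE. Qed.

Lemma smooth_at_near E F (f g : E -> F) x :
  (\forall y \near x, f y = g y) -> smooth_at f x -> smooth_at g x.
Proof.
move=> /near_open_nbhs[V [oV Vx] fg] [U [oU Ux] sf]; exists (U `&` V).
  by split; [exact: openI|].
move=> k; apply: (@Ck_eq _ k _ _ _ f g); first exact: openI.
  by move=> y [_ /fg].
by apply: Ck_sub (sf k); exact: subIsetl.
Qed.

Lemma smooth_atP E F (U : set E) (f : E -> F) :
  (forall x, U x -> smooth_at f x) -> smooth_on U f.
Proof.
by move=> H k; apply: Ck_locally => x /H[V [_ Vx] sf]; exists V.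
Qed.

Lemma smooth_on_at E F (U : set E) (f : E -> F) x :
  open U -> smooth_on U f -> U x -> smooth_at f x.
Proof. by move=> oU sf Ux; exists U. Qed.

Lemma smooth_at_nbhs E F (f : E -> F) x : smooth_at f x ->
  \forall y \near x, smooth_at f y.
Proof.
move=> [U oU sf]; apply: filterS (open_nbhs_nbhs oU) => y Uy.
by exists U => //; case: oU.
Qed.

Lemma smooth_at_diff E F (f : E -> F) x : smooth_at f x -> differentiable f x.
Proof. by move=> [U [oU Ux] /(_ 1%N)[H _]]; exact: H. Qed.

Lemma smooth_at_cont E F (f : E -> F) x : smooth_at f x -> {for x, continuous f}.
Proof. by move=> /smooth_at_diff/differentiable_continuous. Qed.

Lemma smooth_at_derive E F (f : E -> F) x v : smooth_at f x ->
  smooth_at (fun y => 'D_v f y) x.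
Proof. by move=> [U oU sf]; exists U => // k; have [_] := sf k.+1; apply. Qed.

Lemma smooth_at_cst E F (a : F) (x : E) : smooth_at (fun=> a) x.
Proof. by exists setT => [|k]; [split=> //; exact: openT|exact: Ck_cst]. Qed.

Lemma smooth_at_add E F (f g : E -> F) x : smooth_at f x -> smooth_at g x ->
  smooth_at (fun y => f y + g y) x.
Proof.
move=> [U [oU Ux] sf] [V [oV Vx] sg]; have oUV : open (U `&` V) by exact: openI.
exists (U `&` V) => // k; apply: Ck_add => //.
  by apply: Ck_sub (sf k); exact: subIsetl.
by apply: Ck_sub (sg k); exact: subIsetr.
Qed.

Lemma smooth_at_scale E F (f : E -> R) (g : E -> F) x : smooth_at f x -> smooth_at g x ->
  smooth_at (fun y => f y *: g y) x.
Proof.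
move=> [U [oU Ux] sf] [V [oV Vx] sg]; have oUV : open (U `&` V) by exact: openI.
exists (U `&` V) => // k; apply: Ck_scale => //.
  by apply: Ck_sub (sf k); exact: subIsetl.
by apply: Ck_sub (sg k); exact: subIsetr.
Qed.

Lemma smooth_at_mul E (f g : E -> R) x : smooth_at f x -> smooth_at g x ->
  smooth_at (fun y => f y * g y) x.
Proof. exact: smooth_at_scale. Qed.

Lemma smooth_at_opp E F (f : E -> F) x : smooth_at f x ->
  smooth_at (fun y => - f y) x.
Proof.
move=> sf; apply: (@smooth_at_near _ _ (fun y => (-1 : R) *: f y)).
  by apply: nearW => y; rewrite scaleN1r.
by apply: smooth_at_scale sf; exact: smooth_at_cst.
Qed.

Lemma smooth_at_sub E F (f g : E -> F) x : smooth_at f x -> smooth_at g x ->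
  smooth_at (fun y => f y - g y) x.
Proof. by move=> sf sg; apply: smooth_at_add => //; exact: smooth_at_opp. Qed.

Lemma smooth_at_postlin E F G (L : {linear F -> G}) (f : E -> F) x :
  continuous L -> smooth_at f x -> smooth_at (fun y => L (f y)) x.
Proof.
by move=> cL [U [oU Ux] sf]; exists U => // k; apply: Ck_postlin.
Qed.

Lemma smooth_at_id E (x : E) : smooth_at id x.
Proof.
exists setT => [|k]; first by split=> //; exact: openT.
case: k => [|k] /=; first by move=> y _; exact: cvg_id.
split=> [y _|v]; first exact: ex_diff.
have -> : 'D_v (id : E -> E) = fun=> v by apply/funext => y; exact: derive_id.
exact: Ck_cst.
Qed.

Lemma smooth_at_lin E F (L : {linear E -> F}) x : continuous L -> smooth_at L x.
Proof. by move=> cL; apply: (@smooth_at_postlin _ _ _ L id) => //; exact: smooth_at_id. Qed.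

Lemma smooth_at_inv E (f : E -> R) x : f x != 0 -> smooth_at f x ->
  smooth_at (fun y => (f y)^-1) x.
Proof.
move=> fx sf; have [U [oU Ux] {}sf] := sf.
have : \forall y \near x, U y /\ f y != 0.
  near=> y; split; first by near: y; exact: open_nbhs_nbhs.
  near: y; have cf : {for x, continuous f}.
    by apply: differentiable_continuous; have [H _] := sf 1%N; exact: H.
  have := cf [set z | z != 0]; apply.
  by apply: open_nbhs_nbhs; split=> //; exact: open_neq.
move=> /near_open_nbhs[V [oV Vx] VH]; exists V => // k.
apply: Ck_inv => // [y /VH[]//|].
by apply: Ck_sub (sf k) => y /VH[].
Unshelve. all: by end_near. Qed.

Lemma smooth_at_comp E F G (f : E -> F) (g : F -> G) x : findim F ->
  smooth_at f x -> smooth_at g (f x) -> smooth_at (fun y => g (f y)) x.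
Proof.
move=> fF sf [V [oV Vx] sg]; have cf := smooth_at_cont sf.
have [U [oU Ux] {}sf] := sf.
have : \forall y \near x, U y /\ V (f y).
  near=> y; split; first by near: y; exact: open_nbhs_nbhs.
  by near: y; apply: cf; exact: open_nbhs_nbhs.
move=> /near_open_nbhs[W [oW Wx] WH]; exists W => // k.
apply: (@Ck_comp _ k _ _ _ W V) => // [y /WH[]//|].
by apply: Ck_sub (sf k) => y /WH[].
Unshelve. all: by end_near. Qed.

Lemma smooth_at_sum E F I (r : seq I) (P : pred I) (f : I -> E -> F) x :
  (forall i, smooth_at (f i) x) -> smooth_at (fun y => \sum_(i <- r | P i) f i y) x.
Proof.
move=> H; elim: r => [|i r IH].
  rewrite (_ : (fun y => _) = fun=> 0); first exact: smooth_at_cst.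
  by apply/funext => y; rewrite big_nil.
case: (boolP (P i)) => Pi; last first.
  rewrite (_ : (fun y => _) = (fun y => \sum_(i <- r | P i) f i y))//.
  by apply/funext => y; rewrite big_cons (negPf Pi).
rewrite (_ : (fun y => _) = (fun y => f i y + \sum_(i <- r | P i) f i y)).
  exact: smooth_at_add.
by apply/funext => y; rewrite big_cons Pi.
Qed.

Lemma smooth_at_prod E I (r : seq I) (P : pred I) (f : I -> E -> R) x :
  (forall i, smooth_at (f i) x) -> smooth_at (fun y => \prod_(i <- r | P i) f i y) x.
Proof.
move=> H; elim: r => [|i r IH].
  rewrite (_ : (fun y => _) = fun=> 1); first exact: smooth_at_cst.
  by apply/funext => y; rewrite big_nil.
case: (boolP (P i)) => Pi; last first.
  rewrite (_ : (fun y => _) = (fun y => \prod_(i <- r | P i) f i y))//.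
  by apply/funext => y; rewrite big_cons (negPf Pi).
rewrite (_ : (fun y => _) = (fun y => f i y * \prod_(i <- r | P i) f i y)).
  exact: smooth_at_mul.
by apply/funext => y; rewrite big_cons Pi.
Qed.

Lemma smooth_at_coord E m n (f : E -> 'M[R]_(m, n)) i j x :
  smooth_at f x -> smooth_at (fun y => f y i j) x.
Proof.
move=> sf; apply: (@smooth_at_postlin _ _ _ (@coordf R m n i j)) => //.
exact: coordf_continuous.
Qed.

Lemma smooth_at_mx E m n (f : E -> 'M[R]_(m, n)) x :
  (forall i j, smooth_at (fun y => f y i j) x) -> smooth_at f x.
Proof.
move=> H; rewrite (_ : f = fun y => \sum_i \sum_j f y i j *: delta_mx i j).
  do 2 (apply: smooth_at_sum => ?); apply: smooth_at_scale => //.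
  exact: smooth_at_cst.
by apply/funext => y; exact: matrix_sum_delta.
Qed.

Lemma smooth_at_mulmx E m n p (f : E -> 'M[R]_(m, n)) (g : E -> 'M[R]_(n, p)) x :
  smooth_at f x -> smooth_at g x -> smooth_at (fun y => f y *m g y) x.
Proof.
move=> sf sg; apply: smooth_at_mx => i j.
rewrite (_ : (fun y => _) = fun y => \sum_k f y i k * g y k j); last first.
  by apply/funext => y; rewrite mxE.
by apply: smooth_at_sum => k; apply: smooth_at_mul; exact: smooth_at_coord.
Qed.

Lemma smooth_at_det E n (f : E -> 'M[R]_n) x :
  smooth_at f x -> smooth_at (fun y => \det (f y)) x.
Proof.
move=> sf; apply: smooth_at_sum => s; apply: smooth_at_mul.
  exact: smooth_at_cst.
by apply: smooth_at_prod => i; exact: smooth_at_coord.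
Qed.

(** Cramer's formula, adjugate over determinant, gives the inverse on the open set where the
    determinant does not vanish. *)
Lemma smooth_at_invmx E n (f : E -> 'M[R]_n) x : f x \in unitmx ->
  smooth_at f x -> smooth_at (fun y => invmx (f y)) x.
Proof.
move=> ux sf; have sd := smooth_at_det sf.
have dx : \det (f x) != 0 by move: ux; rewrite unitmxE unitfE.
apply: (@smooth_at_near _ _ (fun y => (\det (f y))^-1 *: \adj (f y))).
  have nz : \forall y \near x, \det (f y) != 0.
    have cf : {for x, continuous (fun y => \det (f y))} by exact: smooth_at_cont.
    have := cf [set z | z != 0]; apply.
    by apply: open_nbhs_nbhs; split=> //; exact: open_neq.
  by apply: filterS nz => y; rewrite /invmx unitmxE unitfE /= => ->.
apply: smooth_at_scale; first exact: smooth_at_inv.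
apply: smooth_at_mx => i j.
rewrite (_ : (fun y => _) = fun y => (-1) ^+ (j + i) * \det (row' j (col' i (f y)))); last first.
  by apply/funext => y; rewrite mxE.
apply: smooth_at_mul; first exact: smooth_at_cst.
apply: smooth_at_det; apply: smooth_at_mx => a b.
rewrite (_ : (fun y => _) = fun y => f y (lift j a) (lift i b)); last first.
  by apply/funext => y; rewrite !mxE.
exact: smooth_at_coord.
Qed.

Lemma smooth_at_pair E F G (f : E -> F) (g : E -> G) x :
  smooth_at f x -> smooth_at g x -> smooth_at (fun y => (f y, g y)) x.
Proof.
move=> sf sg.
pose i1 (u : F) : F * G := (u, 0); pose i2 (u : G) : F * G := (0, u).
have l1 : linear i1 by move=> a u v; rewrite /i1; apply/eqP; rewrite xpair_eqE /= scaler0 addr0 !eqxx.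
have l2 : linear i2 by move=> a u v; rewrite /i2; apply/eqP; rewrite xpair_eqE /= scaler0 addr0 !eqxx.
pose L1 : {linear F -> (F * G)%type} := HB.pack i1 (GRing.isLinear.Build _ _ _ _ _ l1).
pose L2 : {linear G -> (F * G)%type} := HB.pack i2 (GRing.isLinear.Build _ _ _ _ _ l2).
rewrite (_ : (fun y => _) = fun y => L1 (f y) + L2 (g y)); last first.
  by apply/funext => y; apply/eqP; rewrite xpair_eqE /= addr0 add0r !eqxx.
apply: smooth_at_add; apply: smooth_at_postlin => // u.
  by apply: cvg_pair => //; exact: cvg_cst.
by apply: cvg_pair => //; exact: cvg_cst.
Qed.

Lemma fst_continuous E F : continuous (fst : E * F -> E).
Proof. by move=> x; exact: cvg_fst. Qed.
Lemma snd_continuous E F : continuous (snd : E * F -> F).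
Proof. by move=> x; exact: cvg_snd. Qed.

Lemma smooth_at_fst E F (x : E * F) : smooth_at fst x.
Proof. exact/smooth_at_lin/fst_continuous. Qed.
Lemma smooth_at_snd E F (x : E * F) : smooth_at snd x.
Proof. exact/smooth_at_lin/snd_continuous. Qed.

Lemma derive_snd E F G (f : E * F -> G) x y v :
  'D_v (fun y => f (x, y)) y = 'D_(0, v) f (x, y).
Proof.
rewrite /derive.
set u := (X in lim (X @ _) = _); set w := (X in _ = lim (X @ _)).
suff -> : u = w by [].
apply/funext => h; rewrite /u /w /=; congr (_ *: (f _ - _)).
by apply/eqP; rewrite xpair_eqE /= scaler0 add0r !eqxx.
Qed.

Lemma derive_fst E F G (f : E * F -> G) x y v :
  'D_v (fun x => f (x, y)) x = 'D_(v, 0) f (x, y).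
Proof.
rewrite /derive.
set u := (X in lim (X @ _) = _); set w := (X in _ = lim (X @ _)).
suff -> : u = w by [].
apply/funext => h; rewrite /u /w /=; congr (_ *: (f _ - _)).
by apply/eqP; rewrite xpair_eqE /= scaler0 add0r !eqxx.
Qed.

Lemma derive_shift_arg E F (f : E -> F) c x v :
  'D_v (fun y => f (y + c)) x = 'D_v f (x + c).
Proof.
rewrite /derive.
set u := (X in lim (X @ _) = _); set w := (X in _ = lim (X @ _)).
suff -> : u = w by [].
by apply/funext => h; rewrite /u /w /= addrA.
Qed.

Lemma derive_line E F (f : E -> F) x v t :
  'D_1 (fun s : R => f (s *: v + x)) t = 'D_v f (t *: v + x).
Proof.
rewrite /derive.
set u := (X in lim (X @ _) = _); set w := (X in _ = lim (X @ _)).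
suff -> : u = w by [].
by apply/funext => h; rewrite /u /w /= scalerDl addrA -[h *: 1]/(h * 1) mulr1.
Qed.

Lemma derivable_line E F (f : E -> F) x v (t : R) :
  derivable (fun s : R => f (s *: v + x)) t 1 <-> derivable f (t *: v + x) v.
Proof.
rewrite /derivable.
set u := (X in cvg (X @ _) <-> _); set w := (X in _ <-> cvg (X @ _)).
suff -> : u = w by [].
by apply/funext => h; rewrite /u /w /= scalerDl addrA -[h *: 1]/(h * 1) mulr1.
Qed.

End SmoothAt.

Opaque derive.

(** * Mean value estimates and symmetry of second derivatives *)

Section MeanValue.
Context {R : realType}.
Implicit Types E F G : normedModType R.

Lemma near_add0 E (x : E) (A : set E) :
  (\forall y \near x, A y) <-> \forall h \near (0 : E), A (x + h).
Proof.
rewrite (near_shift 0 x); split; apply: filterS => h /=; rewrite subr0 addrC//.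
Qed.

Lemma near_line E (x v : E) (A : set E) : (\forall y \near x, A y) ->
  exists2 e : R, 0 < e & forall t, `|t| < e -> A (x + t *: v).
Proof.
move=> H; have cl : {for (0 : R), continuous (fun t : R => x + t *: v)}.
  by apply: continuousD; [exact: cst_continuous|exact: scalel_continuous].
have := cl A; rewrite scale0r addr0 => /(_ H) /nbhs_ballP[e e0 eH].
by exists e => // t te; apply: eH; rewrite -ball_normE /= sub0r normrN.
Qed.

Lemma mvt_segment E (f : E -> R) (x v : E) :
  (forall t, 0 <= t <= 1 -> differentiable f (x + t *: v)) ->
  exists2 t, 0 <= t <= 1 & f (x + v) - f x = 'D_v f (x + t *: v).
Proof.
move=> df; pose phi (t : R) := f (t *: v + x).
have dphi t : 0 <= t <= 1 -> derivable phi t 1.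
  by move=> t01; apply/derivable_line/diff_derivable; rewrite addrC; exact: df.
have [||c] := @MVT_segment R phi (fun t => 'D_1 phi t) 0 1 ler01.
- move=> t; rewrite in_itv /= => /andP[t0 t1].
  by apply: derivableP; apply: dphi; rewrite !ltW.
- apply: derivable_within_continuous => t; rewrite in_itv /= => t01; exact: dphi.
rewrite in_itv /= => c01; rewrite /phi scale1r scale0r add0r subr0 mulr1 derive_line => H.
by exists c => //; rewrite [x + v]addrC H addrC.
Qed.

Lemma rV_normP n (x : 'rV[R]_n) (e : R) : 0 <= e ->
  (forall j, `|x 0 j| <= e) -> `|x| <= e.
Proof.
move=> e0 H; rewrite [leLHS]/Num.Def.normr /= mx_normrE (bigmax_le _ e0)// => -[i j] _ /=.
by rewrite (ord1 i).
Qed.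

Lemma rV_coord_le n (x : 'rV[R]_n) j : `|x 0 j| <= `|x|.
Proof.
by rewrite [leRHS]/Num.Def.normr /= mx_normrE; exact: (le_bigmax _ _ (0, j)).
Qed.

Lemma mulmx_bounded n p (B : 'M[R]_(n, p)) :
  exists2 k, 0 < k & forall x : 'rV[R]_n, `|x *m B| <= k * `|x|.
Proof.
exists (1 + \sum_i \sum_j `|B i j|); first by rewrite ltr_pwDl// sumr_ge0// => i _; rewrite sumr_ge0.
move=> x; apply: rV_normP => [|j].
  by rewrite mulr_ge0// addr_ge0// sumr_ge0// => i _; rewrite sumr_ge0.
rewrite mxE (le_trans (ler_norm_sum _ _ _))//.
apply: (@le_trans _ _ (\sum_i `|B i j| * `|x|)).
  by apply: ler_sum => i _; rewrite normrM mulrC ler_wpM2l// rV_coord_le.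
rewrite -mulr_suml ler_wpM2r//.
apply: (@le_trans _ _ (\sum_i \sum_j `|B i j|)); last by rewrite lerDr.
apply: ler_sum => i _; rewrite (bigD1 j)//= lerDl; apply: sumr_ge0 => //.
Qed.

Lemma derive_rV E n (f : E -> 'rV[R]_n) x v j : differentiable f x ->
  ('D_v f x) 0 j = 'D_v (fun y => f y 0 j) x.
Proof. by move=> df; rewrite derive_mx ?mxE//; exact: diff_derivable. Qed.

Lemma derive_sum_delta n F (f : 'rV[R]_n -> F) x v : differentiable f x ->
  'D_v f x = \sum_i v 0 i *: 'D_(delta_mx 0 i) f x.
Proof.
move=> df; rewrite deriveE// [in LHS](row_sum_delta v) linear_sum.
by apply: eq_bigr => i _; rewrite linearZ /= deriveE.
Qed.

(** The [n] partial derivatives are continuous and vanish at [x], so each is at most [e / (n+1)] on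
    a common ball, and their sum gives the bound on every directional derivative. The norm being the
    maximum of the coordinates, the mean value theorem can be applied to one coordinate at a
    time. *)
Lemma small_derive_ball n p (f : 'rV[R]_n -> 'rV[R]_p) x e : 0 < e ->
  smooth_at f x -> (forall v, 'D_v f x = 0) ->
  exists2 r, 0 < r &
    (forall y, ball x r y -> smooth_at f y /\ forall v, `|'D_v f y| <= e * `|v|) /\
    forall y z, ball x r y -> ball x r z -> `|f y - f z| <= e * `|y - z|.
Proof.
move=> e0 sf d0; pose e' := e / n.+1%:R.
have e'0 : 0 < e' by rewrite divr_gt0.
have : \forall y \near x, smooth_at f y /\
    forall i : 'I_n, `|'D_(delta_mx 0 i) f y| <= e'.
  near=> y; split; first by near: y; exact: (smooth_at_nbhs sf).
  near: y; apply: filter_forall => i.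
  have c : {for x, continuous (fun y => 'D_(delta_mx 0 i) f y)}.
    exact/smooth_at_cont/smooth_at_derive.
  by move/cvgrPdist_le: c => /(_ _ e'0); apply: filterS => z; rewrite d0 sub0r normrN.
move=> /nbhs_ballP[r r0 rH]; exists r => //.
have H1 y : ball x r y -> smooth_at f y /\ forall v, `|'D_v f y| <= e * `|v|.
  move=> /rH[sy Hy]; split=> // v; rewrite derive_sum_delta; last exact: smooth_at_diff.
  rewrite (le_trans (ler_norm_sum _ _ _))//.
  apply: (@le_trans _ _ (\sum_(i < n) e' * `|v|)).
    apply: ler_sum => i _; rewrite normrZ mulrC ler_pM//.
    exact: rV_coord_le.
  rewrite sumr_const card_ord -mulr_natr mulrAC ler_wpM2r//.
  by rewrite /e' -mulrA ger_pMr// mulrC ler_pdivrMr// mul1r ler_nat.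
split=> // y z By Bz; apply: rV_normP => [|j]; first by rewrite mulr_ge0// ltW.
have Bt t : 0 <= t <= 1 -> ball x r (z + t *: (y - z)).
  move=> /andP[t0 t1]; move: By Bz; rewrite -!ball_normE /= => By Bz.
  have -> : x - (z + t *: (y - z)) = t *: (x - y) + (1 - t) *: (x - z).
    by apply/rowP => i; rewrite !mxE; ring.
  rewrite (le_lt_trans (ler_normD _ _))// !normrZ (ger0_norm t0) ger0_norm ?subr_ge0//.
  have [->|tn0] := eqVneq t 0; first by rewrite mul0r add0r subr0 mul1r.
  rewrite (@lt_le_trans _ _ (t * r + (1 - t) * r))//; last by rewrite -mulrDl subrKC mul1r.
  rewrite ltr_leD ?ltr_pM2l ?lt0r ?tn0 ?t0// ler_wpM2l ?subr_ge0//.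
  exact: ltW.
have [|t t01 Ht] := @mvt_segment _ (fun u => f u 0 j) z (y - z).
  move=> t t01; apply: smooth_at_diff; apply: smooth_at_coord.
  by have [] := H1 _ (Bt _ t01).
rewrite !mxE; move: Ht; rewrite subrKC => ->.
have [sz Hz] := H1 _ (Bt _ t01).
rewrite -derive_rV; last exact: smooth_at_diff.
exact: le_trans (rV_coord_le _ _) (Hz _).
Unshelve. all: by end_near. Qed.

(** The mean value theorem is used twice: on [phi y = f (y + v) - f y] in direction [w], then on
    ['D_w f] in direction [v]. *)
Lemma second_difference E (f : E -> R) (x v w : E) :
  (forall s t, 0 <= s <= 1 -> 0 <= t <= 1 -> differentiable f (x + s *: v + t *: w)) ->
  (forall s t, 0 <= s <= 1 -> 0 <= t <= 1 -> differentiable ('D_w f) (x + s *: v + t *: w)) ->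
  exists s t, [/\ 0 <= s <= 1, 0 <= t <= 1 &
    f (x + v + w) - f (x + v) - f (x + w) + f x = 'D_v ('D_w f) (x + s *: v + t *: w)].
Proof.
move=> d1 d2; pose phi (y : E) := f (y + v) - f y.
have z1 : 0 <= (0 : R) <= 1 by rewrite lexx ler01.
have o1 : 0 <= (1 : R) <= 1 by rewrite lexx ler01.
have dv (c y : E) : differentiable f (y + c) -> differentiable (fun u => f (u + c)) y.
  by move=> H; apply: (@differentiable_comp _ _ _ _ (fun u => u + c) f).
have [|t t01 Ht] := @mvt_segment _ phi x w.
  move=> t t01; apply: differentiableB.
    by apply: dv; have := d1 1 t o1 t01; rewrite scale1r addrAC.
  by have := d1 0 t z1 t01; rewrite scale0r addr0.
have [|s s01 Hs] := @mvt_segment _ ('D_w f) (x + t *: w) v.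
  by move=> s s01; have := d2 s t s01 t01; rewrite addrAC.
exists s, t; split; [exact: s01|exact: t01|]; rewrite [x + s *: v + _]addrAC -Hs.
have -> : 'D_w f (x + t *: w + v) - 'D_w f (x + t *: w) = 'D_w phi (x + t *: w).
  rewrite /phi -[RHS]/('D_w ((fun y => f (y + v)) \- f) _) deriveB.
  - by rewrite derive_shift_arg.
  - apply: diff_derivable; apply: dv.
    by have := d1 1 t o1 t01; rewrite scale1r addrAC.
  - by apply: diff_derivable; have := d1 0 t z1 t01; rewrite scale0r addr0.
rewrite -Ht /phi.
rewrite [x + w + v]addrAC; ring.
Qed.

Lemma swap_second_difference (p q r s p' : R) : p = p' -> p - q - r + s = p' - r - q + s.
Proof. by move=> ->; ring. Qed.

Lemma dist_lt_double (p q s e : R) : `|p - s| < e -> `|q - s| < e -> `|p - q| < e + e.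
Proof.
move=> H1 H2; rewrite (_ : p - q = (p - s) - (q - s)); last by ring.
by rewrite (le_lt_trans (ler_normB _ _))// ltrD.
Qed.

(** The second difference over a small parallelogram is symmetric in its two sides. It equals [c^2]
    times a value of either mixed derivative at some point close to [x], so by continuity the two
    cannot differ at [x]. *)
Lemma derive_comm E (f : E -> R) x v w : smooth_at f x ->
  'D_v ('D_w f) x = 'D_w ('D_v f) x.
Proof.
move=> sf; pose a y := 'D_v ('D_w f) y; pose b y := 'D_w ('D_v f) y.
apply/eqP/negPn/negP => ab; pose e := `|a x - b x| / 2.
have e0 : 0 < e by rewrite divr_gt0// normr_gt0 subr_eq0.
have ca : {for x, continuous a} := smooth_at_cont (smooth_at_derive v (smooth_at_derive w sf)).
have cb : {for x, continuous b} := smooth_at_cont (smooth_at_derive w (smooth_at_derive v sf)).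
have na : \forall y \near x, `|a x - a y| < e.
  exact: ((cvgrPdist_lt _ _).1 ca _ e0).
have nb : \forall y \near x, `|b x - b y| < e.
  exact: ((cvgrPdist_lt _ _).1 cb _ e0).
have : nbhs x [set y | smooth_at f y /\ (`|a x - a y| < e /\ `|b x - b y| < e)].
  exact: (filterI (smooth_at_nbhs sf) (filterI na nb)).
move=> /nbhs_ballP[r r0 rH].
(* This factor keeps the parallelogram with sides [c *: v] and [c *: w] inside the ball of radius
   [r]; the summand 1 avoids a division by zero. *)
pose c := r / (`|v| + `|w| + 1).
have vw0 : 0 < `|v| + `|w| + 1 by rewrite ltr_wpDl// addr_ge0.
have c0 : 0 < c by rewrite divr_gt0.
have nZ (t0 : R) (u : E) : 0 <= t0 <= 1 -> `|t0 *: (c *: u)| <= c * `|u|.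
  move=> /andP[s0 s1]; rewrite scalerA normrZ ger0_norm; last first.
    by apply: mulr_ge0 => //; exact: ltW.
  by apply: ler_wpM2r => //; apply: ler_piMl => //; exact: ltW.
have B (s t : R) : 0 <= s <= 1 -> 0 <= t <= 1 -> ball x r (x + s *: (c *: v) + t *: (c *: w)).
  move=> s01 t01; rewrite -ball_normE /= opprD opprD !addrA subrr sub0r -opprD normrN.
  rewrite (le_lt_trans (ler_normD _ _))//.
  rewrite (le_lt_trans (lerD (nZ s v s01) (nZ t w t01)))//.
  by rewrite -mulrDr /c mulrAC -mulrA gtr_pMr// ltr_pdivrMr// mul1r ltrDl.
have DZ (u u' : E) y : smooth_at f y -> 'D_(c *: u) ('D_(c *: u') f) y = c * (c * 'D_u ('D_u' f) y).
  move=> sy; have dd := smooth_at_diff (smooth_at_derive u' sy).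
  have -> : 'D_(c *: u) ('D_(c *: u') f) y = 'D_(c *: u) (c \*: 'D_u' f) y.
    apply: (@near_eq_derive _ _ _ ('D_(c *: u') f) (c \*: 'D_u' f)).
    have := smooth_at_nbhs sy; apply: filterS => z sz /=.
    by rewrite !(deriveE _ (smooth_at_diff sz)) linearZ.
  rewrite deriveZ; last exact: (@diff_derivable _ _ _ _ _ _ dd).
  by rewrite !(deriveE _ dd) linearZ.
have ds (u : E) (s t : R) : 0 <= s <= 1 -> 0 <= t <= 1 ->
    differentiable ('D_u f) (x + s *: (c *: v) + t *: (c *: w)).
  by move=> s01 t01; have [sy _] := rH _ (B s t s01 t01); exact/smooth_at_diff/smooth_at_derive.
have [||s [t [s01 t01 H1]]] := @second_difference _ f x (c *: v) (c *: w).
- move=> s t s01 t01; have [sy _] := rH _ (B s t s01 t01); exact: smooth_at_diff.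
- by move=> s t; exact: ds.
have [||t' [s' [t01' s01' H2]]] := @second_difference _ f x (c *: w) (c *: v).
- move=> t' s' t01' s01'; rewrite addrAC; have [sy _] := rH _ (B s' t' s01' t01'); exact: smooth_at_diff.
- by move=> t' s' t01' s01'; rewrite addrAC; exact: ds.
have [sy [ay _]] := rH _ (B s t s01 t01).
have [sy' [_ by']] := rH _ (B s' t' s01' t01').
rewrite (DZ _ _ _ sy) in H1; rewrite [x + t' *: _ + _]addrAC (DZ _ _ _ sy') in H2.
have E1 : a (x + s *: (c *: v) + t *: (c *: w)) = b (x + s' *: (c *: v) + t' *: (c *: w)).
  apply: (mulfI (lt0r_neq0 c0)); apply: (mulfI (lt0r_neq0 c0)).
  apply: (etrans (esym H1)); apply: (etrans _ H2).
  by apply: swap_second_difference; rewrite addrAC.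
rewrite -E1 in by'; have := dist_lt_double ay by'.
by rewrite /e -splitr ltxx.
Qed.

End MeanValue.

(** * The inverse function theorem *)

HB.instance Definition _ (R : realType) (n : nat) :=
  Uniform_isComplete.Build 'rV[R]_n (@cauchy_cvg 'rV[R]_n).

Section InverseFunction.
Context {R : realType}.
Implicit Types E F G : normedModType R.

Definition jac n p (f : 'rV[R]_n -> 'rV[R]_p) (x : 'rV[R]_n) : 'M[R]_(n, p) :=
  \matrix_(i, j) ('D_(delta_mx 0 i) f x) 0 j.

Lemma jacE n p (f : 'rV[R]_n -> 'rV[R]_p) x v : differentiable f x ->
  'D_v f x = v *m jac f x.
Proof.
move=> df; rewrite (derive_sum_delta v df); apply/rowP => j.
rewrite summxE !mxE; apply: eq_bigr => i _; by rewrite !mxE.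
Qed.

Lemma smooth_at_jac n p (f : 'rV[R]_n -> 'rV[R]_p) x :
  smooth_at f x -> smooth_at (jac f) x.
Proof.
move=> sf; apply: smooth_at_mx => i j.
rewrite (_ : (fun y => _) = fun y => ('D_(delta_mx 0 i) f y) 0 j); last first.
  by apply/funext => y; rewrite mxE.
exact: (smooth_at_coord 0 j (smooth_at_derive (delta_mx 0 i) sf)).
Qed.

(** The solutions are the fixed points of [x |-> z - r x], a contraction of the closed ball of
    radius [d]: half of [d] pays for the variation of [r], the other half for the distance of [z]
    from the value at the centre. *)
Lemma contraction_solution n (r : 'rV[R]_n -> 'rV[R]_n) (x0 z : 'rV[R]_n) (d : R) :
  0 < d ->
  (forall x y, `|x0 - x| <= d -> `|x0 - y| <= d -> `|r x - r y| <= 2^-1 * `|x - y|) ->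
  `|z - (x0 + r x0)| <= d / 2 ->
  exists2 x, `|x0 - x| <= d & x + r x = z.
Proof.
move=> d0 lr zd; pose T x := z - r x.
pose U := [set x : 'rV[R]_n | `|x0 - x| <= d].
have Tmap : set_fun U U T.
  move=> x Ux; rewrite /U /T /=.
  rewrite (_ : x0 - (z - r x) = (r x - r x0) - (z - (x0 + r x0))); last first.
    by apply/rowP => i; rewrite !mxE; ring.
  rewrite (le_trans (ler_normB _ _))// (@le_trans _ _ (2^-1 * d + d / 2))//.
    apply: lerD => //; apply: le_trans (lr _ _ Ux _) _; first by rewrite subrr normr0 ltW.
    by rewrite ler_wpM2l ?invr_ge0// distrC.
  by rewrite [2^-1 * d]mulrC -splitr.
pose TM := isFun.Build _ _ U U T Tmap.
pose Tf : {fun U >-> U} := HB.pack T TM.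
have ctr : is_contraction Tf.
  have h0 : 0 <= 2^-1 :> R by rewrite invr_ge0.
  exists (NngNum h0); split=> /=; first by rewrite invf_lt1// ltr1n.
  move=> [x y] [/= Ux Uy]; rewrite /T opprB addrC addrA subrK distrC.
  exact: le_trans (lr _ _ Ux Uy) _.
have clU : closed U.
  rewrite (_ : U = (fun x => `|x0 - x|) @^-1` [set y | y <= d]) //.
  apply: closed_comp; last exact: closed_le.
  move=> x _; apply: (@continuous_comp _ _ _ (fun y : 'rV[R]_n => x0 - y) (fun z : 'rV[R]_n => `|z|)).
    by apply: smooth_at_cont; apply: smooth_at_sub; [exact: smooth_at_cst|exact: smooth_at_id].
  exact: norm_continuous.
have [|x Ux fx] := @banach_fixed_point R 'rV[R]_n U Tf ctr clU.
  by exists x0; rewrite /U /= subrr normr0 ltW.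
by exists x => //; rewrite {1}fx /= /T subrK.
Qed.

Lemma jac_unitmx n (f : 'rV[R]_n -> 'rV[R]_n) x : differentiable f x ->
  (forall v, 'D_v f x = 0 -> v = 0) -> jac f x \in unitmx.
Proof.
move=> df inj; rewrite -row_free_unit -kermx_eq0; apply/eqP/row_matrixP => i.
rewrite row0; apply: inj; rewrite jacE//.
by apply/sub_kermxP; exact: row_sub.
Qed.

Lemma continuous_mulmxr m n p (B : 'M[R]_(n, p)) : continuous (mulmxr B : 'M[R]_(m, n) -> 'M[R]_(m, p)).
Proof.
move=> y; apply: (@smooth_at_cont _ _ _ (fun y : 'M[R]_(m, n) => y *m B)).
by apply: smooth_at_mulmx; [exact: smooth_at_id|exact: smooth_at_cst].
Qed.

Lemma differentiable_mx E m n (f : E -> 'M[R]_(m, n)) x :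
  (forall i j, differentiable (fun y => f y i j) x) -> differentiable f x.
Proof.
move=> H; rewrite (_ : f = \sum_i \sum_j (fun y => f y i j *: delta_mx i j)); last first.
  apply/funext => y; rewrite [LHS]matrix_sum_delta fct_sumE.
  by apply: eq_bigr => i _; rewrite fct_sumE.
do 2 (apply: differentiable_sum => ?).
exact: (diff_scalev (H _ _) (differentiable_cst _ _)).1.
Qed.

Lemma differentiable_entry E m n (f : E -> 'M[R]_(m, n)) i j x :
  differentiable f x -> differentiable (fun y => f y i j) x.
Proof.
by move=> df; apply: (@differentiable_comp _ _ _ _ f (fun M : 'M_(m, n) => M i j));
  last exact: differentiable_coord.
Qed.

Lemma derive_entry E m n (f : E -> 'M[R]_(m, n)) i j x v :
  differentiable f x -> 'D_v f x i j = 'D_v (fun y => f y i j) x.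
Proof. by move=> df; rewrite derive_mx ?mxE//; exact: diff_derivable. Qed.

Lemma derive_mulmx E m n p (f : E -> 'M[R]_(m, n)) (g : E -> 'M[R]_(n, p)) x :
  differentiable f x -> differentiable g x ->
  differentiable (fun y => f y *m g y) x /\
  forall v, 'D_v (fun y => f y *m g y) x = 'D_v f x *m g x + f x *m 'D_v g x.
Proof.
move=> df dg.
have fE i j : (fun y => (f y *m g y) i j) =
    \sum_k ((fun y => f y i k) \* (fun y => g y k j)).
  by apply/funext => y; rewrite mxE fct_sumE.
have dk i j k : differentiable ((fun y => f y i k) \* (fun y => g y k j)) x.
  by apply: differentiableM; exact: differentiable_entry.
have dfg : differentiable (fun y => f y *m g y) x.
  by apply: differentiable_mx => i j; rewrite fE; apply: differentiable_sum.
split=> // v; apply/matrixP => i j.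
rewrite (derive_entry _ _ _ dfg) fE derive_sum; last by move=> k; exact: diff_derivable.
rewrite !mxE -big_split; apply: eq_bigr => k _ /=.
rewrite deriveM; [|exact/diff_derivable/differentiable_entry..].
rewrite (derive_entry i k v df) (derive_entry k j v dg) addrC.
by congr (_ + _); exact: mulrC.
Qed.

Lemma derive_mulmxr E m n p (f : E -> 'M[R]_(m, n)) (B : 'M[R]_(n, p)) x v :
  differentiable f x -> differentiable (fun y => f y *m B) x /\
  'D_v (fun y => f y *m B) x = 'D_v f x *m B.
Proof.
move=> df; have [H1 H2] := derive_mulmx df (differentiable_cst B x).
by split=> //; rewrite H2 derive_cst mulmx0 addr0.
Qed.

(** Multiplication by [B] inverts the derivative at [x], so [f y *m B - y] has derivative zero there
    and is 1/2-Lipschitz nearby. A kernel vector [v] of a nearby derivative satisfies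
    [|v| <= |v| / 2]. As [p] may exceed [n], this serves immersions as well as local
    diffeomorphisms. *)
Lemma close_to_id n p (f : 'rV[R]_n -> 'rV[R]_p) (B : 'M[R]_(p, n)) x :
  smooth_at f x -> (forall v, 'D_v f x *m B = v) ->
  exists2 d, 0 < d & forall y, ball x d y -> [/\ smooth_at f y,
    forall v, 'D_v f y = 0 -> v = 0 &
    forall z, ball x d z ->
     `|(f y *m B - y) - (f z *m B - z)| <= 2^-1 * `|y - z|].
Proof.
move=> sf JB; pose r y := f y *m B - y.
have sfB y : smooth_at f y -> smooth_at (fun y => f y *m B) y.
  by move=> sy; apply: smooth_at_mulmx => //; exact: smooth_at_cst.
have sr y : smooth_at f y -> smooth_at r y.
  by move=> sy; apply: smooth_at_sub; [exact: sfB|exact: smooth_at_id].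
have dr y v : smooth_at f y -> 'D_v r y = 'D_v f y *m B - v.
  move=> sy; have [d1 d2] := derive_mulmxr B v (smooth_at_diff sy).
  rewrite /r -[LHS]/('D_v ((fun y => f y *m B) \- id) y) deriveB.
  - by rewrite derive_id d2.
  - exact: diff_derivable.
  - exact: derivable_id.
have h0 : 0 < 2^-1 :> R by rewrite invr_gt0.
have d0 v : 'D_v r x = 0 by rewrite dr// JB subrr.
have [d1 d10 [Hr1 Hr2]] := small_derive_ball h0 (sr _ sf) d0.
have /nbhs_ballP[d2 /= d20 Hd2] := smooth_at_nbhs sf.
have B1 y : ball x (Num.min d1 d2) y -> ball x d1 y.
  by apply: le_ball; rewrite ge_min lexx.
have B2 y : ball x (Num.min d1 d2) y -> ball x d2 y.
  by apply: le_ball; rewrite ge_min lexx orbT.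
exists (Num.min d1 d2); first by rewrite lt_min d10.
move=> y By; have sy := Hd2 _ (B2 _ By); split=> //.
  move=> v fv0; have [_ /(_ v)] := Hr1 _ (B1 _ By).
  rewrite dr// fv0 mul0mx sub0r normrN => H; apply/normr0_eq0.
  by have := normr_ge0 v; lra.
by move=> z /B1 Bz; apply: Hr2 => //; exact: B1.
Qed.

Lemma halving_injective n (u v : 'rV[R]_n) (a b : 'rV[R]_n) :
  `|(a - u) - (b - v)| <= 2^-1 * `|u - v| -> `|u - v| <= 2 * `|a - b|.
Proof.
move=> H; have : `|u - v| <= `|a - b| + `|(a - u) - (b - v)|.
  rewrite (_ : u - v = (a - b) - ((a - u) - (b - v))); last first.
    by apply/rowP => i; rewrite !mxE; ring.
  exact: ler_normB.
lra.
Qed.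

(** The Jacobian has a one-sided inverse [B] even for [p > n], and [f y *m B] is the identity up to
    a 1/2-Lipschitz error, which leaves no room for two points with the same image. *)
Lemma locally_injective n p (f : 'rV[R]_n -> 'rV[R]_p) x : smooth_at f x ->
  (forall v, 'D_v f x = 0 -> v = 0) ->
  exists2 d, 0 < d & forall y z, ball x d y -> ball x d z -> f y = f z -> y = z.
Proof.
move=> sf inj; pose J := jac f x.
have fJ : row_free J.
  rewrite -kermx_eq0; apply/eqP/row_matrixP => i; rewrite row0; apply: inj.
  rewrite jacE; last exact: smooth_at_diff.
  by apply/sub_kermxP; exact: row_sub.
have [B JB] := row_freeP fJ.
have [|d d0 H] := @close_to_id _ _ f B x sf.
  by move=> v; rewrite (jacE _ (smooth_at_diff sf)) -mulmxA -/J JB mulmx1.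
exists d => // y z By Bz fyz; have [_ _ /(_ _ Bz) /halving_injective] := H _ By.
by rewrite fyz subrr normr0 mulr0 normr_le0 subr_eq0 => /eqP.
Qed.

(** Solving [f x = y] is solving [x + r x = y *m B] with [r] a 1/2-Lipschitz map. The local inverse
    [g] is then Lipschitz, hence differentiable, with the inverse of the Jacobian at [g y] as
    derivative. *)
Theorem inverse_function n (f : 'rV[R]_n -> 'rV[R]_n) x0 : smooth_at f x0 ->
  (forall v, 'D_v f x0 = 0 -> v = 0) ->
  exists U V g, [/\ open_nbhs x0 U, open_nbhs (f x0) V, smooth_on U f, smooth_on V g &
    (forall x, U x -> V (f x) /\ g (f x) = x) /\
    (forall y, V y -> U (g y) /\ f (g y) = y)].
Proof.
move=> sf inj; pose J := jac f x0; have Ju := jac_unitmx (smooth_at_diff sf) inj.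
pose B := invmx J.
have [|rho rho0 H] := @close_to_id _ _ f B x0 sf.
  by move=> v; rewrite (jacE _ (smooth_at_diff sf)) -mulmxA mulmxV ?mulmx1.
have x0B : ball x0 rho x0 by exact: ballxx.
pose d := rho / 2; have d0 : 0 < d by rewrite divr_gt0.
have dB x : `|x0 - x| <= d -> ball x0 rho x.
  rewrite -ball_normE /= => /le_lt_trans; apply.
  by rewrite /d ltr_pdivrMr// ltr_pMr// ltr1n.
pose V := [set y : 'rV[R]_n | `|y *m B - f x0 *m B| < d / 2].
have oV : open V.
  apply: (@open_comp _ _ (fun y : 'rV[R]_n => `|y *m B - f x0 *m B|) [set t | t < d / 2]).
    move=> y _; apply: (@continuous_comp _ _ _ (fun y : 'rV[R]_n => y *m B - f x0 *m B) (fun z => `|z|)).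
      apply: smooth_at_cont; apply: smooth_at_sub; last exact: smooth_at_cst.
      by apply: smooth_at_mulmx; [exact: smooth_at_id|exact: smooth_at_cst].
    exact: norm_continuous.
  exact: open_lt.
pose U := ball x0 rho `&` f @^-1` V.
have oU : open U.
  rewrite openE => x [Bx Vfx]; apply: filterI; first exact: open_nbhs_nbhs (conj (ball_open _ _) Bx).
  have [sx _ _] := H _ Bx; have cx := smooth_at_cont sx.
  by apply: cx; exact: open_nbhs_nbhs.
have injB x y : ball x0 rho x -> ball x0 rho y -> f x = f y -> x = y.
  move=> Bx By fxy; have [_ _ /(_ _ By) /halving_injective] := H _ Bx.
  by rewrite fxy subrr normr0 mulr0 normr_le0 subr_eq0 => /eqP.
have mulBI y y' : y *m B = y' *m B :> 'rV[R]_n -> y = y'.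
  by move=> /(congr1 (mulmx^~ J)); rewrite -!mulmxA mulVmx// !mulmx1.
have surj y : V y -> exists x, ball x0 rho x /\ f x = y.
  move=> Vy.
  have [||x xd xr] := @contraction_solution _ (fun x => f x *m B - x) x0 (y *m B) d d0.
  - move=> x z /dB Bx /dB Bz; have [_ _] := H _ Bx; exact.
  - by rewrite subrKC ltW.
  by exists x; split; [exact: dB|apply: mulBI; rewrite -xr subrKC].
(* The default value [x0] is taken only where [y] has no preimage in the ball, hence outside [V]. *)
pose g y := xget x0 [set x | ball x0 rho x /\ f x = y].
have gP y : V y -> ball x0 rho (g y) /\ f (g y) = y.
  by move=> /surj[x Hx]; rewrite /g; case: xgetP => [z _ []//|/(_ x)].
have VU y : V y -> U (g y) /\ f (g y) = y.
  by move=> Vy; have [Bg fg] := gP _ Vy; split=> //; split=> //; rewrite /preimage /= fg.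
have UV x : U x -> V (f x) /\ g (f x) = x.
  by move=> [Bx Vfx]; split=> //; have [Bg fg] := gP _ Vfx; exact: injB.
have dg y : V y -> differentiable g y /\ forall v, 'D_v g y = v *m invmx (jac f (g y)).
  move=> Vy; have [Bg fg] := gP _ Vy; have [sg kg lg] := H _ Bg.
  have Jg := jac_unitmx (smooth_at_diff sg) kg.
  set A := invmx (jac f (g y)).
  suff [D1 D2] : differentiable g y /\ forall v, 'D_v g y = mulmxr A v by [].
  apply: diff_epsP; first exact: continuous_mulmxr.
  move=> e e0.
  have [kB kB0 HB] := mulmx_bounded B; have [kA kA0 HA] := mulmx_bounded A.
  have nV : \forall h \near (0 : 'rV[R]_n), V (y + h).
    by apply: (near_add0 y V).1; exact: open_nbhs_nbhs.
  have lip h : V (y + h) -> `|g (y + h) - g y| <= 2 * kB * `|h|.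
    move=> Vh; have [Bh fh] := gP _ Vh.
    have [_ _ /(_ _ Bg) /halving_injective/le_trans] := H _ Bh; apply.
    rewrite fh fg -mulmxBl [y + h]addrC addrK -mulrA ler_wpM2l//.
  (* The first-order error of [f] gets multiplied by the bound [kA] of the inverse Jacobian, and is
     measured against an increment of [g] of size at most [2 * kB * |h|]; the quotient compensates
     both factors. *)
  have e'0 : 0 < e / (kA * (2 * kB)) by rewrite divr_gt0// !mulr_gt0.
  have := diff_eps (smooth_at_diff sg) e'0.
  move=> /nbhs_ballP[d' /= d'0 Hd'].
  have n0 : \forall h \near (0 : 'rV[R]_n), 2 * kB * `|h| < d'.
    apply/nbhs_ballP; exists (d' / (2 * kB)); first by rewrite /= divr_gt0// mulr_gt0.
    move=> h; rewrite -ball_normE /= sub0r normrN ltr_pdivlMr ?mulr_gt0// mulrC.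
    by [].
  near=> h; have Vh : V (y + h) by near: h.
  have [Bh fh] := gP _ Vh; set k := g (y + h) - g y.
  have kd : `|k| < d' by apply: le_lt_trans (lip _ Vh) _; near: h.
  have := Hd' k; rewrite -ball_normE /= sub0r normrN => /(_ kd).
  rewrite {1}/k subrKC fh fg [y + h]addrC addrK (jacE _ (smooth_at_diff sg)) => Hk.
  have -> : k - h *m A = - ((h - k *m jac f (g y)) *m A).
    by rewrite mulmxBl -mulmxA mulmxV// mulmx1 opprB.
  rewrite normrN (le_trans (HA _))// (@le_trans _ _ (kA * (e / (kA * (2 * kB)) * `|k|)))//.
    by rewrite ler_wpM2l// ltW.
  rewrite (@le_trans _ _ (kA * (e / (kA * (2 * kB)) * (2 * kB * `|h|))))//.
    by rewrite ler_wpM2l ?(ltW kA0)// ler_wpM2l ?(ltW e'0)// lip.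
  rewrite (_ : kA * _ = e * `|h|)//.
  by field; rewrite !gt_eqF.
(* Bootstrap: the derivative of [g] is a smooth function of [g] itself, so each order of smoothness
   of [g] yields the next. *)
have sgV : smooth_on V g.
  move=> k; elim: k => [|k IH].
    by move=> y /dg[/differentiable_continuous].
  split=> [y /dg[]//|v].
  apply: (@Ck_eq _ k _ _ V (fun y => v *m invmx (jac f (g y)))) => //.
    by move=> y /dg[_ ->].
  apply: (@Ck_comp _ k _ _ _ V U g (fun x => v *m invmx (jac f x))) => //.
  - exact: findim_rV.
  - by move=> y /VU[].
  - apply: smooth_atP => x [Bx _]; have [sx kx _] := H _ Bx.
    apply: smooth_at_mulmx; first exact: smooth_at_cst.
    apply: smooth_at_invmx; first exact: jac_unitmx (smooth_at_diff sx) kx.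
    exact: smooth_at_jac.
have Vx0 : V (f x0) by rewrite /V /= subrr normr0 divr_gt0.
exists U, V, g; split=> //.
by apply: smooth_atP => x [Bx _]; have [] := H _ Bx.
Unshelve. all: by end_near. Qed.

End InverseFunction.

(** * Antiderivatives on the line *)

Section Antiderivative.
Context {R : realType}.
Implicit Types E F G : normedModType R.

(** The integral from -3, shifted to vanish at 0. Working on [[-3, 3]] keeps every [t] with
    [|t| < 2] in the interior, and this range contains [[0, 1]] in its own interior. *)
Lemma antiderivative (g : R -> R) : continuous g ->
  exists G : R -> R, G 0 = 0 /\ forall t : R, `|t| < 2 -> is_derive t 1 G (g t).
Proof.
move=> cg.
have ig : lebesgue_measure.-integrable `[-3, 3] (EFin \o g).
  apply: continuous_compact_integrable; first exact: segment_compact.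
  exact: continuous_subspaceT.
have [F HF] : exists F : R -> R, forall t : R, `|t| < 2 -> is_derive t 1 F (g t).
  exists (fun x => (\int[lebesgue_measure]_(t in [set` `[-3, x]]) (g t))%R).
  move=> t; rewrite ltr_norml => /andP[t1 t2].
  have t3 : t < 3 by apply: lt_trans t2 _; rewrite ltr_nat.
  have t4 : -3 < t by apply: lt_trans t1; rewrite ltrN2 ltr_nat.
  have [d1 d2] := continuous_FTC1_closed t3 ig t4 (cg t).
  by apply: DeriveDef; [exact: d1|rewrite -derive1E; exact: d2].
exists (F - cst (F 0)); split; first by rewrite !fctE subrr.
by move=> t t2; rewrite -[g t]subr0; apply: is_deriveB; exact: HF.
Qed.

Definition prim (g : R -> R) : R -> R :=
  xget (fun=> 0) [set G | G 0 = 0 /\ forall t : R, `|t| < 2 -> is_derive t 1 G (g t)].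

Lemma primP (g : R -> R) : continuous g ->
  prim g 0 = 0 /\ forall t : R, `|t| < 2 -> is_derive t 1 (prim g) (g t).
Proof.
by move=> /antiderivative[G HG]; rewrite /prim; case: xgetP => [H _ //|/(_ G)].
Qed.

Lemma increment_bound (F f : R -> R) (e s t : R) :
  (forall u : R, u \in `]s, t[ -> is_derive u 1 F (f u)) ->
  {within `[s, t], continuous F} ->
  (forall u : R, u \in `]s, t[ -> `|f u| <= e) -> s <= t -> `|F t - F s| <= e * (t - s).
Proof.
move=> dF cF fe; rewrite le_eqVlt => /predU1P[->|st]; first by rewrite !subrr normr0 mulr0.
have [c cst ->] := MVT st dF cF.
rewrite normrM [X in _ * X]gtr0_norm ?subr_gt0//.
by apply: ler_wpM2r; [rewrite subr_ge0 ltW|exact: fe].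
Qed.

Lemma derive_increment_bound (F f : R -> R) (e s t T : R) :
  (forall u : R, `|u| < T -> is_derive u 1 F (f u)) -> `|s| < T -> `|t| < T ->
  (forall u, Num.min s t <= u <= Num.max s t -> `|f u| <= e) ->
  `|F t - F s| <= e * `|t - s|.
Proof.
wlog st : s t / s <= t.
  move=> H dF sT tT fe; have [st|/ltW st] := leP s t; first exact: H.
  by rewrite distrC [`|t - s|]distrC; apply: H => // u; rewrite minC maxC; exact: fe.
move=> dF; rewrite !ltr_norml => /andP[s1 s2] /andP[t1 t2]; rewrite min_l// max_r// => fe.
have uT u : s <= u -> u <= t -> `|u| < T.
  move=> su ut; rewrite ltr_norml; apply/andP; split; first exact: lt_le_trans s1 su.
  exact: le_lt_trans ut t2.
rewrite [`|t - s|]ger0_norm ?subr_ge0//; apply: (@increment_bound F f).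
- by move=> u; rewrite in_itv /= => /andP[su ut]; apply: dF; apply: uT; exact: ltW.
- apply: derivable_within_continuous => u; rewrite in_itv /= => /andP[su ut].
  by have [] := dF _ (uT _ su ut).
- by move=> u; rewrite in_itv /= => /andP[su ut]; apply: fe; rewrite !ltW.
- exact: st.
Qed.

Lemma antideriv_unique01 (G Phi g h : R -> R) :
  (forall u : R, 0 <= u <= 1 -> is_derive u 1 G (g u)) ->
  (forall u : R, 0 <= u <= 1 -> is_derive u 1 Phi (h u)) ->
  (forall u, 0 < u -> u < 1 -> g u = h u) -> G 1 - G 0 = Phi 1 - Phi 0.
Proof.
move=> dG dPhi gh.
have dD (u : R) : 0 <= u <= 1 -> is_derive u 1 (G - Phi) (g u - h u).
  by move=> u01; apply: is_deriveB; [exact: dG|exact: dPhi].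
have : `|(G - Phi) 1 - (G - Phi) 0| <= 0 * (1 - 0).
  apply: (@increment_bound _ (fun u => g u - h u)).
  - move=> u; rewrite in_itv /= => /andP[u0 u1]; apply: dD.
    by rewrite (ltW u0) (ltW u1).
  - apply: derivable_within_continuous => u; rewrite in_itv /= => u01.
    by have [] := dD u u01.
  - move=> u; rewrite in_itv /= => /andP[u0 u1].
    by rewrite gh// subrr normr0.
  - exact: ler01.
rewrite mul0r normr_le0 !fctE => /eqP; lra.
Qed.

Lemma prim_comb n (a : R) (g h : R -> R) (c : 'I_n -> R) (k : 'I_n -> R -> R) (G : R -> R) :
  continuous g -> continuous h -> (forall i, continuous (k i)) ->
  (forall t, G t = g t - h t - \sum_i c i * k i t) -> a = 1 ->
  forall t : R, `|t| < 2 ->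
  is_derive t 1 (fun t => prim g t - prim h t - \sum_i c i * prim (k i) t) (G t).
Proof.
move=> cg ch ck GE _ t t2; rewrite GE.
have -> : (fun t => prim g t - prim h t - \sum_i c i * prim (k i) t) =
   (prim g - prim h) - \sum_i (c i *: prim (k i)).
  by apply/funext => s; rewrite !fctE fct_sumE.
have [_ dg] := primP cg; have [_ dh] := primP ch.
apply: is_deriveB; first by apply: is_deriveB; [exact: dg|exact: dh].
apply: is_derive_sum => i; apply: is_deriveZ; have [_] := primP (ck i); exact.
Qed.

Definition clamp (e t : R) : R := Num.max (- e) (Num.min e t).

Lemma clamp_continuous e : continuous (clamp e).
Proof.
move=> t; apply: (@continuous_max R R (cst (- e)) (cst e \min id)).
  exact: cst_continuous.
apply: (@continuous_min R R (cst e) id); [exact: cst_continuous|exact: cvg_id].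
Qed.

Lemma clamp_id e t : `|t| <= e -> clamp e t = t.
Proof. by rewrite ler_norml => /andP[t1 t2]; rewrite /clamp min_r// max_r. Qed.

Lemma clamp_le e t : 0 <= e -> `|clamp e t| <= e.
Proof.
move=> e0; rewrite ler_norml /clamp le_max lexx /= ge_max ge_min lexx /= andbT.
by rewrite (le_trans _ e0)// oppr_le0.
Qed.

Lemma clamp_lip e s t : `|clamp e s - clamp e t| <= `|s - t|.
Proof.
rewrite /clamp; wlog st : s t / s <= t.
  by move=> H; have [|/ltW] := leP s t => /H//; rewrite distrC [leRHS]distrC.
rewrite [leRHS]distrC [leLHS]distrC [leRHS]ger0_norm ?subr_ge0//.
have H (a b c d : R) : a <= b -> b - a <= d - c -> `|b - a| <= d - c.
  by move=> ab; rewrite ger0_norm ?subr_ge0.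
apply: H.
  by rewrite ge_max !le_max lexx /= ge_min !le_min ge_min lexx /= ge_min st !orbT.
rewrite /Order.max /Order.min; do ! case: ifPn => //; rewrite -?leNgt => *; lra.
Qed.

End Antiderivative.

(** * Differentiation under the integral sign *)

Section ParametricIntegral.
Context {R : realType} (n : nat).
Implicit Types F : R * 'rV[R]_n -> R.

(* The integral of F(u, x) over 0 <= u <= 1; clamping makes the integrand
   continuous on the whole line. *)
Definition pint F (x : 'rV[R]_n) : R := prim (fun u => F (`|clamp 1 u|, x)) 1.

Definition smooth_strip F (V : set 'rV[R]_n) :=
  forall u x, 0 <= u <= 1 -> V x -> smooth_at F (u, x).

Let c01 u : 0 <= `|clamp 1 u| <= (1 : R).
Proof. by rewrite normr_ge0 clamp_le. Qed.

Lemma pint_integrand_continuous F (V : set 'rV[R]_n) x : smooth_strip F V -> V x ->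
  continuous (fun u => F (`|clamp 1 u|, x)).
Proof.
move=> sF Vx u.
apply: (@continuous_comp _ _ _ (fun u => (`|clamp 1 u|, x)) F).
  have cc : {for u, continuous (fun u : R => `|clamp 1 u|)}.
    apply: (@continuous_comp _ _ _ (clamp 1) (fun z : R => `|z|)); first exact: clamp_continuous.
    exact: norm_continuous.
  exact: (cvg_pair cc (cvg_cst x)).
by apply: smooth_at_cont; exact: sF.
Qed.

Lemma smooth_strip_derive F V v : smooth_strip F V ->
  smooth_strip (fun p => 'D_((0 : R), v) F p) V.
Proof. by move=> sF u x u01 Vx; apply: smooth_at_derive; exact: sF. Qed.

(** For small [h] the partial derivatives of [F] at [(u, x + h)] and [(u, x)] differ by at most
    [e / (n+1)] for all [u] simultaneously. The mean value theorem in [x] then bounds the integrand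
    of the first-order error by [e * |h|], and the bound passes to the integral. *)
Lemma pint_diff F (V : set 'rV[R]_n) x : open V -> smooth_strip F V -> V x ->
  differentiable (pint F) x /\
  forall v, 'D_v (pint F) x = pint (fun p => 'D_((0 : R), v) F p) x.
Proof.
move=> oV sF Vx.
pose D i p := 'D_((0 : R), delta_mx 0 i) F p.
have sD i : smooth_strip (D i) V by exact: smooth_strip_derive.
have dsum v u y : 0 <= u <= 1 -> V y -> 'D_((0 : R), v) F (u, y) = \sum_i v 0 i * D i (u, y).
  move=> u01 Vy; rewrite -derive_snd derive_sum_delta; last first.
    apply: (@differentiable_comp _ _ _ _ (fun y => (u, y)) F).
      by apply: smooth_at_diff; apply: smooth_at_pair; [exact: smooth_at_cst|exact: smooth_at_id].
    by apply: smooth_at_diff; exact: sF.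
  by apply: eq_bigr => i _; rewrite derive_snd.
pose col : 'cV[R]_n := \col_i pint (D i) x.
pose L : {linear 'rV[R]_n -> R} := @coordf R 1 1 0 0 \o mulmxr col.
have LE v : L v = \sum_i v 0 i * pint (D i) x.
  by rewrite /L /= /coordf mxE; apply: eq_bigr => i _; rewrite mxE.
have cL : continuous L.
  move=> y; apply: (@continuous_comp _ _ _ (mulmxr col) (@coordf R 1 1 0 0)).
    exact: continuous_mulmxr.
  exact: coordf_continuous.
(* Compactness of [[0, 1]] turns the continuity at each [u] into a neighbourhood of 0 valid for all
   [u]. *)
have unif e : 0 < e -> \forall h \near (0 : 'rV[R]_n), [set` `[0, 1]%R] `<=`
    (fun u => V (x + h) /\ forall i, `|D i (u, x + h) - D i (u, x)| <= e).
  move=> e0; have cov := (@compact_near_coveringP R [set` `[0, 1]%R]).1 (@segment_compact R 0 1).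
  apply: (cov _ (nbhs (0 : 'rV[R]_n)) (fun h u => V (x + h) /\
    forall i, `|D i (u, x + h) - D i (u, x)| <= e)) => u; rewrite /= in_itv /= => u01.
  have e2 : 0 < e / 2 by rewrite divr_gt0.
  have Hn : \forall p \near (u, x), V p.2 /\ forall i, `|D i (u, x) - D i p| <= e / 2.
    near=> p; split.
      by near: p; apply: (@snd_continuous R R 'rV[R]_n); exact: open_nbhs_nbhs.
    near: p; apply: filter_forall => i.
    by have := smooth_at_cont (sD i u x u01 Vx); move/cvgrPdist_le; exact.
  have [[A B] /= [nA nB] AB] := Hn.
  have Au : A u := nbhs_singleton nA; have Bx : B x := nbhs_singleton nB.
  exists (A, [set h | B (x + h)]) => /=; first by split=> //; exact: (near_add0 x B).1.
  move=> [u' h] [/= Au' Bh]; have [V1 H1] := AB (u', x + h) (conj Au' Bh).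
  have [V2 H2] := AB (u', x) (conj Au' Bx); split=> // i.
  rewrite (_ : _ - _ = (D i (u, x) - D i (u', x)) - (D i (u, x) - D i (u', x + h))); last by ring.
  by rewrite (le_trans (ler_normB _ _))// [e]splitr lerD.
have HL e : 0 < e -> \forall h \near (0 : 'rV[R]_n), `|pint F (x + h) - pint F x - L h| <= e * `|h|.
  move=> e0; have e'0 : 0 < e / n.+1%:R by rewrite divr_gt0.
  have /nbhs_ballP[r /= r0 Hr] := unif _ e'0.
  apply/nbhs_ballP; exists r => // h Bh.
  have Vh : V (x + h).
    by have /= [] := Hr _ Bh 0; rewrite // in_itv /= lexx ler01.
  have Bth t : 0 <= t <= 1 -> ball 0 r (t *: h).
    move=> /andP[t0 t1]; move: Bh; rewrite -!ball_normE /= !sub0r !normrN normrZ ger0_norm//.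
    by apply: le_lt_trans; rewrite ler_piMl.
  have cF y : V y -> continuous (fun u => F (`|clamp 1 u|, y)).
    exact: pint_integrand_continuous sF.
  have cD i : continuous (fun u => D i (`|clamp 1 u|, x)).
    exact: pint_integrand_continuous (sD i) Vx.
  pose G u := F (`|clamp 1 u|, x + h) - F (`|clamp 1 u|, x) - \sum_i h 0 i * D i (`|clamp 1 u|, x).
  have dG := @prim_comb R n 1 _ _ (fun i => h 0 i) _ G (cF _ Vh) (cF _ Vx) cD (fun=> erefl) erefl.
  have := @derive_increment_bound R _ G (e * `|h|) 0 1 2 dG.
  rewrite normr0 normr1 ltr0n ltr1n => /(_ isT isT).
  have [p1 _] := primP (cF _ Vh); have [p2 _] := primP (cF _ Vx).
  rewrite p1 p2 [X in _ - (_ - X)]big1; last first.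
    by move=> i _; have [-> _] := primP (cD i); rewrite mulr0.
  rewrite !subr0 normr1 mulr1 => H.
  suff H' : `|pint F (x + h) - pint F x - \sum_i h 0 i * pint (D i) x| <= e * `|h| by rewrite -LE in H'.
  apply: H => u _.
  rewrite /G; move: (`|clamp 1 u|) (c01 u) => {}u u01.
  have [|t t01 Ht] := @mvt_segment R _ (fun y => F (u, y)) x h.
    move=> t t01; apply: (@differentiable_comp _ _ _ _ (fun y => (u, y)) F).
      by apply: smooth_at_diff; apply: smooth_at_pair; [exact: smooth_at_cst|exact: smooth_at_id].
    apply: smooth_at_diff; apply: sF => //.
    by have [] := Hr _ (Bth _ t01) u; rewrite //= in_itv.
  have [Vt Htt] : V (x + t *: h) /\ forall i, `|D i (u, x + t *: h) - D i (u, x)| <= e / n.+1%:R.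
    by have [] := Hr _ (Bth _ t01) u; rewrite //= in_itv.
  rewrite Ht derive_snd dsum// -sumrB (le_trans (ler_norm_sum _ _ _))//.
  apply: (@le_trans _ _ (\sum_(i < n) e / n.+1%:R * `|h|)).
    apply: ler_sum => i _; rewrite -mulrBr normrM mulrC ler_pM//; exact: rV_coord_le.
  rewrite -mulr_suml; apply: ler_wpM2r => //; rewrite sumr_const card_ord -[leLHS]mulr_natr.
  by rewrite -mulrA ger_pMr// mulrC ler_pdivrMr// mul1r ler_nat.
have [D1 D2] := diff_epsP cL HL; split=> // v.
(* It remains to exchange the integral with the finite sum over the coordinates of [v]: the
   difference of the two antiderivatives has derivative zero and vanishes at 0. *)
rewrite D2 LE.
have cv : continuous (fun u => 'D_((0 : R), v) F (`|clamp 1 u|, x)).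
  exact: pint_integrand_continuous (smooth_strip_derive v sF) Vx.
have cD i : continuous (fun u => D i (`|clamp 1 u|, x)).
  exact: pint_integrand_continuous (sD i) Vx.
have c0 : continuous (fun _ : R => 0 : R) by move=> ?; exact: cvg_cst.
have dG := @prim_comb R n 1 _ _ (fun i => v 0 i) _ (fun _ => 0) cv c0 cD _ erefl.
have := @derive_increment_bound R _ (fun _ => 0) 0 0 1 2 (dG _).
rewrite normr0 normr1 ltr0n ltr1n mul0r => H.
have {}H := H _ isT isT _.
have [p1 _] := primP cv; have [p2 _] := primP c0.
move: H; rewrite p1 p2 [X in _ - (_ - X)]big1; last first.
  by move=> i _; have [-> _] := primP (cD i); rewrite mulr0.
have -> : prim (fun _ : R => 0 : R) 1 = 0.
  have := @derive_increment_bound R (prim (fun _ : R => 0 : R)) (fun _ => 0) 0 0 1 2 (primP c0).2.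
  rewrite normr0 normr1 ltr0n ltr1n mul0r (primP c0).1 subr0 => /(_ isT isT (fun _ _ => lexx _)).
  by rewrite normr_le0 => /eqP.
rewrite !subr0 => H; apply/esym/eqP; rewrite -subr_eq0 -normr_le0; apply: H => //.
by move=> t; rewrite dsum// !subr0 subrr.
Unshelve. all: by end_near. Qed.

(** The derivative of a parameter integral is again one, with an integrand that is smooth on the
    same strip. *)
Theorem smooth_pint F (V : set 'rV[R]_n) : open V -> smooth_strip F V ->
  smooth_on V (pint F).
Proof.
move=> oV + k; elim: k F => [|k IH] F sF.
  by move=> x Vx; apply: differentiable_continuous; have [] := pint_diff oV sF Vx.
split=> [x Vx|v]; first by have [] := pint_diff oV sF Vx.
apply: Ck_eq (IH _ (smooth_strip_derive v sF)) => // x Vx.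
by have [_ ->] := pint_diff oV sF Vx.
Qed.

Lemma pint_ftc F (x : 'rV[R]_n) (Phi : R -> R) :
  continuous (fun u => F (`|clamp 1 u|, x)) ->
  (forall u : R, 0 <= u <= 1 -> is_derive u 1 Phi (F (u, x))) ->
  pint F x = Phi 1 - Phi 0.
Proof.
move=> cF dPhi; have [p0 dp] := primP cF.
have := @antideriv_unique01 R (prim (fun u => F (`|clamp 1 u|, x))) Phi
  (fun u => F (`|clamp 1 u|, x)) (fun u => F (u, x)) _ dPhi _.
rewrite p0 subr0; apply.
  move=> u u01; apply: dp; case/andP: u01 => u0 u1.
  by rewrite ger0_norm// (le_lt_trans u1)// ltr1n.
move=> u u0 u1; have u00 := ltW u0; have u11 := ltW u1.
by rewrite clamp_id ger0_norm.
Qed.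

End ParametricIntegral.

(** * Limits of geometrically convergent sequences *)

Section GeometricLimit.
Context {R : realType}.

Let q k : R := 2^-1 ^+ k.
Let qS k : q k.+1 = q k / 2.
Proof. by rewrite /q exprSr. Qed.
Let q0 k : 0 < q k.
Proof. by rewrite exprn_gt0// invr_gt0. Qed.

(** The intervals of centre [u k] and radius [2 C / 2^k] are nested, and the supremum of their left
    end points lies in all of them. *)
Lemma geometric_limit (u : nat -> R) (C : R) :
  (forall k, `|u k.+1 - u k| <= C * 2^-1 ^+ k) ->
  exists l, forall k, `|u k - l| <= 2 * C * 2^-1 ^+ k.
Proof.
rewrite -/(q _) => H; have {}H k : `|u k.+1 - u k| <= C * q k by exact: H.
have C0 : 0 <= C by have := le_trans (normr_ge0 _) (H 0); rewrite /q expr0 mulr1.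
pose a k := u k - 2 * C * q k; pose b k := u k + 2 * C * q k.
have aS k : a k <= a k.+1.
  by have := H k; rewrite ler_norml /a qS => /andP[h1 _]; lra.
have bS k : b k.+1 <= b k.
  by have := H k; rewrite ler_norml /b qS => /andP[_ h1]; lra.
have am k j : a k <= a (j + k)%N by elim: j => // j /le_trans; apply; exact: aS.
have bm k j : b (j + k)%N <= b k by elim: j => // j; apply: le_trans; exact: bS.
have ab k : a k <= b k.
  by have := mulr_ge0 C0 (ltW (q0 k)); rewrite /a /b; lra.
have abkj k j : a k <= b j.
  have [kj|/ltnW jk] := leqP k j.
    by have := am k (j - k)%N; rewrite subnK// => /le_trans; apply.
  by have := bm j (k - j)%N; rewrite subnK//; apply: le_trans.
exists (sup [set a k | k in setT]) => k.
have hu : has_ubound [set a k | k in setT] by exists (b 0%N) => _ [j _ <-].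
have h1 : a k <= sup [set a k | k in setT] by apply: ub_le_sup => //; exists k.
have h2 : sup [set a k | k in setT] <= b k.
  by apply: ge_sup; [exists (a 0%N); exists 0%N|move=> _ [j _ <-]].
by rewrite -/(q k) ler_norml; move: h1 h2; rewrite /a /b => h1 h2; apply/andP; split; lra.
Qed.

Lemma geometric_le0 (x C : R) : (forall k, x <= C * 2^-1 ^+ k) -> x <= 0.
Proof.
move=> H; rewrite leNgt; apply/negP => x0.
have C0 : 0 < C by have := H 0%N; rewrite expr0 mulr1; exact: lt_le_trans.
pose k := Num.truncn (C / x).
have hk : C / x < k.+1%:R by exact: truncnS_gt.
have hk2 : k.+1%:R <= 2 ^+ k.+1 :> R by rewrite -natrX ler_nat; apply/ltnW/ltn_expl.
have := H k.+1; rewrite exprVn leNgt ltr_pdivrMr ?exprn_gt0//.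
rewrite mulrC -ltr_pdivrMr// => /negP; apply; exact: lt_le_trans hk hk2.
Qed.

End GeometricLimit.

(** * Existence of integral curves *)

Section Picard.
Context {R : realType} (n : nat).
Implicit Types g h : R -> 'rV[R]_n.

Definition vprim g (t : R) : 'rV[R]_n := \row_j prim (fun s => g s 0 j) t.

Let coord_cont g (j : 'I_n) : continuous g -> continuous (fun s => g s 0 j).
Proof.
move=> cg t; apply: (@continuous_comp _ _ _ g (fun M : 'rV[R]_n => M 0 j)).
  exact: cg.
exact: coord_continuous.
Qed.

Lemma vprim0 g : continuous g -> vprim g 0 = 0.
Proof.
by move=> cg; apply/rowP => j; rewrite !mxE; have [] := primP (coord_cont (j := j) cg).
Qed.

Lemma vprim_lip g (M s t : R) : continuous g -> (forall u, `|g u| <= M) ->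
  `|s| < 2 -> `|t| < 2 -> `|vprim g s - vprim g t| <= M * `|s - t|.
Proof.
move=> cg gM s2 t2; have M0 := le_trans (normr_ge0 _) (gM 0).
apply: rV_normP => [|j]; first by rewrite mulr_ge0.
rewrite !mxE; have [_ dp] := primP (coord_cont (j := j) cg).
apply: (derive_increment_bound dp) => // u _.
exact: le_trans (rV_coord_le _ _) (gM u).
Qed.

Lemma vprim_close g h (c t : R) : continuous g -> continuous h ->
  (forall u, `|g u - h u| <= c) -> `|t| < 2 ->
  `|vprim g t - vprim h t| <= c * `|t|.
Proof.
move=> cg ch gh t2; have c0 := le_trans (normr_ge0 _) (gh 0).
apply: rV_normP => [|j]; first by rewrite mulr_ge0.
rewrite !mxE; have [p0 dp] := primP (coord_cont (j := j) cg); have [p0' dp'] := primP (coord_cont (j := j) ch).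
have dd (u : R) : `|u| < 2 -> is_derive u 1
    (prim (fun s => g s 0 j) - prim (fun s => h s 0 j)) ((g u - h u) 0 j).
  by move=> u2; rewrite !mxE; apply: is_deriveB; [exact: dp|exact: dp'].
have := @derive_increment_bound R _ _ c 0 t 2 dd.
rewrite !fctE p0 p0' subrr !subr0 normr0 => H.
apply: H => // u _.
exact: le_trans (rV_coord_le _ _) (gh u).
Qed.

Lemma is_derive_rV (g : R -> 'rV[R]_n) (dg : 'rV[R]_n) (t : R) :
  (forall j, is_derive t 1 (fun s => g s 0 j) (dg 0 j)) -> is_derive t 1 g dg.
Proof.
move=> H; have dgt : derivable g t 1.
  by apply/derivable_mxP => i j; rewrite (ord1 i); have [] := H j.
apply: DeriveDef => //; rewrite derive_mx//; apply/rowP => j; rewrite mxE.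
by have [] := H j.
Qed.

Lemma derive_vprim g (t : R) : continuous g -> `|t| < 2 -> is_derive t 1 (vprim g) (g t).
Proof.
move=> cg t2; apply: is_derive_rV => j.
rewrite (_ : (fun s => vprim g s 0 j) = prim (fun s => g s 0 j)); last first.
  by apply/funext => s; rewrite mxE.
by have [_] := primP (coord_cont (j := j) cg); apply.
Qed.

Lemma lipschitz_continuous g (M : R) : (forall s t, `|g s - g t| <= M * `|s - t|) ->
  continuous g.
Proof.
move=> gM t; apply/cvgrPdist_lt => e e0.
have M1 : 0 < `|M| + 1 by rewrite ltr_wpDl.
apply/nbhs_ballP; exists (e / (`|M| + 1)); first by rewrite /= divr_gt0.
move=> s /=; rewrite ltr_pdivlMr// => ts.
apply: le_lt_trans (gM _ _) _; apply: le_lt_trans ts; rewrite mulrC; apply: ler_wpM2l => //.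
by rewrite (le_trans (ler_norm _))// lerDl.
Qed.

(** Picard iteration from the constant curve [p]. Successive iterates differ by at most [r / 2]
    times [2^-k], so they converge geometrically at each time. The bounds in [good] are closed
    conditions, so the limit satisfies them too and is a fixed point of [step]. *)
Theorem picard (F : 'rV[R]_n -> 'rV[R]_n) p : smooth_at F p ->
  exists e (c : R -> 'rV[R]_n), [/\ 0 < e, c 0 = p &
    forall t : R, `|t| < e -> smooth_at F (c t) /\ is_derive t 1 c (F (c t))].
Proof.
move=> sF; pose J := jac F p; have [kJ kJ0 HJ] := mulmx_bounded J.
pose F' x := F x - x *m J.
have sJ (x : 'rV[R]_n) : smooth_at (fun x : 'rV[R]_n => x *m J) x.
  by apply: smooth_at_mulmx; [exact: smooth_at_id|exact: smooth_at_cst].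
have sF' : smooth_at F' p by exact: smooth_at_sub.
have dF' v : 'D_v F' p = 0.
  rewrite /F' -[LHS]/('D_v (F \- (fun x : 'rV[R]_n => x *m J)) p) deriveB.
  - have [_ ->] := derive_mulmxr J v (smooth_at_diff (smooth_at_id p)).
    by rewrite derive_id (jacE _ (smooth_at_diff sF)) subrr.
  - exact/diff_derivable/smooth_at_diff.
  - exact/diff_derivable/smooth_at_diff/sJ.
have [r1 r10 [_ Hr1]] := small_derive_ball ltr01 sF' dF'.
have /nbhs_ballP[r2 /= r20 Hr2] := smooth_at_nbhs sF.
pose r := Num.min r1 r2; have r0 : 0 < r by rewrite lt_min r10.
(* A Lipschitz constant of [F] near [p]: [kJ] for its linear part and 1 for the remainder, whose
   derivative at [p] is zero. *)
pose L := 1 + kJ; have L0 : 0 < L by rewrite addr_gt0.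
have B1 y : ball p r y -> ball p r1 y by apply: le_ball; rewrite ge_min lexx.
have B2 y : ball p r y -> smooth_at F y.
  by move=> By; apply: Hr2; move: By; apply: le_ball; rewrite ge_min lexx orbT.
have LF x y : ball p r x -> ball p r y -> `|F x - F y| <= L * `|x - y|.
  move=> /B1 Bx /B1 By; have := Hr1 _ _ Bx By; rewrite /F' mul1r => H.
  rewrite (_ : F x - F y = (F x - x *m J - (F y - y *m J)) + (x - y) *m J); last first.
    by rewrite mulmxBl; move: (x *m J) (y *m J) => u w; apply/rowP => i; rewrite !mxE; ring.
  by rewrite (le_trans (ler_normD _ _))// mulrDl mul1r lerD.
pose M := `|F p| + L * r + 1.
have M0 : 0 < M by rewrite ltr_wpDl// addr_ge0// mulr_ge0 ?ltW.
have MF x : ball p r x -> `|F x| <= M.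
  move=> Bx; have := LF _ _ Bx (ballxx _ r0); move: Bx; rewrite -ball_normE /= => Bx H.
  have : `|F x| <= `|F p| + `|F x - F p| by rewrite -{1}[F x](subrK (F p)) addrC ler_normD.
  move=> /le_trans; apply; rewrite /M -addrA lerD2l (le_trans H)// ler_wpDr// ler_wpM2l ?ltW//.
  by rewrite distrC.
(* The three bounds keep times within the range [|t| < 2] of the antiderivatives, make [step] halve
   distances ([e * L <= 1/2]), and keep the curves within [r / 2] of [p] ([M * e <= r / 2]). *)
pose e := Num.min 1 (Num.min (L^-1 / 2) (r / 2 / M)).
have e0 : 0 < e by rewrite !lt_min ltr01 !divr_gt0 ?invr_gt0.
have e1 : e <= 1 by rewrite ge_min lexx.
have eL : e * L <= 2^-1.
  apply: (@le_trans _ _ (L^-1 / 2 * L)); first by rewrite ler_pM2r// /e !ge_min lexx !orbT.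
  by rewrite mulrAC mulVf ?mul1r// gt_eqF.
have eM : M * e <= r / 2.
  rewrite mulrC -ler_pdivlMr// /e !ge_min lexx !orbT//.
have c2 t : `|clamp e t| < 2.
  by apply: le_lt_trans (clamp_le _ (ltW e0)) _; apply: le_lt_trans e1 _; rewrite ltr1n.
(* Clamping freezes a curve outside [[-e, e]], so that all iterates are defined and Lipschitz on the
   whole line. *)
pose step (g : R -> 'rV[R]_n) t := p + vprim (F \o g) (clamp e t).
pose good g := (forall t, `|g t - p| <= r / 2) /\ forall s t, `|g s - g t| <= M * `|s - t|.
have inB g : good g -> forall t, ball p r (g t).
  move=> [gr _] t; rewrite -ball_normE /= distrC (le_lt_trans (gr t))//.
  by rewrite ltr_pdivrMr// ltr_pMr// ltr1n.
have cFg g : good g -> continuous (F \o g).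
  move=> gg t; apply: continuous_comp; first by have [_ /lipschitz_continuous] := gg; exact.
  exact/smooth_at_cont/B2/inB.
have bFg g : good g -> forall t, `|(F \o g) t| <= M by move=> gg t; exact/MF/inB.
have gstep g : good g -> good (step g).
  move=> gg; split=> [t|s t]; rewrite /step.
    rewrite addrC addKr -[vprim _ _]subr0 -(vprim0 (cFg _ gg)).
    apply: le_trans (vprim_lip (cFg _ gg) (bFg _ gg) (c2 t) _) _; first by rewrite normr0 ltr0n.
    rewrite subr0 (le_trans _ eM)//; apply: ler_wpM2l; first exact: ltW.
    exact: clamp_le (ltW e0).
  rewrite opprD addrACA subrr add0r.
  apply: le_trans (vprim_lip (cFg _ gg) (bFg _ gg) (c2 s) (c2 t)) _.
  by apply: ler_wpM2l; [exact: ltW|exact: clamp_lip].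
have sdist g h d : good g -> good h -> (forall t, `|g t - h t| <= d) ->
    forall t, `|step g t - step h t| <= d / 2.
  move=> gg gh gd t; rewrite /step opprD addrACA subrr add0r.
  have d0 := le_trans (normr_ge0 _) (gd 0).
  apply: (@le_trans _ _ (L * d * `|clamp e t|)).
    apply: (vprim_close (cFg _ gg) (cFg _ gh)) => // u /=.
    apply: le_trans (LF _ _ (inB _ gg u) (inB _ gh u)) _.
    by apply: ler_wpM2l; [exact: ltW|].
  apply: (@le_trans _ _ (L * d * e)).
    by apply: ler_wpM2l; [apply: mulr_ge0 => //; exact: ltW|exact: clamp_le (ltW e0)].
  by rewrite -mulrA mulrCA; apply: ler_wpM2l => //; rewrite mulrC.
pose g k := iter k step (fun=> p).
have gg k : good (g k).
  elim: k => [|k IH]; last exact: gstep.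
  by split=> [t|s t]; rewrite /= subrr normr0 ?divr_ge0 ?mulr_ge0// ltW.
have gS k t : `|g k.+1 t - g k t| <= r / 2 * 2^-1 ^+ k.
  elim: k t => [|k IH] t; first by rewrite expr0 mulr1; have [] := gg 1%N.
  by rewrite exprSr mulrA; exact: (sdist _ _ _ (gg k.+1) (gg k) IH t).
have lim t : exists l : 'rV[R]_n, forall k, `|g k t - l| <= r * 2^-1 ^+ k.
  have H j : exists l, forall k, `|g k t 0 j - l| <= 2 * (r / 2) * 2^-1 ^+ k.
    apply: geometric_limit => k; apply: le_trans (gS k t).
    by have := rV_coord_le (g k.+1 t - g k t) j; rewrite !mxE.
  exists (\row_j sval (cid (H j))) => k; apply: rV_normP.
    by apply: mulr_ge0; [exact: ltW|rewrite exprn_ge0// invr_ge0].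
  move=> j; rewrite !mxE; case: (cid (H j)) => l /= /(_ k).
  by rewrite mulrCA divff ?mulr1.
pose c t := sval (cid (lim t)).
have cP t k : `|g k t - c t| <= r * 2^-1 ^+ k by rewrite /c; case: cid.
have gc : good c.
  have tri (x y : 'rV[R]_n) z : `|x| <= `|y| + `|x - y| + z -> `|x| <= `|y| + `|x - y| + z by [].
  split=> [t|s t]; rewrite -subr_le0.
    apply: (@geometric_le0 _ _ r) => k; rewrite lerBlDr.
    rewrite (_ : c t - p = (g k t - p) - (g k t - c t)); last by apply/rowP => i; rewrite !mxE; ring.
    rewrite (le_trans (ler_normB _ _))// addrC lerD//.
    by have [] := gg k.
  apply: (@geometric_le0 _ _ (2 * r)) => k; rewrite lerBlDr.
  rewrite (_ : c s - c t = (g k s - g k t) - ((g k s - c s) - (g k t - c t))); last first.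
    by apply/rowP => i; rewrite !mxE; ring.
  rewrite (le_trans (ler_normB _ _))// addrC lerD//; last by have [] := gg k.
  by rewrite (le_trans (ler_normB _ _))// mulrDl mulrDl mul1r lerD.
have cE t : c t = step c t.
  apply/eqP; rewrite -subr_eq0 -normr_le0; apply: (@geometric_le0 _ _ (2 * r)) => k.
  rewrite (_ : c t - step c t = (g k.+1 t - step c t) - (g k.+1 t - c t)); last first.
    by rewrite opprB [RHS]addrC addrA subrK.
  rewrite (le_trans (ler_normB _ _))// mulrDl mulrDl mul1r lerD//.
    have := @sdist (g k) c _ (gg k) gc (fun u => cP u k) t => /le_trans; apply.
    by rewrite ler_pdivrMr// ler_peMr ?ler1n//; apply: mulr_ge0; [exact: ltW|rewrite exprn_ge0// invr_ge0].
  apply: le_trans (cP t k.+1) _; rewrite ler_wpM2l ?(ltW r0)// exprS ler_piMl ?exprn_ge0 ?invr_ge0//.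
  by rewrite invf_le1// ler1n.
exists e, c; split=> //.
  rewrite cE /step clamp_id ?normr0 ?(ltW e0)// (vprim0 (cFg _ gc)) addr0//.
move=> t te; split; first exact/B2/inB.
have t2 : `|t| < 2 by apply: lt_trans te _; apply: le_lt_trans e1 _; rewrite ltr1n.
have dv := derive_vprim (cFg _ gc) t2.
apply: (@near_eq_is_derive _ _ _ (cst p + vprim (F \o c))); last first.
  by rewrite -[F (c t)]add0r; apply: is_deriveD; exact: dv.
have : \forall s \near t, `|s| < e.
  have : {for t, continuous (fun s : R => `|s|)} by exact: norm_continuous.
  by move=> /(_ [set z | z < e]); apply; apply: open_nbhs_nbhs; split=> //; exact: open_lt.
by apply: filterS => s se; rewrite cE /step clamp_id// ltW.
Qed.

End Picard.

(** * Uniqueness for homogeneous linear equations *)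

Section Gronwall.
Context {R : realType}.

(** For positive [T], the function [y^2 exp (-2 C t)] has derivative
    [-2 (C - p) y^2 exp (-2 C t) <= 0] and starts at 0. Negative [T] is reduced to this by reversing
    time. *)
Lemma gronwall_zero (y p : R -> R) (C T : R) :
  (forall t, Num.min 0 T <= t <= Num.max 0 T -> is_derive t 1 y (p t * y t)) ->
  (forall t, Num.min 0 T <= t <= Num.max 0 T -> `|p t| <= C) -> y 0 = 0 -> y T = 0.
Proof.
wlog T0 : y p T / 0 <= T.
  move=> H dy pC y0; have [T0|/ltW T0] := leP 0 T; first exact: (H y p T).
  have := H (y \o -%R) (fun t => - p (- t)) (- T); rewrite oppr_ge0 /= opprK oppr0 => H'.
  apply: H' => // t; rewrite min_l ?max_r ?oppr_ge0// => /andP[t0 t1].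
    have t' : Num.min 0 T <= - t <= Num.max 0 T.
      by rewrite min_r// max_l// lerNr t1 oppr_le0.
    rewrite mulNr -mulrN1; apply: is_derive1_comp; first exact: dy.
  rewrite normrN; apply: pC; rewrite min_r// max_l// lerNr t1 oppr_le0//.
rewrite min_l// max_r// => dy pC y0.
move: T0; rewrite le_eqVlt => /predU1P[<-//|T0].
pose E := expR \o (fun t => - (2 * C) * t).
have dE (t : R) : is_derive t 1 E (E t * - (2 * C)).
  apply: is_derive1_comp; rewrite -[X in is_derive _ _ _ X]mulr1.
  exact: is_deriveZ.
pose dz t := (y * y) t *: (E t * - (2 * C)) + E t *: (y t *: (p t * y t) + y t *: (p t * y t)).
have Dz t : 0 <= t <= T -> is_derive t 1 (y * y * E) (dz t).
  by move=> tT; apply: is_deriveM; apply: is_deriveM; exact: dy.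
have [||c] := @MVT _ (y * y * E) dz 0 T T0.
- by move=> t; rewrite in_itv /= => /andP[t0 t1]; apply: Dz; rewrite !ltW.
- apply: derivable_within_continuous => t; rewrite in_itv /= => tT.
  by have [] := Dz t tT.
rewrite in_itv /= => /andP[c0 cT]; rewrite !fctE y0 !mul0r !subr0 => H.
have pc : p c <= C by rewrite (le_trans (ler_norm _))// pC// !ltW.
have dz0 : dz c <= 0.
  have -> : dz c = - (E c * (y c * y c) * (2 * (C - p c))).
    by rewrite /dz -![_ *: _]/(_ * _) !fctE; ring.
  rewrite oppr_le0; apply: mulr_ge0; last by rewrite mulr_ge0// subr_ge0.
  apply: mulr_ge0; first exact/ltW/expR_gt0.
  by rewrite -expr2 sqr_ge0.
have : y T * y T * E T <= 0 by rewrite H mulr_le0_ge0// ltW.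
have ET : 0 < E T by exact: expR_gt0.
rewrite pmulr_lle0// -expr2 => yT; apply/eqP; rewrite -sqrf_eq0 eq_le yT.
exact: sqr_ge0.
Qed.

End Gronwall.

(** * Hadamard's lemma and a countable basis of the row space *)

Section Hadamard.
Context {R : realType}.

(** Integrating the derivative of [f] along the segment from [p] to [x] gives the formula with
    [g i x] the integral over [u] in [[0, 1]] of the partial derivative at [p + u (x - p)], which is
    smooth in [x]. *)
Lemma hadamard n (f : 'rV[R]_n -> R) p : smooth_at f p ->
  exists g : 'I_n -> 'rV[R]_n -> R,
    (forall i, smooth_at (g i) p /\ g i p = 'D_(delta_mx 0 i) f p) /\
    \forall x \near p, f x = f p + \sum_i (x - p) 0 i * g i x.
Proof.
move=> /smooth_at_nbhs/nbhs_ballP[r /= r0 Hr].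
pose F (i : 'I_n) (q : R * 'rV[R]_n) := 'D_(delta_mx 0 i) f (q.1 *: (q.2 - p) + p).
have Bt t x : 0 <= t <= 1 -> ball p r x -> ball p r (t *: (x - p) + p).
  move=> /andP[t0 t1]; rewrite -!ball_normE /= opprD addrCA subrr addr0 normrN normrZ ger0_norm//.
  by rewrite distrC; apply: le_lt_trans; rewrite ler_piMl.
have sF i : smooth_strip (F i) (ball p r).
  move=> u x u01 Bx; apply: (@smooth_at_comp R _ _ _ (fun q : R * 'rV[R]_n => q.1 *: (q.2 - p) + p)
    (fun y => 'D_(delta_mx 0 i) f y)).
  - exact: findim_rV.
  - apply: smooth_at_add; last exact: smooth_at_cst.
    apply: smooth_at_scale; first exact: smooth_at_fst.
    by apply: smooth_at_sub; [exact: smooth_at_snd|exact: smooth_at_cst].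
  - by apply: smooth_at_derive; apply: Hr; exact: Bt.
have oB : open (ball p r) by exact: ball_open.
have Bp : ball p r p by exact: ballxx.
exists (fun i => pint (F i)); split=> [i|].
  split; first exact: smooth_on_at oB (smooth_pint oB (sF i)) Bp.
  have := @pint_ftc R n (F i) p (fun u => u * 'D_(delta_mx 0 i) f p)
    (pint_integrand_continuous (sF i) Bp).
  rewrite mul1r mul0r subr0; apply => u _.
  rewrite /F /= subrr scaler0 add0r; set a := 'D_(delta_mx 0 i) f p.
  rewrite (_ : (fun u => _) = a \*: id); last first.
    by apply/funext => v; rewrite mulrC.
  by rewrite -[X in is_derive _ _ _ X]mulr1; apply: is_deriveZ.
apply/nbhs_ballP; exists r => // x Bx.
pose k i u := F i (`|clamp 1 u|, x).
have ck i : continuous (k i) by exact: pint_integrand_continuous (sF i) Bx.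
have Z : (\sum_i ((x - p) 0 i *: prim (k i))) 0 = 0.
  by rewrite fct_sumE big1// => i _; have [p0 _] := primP (ck i); rewrite !fctE p0 scaler0.
have := @antideriv_unique01 R (\sum_i ((x - p) 0 i *: prim (k i)))
  (fun u => f (u *: (x - p) + p)) (fun u => \sum_i (x - p) 0 i * k i u)
  (fun u => 'D_(x - p) f (u *: (x - p) + p)) _ _ _.
have E1 : (\sum_i ((x - p) 0 i *: prim (k i))) 1 = \sum_i (x - p) 0 i * pint (F i) x.
  by rewrite fct_sumE.
rewrite Z E1 scale0r add0r scale1r subrK.
rewrite subr0 => H; apply/eqP; rewrite addrC -subr_eq; apply/eqP/esym; apply: H.
- move=> u /andP[u0 u1]; apply: is_derive_sum => i; apply: is_deriveZ.
  by have [_] := primP (ck i); apply; rewrite ger0_norm// (le_lt_trans u1)// ltr1n.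
- move=> u u01; have df := smooth_at_diff (Hr _ (Bt _ _ u01 Bx)).
  apply: DeriveDef; first by apply/derivable_line/diff_derivable.
  exact: derive_line.
- move=> u u0 u1; have u01 : 0 <= u <= 1 by rewrite !ltW.
  have df := smooth_at_diff (Hr _ (Bt _ _ u01 Bx)).
  rewrite (derive_sum_delta _ df); apply: eq_bigr => i _.
  by rewrite /k /F clamp_id ger0_norm ?(ltW u0) ?(ltW u1).
Qed.

(** Balls with rational centres and radii [1 / (k+1)]. Taking [k+1 > 2 / e] puts such a ball around
    [x], together with its diameter, inside the ball of radius [e]. *)
Lemma rV_second_countable n : exists B : nat -> set 'rV[R]_n,
  (forall i, open (B i)) /\
  forall U x, open U -> U x -> exists i, B i x /\ B i `<=` U.
Proof.
pose b (qk : 'rV[rat]_n * nat) : set 'rV[R]_n :=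
  ball (map_mx (ratr : rat -> R) qk.1) (qk.2.+1%:R^-1).
exists (fun i => if unpickle i is Some qk then b qk else set0); split.
  by move=> i; case: unpickle => [qk|]; [exact: ball_open|exact: open0].
move=> U x oU Ux; have /nbhs_ballP[e /= e0 He] := open_nbhs_nbhs (conj oU Ux).
pose k := Num.truncn (2 / e).
have hk : 2 / e < k.+1%:R by exact: truncnS_gt.
have k0 : 0 < k.+1%:R^-1 :> R by rewrite invr_gt0.
have H (i : 'I_n) : exists q : rat, `|ratr q - x 0 i| < k.+1%:R^-1.
  have [|q] := @rat_in_itvoo R (x 0 i - k.+1%:R^-1) (x 0 i + k.+1%:R^-1).
    by rewrite ltrD2l gtrN.
  by rewrite in_itv /= => qx; exists q; rewrite ltr_distl.
pose q : 'rV[rat]_n := \row_i xchoose (H i).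
exists (pickle (q, k)); rewrite pickleK /b /=.
have Bx : ball (map_mx (ratr : rat -> R) q) (k.+1%:R^-1) x.
  by split=> // i j; rewrite (ord1 i) !mxE -ball_normE /=; exact: (xchooseP (H j)).
split=> // y By; apply: He; apply: le_ball (ball_triangle (ball_sym Bx) By).
move: hk; rewrite ltr_pdivrMr// => hk.
have s0 : 0 < k.+1%:R :> R by rewrite ltr0n.
by rewrite -(ler_pM2l s0) mulrDr divff ?gt_eqF//; lra.
Qed.

End Hadamard.

(** * Plots, velocities and tangent vectors *)

Section Plots.
Context {R : realType}.
Implicit Types E F G : normedModType R.

(* Smoothness of maps into a manifold is tested in one chart at a point; maps
   out of a manifold are then studied through their composites with plots. *)
Definition plot n T (mT : manifold R n T) E (g : E -> T) (y : E) :=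
  exists c, [/\ atlas mT c, \forall z \near y, cdom c (g z) &
    smooth_at (fun z => cphi c (g z)) y].

Section OneManifold.
Context {n : nat} {T : Type} (mT : manifold R n T).

Let ok c : atlas mT c -> chart_ok c. Proof. exact: atlas_ok. Qed.

Lemma chart_phiK c x : atlas mT c -> cdom c x -> cpsi c (cphi c x) = x.
Proof. by move=> /ok[_ H _] /H[]. Qed.
Lemma chart_phi_img c x : atlas mT c -> cdom c x -> cimg c (cphi c x).
Proof. by move=> /ok[_ H _] /H[]. Qed.
Lemma chart_psiK c y : atlas mT c -> cimg c y -> cphi c (cpsi c y) = y.
Proof. by move=> /ok[_ _ H] /H[]. Qed.
Lemma chart_psi_dom c y : atlas mT c -> cimg c y -> cdom c (cpsi c y).
Proof. by move=> /ok[_ _ H] /H[]. Qed.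
Lemma chart_img_open c : atlas mT c -> open (cimg c).
Proof. by move=> /ok[]. Qed.

(** The chart in [plot] is existential; smooth transition maps allow it to be replaced by any chart
    at [g y]. *)
Lemma plot_chart E (g : E -> T) y d : plot mT g y -> atlas mT d -> cdom d (g y) ->
  (\forall z \near y, cdom d (g z)) /\ smooth_at (fun z => cphi d (g z)) y.
Proof.
move=> [c [ac nc sc]] ad dy; have [oD sD] := atlas_compat ac ad.
set D := [set u | _] in oD sD.
have cy := nbhs_singleton nc.
have Dy : D (cphi c (g y)) by split; [exact: chart_phi_img|rewrite chart_phiK].
have nD : \forall z \near y, D (cphi c (g z)).
  by apply: (smooth_at_cont sc); exact: open_nbhs_nbhs.
split; first by apply: filterS2 nc nD => z cz [_]; rewrite chart_phiK.
have : smooth_at (fun z => (cphi d \o cpsi c) (cphi c (g z))) y.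
  apply: (@smooth_at_comp R _ _ _ (fun z => cphi c (g z)) (cphi d \o cpsi c)) => //.
    exact: findim_rV.
  exact: smooth_on_at Dy.
apply: smooth_at_near; near=> z; rewrite /= chart_phiK//; near: z; exact: nc.
Unshelve. all: by end_near. Qed.

Lemma plot_near E (g : E -> T) y : plot mT g y -> \forall z \near y, plot mT g z.
Proof.
move=> [c [ac nc sc]]; have [V [oV Vy] VH] := near_open_nbhs nc.
apply: filterS2 (smooth_at_nbhs sc) (open_nbhs_nbhs (conj oV Vy)) => z sz Vz.
exists c; split=> //; apply: filterS (open_nbhs_nbhs (conj oV Vz)); exact: VH.
Qed.

Lemma eq_plot E (g h : E -> T) y : (\forall z \near y, g z = h z) -> plot mT g y -> plot mT h y.
Proof.
move=> gh [c [ac nc sc]]; exists c; split=> //.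
  by near=> z; rewrite -(near gh z)//; near: z.
by apply: smooth_at_near sc; apply: filterS gh => z ->.
Unshelve. all: by end_near. Qed.

Lemma plot_comp E F (f : F -> E) (g : E -> T) x : findim E -> smooth_at f x ->
  plot mT g (f x) -> plot mT (fun z => g (f z)) x.
Proof.
move=> fE sf [c [ac nc sc]]; exists c; split=> //.
  by apply: (smooth_at_cont sf nc).
exact: (@smooth_at_comp R _ _ _ f (fun z => cphi c (g z))).
Qed.

Lemma plot_cpsi c u : atlas mT c -> cimg c u -> plot mT (cpsi c) u.
Proof.
move=> ac cu; exists c; have nc : \forall z \near u, cimg c z.
  by apply: open_nbhs_nbhs; split=> //; exact: chart_img_open.
split=> //; first by apply: filterS nc => z; exact: chart_psi_dom.
apply: smooth_at_near (smooth_at_id u).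
by apply: filterS nc => z cz; rewrite chart_psiK.
Qed.

Lemma plot_cst E (x : T) (y : E) : plot mT (fun=> x) y.
Proof.
have [c ac cx] := atlas_cover mT x; exists c; split=> //; first exact: nearW.
exact: smooth_at_cst.
Qed.

Lemma plot_mopen E (g : E -> T) y U : plot mT g y -> mopen mT U -> U (g y) ->
  \forall z \near y, U (g z).
Proof.
move=> [c [ac nc sc]] oU Uy; have cy := nbhs_singleton nc.
have nV : \forall z \near y, [set u | cimg c u /\ U (cpsi c u)] (cphi c (g z)).
  apply: (smooth_at_cont sc); apply: open_nbhs_nbhs; split; first exact: oU.
  by split; [exact: chart_phi_img|rewrite chart_phiK].
by apply: filterS2 nc nV => z cz [_]; rewrite chart_phiK.
Qed.

Lemma mopenP U : (forall x, U x -> exists c, [/\ atlas mT c, cdom c x &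
    \forall u \near cphi c x, cimg c u -> U (cpsi c u)]) -> mopen mT U.
Proof.
move=> H d ad; rewrite openE => u [du Uu].
have [c [ac cx nU]] := H _ Uu.
have pu := plot_cpsi ad du; have [nc sc] := plot_chart pu ac cx.
have nd : \forall z \near u, cimg d z.
  by apply: open_nbhs_nbhs; split=> //; exact: chart_img_open.
have nU' := smooth_at_cont sc nU.
apply: filterS3 nc nd nU' => z cz dz /=.
by move=> /(_ (chart_phi_img ac cz)); rewrite chart_phiK.
Qed.

Lemma mopen_chart c (V : set 'rV[R]_n) : atlas mT c -> open V ->
  mopen mT [set x | cdom c x /\ V (cphi c x)].
Proof.
move=> ac oV; apply: mopenP => x [cx Vx]; exists c; split=> //.
apply: filterS (open_nbhs_nbhs (conj oV Vx)) => u Vu cu /=.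
by split; [exact: chart_psi_dom|rewrite chart_psiK].
Qed.

Lemma mopenI U V : mopen mT U -> mopen mT V -> mopen mT (U `&` V).
Proof.
move=> oU oV c ac; rewrite (_ : [set y | _] =
  [set y | cimg c y /\ U (cpsi c y)] `&` [set y | cimg c y /\ V (cpsi c y)]).
  by apply: openI; [exact: oU|exact: oV].
by apply/seteqP; split=> y /=; [move=> [? []]|move=> [[? ?] []]].
Qed.

Lemma smooth_near_plot E (g : E -> T) y f : plot mT g y -> smooth_near mT (g y) f ->
  smooth_at (fun z => f (g z)) y.
Proof.
move=> pg [U [oU Uy sf]]; have nU := plot_mopen pg oU Uy.
have [c [ac nc sc]] := pg; have cy := nbhs_singleton nc.
have : smooth_at (fun z => (f \o cpsi c) (cphi c (g z))) y.
  apply: (@smooth_at_comp R _ _ _ (fun z => cphi c (g z)) (f \o cpsi c)) => //.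
    exact: findim_rV.
  apply: smooth_on_at (oU _ ac) (sf _ ac) _.
  by split; [exact: chart_phi_img|rewrite chart_phiK].
by apply: smooth_at_near; apply: filterS nc => z cz /=; rewrite chart_phiK.
Qed.

Lemma chart_smooth_near c x f : atlas mT c -> cdom c x ->
  smooth_at (fun u => f (cpsi c u)) (cphi c x) -> smooth_near mT x f.
Proof.
move=> ac cx [V [oV Vx] sV].
exists [set z | cdom c z /\ V (cphi c z)]; split=> //; first exact: mopen_chart.
move=> d ad; apply: smooth_atP => u [du [cu Vu]].
have [nc sc] := plot_chart (plot_cpsi ad du) ac cu.
have : smooth_at (fun z => (f \o cpsi c) (cphi c (cpsi d z))) u.
  apply: (@smooth_at_comp R _ _ _ (fun z => cphi c (cpsi d z)) (f \o cpsi c)) => //.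
    exact: findim_rV.
  exact: smooth_on_at oV sV Vu.
by apply: smooth_at_near; apply: filterS nc => z cz /=; rewrite chart_phiK.
Qed.

Lemma smooth_near_chart c x f : atlas mT c -> cdom c x -> smooth_near mT x f ->
  smooth_at (fun u => f (cpsi c u)) (cphi c x).
Proof.
move=> ac cx sf; apply: smooth_near_plot; last by rewrite chart_phiK.
by apply: plot_cpsi => //; exact: chart_phi_img.
Qed.

Lemma smooth_nearP x f : (forall (g : 'rV[R]_n -> T) y, g y = x -> plot mT g y ->
  smooth_at (fun z => f (g z)) y) -> smooth_near mT x f.
Proof.
move=> H; have [c ac cx] := atlas_cover mT x.
apply: chart_smooth_near (ac) (cx) _; apply: H; first by rewrite chart_phiK.
by apply: plot_cpsi => //; exact: chart_phi_img.
Qed.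

Lemma smooth_near_cst x a : smooth_near mT x (fun=> a).
Proof. by apply: smooth_nearP => *; exact: smooth_at_cst. Qed.

Lemma smooth_near_add x f g : smooth_near mT x f -> smooth_near mT x g ->
  smooth_near mT x (fun y => f y + g y).
Proof.
move=> sf sg; apply: smooth_nearP => h y hy ph.
by apply: smooth_at_add; apply: smooth_near_plot => //; rewrite hy.
Qed.

Lemma smooth_near_mul x f g : smooth_near mT x f -> smooth_near mT x g ->
  smooth_near mT x (fun y => f y * g y).
Proof.
move=> sf sg; apply: smooth_nearP => h y hy ph.
by apply: smooth_at_mul; apply: smooth_near_plot => //; rewrite hy.
Qed.

Lemma smooth_near_mopen x f : smooth_near mT x f ->
  exists U, [/\ mopen mT U, U x & forall y, U y -> smooth_near mT y f].
Proof.
by move=> [U [oU Ux sf]]; exists U; split=> // y Uy; exists U.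
Qed.

Lemma eq_smooth_near x f g U : mopen mT U -> U x -> (forall y, U y -> f y = g y) ->
  smooth_near mT x f -> smooth_near mT x g.
Proof.
move=> oU Ux fg sf; apply: smooth_nearP => h y hy ph.
have : smooth_at (fun z => f (h z)) y by apply: smooth_near_plot => //; rewrite hy.
apply: smooth_at_near; rewrite -hy in Ux.
by apply: filterS (plot_mopen ph oU Ux) => z; exact: fg.
Qed.

(** The value 0 on functions that are not smooth near [g y] is the convention imposed on tangent
    vectors, so that equality of velocities is equality of functions. *)
Definition vel E (g : E -> T) (y a : E) : tvec R T :=
  fun f => if `[< smooth_near mT (g y) f >] then 'D_a (fun z => f (g z)) y else 0.

Lemma velE E (g : E -> T) y a f : smooth_near mT (g y) f ->
  vel g y a f = 'D_a (fun z => f (g z)) y.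
Proof. by move=> sf; rewrite /vel; case: asboolP. Qed.

Lemma vel_tangent E (g : E -> T) y a : plot mT g y -> tangent mT (g y) (vel g y a).
Proof.
move=> pg; split.
- by move=> f nf; rewrite /vel; case: asboolP.
- move=> f h U oU Uy fh; rewrite /vel.
  have -> : smooth_near mT (g y) f = smooth_near mT (g y) h.
    apply/propext; split; apply: eq_smooth_near oU Uy _ => // z Uz.
    by rewrite fh.
  case: ifP => // _; apply: near_eq_derive.
  by apply: filterS (plot_mopen pg oU Uy) => z; exact: fh.
- move=> t f h sf sh; have stf := smooth_near_mul (smooth_near_cst (g y) t) sf.
  rewrite (velE _ (smooth_near_add stf sh)) (velE _ sf) (velE _ sh).
  have df := smooth_at_diff (smooth_near_plot pg sf).
  have dh := smooth_at_diff (smooth_near_plot pg sh).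
  rewrite -[LHS]/('D_a ((t *: (fun z => f (g z))) + (fun z => h (g z))) y).
  rewrite deriveD; [|exact/diff_derivable/differentiableZ|exact: diff_derivable].
  by rewrite deriveZ//; exact: diff_derivable.
- move=> f h sf sh; rewrite (velE _ (smooth_near_mul sf sh)) (velE _ sf) (velE _ sh).
  have df := smooth_at_diff (smooth_near_plot pg sf).
  have dh := smooth_at_diff (smooth_near_plot pg sh).
  rewrite -[LHS]/('D_a ((fun z => f (g z)) * (fun z => h (g z))) y).
  rewrite deriveM; [|exact: diff_derivable..].
  by rewrite addrC mulrC; congr (_ + _); exact: mulrC.
Qed.

Lemma vel_linear E (g : E -> T) y : plot mT g y -> is_linear (vel g y).
Proof.
move=> pg t a b; apply/funext => f; rewrite fctE /= fctE.
have [sf|nf] := pselect (smooth_near mT (g y) f); last first.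
  by rewrite /vel; case: asboolP => // _; rewrite scaler0 addr0.
have df := smooth_at_diff (smooth_near_plot pg sf).
by rewrite !velE// derive_lin.
Qed.

Lemma vel_comp E F (f : F -> E) (g : E -> T) x a : smooth_at f x -> plot mT g (f x) ->
  vel (fun z => g (f z)) x a = vel g (f x) ('D_a f x).
Proof.
move=> sf pg; apply/funext => h; rewrite /vel; case: asboolP => // sh.
rewrite (@derive_comp R _ _ _ f (fun z => h (g z)))//; first exact: smooth_at_diff.
exact/smooth_at_diff/(smooth_near_plot pg).
Qed.

Lemma eq_vel E (g h : E -> T) y a : (\forall z \near y, g z = h z) -> vel g y a = vel h y a.
Proof.
move=> gh; apply/funext => f; rewrite /vel (nbhs_singleton gh).
by case: asboolP => // _; apply: near_eq_derive; apply: filterS gh => z ->.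
Qed.

Lemma vel_chart E (g : E -> T) y a c : plot mT g y -> atlas mT c -> cdom c (g y) ->
  vel g y a = vel (cpsi c) (cphi c (g y)) ('D_a (fun z => cphi c (g z)) y).
Proof.
move=> pg ac cy; have [nc sc] := plot_chart pg ac cy.
rewrite -vel_comp//; last by apply: plot_cpsi => //; exact: chart_phi_img.
by apply: eq_vel; apply: filterS nc => z cz; rewrite chart_phiK.
Qed.

Lemma coord_smooth_near c x i : atlas mT c -> cdom c x ->
  smooth_near mT x (fun z => cphi c z 0 i).
Proof.
move=> ac cx; apply: (chart_smooth_near ac cx).
have := smooth_at_coord 0 i (smooth_at_id (cphi c x)).
apply: smooth_at_near.
have nc : \forall z \near (cphi c x), cimg c z.
  apply: open_nbhs_nbhs; split; [exact: chart_img_open|exact: chart_phi_img].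
by apply: filterS nc => z cz; rewrite chart_psiK.
Qed.

Lemma vel_cpsi_coord c x a i : atlas mT c -> cdom c x ->
  vel (cpsi c) (cphi c x) a (fun z => cphi c z 0 i) = a 0 i.
Proof.
move=> ac cx; have ci := chart_phi_img ac cx; rewrite velE; last first.
  by rewrite chart_phiK//; exact: coord_smooth_near.
rewrite (@near_eq_derive _ _ _ _ (fun u : 'rV[R]_n => u 0 i)).
  rewrite -(@derive_entry R _ _ _ id 0 i); last exact: smooth_at_diff (smooth_at_id _).
  by rewrite derive_id.
have nc : \forall z \near (cphi c x), cimg c z.
  by apply: open_nbhs_nbhs; split=> //; exact: chart_img_open.
by apply: filterS nc => z cz; rewrite chart_psiK.
Qed.

Lemma vel_cpsi_inj c x a b : atlas mT c -> cdom c x ->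
  vel (cpsi c) (cphi c x) a = vel (cpsi c) (cphi c x) b -> a = b.
Proof.
by move=> ac cx ab; apply/rowP => i; rewrite -!(vel_cpsi_coord _ _ ac cx) ab.
Qed.

Section TangentDerivation.
Context {x : T} {v : tvec R T} (tv : tangent mT x v).

Lemma tangent_off f : ~ smooth_near mT x f -> v f = 0.
Proof. by have [H _ _ _] := tv; exact: H. Qed.

Lemma tangent_local f g U : mopen mT U -> U x -> (forall y, U y -> f y = g y) -> v f = v g.
Proof. by have [_ H _ _] := tv; exact: H. Qed.

Lemma tangent_comb t f g : smooth_near mT x f -> smooth_near mT x g ->
  v (fun y => t * f y + g y) = t * v f + v g.
Proof. by have [_ _ H _] := tv; exact: H. Qed.

Lemma tangent_mul f g : smooth_near mT x f -> smooth_near mT x g ->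
  v (fun y => f y * g y) = v f * g x + f x * v g.
Proof. by have [_ _ _ H] := tv; exact: H. Qed.

Lemma tangent_add f g : smooth_near mT x f -> smooth_near mT x g ->
  v (fun y => f y + g y) = v f + v g.
Proof.
move=> sf sg; rewrite -[v f]mul1r -tangent_comb//; congr v.
by apply/funext => y; rewrite mul1r.
Qed.

Lemma tangent_cst a : v (fun=> a) = 0.
Proof.
have s1 := smooth_near_cst x 1; have s0 := smooth_near_cst x 0.
have v1 : v (fun=> 1) = 0.
  have e1 : (fun _ : T => 1 * 1 : R) = fun=> 1 by apply/funext => y; rewrite mulr1.
  have := tangent_mul s1 s1; rewrite e1 mulr1 mul1r.
  by move=> /eqP; rewrite -subr_eq0 opprD addrA subrr sub0r oppr_eq0 => /eqP.
have v0 : v (fun=> 0) = 0.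
  have e0 : (fun _ : T => 1 * 0 + 0 : R) = fun=> 0.
    by apply/funext => y; rewrite mulr0 addr0.
  have := tangent_comb 1 s0 s0; rewrite e0 mul1r.
  by move=> /eqP; rewrite -subr_eq0 opprD addrA subrr sub0r oppr_eq0 => /eqP.
have ea : (fun _ : T => a * 1 + 0 : R) = fun=> a.
  by apply/funext => y; rewrite mulr1 addr0.
by have := tangent_comb a s1 s0; rewrite ea v1 v0 mulr0 addr0.
Qed.

Lemma tangent_sum m (f : 'I_m -> T -> R) : (forall i, smooth_near mT x (f i)) ->
  smooth_near mT x (fun y => \sum_i f i y) /\
  v (fun y => \sum_i f i y) = \sum_i v (f i).
Proof.
elim: m f => [|m IH] f sf.
  rewrite (_ : (fun y => _) = fun=> 0); last by apply/funext => y; rewrite big_ord0.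
  by rewrite big_ord0 tangent_cst; split=> //; exact: smooth_near_cst.
rewrite (_ : (fun y => _) = fun y => (\sum_i f (widen_ord (leqnSn m) i) y) + f ord_max y); last first.
  by apply/funext => y; rewrite big_ord_recr.
have [s1 E1] := IH (fun i => f (widen_ord (leqnSn m) i)) (fun i => sf _).
split; first exact: smooth_near_add.
by rewrite tangent_add// E1 big_ord_recr.
Qed.

(** By Hadamard's lemma a smooth [f] is near [x] a constant plus a sum of products of a centred
    coordinate with a smooth function. A derivation is local, kills constants and, by the Leibniz
    rule, sees of each product only its value on the coordinate. Hence it is the velocity whose
    components are these values. *)
Lemma tangent_vel c : atlas mT c -> cdom c x ->
  exists a, v = vel (cpsi c) (cphi c x) a.
Proof.
move=> ac cx; set p := cphi c x; have pK : cpsi c p = x by exact: chart_phiK.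
exists (\row_i v (fun z => cphi c z 0 i)); apply/funext => f.
have [sf|nf] := pselect (smooth_near mT x f); last first.
  by rewrite tangent_off// /vel pK; case: asboolP.
rewrite velE ?pK//.
have sfp := smooth_near_chart ac cx sf.
have [g [Hg Hf]] := hadamard sfp.
have [V [oV Vp] HV] := near_open_nbhs Hf.
pose U := [set z | cdom c z /\ V (cphi c z)].
have oU : mopen mT U by exact: mopen_chart.
have Ux : U x by [].
have sc i : smooth_near mT x (fun z => cphi c z 0 i - p 0 i).
  by apply: smooth_near_add; [exact: coord_smooth_near|exact: smooth_near_cst].
have sg i : smooth_near mT x (fun z => g i (cphi c z)).
  apply: (chart_smooth_near ac cx); have [sgi _] := Hg i.
  apply: smooth_at_near sgi.
  have nc : \forall z \near p, cimg c z.
    by apply: open_nbhs_nbhs; split; [exact: chart_img_open|exact: chart_phi_img].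
  by apply: filterS nc => z cz; rewrite chart_psiK.
have sp i := smooth_near_mul (sc i) (sg i).
have [ss Es] := tangent_sum sp.
rewrite (@tangent_local f (fun z => f x + \sum_i (cphi c z 0 i - p 0 i) * g i (cphi c z)) U)//; last first.
  move=> z [cz Vz]; have := HV _ Vz; rewrite chart_phiK// pK => ->.
  by congr (_ + _); apply: eq_bigr => i _; rewrite !mxE.
rewrite (tangent_add (smooth_near_cst x (f x)) ss) tangent_cst add0r Es.
rewrite (derive_sum_delta _ (smooth_at_diff sfp)).
apply: eq_bigr => i _; rewrite tangent_mul// subrr mul0r addr0 mxE.
have [_ <-] := Hg i; rewrite (tangent_add (coord_smooth_near i ac cx) (smooth_near_cst x _)).
by rewrite tangent_cst addr0.
Qed.

End TangentDerivation.

Lemma tangent_subspace x : Defs.subspace (tangent mT x).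
Proof.
have [c ac cx] := atlas_cover mT x.
have pc : plot mT (cpsi c) (cphi c x) by apply: plot_cpsi => //; exact: chart_phi_img.
have vL := vel_linear pc.
have H a : tangent mT x (vel (cpsi c) (cphi c x) a).
  by have := vel_tangent a pc; rewrite chart_phiK.
split.
  by have := H 0; rewrite (is_linear0 vL).
move=> t v w tv tw; have [a ->] := tangent_vel tv ac cx.
have [b ->] := tangent_vel tw ac cx.
by rewrite -vL; exact: H.
Qed.

End OneManifold.
End Plots.

(** * Smooth maps between manifolds *)

Section SmoothMaps.
Context {R : realType}.
Implicit Types E F G : normedModType R.

(** Testing on all plots through [x], over arbitrary normed spaces, makes composition of smooth maps
    immediate; [msmoothP] reduces the test to one chart. *)
Definition msmooth n n' T T' (mT : manifold R n T) (mT' : manifold R n' T')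
    (phi : T -> T') (x : T) :=
  forall E (g : E -> T) y, g y = x -> plot mT g y -> plot mT' (fun z => phi (g z)) y.

Section TwoManifolds.
Context {n n' : nat} {T T' : Type} (mT : manifold R n T) (mT' : manifold R n' T').
Implicit Type phi : T -> T'.

Lemma msmoothP phi x c : atlas mT c -> cdom c x ->
  plot mT' (fun u => phi (cpsi c u)) (cphi c x) -> msmooth mT mT' phi x.
Proof.
move=> ac cx pp E g y gx pg; rewrite -gx in cx pp.
have [nc sc] := plot_chart pg ac cx.
have : plot mT' (fun z => phi (cpsi c (cphi c (g z)))) y.
  by apply: (@plot_comp R _ _ mT' _ _ (fun z => cphi c (g z)) (fun u => phi (cpsi c u))) => //;
    exact: findim_rV.
by apply: eq_plot; apply: filterS nc => z cz; rewrite (chart_phiK ac).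
Qed.

Lemma msmooth_plot phi E (g : E -> T) y : msmooth mT mT' phi (g y) -> plot mT g y ->
  plot mT' (fun z => phi (g z)) y.
Proof. by move=> sp; exact: sp. Qed.

Lemma msmooth_near phi x f : msmooth mT mT' phi x -> smooth_near mT' (phi x) f ->
  smooth_near mT x (f \o phi).
Proof.
move=> sp sf; apply: smooth_nearP => g y gx pg; rewrite -gx in sp sf.
by apply: (@smooth_near_plot R _ _ mT' _ (fun z => phi (g z))) => //; exact: msmooth_plot.
Qed.

Lemma smooth_mapP phi : smooth_map mT mT' phi <-> forall x, msmooth mT mT' phi x.
Proof.
split=> [sp x|sp c d ac ad D].
  have [c ac cx] := atlas_cover mT x; apply: (msmoothP ac cx).
  have [d ad dx] := atlas_cover mT' (phi x).
  have [oD sD] := sp c d ac ad; set D := [set y | _] in oD sD.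
  have Dx : D (cphi c x) by split; [exact: (chart_phi_img ac cx)|rewrite (chart_phiK ac)].
  exists d; split=> //; last exact: smooth_on_at sD Dx.
  by apply: filterS (open_nbhs_nbhs (conj oD Dx)) => z [].
have H y : D y -> plot mT' (fun u => phi (cpsi c u)) y.
  by move=> [cy dy]; apply: msmooth_plot; [exact: sp|exact: plot_cpsi].
split.
  rewrite openE => y Dy; have [cy dy] := Dy.
  have [nd sd] := plot_chart (H _ Dy) ad dy.
  have nc : \forall z \near y, cimg c z.
    by apply: open_nbhs_nbhs; split=> //; exact: (chart_img_open ac).
  by apply: filterS2 nc nd.
by apply: smooth_atP => y Dy; have [_ dy] := Dy; have [] := plot_chart (H _ Dy) ad dy.
Qed.

Lemma push_vel phi E (g : E -> T) y a x : g y = x -> msmooth mT mT' phi x ->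
  push mT' phi x (vel mT g y a) = vel mT' (fun z => phi (g z)) y a.
Proof.
move=> gx sp; apply/funext => f; rewrite /push /vel gx; case: asboolP => // sf.
by case: asboolP => // -[]; exact: msmooth_near.
Qed.

Lemma push_tangent phi x v : msmooth mT mT' phi x -> tangent mT x v ->
  tangent mT' (phi x) (push mT' phi x v).
Proof.
move=> sp tv; have [c ac cx] := atlas_cover mT x.
have [a ->] := tangent_vel tv ac cx; have xK := chart_phiK ac cx.
rewrite (push_vel _ xK)// -[x in phi x]xK; apply: (@vel_tangent R _ _ mT' _ (fun z => phi (cpsi c z))).
by apply: msmooth_plot; [rewrite xK|exact: (plot_cpsi ac (chart_phi_img ac cx))].
Qed.

Lemma push_linear phi x : is_linear (push mT' phi x).
Proof.
move=> t v w; apply/funext => f.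
rewrite -[RHS]/(t * push mT' phi x v f + push mT' phi x w f) /push.
by case: asboolP => // _; rewrite mulr0 addr0.
Qed.

End TwoManifolds.

Section MoreManifolds.
Context {n n' n'' : nat} {T T' T'' : Type} {mT : manifold R n T}
  {mT' : manifold R n' T'} {mT'' : manifold R n'' T''}.

Lemma push_comp (phi : T -> T') (psi : T' -> T'') x v : msmooth mT' mT'' psi (phi x) ->
  push mT'' psi (phi x) (push mT' phi x v) = push mT'' (fun y => psi (phi y)) x v.
Proof.
move=> sp; apply/funext => f; rewrite /push; case: asboolP => // sf.
by case: asboolP => // -[]; exact: (msmooth_near sp sf).
Qed.

Lemma push_id x v : tangent mT x v -> push mT id x v = v.
Proof.
move=> tv; apply/funext => f; rewrite /push; case: asboolP => // nf.
by rewrite (tangent_off tv nf).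
Qed.

Lemma plot_map2 (phi : T -> T' -> T'') E (g : E -> T) (h : E -> T') y :
  smooth_map2 mT mT' mT'' phi -> plot mT g y -> plot mT' h y ->
  plot mT'' (fun z => phi (g z) (h z)) y.
Proof.
move=> sphi [c [ac nc sc]] [c' [ac' nc' sc']].
have [d ad dy] := atlas_cover mT'' (phi (g y) (h y)).
have [cy cy'] := (nbhs_singleton nc, nbhs_singleton nc').
have [oD sD] := sphi c c' d ac ac' ad; set D := [set p | _] in oD sD.
have Dy : D (cphi c (g y), cphi c' (h y)).
  split; rewrite /= ?(chart_phiK ac)// ?(chart_phiK ac')//.
    exact: (chart_phi_img ac cy).
  exact: (chart_phi_img ac' cy').
have sp := smooth_at_pair sc sc'.
have nD : \forall z \near y, D (cphi c (g z), cphi c' (h z)).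
  by apply: (smooth_at_cont sp); exact: open_nbhs_nbhs.
exists d; split=> //.
  apply: filterS3 nc nc' nD => z cz cz' [_ _] /=.
  by rewrite (chart_phiK ac)// (chart_phiK ac').
have : smooth_at (fun z => (cphi d \o (fun p : 'rV[R]_n * 'rV[R]_n' => phi (cpsi c p.1) (cpsi c' p.2)))
    (cphi c (g z), cphi c' (h z))) y.
  apply: (@smooth_at_comp R _ _ _ (fun z => (cphi c (g z), cphi c' (h z)))
     (cphi d \o (fun p : 'rV[R]_n * 'rV[R]_n' => phi (cpsi c p.1) (cpsi c' p.2)))) => //.
    by apply: findim_prod; exact: findim_rV.
  exact: smooth_on_at oD sD Dy.
apply: smooth_at_near; apply: filterS2 nc nc' => z cz cz' /=.
by rewrite (chart_phiK ac)// (chart_phiK ac').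
Qed.


End MoreManifolds.

Section InversePlot.
Context {n : nat} {T : Type} (mT : manifold R n T).

Lemma vel_inj_coord E (g : E -> T) y c : plot mT g y -> atlas mT c -> cdom c (g y) ->
  (forall a, vel mT g y a = 0 -> a = 0) ->
  forall a, 'D_a (fun z => cphi c (g z)) y = 0 -> a = 0.
Proof.
move=> pg ac cy inj a Da; apply: inj; rewrite (vel_chart a pg ac cy) Da.
have pc : plot mT (cpsi c) (cphi c (g y)) by exact: (plot_cpsi ac (chart_phi_img ac cy)).
by exact: (is_linear0 (vel_linear pc)).
Qed.

Lemma vel0 E (g : E -> T) y : plot mT g y -> vel mT g y 0 = 0.
Proof. by move=> pg; exact: (is_linear0 (vel_linear pg)). Qed.

Lemma vel_full (g : 'rV[R]_n -> T) y v : plot mT g y ->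
  (forall a, vel mT g y a = 0 -> a = 0) -> tangent mT (g y) v -> exists a, vel mT g y a = v.
Proof.
move=> pg inj tv; have [c ac cy] := atlas_cover mT (g y).
have [b ->] := tangent_vel tv ac cy.
have [nc sc] := plot_chart pg ac cy; have ds := smooth_at_diff sc.
have ju := jac_unitmx ds (vel_inj_coord pg ac cy inj).
exists (b *m invmx (jac (fun z => cphi c (g z)) y)).
by rewrite (vel_chart _ pg ac cy) (jacE _ ds) -mulmxA mulVmx// mulmx1.
Qed.

(** The inverse function theorem read in a chart. Smoothness of the inverse [Gi] is expressed on
    plots, the form in which it is composed later; the set [A] allows the domain to be shrunk in
    advance. *)
Lemma inverse_plot (G : 'rV[R]_n -> T) y (A : set 'rV[R]_n) : plot mT G y ->
  (forall a, vel mT G y a = 0 -> a = 0) -> nbhs y A ->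
  exists O U Gi, [/\ open_nbhs y O /\ O `<=` A, mopen mT U,
    forall t, O t -> [/\ plot mT G t, U (G t) & Gi (G t) = t],
    forall x, U x -> O (Gi x) /\ G (Gi x) = x &
    forall E (h : E -> T) z, plot mT h z -> U (h z) -> smooth_at (fun z => Gi (h z)) z].
Proof.
move=> pG inj nA; have [c ac cy] := atlas_cover mT (G y).
have [nc sc] := plot_chart pG ac cy; pose f z := cphi c (G z).
have [U0 [V0 [g [[oU0 U0y] [oV0 V0y] sU0 sV0 [H1 H2]]]]] :=
  inverse_function sc (vel_inj_coord pG ac cy inj).
have [W [oW Wy] HW] := near_open_nbhs (filterI (filterI nc (plot_near pG)) nA).
pose O := U0 `&` W; have oO : open O by exact: openI.
pose V := V0 `&` g @^-1` O.
have sg u : V0 u -> smooth_at g u by exact: smooth_on_at.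
have oV : open V.
  rewrite openE => u [Vu Ou]; apply: filterI; first exact: open_nbhs_nbhs.
  by apply: (smooth_at_cont (sg _ Vu)); exact: open_nbhs_nbhs.
have fV t : O t -> [/\ cdom c (G t), V (f t), g (f t) = t & plot mT G t].
  move=> [Ut Ot]; have [Vt gt] := H1 _ Ut; have [[ct pt] _] := HW _ Ot.
  by split=> //; split=> //; rewrite /preimage /= gt.
exists O, [set x | cdom c x /\ V (cphi c x)], (fun x => g (cphi c x)); split.
- by split=> // t [_ /HW[]].
- exact: mopen_chart.
- by move=> t Ot; have [ct Vt gt pt] := fV _ Ot.
- move=> x [cx [V0x Ox]]; split=> //.
  have [ct _ _ _] := fV _ Ox; have [_ fg] := H2 _ V0x.
  by rewrite -[LHS](chart_phiK ac ct) fg (chart_phiK ac cx).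
- move=> E h z ph [ch [Vh _]]; have [nh sh] := plot_chart ph ac ch.
  apply: (@smooth_at_comp R _ _ _ (fun z => cphi c (h z)) g) => //; first exact: findim_rV.
  exact: sg.
Qed.

End InversePlot.

End SmoothMaps.

(** * Lie groups and homogeneous spaces *)

Section TwoVariables.
Context {R : realType}.
Implicit Types E F G : normedModType R.

Lemma smooth_at_partial E F G (f : E * F -> G) x y b : findim E -> findim F ->
  smooth_at f (x, y) -> smooth_at (fun s => 'D_b (fun t => f (s, t)) y) x.
Proof.
move=> fE fF sf.
rewrite (_ : (fun s => _) = fun s => 'D_(0, b) f (s, y)); last first.
  by apply/funext => s; exact: derive_snd.
apply: (@smooth_at_comp R _ _ _ (fun s => (s, y)) (fun p => 'D_(0, b) f p)).
- exact: findim_prod.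
- by apply: smooth_at_pair; [exact: smooth_at_id|exact: smooth_at_cst].
- exact: smooth_at_derive.
Qed.

Lemma derive_comm2 E F (f : E * F -> R) x y a b : smooth_at f (x, y) ->
  'D_a (fun s => 'D_b (fun t => f (s, t)) y) x = 'D_b (fun t => 'D_a (fun s => f (s, t)) x) y.
Proof.
move=> sf.
rewrite (_ : (fun s => _) = fun s => 'D_(0, b) f (s, y)); last first.
  by apply/funext => s; exact: derive_snd.
rewrite [in RHS](_ : (fun t => _) = fun t => 'D_(a, 0) f (x, t)); last first.
  by apply/funext => t; exact: derive_fst.
by rewrite (derive_fst (fun p => 'D_(0, b) f p)) (derive_snd (fun p => 'D_(a, 0) f p)) derive_comm.
Qed.

Lemma derive_diag E G (f : E * E -> G) y a : findim E -> smooth_at f (y, y) ->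
  'D_a (fun s => f (s, s)) y = 'D_a (fun s => f (s, y)) y + 'D_a (fun s => f (y, s)) y.
Proof.
move=> fE sf; have df := smooth_at_diff sf.
have dd : differentiable (fun s : E => (s, s)) y.
  by apply: differentiable_pair; exact: (smooth_at_diff (smooth_at_id y)).
rewrite (@derive_comp R _ _ _ (fun s => (s, s)) f)//.
rewrite derive_fst derive_snd.
have -> : 'D_a (fun s : E => (s, s)) y = (a, 0) + (0, a).
  rewrite (deriveE _ dd) (@diff_pair R _ _ _ id id) //; try exact: (smooth_at_diff (smooth_at_id y)).
  by rewrite -(deriveE _ (smooth_at_diff (smooth_at_id y))) derive_id; apply/eqP; rewrite xpair_eqE /= addr0 add0r !eqxx.
by rewrite !(deriveE _ df) linearD.
Qed.

End TwoVariables.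

Section LieGroup.
Context {R : realType} {N : nat} {K : groupType} (mK : manifold R N K).
Hypothesis K_lie : lie_group mK.
Implicit Types E F : normedModType R.
Local Notation kk := (tangent mK (1%g : K)).

Lemma plot_mul E (g h : E -> K) y : plot mK g y -> plot mK h y ->
  plot mK (fun z => g z * h z)%g y.
Proof. exact: (plot_map2 K_lie.1). Qed.

Lemma plot_inv E (g : E -> K) y : plot mK g y -> plot mK (fun z => (g z)^-1)%g y.
Proof. by move=> pg; apply: (msmooth_plot _ pg); apply: (smooth_mapP _ _ _).1; exact: K_lie.2. Qed.

Lemma msmooth_lmul a x : msmooth mK mK (fun b => a * b)%g x.
Proof. by move=> E g y _ pg; apply: plot_mul => //; exact: plot_cst. Qed.

Lemma msmooth_conj h x : msmooth mK mK (fun b => h * b * h^-1)%g x.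
Proof.
by move=> E g y _ pg; do ! apply: plot_mul => //; exact: plot_cst.
Qed.

(** The left-invariant vector field extending [w], as an operator on functions; the bracket is the
    value at 1 of the commutator of two such operators. *)
Definition lfield (w : tvec R K) (f : K -> R) (x : K) : R :=
  push mK (fun b => x * b)%g 1%g w f.

Lemma lfieldE w f x : smooth_near mK x f -> lfield w f x = w (fun b => f (x * b)%g).
Proof. by rewrite /lfield /push mulg1; case: asboolP. Qed.

Lemma plot_mul2 E F (g : E -> K) (h : F -> K) s t : findim E -> findim F ->
  plot mK g s -> plot mK h t -> plot mK (fun p : E * F => g p.1 * h p.2)%g (s, t).
Proof.
move=> fE fF pg ph; apply: plot_mul.
  by apply: (@plot_comp R _ _ mK _ _ (fst : E * F -> E) g) => //; exact: smooth_at_fst.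
by apply: (@plot_comp R _ _ mK _ _ (snd : E * F -> F) h) => //; exact: smooth_at_snd.
Qed.

Lemma lfield_vel E (h : E -> K) y b f x : h y = 1%g -> plot mK h y -> smooth_near mK x f ->
  lfield (vel mK h y b) f x = 'D_b (fun t => f (x * h t)%g) y.
Proof.
move=> hy ph sf; rewrite lfieldE// velE//.
apply: (@msmooth_near R _ _ _ _ mK mK (fun b => x * b)%g); first exact: msmooth_lmul.
by rewrite hy mulg1.
Qed.

Lemma smooth_at_lfield_plot E F (g : E -> K) (h : F -> K) s y b f : findim E -> findim F ->
  h y = 1%g -> plot mK g s -> plot mK h y -> smooth_near mK (g s) f ->
  smooth_at (fun s => lfield (vel mK h y b) f (g s)) s /\
  \forall s' \near s, lfield (vel mK h y b) f (g s') = 'D_b (fun t => f (g s' * h t)%g) y.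
Proof.
move=> fE fF hy pg ph sf; have [U [oU Us HU]] := smooth_near_mopen sf.
have E1 : \forall s' \near s, lfield (vel mK h y b) f (g s') = 'D_b (fun t => f (g s' * h t)%g) y.
  by apply: filterS (plot_mopen pg oU Us) => s' Us'; apply: lfield_vel => //; exact: HU.
split=> //; have : smooth_at (fun s' => 'D_b (fun t => f (g s' * h t)%g) y) s.
  apply: (@smooth_at_partial R E F R (fun p => f (g p.1 * h p.2)%g)) => //.
  apply: (smooth_near_plot (plot_mul2 fE fF pg ph)).
  by rewrite /= hy mulg1.
by apply: smooth_at_near; apply: filterS E1 => s' ->.
Qed.

Definition chart1 : chart R N K := sval (cid2 (atlas_cover mK 1%g)).
Lemma chart1_atlas : atlas mK chart1. Proof. by rewrite /chart1; case: cid2. Qed.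
Lemma chart1_dom : cdom chart1 1%g. Proof. by rewrite /chart1; case: cid2. Qed.

(** A chart at 1 translated so that 0 is sent to 1: one fixed plot whose velocities at 0 are all
    tangent vectors at 1, which turns [lfield] and [Ad] into directional derivatives. *)
Definition econ (x : 'rV[R]_N) : K := cpsi chart1 (x + cphi chart1 1%g).

Lemma econ0 : econ 0 = 1%g.
Proof. by rewrite /econ add0r (chart_phiK chart1_atlas chart1_dom). Qed.

Lemma econ_plot : plot mK econ 0.
Proof.
apply: (@plot_comp R _ _ mK _ _ (fun x => x + cphi chart1 1%g) (cpsi chart1)).
- exact: findim_rV.
- by apply: smooth_at_add; [exact: smooth_at_id|exact: smooth_at_cst].
- rewrite add0r; apply: plot_cpsi; first exact: chart1_atlas.
  exact: chart_phi_img chart1_atlas chart1_dom.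
Qed.

Lemma tangent_econ v : kk v -> exists a, v = vel mK econ 0 a.
Proof.
move=> tv; have [a ->] := tangent_vel tv chart1_atlas chart1_dom; exists a.
have := @vel_comp R _ _ mK _ _ (fun x => x + cphi chart1 1%g) (cpsi chart1) 0 a.
rewrite add0r => -> //.
- rewrite -[X in 'D_a X _]/(id + cst (cphi chart1 1%g)) deriveD.
  + by rewrite derive_id derive_cst addr0.
  + exact: derivable_id.
  + exact: derivable_cst.
- by apply: smooth_at_add; [exact: smooth_at_id|exact: smooth_at_cst].
- apply: plot_cpsi; first exact: chart1_atlas.
  exact: chart_phi_img chart1_atlas chart1_dom.
Qed.

Lemma smooth_near_lfield w f x : kk w -> smooth_near mK x f -> smooth_near mK x (lfield w f).
Proof.
move=> /tangent_econ[b ->] sf; apply: smooth_nearP => g y gy pg.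
have [|s1 _] := @smooth_at_lfield_plot _ _ g econ y 0 b f (findim_rV N) (findim_rV N) econ0 pg econ_plot _.
  by rewrite gy.
exact: s1.
Qed.

Lemma lie_bracketE v w f : smooth_near mK 1%g f ->
  lie_bracket mK v w f = v (lfield w f) - w (lfield v f).
Proof. by rewrite /lie_bracket; case: asboolP. Qed.

Lemma lie_bracket_plots E F (g : E -> K) (h : F -> K) s t a b f :
  findim E -> findim F -> g s = 1%g -> h t = 1%g -> plot mK g s -> plot mK h t ->
  smooth_near mK 1%g f ->
  lie_bracket mK (vel mK g s a) (vel mK h t b) f =
  'D_a (fun s => 'D_b (fun t => f (g s * h t)%g) t) s -
  'D_b (fun t => 'D_a (fun s => f (h t * g s)%g) s) t.
Proof.
move=> fE fF gs ht pg ph sf; rewrite lie_bracketE//.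
have kg : kk (vel mK g s a) by rewrite -[X in tangent mK X]gs; exact: vel_tangent.
have kh : kk (vel mK h t b) by rewrite -[X in tangent mK X]ht; exact: vel_tangent.
rewrite velE; last by rewrite gs; exact: smooth_near_lfield.
rewrite velE; last by rewrite ht; exact: smooth_near_lfield.
have sfg : smooth_near mK (g s) f by rewrite gs.
have sfh : smooth_near mK (h t) f by rewrite ht.
have [_ E1] := @smooth_at_lfield_plot _ _ g h s t b f fE fF ht pg ph sfg.
have [_ E2] := @smooth_at_lfield_plot _ _ h g t s a f fF fE gs ph pg sfh.
by congr (_ - _); apply: near_eq_derive.
Qed.

Lemma lie_bracketC v w : lie_bracket mK w v = - lie_bracket mK v w.
Proof.
apply/funext => f; rewrite -[RHS]/(- (lie_bracket mK v w f)) /lie_bracket.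
by case: asboolP => _; rewrite ?opprB ?oppr0.
Qed.

Lemma lie_bracketDl t v v' w : kk v -> kk v' -> kk w ->
  lie_bracket mK (t *: v + v') w = t *: lie_bracket mK v w + lie_bracket mK v' w.
Proof.
move=> kv kv' kw; apply/funext => f.
rewrite -[RHS]/(t * lie_bracket mK v w f + lie_bracket mK v' w f).
have [sf|nf] := pselect (smooth_near mK 1%g f); last first.
  by rewrite /lie_bracket; case: asboolP => // _; rewrite mulr0 addr0.
rewrite !lie_bracketE//.
rewrite (_ : lfield (t *: v + v') f = fun x => t * lfield v f x + lfield v' f x); last first.
  by apply/funext => x; rewrite /lfield push_linear.
rewrite (tangent_comb kw); [|exact: smooth_near_lfield..].
by rewrite -[(t *: v + v') _]/(t * v _ + v' _); ring.
Qed.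

Lemma lie_bracketDr t v w w' : kk v -> kk w -> kk w' ->
  lie_bracket mK v (t *: w + w') = t *: lie_bracket mK v w + lie_bracket mK v w'.
Proof.
move=> kv kw kw'; rewrite lie_bracketC lie_bracketDl// opprD -scalerN.
by rewrite -!lie_bracketC.
Qed.

Lemma lfield_mul w f g x : kk w -> smooth_near mK x f -> smooth_near mK x g ->
  lfield w (fun y => f y * g y) x = lfield w f x * g x + f x * lfield w g x.
Proof.
move=> kw sf sg; rewrite !lfieldE//; last exact: smooth_near_mul.
have H h : smooth_near mK x h -> smooth_near mK 1%g (fun b => h (x * b)%g).
  move=> sh; apply: (@msmooth_near R _ _ _ _ mK mK (fun b => x * b)%g); first exact: msmooth_lmul.
  by rewrite mulg1.
by rewrite (tangent_mul kw) ?mulg1//; exact: H.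
Qed.

Lemma lfield_comb w t f g x : kk w -> smooth_near mK x f -> smooth_near mK x g ->
  lfield w (fun y => t * f y + g y) x = t * lfield w f x + lfield w g x.
Proof.
move=> kw sf sg; rewrite !lfieldE//; last first.
  by apply: smooth_near_add => //; apply: smooth_near_mul => //; exact: smooth_near_cst.
have H h : smooth_near mK x h -> smooth_near mK 1%g (fun b => h (x * b)%g).
  move=> sh; apply: (@msmooth_near R _ _ _ _ mK mK (fun b => x * b)%g); first exact: msmooth_lmul.
  by rewrite mulg1.
by rewrite (tangent_comb kw)//; exact: H.
Qed.

Lemma smooth_near2 x f g : smooth_near mK x f -> smooth_near mK x g ->
  exists U, [/\ mopen mK U, U x & forall y, U y -> smooth_near mK y f /\ smooth_near mK y g].
Proof.
move=> sf sg; have [U [oU Ux HU]] := smooth_near_mopen sf.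
have [V [oV Vx HV]] := smooth_near_mopen sg.
exists (U `&` V); split=> //; first exact: mopenI.
by move=> y [/HU ? /HV ?].
Qed.

(** Only the Leibniz rule needs a computation: the second-order operator [v (lfield w _)] produces
    the cross terms [v f * w g + w f * v g], symmetric in [v] and [w], which cancel in the
    commutator. *)
Lemma lie_bracket_tangent v w : kk v -> kk w -> kk (lie_bracket mK v w).
Proof.
move=> kv kw; split.
- by move=> f nf; rewrite /lie_bracket; case: asboolP.
- move=> f g U oU U1 fg.
  have [sf|nf] := pselect (smooth_near mK 1%g f); last first.
    rewrite /lie_bracket; case: asboolP => // _; case: asboolP => // sg; exfalso; apply: nf.
    by apply: eq_smooth_near oU U1 _ sg => y Uy; rewrite fg.
  have sg := eq_smooth_near oU U1 fg sf; rewrite !lie_bracketE//.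
  have [V [oV V1 HV]] := smooth_near2 sf sg.
  have lE u x : kk u -> (U `&` V) x -> lfield u f x = lfield u g x.
    move=> ku [Ux Vx]; have [sfx sgx] := HV _ Vx; rewrite !lfieldE//.
    apply: (tangent_local ku (U := [set b | U (x * b)%g])) => [||b]; last exact: fg.
      apply: mopenP => b Ub; have [c ac cb] := atlas_cover mK b; exists c; split=> //.
      have pc : plot mK (cpsi c) (cphi c b) by exact: (plot_cpsi ac (chart_phi_img ac cb)).
      have px := plot_mul (plot_cst mK x (cphi c b)) pc.
      have := plot_mopen px oU; rewrite (chart_phiK ac cb) => /(_ Ub).
      by apply: filterS.
    by rewrite /= mulg1.
  have oUV : mopen mK (U `&` V) by exact: mopenI.
  congr (_ - _).
    by apply: (tangent_local kv oUV) => // x; exact: lE.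
  by apply: (tangent_local kw oUV) => // x; exact: lE.
- move=> t f g sf sg.
  have sfg : smooth_near mK 1%g (fun y => t * f y + g y).
    by apply: smooth_near_add => //; apply: smooth_near_mul => //; exact: smooth_near_cst.
  rewrite !lie_bracketE//; have [V [oV V1 HV]] := smooth_near2 sf sg.
  have lE u u' : kk u -> kk u' ->
      u (lfield u' (fun y => t * f y + g y)) = t * u (lfield u' f) + u (lfield u' g).
    move=> ku ku'; rewrite -(tangent_comb ku); [|exact: smooth_near_lfield..].
    apply: (tangent_local ku oV) => // x Vx; have [sfx sgx] := HV _ Vx.
    exact: lfield_comb.
  by rewrite !lE//; ring.
- move=> f g sf sg; have sfg := smooth_near_mul sf sg.
  rewrite !lie_bracketE//; have [V [oV V1 HV]] := smooth_near2 sf sg.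
  have lE u u' : kk u -> kk u' ->
      u (lfield u' (fun y => f y * g y)) =
      u (lfield u' f) * g 1%g + u' f * u g + (u f * u' g + f 1%g * u (lfield u' g)).
    move=> ku ku'; rewrite (tangent_local ku oV (g := fun x => lfield u' f x * g x + f x * lfield u' g x))//.
      have [s1 s2] := (smooth_near_lfield ku' sf, smooth_near_lfield ku' sg).
      rewrite (tangent_add ku); [|exact: smooth_near_mul..].
      rewrite !(tangent_mul ku)// !lfieldE//.
      by do 2 (congr (_ + _)); congr (_ * _); congr u'; apply/funext => x; rewrite mul1g.
    by move=> x Vx; have [sfx sgx] := HV _ Vx; exact: lfield_mul.
  by rewrite !lE//; ring.
Qed.

(** [Ad (g s) w f] is a derivative in [t] of [f (g s * econ t * (g s)^-1)]. Mixed derivatives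
    commute, so the derivative in [s] can be taken first, with [t] fixed. There the two occurrences
    of [g s] contribute separately and give the derivatives of [f (g s * econ t)] and of
    [f (econ t * g s)] with opposite signs, that is, the bracket. *)
Lemma derive_Ad E (g : E -> K) s a w f : findim E -> g s = 1%g -> plot mK g s ->
  kk w -> smooth_near mK 1%g f ->
  smooth_at (fun s => Ad mK (g s) w f) s /\
  'D_a (fun s => Ad mK (g s) w f) s = lie_bracket mK (vel mK g s a) w f.
Proof.
move=> fE gs pg /tangent_econ[b ->] sf.
have fN := findim_rV (R := R) N; have pe := econ_plot.
have pgi := plot_inv pg.
pose F (p : E * 'rV[R]_N) := f (g p.1 * econ p.2 * (g p.1)^-1)%g.
have pF : plot mK (fun p : E * 'rV[R]_N => (g p.1 * econ p.2 * (g p.1)^-1)%g) (s, 0).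
  apply: plot_mul; first exact: plot_mul2.
  by apply: (@plot_comp R _ _ mK _ _ fst (fun s => (g s)^-1)%g) => //; exact: smooth_at_fst.
have sF : smooth_at F (s, 0).
  by apply: (smooth_near_plot pF); rewrite /= gs econ0 invg1 !mulg1.
have E1 : (fun s => Ad mK (g s) (vel mK econ 0 b) f) = fun s => 'D_b (fun t => F (s, t)) 0.
  apply/funext => s'; rewrite /Ad (@push_vel R _ _ _ _ mK mK _ _ econ 0 b _ econ0); last exact: msmooth_conj.
  by rewrite velE// econ0 mulg1 mulgV.
rewrite E1; split; first exact: smooth_at_partial.
rewrite derive_comm2// lie_bracket_plots ?econ0//.
pose F1 (p : E * 'rV[R]_N) := f (g p.1 * econ p.2)%g.
have sF1 : smooth_at F1 (s, 0).
  by apply: (smooth_near_plot (plot_mul2 fE fN pg pe)); rewrite /= gs econ0 mulg1.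
pose F2 (p : E * 'rV[R]_N) := f (econ p.2 * g p.1)%g.
have pF2 : plot mK (fun p : E * 'rV[R]_N => econ p.2 * g p.1)%g (s, 0).
  apply: plot_mul.
    by apply: (@plot_comp R _ _ mK _ _ snd econ) => //; exact: smooth_at_snd.
  by apply: (@plot_comp R _ _ mK _ _ fst g) => //; exact: smooth_at_fst.
have sF2 : smooth_at F2 (s, 0).
  by apply: (smooth_near_plot pF2); rewrite /= gs econ0 mulg1.
have -> : 'D_a (fun s => 'D_b (fun t => f (g s * econ t)%g) 0) s =
          'D_b (fun t => 'D_a (fun s => F1 (s, t)) s) 0 by exact: derive_comm2 sF1.
pose h1 t := 'D_a (fun s => F1 (s, t)) s; pose h2 t := 'D_a (fun s => F2 (s, t)) s.
have sw G t : smooth_at G (s, t) -> smooth_at (fun p : 'rV[R]_N * E => G (p.2, p.1)) (t, s).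
  move=> sG; apply: (@smooth_at_comp R _ _ _ (fun p : 'rV[R]_N * E => (p.2, p.1)) G) => //.
    exact: findim_prod.
  by apply: smooth_at_pair; [exact: smooth_at_snd|exact: smooth_at_fst].
have s1 : smooth_at h1 0 by apply: (@smooth_at_partial R _ _ _ (fun p => F1 (p.2, p.1))) => //; exact: sw.
have s2 : smooth_at h2 0 by apply: (@smooth_at_partial R _ _ _ (fun p => F2 (p.2, p.1))) => //; exact: sw.
have [U [oU U1 HU]] := smooth_near_mopen sf.
have U1' : U (econ 0) by rewrite econ0.
have nU : \forall t \near (0 : 'rV[R]_N), plot mK econ t /\ U (econ t).
  exact: (filterI (plot_near pe) (plot_mopen pe oU U1')).
(* The two occurrences of [g] are made independent variables of [P], and the derivative along the
   diagonal is split. *)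
have E2 : \forall t \near (0 : 'rV[R]_N), 'D_a (fun s => F (s, t)) s = h1 t - h2 t.
  apply: filterS nU => t [pt Ut].
  have ptc : plot mK (fun=> econ t) s by exact: plot_cst.
  pose P (p : E * E) := f (g p.1 * econ t * (g p.2)^-1)%g.
  have sP : smooth_at P (s, s).
    apply: (@smooth_near_plot R _ _ mK _ (fun p : E * E => g p.1 * econ t * (g p.2)^-1)%g).
      exact: (plot_mul2 fE fE (plot_mul pg ptc) pgi).
    by rewrite /= gs invg1 mulg1 mul1g; exact: HU.
  rewrite -[LHS]/('D_a (fun s => P (s, s)) s) derive_diag//.
  (* The same splitting on [econ t * g s * (g s)^-1], which is constant in [s], expresses the
     derivative of the inverse factor by that of [g]. *)
  pose P2 (p : E * E) := f (econ t * g p.1 * (g p.2)^-1)%g.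
  have sP2 : smooth_at P2 (s, s).
    apply: (@smooth_near_plot R _ _ mK _ (fun p : E * E => econ t * g p.1 * (g p.2)^-1)%g).
      exact: (plot_mul2 fE fE (plot_mul ptc pg) pgi).
    by rewrite /= gs invg1 !mulg1; exact: HU.
  have := derive_diag a fE sP2; rewrite /P2 /P /=.
  rewrite (_ : (fun s => f (econ t * g s * (g s)^-1)%g) = cst (f (econ t))); last first.
    by apply/funext => z; rewrite mulgK.
  rewrite derive_cst gs invg1.
  rewrite (_ : (fun z => f (econ t * g z * 1)%g) = fun z => F2 (z, t)); last first.
    by apply/funext => z; rewrite mulg1.
  rewrite (_ : (fun z => f (g z * econ t * 1)%g) = fun z => F1 (z, t)); last first.
    by apply/funext => z; rewrite mulg1.
  rewrite (_ : (fun z => f (1 * econ t * (g z)^-1)%g) = fun z => f (econ t * 1 * (g z)^-1)%g); last first.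
    by apply/funext => z; rewrite mulg1 mul1g.
  by rewrite /h1 /h2 => /esym/eqP; rewrite addrC addr_eq0 => /eqP ->.
rewrite (near_eq_derive _ E2) -[LHS]/('D_b (h1 \- h2) 0) deriveB//.
  exact/diff_derivable/smooth_at_diff.
exact/diff_derivable/smooth_at_diff.
Qed.

End LieGroup.

(** * Smoothness of integral curves and one-parameter curves *)

Section OdeSmooth.
Context {R : realType} {n : nat}.

Lemma near_abs_lt (e t : R) : `|t| < e -> \forall s \near t, `|s| < e.
Proof.
have : {for t, continuous (fun s : R => `|s|)} by exact: norm_continuous.
by move=> /(_ [set z | z < e]) + te; apply; apply: open_nbhs_nbhs; split=> //; exact: open_lt.
Qed.

Lemma derive1_scale (F : normedModType R) (c : R -> F) (t v : R) :
  derivable c t 1 -> 'D_v c t = v *: 'D_1 c t.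
Proof.
move=> /derivable1_diffP dc; rewrite !(deriveE _ dc) -[in LHS](mulr1 v).
by rewrite -[v * 1]/(v *: (1 : R)) linearZ.
Qed.

(** Bootstrap: the derivative of [c] is [F] composed with [c], so each order of smoothness of [c]
    gives one more. *)
Lemma ode_smooth (F : 'rV[R]_n -> 'rV[R]_n) (c : R -> 'rV[R]_n) (e : R) :
  (forall t : R, `|t| < e -> smooth_at F (c t) /\ is_derive t 1 c (F (c t))) ->
  forall t : R, `|t| < e -> smooth_at c t.
Proof.
move=> H; pose U := [set t : R | `|t| < e].
have oU : open U by rewrite openE => t; exact: near_abs_lt.
suff sU : smooth_on U c by move=> t te; exact: smooth_on_at sU te.
have dc t : U t -> differentiable c t.
  by move=> Ut; apply/derivable1_diffP; have [_ []] := H _ Ut.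
elim=> [|k IH]; first by move=> t Ut; exact/differentiable_continuous/dc.
split=> // v.
pose V := [set x | exists2 W, open_nbhs x W & Ck k W F].
have oV : open V.
  rewrite openE => x [W oW cW]; apply: filterS (open_nbhs_nbhs oW) => y Wy.
  by exists W => //; split=> //; case: oW.
have cF : Ck k V F by apply: Ck_locally => x [W [_ Wx] cW]; exists W.
have FV t : U t -> V (c t).
  by move=> Ut; have [[W oW sW] _] := H _ Ut; exists W.
apply: (@Ck_eq _ k _ _ U (fun t => v *: F (c t))) => //.
  move=> t Ut; rewrite derive1_scale; last exact/derivable1_diffP/dc.
  by have [_ [_ ->]] := H _ Ut.
apply: Ck_scale => //; first exact: Ck_cst.
by apply: (@Ck_comp _ k _ _ _ U V c F) => //; exact: findim_rV.
Qed.

(** A countable set has Lebesgue measure 0, whereas the interval has measure [2 d]. *)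
Lemma interval_uncountable (d : R) : 0 < d -> ~ countable [set t : R | `|t| < d].
Proof.
move=> d0 /countable_lebesgue_measure0.
have -> : [set t : R | `|t| < d] = `]- d, d[%classic.
  by apply/seteqP; split=> t /=; rewrite in_itv /= ltr_norml.
rewrite lebesgue_measure_itv /= lte_fin gtrN// => /eqP.
by rewrite -EFinD eqe opprK gt_eqF// addr_gt0.
Qed.

End OdeSmooth.

Section OneParameter.
Context {R : realType} {N : nat} {K : groupType} (mK : manifold R N K).
Hypothesis K_lie : lie_group mK.

(** An integral curve through 1 of the left-invariant field of [v]. In the chart the field becomes
    [F], the derivative at 0 in direction [b] of right multiplication by [econ y], so the equation
    is autonomous with smooth right-hand side. *)
Lemma one_parameter v : tangent mK 1%g v -> exists e (c : R -> K),
  [/\ 0 < e, c 0 = 1%g & forall t : R, `|t| < e -> plot mK c t /\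
    vel mK c t (1 : R) = push mK (fun b => c t * b)%g 1%g v].
Proof.
move=> /tangent_econ[b ->]; set ch := chart1 mK.
have ac : atlas mK ch by exact: chart1_atlas.
have c1 : cdom ch 1%g by exact: chart1_dom.
set p := cphi ch 1%g; have cp := chart_phi_img ac c1 : cimg ch p.
have pK : cpsi ch p = 1%g by exact: (chart_phiK ac c1).
have fN := findim_rV (R := R) N; have pe := econ_plot mK; have e0 := econ0 mK.
pose P (q : 'rV[R]_N * 'rV[R]_N) := (cpsi ch q.1 * econ mK q.2)%g.
have pP x : cimg ch x -> plot mK P (x, 0).
  by move=> cx; apply: (plot_mul2 K_lie fN fN (plot_cpsi ac cx) pe).
pose F x := 'D_b (fun y => cphi ch (P (x, y))) 0.
have sF x : cimg ch x -> smooth_at F x.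
  move=> cx; apply: (@smooth_at_partial R _ _ _ (fun q => cphi ch (P q))) => //.
  have [|_ s1] := plot_chart (pP _ cx) ac _; last exact: s1.
  by rewrite /P /= e0 mulg1; exact: (chart_psi_dom ac cx).
have [e1 [c [e10 c0 Hc]]] := picard (sF _ cp).
have cc : {for (0 : R), continuous c}.
  apply/differentiable_continuous/derivable1_diffP.
  by have [|_ []] := Hc 0; first by rewrite normr0.
have : \forall t \near (0 : R), cimg ch (c t).
  apply: cc; rewrite c0; apply: open_nbhs_nbhs; split=> //; exact: chart_img_open ac.
move=> /nbhs_ballP[e2 /= e20 He2].
have B1 (t : R) : `|t| < Num.min e1 e2 -> `|t| < e1 by move=> /lt_le_trans; apply; rewrite ge_min lexx.
have B2 (t : R) : `|t| < Num.min e1 e2 -> cimg ch (c t).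
  move=> te; apply: He2; rewrite -ball_normE /= sub0r normrN.
  by apply: lt_le_trans te _; rewrite ge_min lexx orbT.
exists (Num.min e1 e2), (fun t => cpsi ch (c t)); split; first by rewrite lt_min e10.
  by rewrite c0.
move=> t te; have sc := ode_smooth Hc (B1 _ te); have ct := B2 _ te.
have pc := plot_cpsi ac ct.
split; first by apply: (@plot_comp R _ _ mK _ _ c (cpsi ch)).
rewrite (@vel_comp R _ _ mK _ _ c (cpsi ch))//.
have [_ [_ ->]] := Hc _ (B1 _ te).
rewrite (@push_vel R _ _ _ _ mK mK _ _ (econ mK) 0 b _ e0); last exact: msmooth_lmul.
have pL : plot mK (fun y => cpsi ch (c t) * econ mK y)%g 0.
  by apply: plot_mul => //; exact: plot_cst.
rewrite (vel_chart b pL ac); last by rewrite e0 mulg1; exact: (chart_psi_dom ac ct).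
by rewrite e0 mulg1 (chart_psiK ac).
Qed.

End OneParameter.

(** * The projection, its local sections and the left translations *)

Section Homogeneous.
Context {R : realType} {N d m : nat} {K : groupType} (mK : manifold R N K)
  {H : set K} (mH : manifold R d {a : K | H a}) (mM : manifold R m.+2 (homspace H)).
Hypothesis K_lie : lie_group mK.
Hypothesis H_lie : lie_subgroup mK mH.
Hypothesis proj_submersion : submersion mK mM (@hproj K H).
Local Notation pi := (@hproj K H).
Local Notation kk := (tangent mK (1%g : K)).
Local Notation hh := (sub_lie_algebra mK mH).
Local Notation dpi := (push mM (@hproj K H) 1%g).
Local Notation o := (hproj H (1%g : K)).

Lemma sub1 : H 1%g. Proof. by case: H_lie. Qed.
Lemma subM a b : H a -> H b -> H (a * b)%g.
Proof.
move=> Ha Hb; have [_ [mulH mulHE _] _ _] := H_lie.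
have := mulHE (exist _ a Ha) (exist _ b Hb) => /= <-; exact: (svalP (mulH _ _)).
Qed.
Lemma subV a : H a -> H a^-1%g.
Proof.
move=> Ha; have [_ _ [invH invHE _] _] := H_lie.
have := invHE (exist _ a Ha) => /= <-; exact: (svalP (invH _)).
Qed.

Lemma sub_ext (x y : {a : K | H a}) : sval x = sval y -> x = y.
Proof. by case: x y => [x hx] [y hy] /= E; subst y; congr exist; exact: Prop_irrelevance. Qed.

Lemma homspace_ext (x y : homspace H) : sval x = sval y -> x = y.
Proof. by case: x y => [A hA] [B hB] /= AB; subst B; congr exist; exact: Prop_irrelevance. Qed.

Lemma hproj_surj (x : homspace H) : exists a, pi a = x.
Proof. by case: x => A [a Aa]; exists a; apply: homspace_ext. Qed.

Lemma ltrans_hproj a b : ltrans a (pi b) = pi (a * b)%g.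
Proof.
apply: homspace_ext => /=; apply/seteqP; split=> c.
  by move=> [_ [h Hh <-] <-]; exists h => //; rewrite mulgA.
by move=> [h Hh <-]; exists (b * h)%g; [exists h|rewrite mulgA].
Qed.

Lemma ltransM a b (x : homspace H) : ltrans a (ltrans b x) = ltrans (a * b)%g x.
Proof. by have [c <-] := hproj_surj x; rewrite !ltrans_hproj mulgA. Qed.

Lemma ltrans1 (x : homspace H) : ltrans 1%g x = x.
Proof. by have [c <-] := hproj_surj x; rewrite ltrans_hproj mul1g. Qed.

Lemma hproj_sub h : H h -> pi h = o.
Proof.
move=> Hh; apply: homspace_ext => /=; apply/seteqP; split=> c.
  by move=> [h' Hh' <-]; exists (h * h')%g; [exact: subM|rewrite mul1g].
move=> [h' Hh' <-]; exists (h^-1 * h')%g; last by rewrite mulgA mulgV.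
by apply: subM => //; exact: subV.
Qed.

Lemma hproj_mulr a h : H h -> pi (a * h)%g = pi a.
Proof. by move=> Hh; rewrite -ltrans_hproj (hproj_sub Hh) ltrans_hproj mulg1. Qed.

Lemma hproj_eq a b : pi a = pi b -> H (a^-1 * b)%g.
Proof.
move=> /(congr1 sval) /= ab; have : lcos H b b by exists 1%g; [exact: sub1|rewrite mulg1].
by rewrite -ab => -[h Hh <-]; rewrite mulKg.
Qed.

Lemma hproj_smooth x : msmooth mK mM pi x.
Proof. by apply: (smooth_mapP _ _ _).1; case: proj_submersion. Qed.

(* By the inverse function theorem applied to a slice on which the differential
   of pi is bijective. *)
Lemma local_section b : exists (U : set (homspace H)) (s : homspace H -> K),
  [/\ mopen mM U, U (pi b), s (pi b) = b, forall y, U y -> pi (s y) = y &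
    forall (E : normedModType R) (h : E -> homspace H) z, plot mM h z -> U (h z) ->
      plot mK (fun z => s (h z)) z].
Proof.
have [c ac cb] := atlas_cover mK b; have [d' ad dx] := atlas_cover mM (pi b).
set p := cphi c b; set q := cphi d' (pi b).
have cp : cimg c p by exact: (chart_phi_img ac cb).
have bK : cpsi c p = b by exact: (chart_phiK ac cb).
have qK : cpsi d' q = pi b by exact: (chart_phiK ad dx).
have pd : plot mM (cpsi d') q by exact: (plot_cpsi ad (chart_phi_img ad dx)).
have pcb : plot mK (cpsi c) p by exact: (plot_cpsi ac cp).
have spi := @hproj_smooth b.
have [_ sub] := proj_submersion.
(* Lifts of the coordinate basis at [pi b] become the rows of [A]. On the affine slice [ell] that
   they span, [pi] has at 0 the same velocities as the chart of K/H. *)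
have lift i : exists a, vel mM (fun z => pi (cpsi c z)) p a = vel mM (cpsi d') q (delta_mx 0 i).
  have [|v tv pv] := sub b (vel mM (cpsi d') q (delta_mx 0 i)).
    by have := vel_tangent (delta_mx 0 i) pd; rewrite qK.
  have [a va] := tangent_vel tv ac cb; exists a.
  by rewrite -(@push_vel R _ _ _ _ mK mM pi _ (cpsi c) p a b bK)// -va.
pose A : 'M[R]_(m.+2, N) := \matrix_i sval (cid (lift i)).
pose ell (t : 'rV[R]_m.+2) := p + t *m A.
have sl t : smooth_at ell t.
  apply: smooth_at_add; first exact: smooth_at_cst.
  by apply: smooth_at_mulmx; [exact: smooth_at_id|exact: smooth_at_cst].
have ell0 : ell 0 = p by rewrite /ell mul0mx addr0.
have dl a : 'D_a ell 0 = a *m A.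
  have [d1 d2] := derive_mulmxr A a (smooth_at_diff (smooth_at_id (0 : 'rV[R]_m.+2))).
  rewrite /ell -[LHS]/('D_a (cst p \+ (fun t : 'rV[R]_m.+2 => t *m A)) 0) deriveD.
  - by rewrite derive_cst add0r d2 derive_id.
  - exact: derivable_cst.
  - exact: diff_derivable.
have ppc : plot mM (fun z => pi (cpsi c z)) p by exact: (msmooth_plot (@hproj_smooth _) pcb).
pose G t := pi (cpsi c (ell t)).
have pG : plot mM G 0.
  apply: (@plot_comp R _ _ mM _ _ ell (fun z => pi (cpsi c z))) => //.
    exact: findim_rV.
  by rewrite ell0.
have velG a : vel mM G 0 a = vel mM (cpsi d') q a.
  rewrite (@vel_comp R _ _ mM _ _ ell (fun z => pi (cpsi c z)))//; last by rewrite ell0.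
  rewrite ell0 dl.
  have Ls := vel_linear ppc; have Ld := vel_linear pd.
  have sumL (L : 'rV[R]_N -> tvec R (homspace H)) (L' : 'rV[R]_m.+2 -> tvec R (homspace H)) :
    is_linear L -> is_linear L' -> (forall i, L (row i A) = L' (delta_mx 0 i)) ->
    forall a, L (a *m A) = L' a.
    move=> hL hL' E {}a.
    pose ML := GRing.isLinear.Build R _ _ _ L hL; pose ML' := GRing.isLinear.Build R _ _ _ L' hL'.
    pose LL : {linear 'rV[R]_N -> tvec R (homspace H)} := HB.pack L ML.
    pose LL' : {linear 'rV[R]_m.+2 -> tvec R (homspace H)} := HB.pack L' ML'.
    rewrite -[L]/(LL : _ -> _) -[L']/(LL' : _ -> _) mulmx_sum_row linear_sum.
    rewrite [in RHS](row_sum_delta a) linear_sum; apply: eq_bigr => i _.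
    by rewrite !linearZ /= E.
  apply: (sumL _ _ Ls Ld) => i; rewrite rowK; exact: (svalP (cid (lift i))).
have inj a : vel mM G 0 a = 0 -> a = 0.
  rewrite velG => va; apply: (vel_cpsi_inj ad dx); rewrite -/q va.
  by rewrite (vel0 pd).
have nA : nbhs (0 : 'rV[R]_m.+2) [set t | cimg c (ell t)].
  apply: (smooth_at_cont (sl 0)); rewrite ell0; apply: open_nbhs_nbhs; split=> //.
  exact: chart_img_open ac.
have [W [U [Gi [[[oW W0] WA] oU HW HU sGi]]]] := inverse_plot pG inj nA.
have [_ UG GG] := HW _ W0.
have G0 : G 0 = pi b by rewrite /G ell0 bK.
exists U, (fun y => cpsi c (ell (Gi y))); split=> //.
- by rewrite -G0.
- by rewrite -G0 GG ell0.
- by move=> y Uy; have [_ GGi] := HU _ Uy.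
- move=> E h z ph Uh; apply: (@plot_comp R _ _ mK _ _ (fun z => ell (Gi (h z))) (cpsi c)).
  + exact: findim_rV.
  + apply: (@smooth_at_comp R _ _ _ (fun z => Gi (h z)) ell) => //; first exact: findim_rV.
    exact: sGi.
  + apply: plot_cpsi => //; apply: WA; by have [] := HU _ Uh.
Qed.

(** Near [pi b] the translation is [y |-> pi (a * s y)] for a smooth local section [s]. *)
Lemma msmooth_ltrans a x : msmooth mM mM (ltrans a) x.
Proof.
have [b <-] := hproj_surj x => E g y gy pg.
have [U [s [oU Ub sb Hs sp]]] := local_section b.
have Ug : U (g y) by rewrite gy.
have pE : plot mM (fun z => pi (a * s (g z))%g) y.
  apply: (msmooth_plot (@hproj_smooth _)); apply: plot_mul => //; first exact: plot_cst.
  exact: sp.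
apply: eq_plot pE; apply: filterS (plot_mopen pg oU Ug) => z Uz.
by rewrite -ltrans_hproj Hs.
Qed.

Lemma push_ltransM a b x v :
  push mM (ltrans a) (ltrans b x) (push mM (ltrans b) x v) = push mM (ltrans (a * b)%g) x v.
Proof.
rewrite (push_comp _ _ (mT'' := mM)); last exact: msmooth_ltrans.
by congr (push mM _ x v); apply/funext => y; exact: ltransM.
Qed.

Lemma push_ltrans1 x v : tangent mM x v -> push mM (ltrans 1%g) x v = v.
Proof.
move=> tv; rewrite -[RHS](push_id tv); congr (push mM _ x v).
by apply/funext => y; exact: ltrans1.
Qed.

Lemma push_hproj_lmul a v :
  push mM pi a (push mK (fun b => a * b)%g 1%g v) = push mM (ltrans a) o (dpi v).
Proof.
rewrite (push_comp _ _ (mT'' := mM)); last exact: msmooth_ltrans.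
have := @push_comp R _ _ _ _ _ mK mM (fun b => a * b)%g pi 1%g v (@hproj_smooth _).
rewrite mulg1 => ->.
by congr (push mM _ 1%g v); apply/funext => b; rewrite ltrans_hproj.
Qed.

Lemma dpi_surj w : tangent mM o w -> exists2 v, kk v & dpi v = w.
Proof. by have [_] := proj_submersion; apply. Qed.

Lemma dpi_tangent v : kk v -> tangent mM o (dpi v).
Proof. by apply: push_tangent; exact: hproj_smooth. Qed.

Lemma sval_smooth x : msmooth mH mK sval x.
Proof. by apply: (smooth_mapP _ _ _).1; have [_ _ _ []] := H_lie. Qed.

Lemma hh_sub v : hh v -> kk v.
Proof. by move=> [e e1 [w tw <-]]; rewrite -e1; exact: (push_tangent (@sval_smooth e) tw). Qed.

Lemma hh_dpi v : hh v -> dpi v = 0.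
Proof.
move=> [e e1 [w tw <-]]; rewrite -e1 (push_comp _ _ (mT'' := mM)); last exact: hproj_smooth.
rewrite (_ : (fun y => _) = fun=> o); last first.
  by apply/funext => y; exact: hproj_sub (svalP y).
apply/funext => f; rewrite /push; case: asboolP => // sf.
exact: (tangent_cst tw (f o)).
Qed.

Lemma hh_subspace : Defs.subspace hh.
Proof.
have [e e1] : exists e : {a : K | H a}, sval e = 1%g by exists (exist _ 1%g sub1).
have [t0 tL] := tangent_subspace mH e; split.
  exists e => //; exists 0 => //.
  have := @push_linear R _ _ _ mK sval e (-1) 0 0; rewrite scaler0 addr0 scaleN1r.
  by rewrite addNr.
move=> t _ _ [e' e1' [v tv <-]] [e'' e1'' [w tw <-]].
have ee : e' = e'' by apply: sub_ext; rewrite e1'.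
subst e''; exists e' => //; exists (t *: v + w); last exact: push_linear.
by have [_] := tangent_subspace mH e'; apply.
Qed.

End Homogeneous.

Section VelocityOfProducts.
Context {R : realType} {N : nat} {K : groupType} (mK : manifold R N K).
Hypothesis K_lie : lie_group mK.
Implicit Types E F : normedModType R.

Lemma vel_mul_id E F (g : E -> K) (h : F -> K) s t a b : findim E -> findim F ->
  g s = 1%g -> h t = 1%g -> plot mK g s -> plot mK h t ->
  vel mK (fun p : E * F => g p.1 * h p.2)%g (s, t) (a, b) = vel mK g s a + vel mK h t b.
Proof.
move=> fE fF gs ht pg ph; have pp := plot_mul2 K_lie fE fF pg ph.
apply/funext => f; rewrite -[RHS]/(vel mK g s a f + vel mK h t b f).
have [sf|nf] := pselect (smooth_near mK 1%g f); last first.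
  by rewrite /vel /= gs ht mulg1; case: asboolP => // _; rewrite addr0.
rewrite !velE ?gs ?ht ?mulg1//=.
have df := smooth_at_diff (smooth_near_plot pp (f := f) _).
have {}df : differentiable (fun p : E * F => f (g p.1 * h p.2)%g) (s, t).
  by apply: df; rewrite /= gs ht mulg1.
have -> : (a, b) = (a, 0) + (0, b) :> E * F.
  by apply/eqP; rewrite xpair_eqE /= addr0 add0r !eqxx.
rewrite (deriveE _ df) linearD -!(deriveE _ df) -derive_fst -derive_snd.
congr (_ + _); [congr ('D_a _ s)|congr ('D_b _ t)]; apply/funext => z /=.
  by rewrite ht mulg1.
by rewrite gs mul1g.
Qed.

End VelocityOfProducts.

Section ConstantPlots.
Context {R : realType} {n : nat} {T : Type} (mT : manifold R n T).

Lemma vel0_constant (g : R -> T) (e : R) : 0 < e ->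
  (forall t : R, `|t| < e -> plot mT g t /\ vel mT g t (1 : R) = 0) ->
  exists2 e', 0 < e' & forall t : R, `|t| < e' -> g t = g 0.
Proof.
move=> e0 H; have [|p0 _] := H 0; first by rewrite normr0.
have [d ad d0] := atlas_cover mT (g 0).
have [nd sd] := plot_chart p0 ad d0.
have /nbhs_ballP[e1 /= e10 He1] := nd.
have B (t : R) : `|t| < Num.min e e1 -> `|t| < e /\ cdom d (g t).
  move=> te; split; first by apply: lt_le_trans te _; rewrite ge_min lexx.
  apply: He1; rewrite -ball_normE /= sub0r normrN; apply: lt_le_trans te _.
  by rewrite ge_min lexx orbT.
exists (Num.min e e1); first by rewrite lt_min e0.
pose f t := cphi d (g t).
have df (t : R) : `|t| < Num.min e e1 -> smooth_at f t /\ 'D_1 f t = 0.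
  move=> /B[te dt]; have [pt vt] := H _ te; have [_ st] := plot_chart pt ad dt.
  split=> //; apply: (vel_cpsi_inj ad dt); rewrite -(vel_chart _ pt ad dt) vt.
  by rewrite (vel0 (plot_cpsi ad (chart_phi_img ad dt))).
move=> t te; have [te' dt] := B _ te.
rewrite -(chart_phiK ad dt) -[RHS](chart_phiK ad d0); congr (cpsi d _).
have Bs s : 0 <= s <= 1 -> `|0 + s *: t| < Num.min e e1.
  move=> /andP[s0 s1]; rewrite add0r normrZ ger0_norm//; apply: le_lt_trans te.
  by rewrite ler_piMl.
apply/rowP => j; apply/eqP; rewrite -subr_eq0.
have [s s01|s s01 Hs] := @mvt_segment R R (fun s => f s 0 j) 0 t.
  by have [sf _] := df _ (Bs _ s01); exact/smooth_at_diff/smooth_at_coord.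
rewrite -/(f t) -/(f 0) -[in f t](add0r t) Hs; have [sf Df] := df _ (Bs _ s01).
rewrite -derive_rV; last exact: smooth_at_diff.
rewrite derive1_scale; last exact/diff_derivable/smooth_at_diff.
by rewrite Df scaler0 mxE.
Qed.

End ConstantPlots.

(** * The kernel of the differential of the projection *)

Section Kernel.
Context {R : realType} {N d m : nat} {K : groupType} (mK : manifold R N K)
  {H : set K} (mH : manifold R d {a : K | H a}) (mM : manifold R m.+2 (homspace H)).
Hypothesis K_lie : lie_group mK.
Hypothesis H_lie : lie_subgroup mK mH.
Hypothesis proj_submersion : submersion mK mM (@hproj K H).
Local Notation pi := (@hproj K H).
Local Notation kk := (tangent mK (1%g : K)).
Local Notation hh := (sub_lie_algebra mK mH).
Local Notation dpi := (push mM (@hproj K H) 1%g).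
Local Notation o := (hproj H (1%g : K)).

Let eH : {a : K | H a} := exist _ 1%g (sub1 H_lie).

(* Otherwise the right translates of a small neighbourhood of 1 in H by the
   points of the curve c would be uncountably many disjoint non-empty open
   subsets of H. *)
Lemma curve_in_subgroup w (c : R -> K) (e : R) : 0 < e -> c 0 = 1%g -> plot mK c (0 : R) ->
  vel mK c (0 : R) (1 : R) = w -> (forall t : R, `|t| < e -> H (c t)) -> hh w.
Proof.
move=> e0 c0 pc vc Hc; apply: contrapT => nw.
have [_ [mulH mulHE sM] _ [_ imm]] := H_lie.
have [ch ac c1] := atlas_cover mH eH; set pe := cphi ch eH.
have peK : cpsi ch pe = eH by exact: (chart_phiK ac c1).
have pch : plot mH (cpsi ch) pe by exact: (plot_cpsi ac (chart_phi_img ac c1)).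
pose g x := cpsi ch (x + pe).
have g0 : g 0 = eH by rewrite /g add0r.
have sadd x : smooth_at (fun x : 'rV[R]_d => x + pe) x.
  by apply: smooth_at_add; [exact: smooth_at_id|exact: smooth_at_cst].
have pg : plot mH g 0.
  apply: (@plot_comp R _ _ mH _ _ (fun x => x + pe) (cpsi ch)) => //; first exact: findim_rV.
  by rewrite add0r.
have velg a : vel mH g 0 a = vel mH (cpsi ch) pe a.
  rewrite (@vel_comp R _ _ mH _ _ (fun x => x + pe) (cpsi ch)) ?add0r//.
  congr (vel mH _ _ _); rewrite -[X in 'D_a X _]/(id + cst pe) deriveD.
  + by rewrite derive_id derive_cst addr0.
  + exact: derivable_id.
  + exact: derivable_cst.
have ssv := sval_smooth H_lie.
pose gK x := sval (g x); have gK0 : gK 0 = 1%g by rewrite /gK g0.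
have pgK : plot mK gK 0 by exact: (msmooth_plot (ssv _) pg).
have velgK a : vel mK gK 0 a = push mK sval eH (vel mH g 0 a).
  by rewrite (@push_vel R _ _ _ _ mH mK _ _ g 0 a _ g0).
have tg a : tangent mH eH (vel mH g 0 a) by rewrite -g0; exact: vel_tangent.
(* Identifies rows of length [d + 1] with pairs, since local injectivity is available on row
   spaces. *)
pose L (z : 'rV[R]_(d + 1)) := (lsubmx z, (rsubmx z) 0 0).
have sL z : smooth_at L z.
  apply: smooth_at_pair; first exact/smooth_at_lin/continuous_lsubmx.
  apply: (@smooth_at_coord R _ 1 1 (fun z : 'rV[R]_(d + 1) => rsubmx z)).
  exact/smooth_at_lin/continuous_rsubmx.
have dL z : 'D_z L 0 = L z.
  have lL : linear L.
    by move=> t a b; apply/eqP; rewrite xpair_eqE /= !linearP !mxE !eqxx.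
  pose LM := GRing.isLinear.Build R _ _ _ L lL.
  pose LL : {linear 'rV[R]_(d + 1) -> ('rV[R]_d * R)%type} := HB.pack L LM.
  have cL : continuous LL by move=> u; exact: (smooth_at_cont (sL u)).
  have dLL := @linear_differentiable _ _ _ LL 0 cL.
  by rewrite -[L]/(LL : _ -> _) (deriveE _ dLL) (diff_lin _ cL).
have L0 : L 0 = (0, 0) by rewrite /L !linear0 mxE.
pose Psi' (p : 'rV[R]_d * R) := (gK p.1 * c p.2)%g.
have fd := findim_rV (R := R) d; have fR := findimR (R := R).
have pPsi' : plot mK Psi' (0, 0) by exact: (plot_mul2 K_lie fd fR pgK pc).
pose Psi z := Psi' (L z).
have pPsi : plot mK Psi 0.
  by apply: (@plot_comp R _ _ mK _ _ L Psi'); [exact: findim_prod|exact: sL|rewrite L0].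
have velPsi z : vel mK Psi 0 z = vel mK gK 0 (L z).1 + (L z).2 *: w.
  rewrite (@vel_comp R _ _ mK _ _ L Psi')// ?L0// dL [L z]surjective_pairing.
  rewrite (vel_mul_id K_lie _ _ fd fR gK0 c0 pgK pc) -vc; congr (_ + _).
  have := vel_linear pc (L z).2 1 0; rewrite (vel0 pc) !addr0 => <-.
  by rewrite -[_ *: 1]/(_ * 1) mulr1.
(* A non-zero second component would express [w] through a vector of [hh], against the assumption;
   with that component zero, injectivity is that of the differential of H in K. *)
have inj z : vel mK Psi 0 z = 0 -> z = 0.
  rewrite velPsi velgK => Hz.
  have hg : hh (push mK sval eH (vel mH g 0 (L z).1)) by exists eH => //; exists (vel mH g 0 (L z).1).
  have [Lz2|Lz2] := eqVneq (L z).2 0; last first.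
    exfalso; apply: nw; have [hh0 hhL] := hh_subspace H_lie.
    have := hhL (- (L z).2^-1) _ _ hg hh0; rewrite addr0; congr (hh _).
    move/eqP: Hz; rewrite addrC addr_eq0 => /eqP Hz.
    by rewrite scaleNr -scalerN -Hz scalerA mulVf// scale1r.
  move: Hz; rewrite Lz2 scale0r addr0 => Hz.
  have t0 := (tangent_subspace mH eH).1.
  have push0 : push mK sval eH (0 : tvec R {a : K | H a}) = 0.
    exact: (is_linear0 (@push_linear R _ _ _ mK sval eH)).
  have v0 : vel mH g 0 (L z).1 = 0 by apply: imm => //; rewrite Hz push0.
  have Lz1 : (L z).1 = 0.
    by apply: (vel_cpsi_inj ac c1); rewrite -/pe -velg v0 (vel0 pch).
  rewrite -[z]hsubmxK; move: Lz1 Lz2; rewrite /L /= => -> r0.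
  rewrite (_ : rsubmx z = 0) ?row_mx0//; apply/rowP => j; rewrite (ord1 j) r0 mxE//.
have [cK acK cK1] := atlas_cover mK (Psi 0).
have [_ sPsi] := plot_chart pPsi acK cK1.
have [D D0 HD] := locally_injective sPsi (vel_inj_coord pPsi acK cK1 inj).
have PsiI x x' (t t' : R) : ball 0 D x -> ball 0 D x' -> `|t| < D -> `|t'| < D ->
    (gK x * c t = gK x' * c t')%g -> t = t'.
  move=> Bx Bx' Bt Bt' E.
  pose z x t : 'rV[R]_(d + 1) := row_mx x (const_mx t).
  have Lz x0 t0 : L (z x0 t0) = (x0, t0) by rewrite /L /z row_mxKl row_mxKr mxE.
  have Bz x0 (t0 : R) : ball 0 D x0 -> `|t0| < D -> ball 0 D (z x0 t0).
    move=> [_ Bx0] Bt0; split=> // i j; rewrite (ord1 i) /z !mxE; case: split_ordP => k _.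
      by have := Bx0 0 k; rewrite mxE.
    by rewrite mxE -ball_normE /= sub0r normrN.
  have := HD _ _ (Bz _ _ Bx Bt) (Bz _ _ Bx' Bt') _.
  rewrite /Psi !Lz /Psi' /= E => /(_ erefl) /(congr1 L).
  by rewrite !Lz => -[].
pose V := [set y : {a : K | H a} | cdom ch y /\ ball pe D (cphi ch y)].
have oV : mopen mH V by apply: mopen_chart => //; exact: ball_open.
pose del := Num.min e D; have del0 : 0 < del by rewrite lt_min e0.
have [B [oB HB]] := atlas_second_countable mH.
(* The right translate of [V] by [c t] is a neighbourhood of [c t] in H, so it contains a set [B i]
   of the countable basis around [c t]. *)
have key (t : R) : `|t| < del -> exists i, exists2 y, B i y & sval y = c t /\
    forall y', B i y' -> exists2 x, ball 0 D x & sval y' = (gK x * c t)%g.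
  move=> td; have Ht : H (c t) by apply: Hc; apply: lt_le_trans td _; rewrite ge_min lexx.
  pose it : {a : K | H a} := exist _ (c t)^-1%g (subV H_lie Ht).
  pose Vt := [set y | V (mulH y it)].
  have oVt : mopen mH Vt.
    apply: mopenP => y Vy; have [c' ac' c'y] := atlas_cover mH y; exists c'; split=> //.
    have py : plot mH (cpsi c') (cphi c' y) by exact: (plot_cpsi ac' (chart_phi_img ac' c'y)).
    have pm := plot_map2 sM py (plot_cst mH it (cphi c' y)).
    have := plot_mopen pm oV; rewrite (chart_phiK ac' c'y) => /(_ Vy).
    by apply: filterS.
  have yt : Vt (exist _ (c t) Ht).
    rewrite /Vt /= (_ : mulH _ it = eH); last by apply: sub_ext; rewrite mulHE /= mulgV.
    by split=> //; exact: ballxx.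
  have [i [Bi BV]] := HB _ _ oVt yt.
  exists i, (exist _ (c t) Ht) => //; split=> // y' /BV[cy By].
  exists (cphi ch (mulH y' it) - pe).
    by move: By; rewrite -!ball_normE /= sub0r opprB.
  by rewrite /gK /g subrK (chart_phiK ac cy) mulHE /= mulgVK.
(* If [t] and [t'] had the same index, a point of the common basic set would be both [gK x * c t]
   and [gK x' * c t'], whence [t = t']. The default 0 is never reached for [|t| < del]. *)
pose i (t : R) := if pselect (`|t| < del) is left td then sval (cid (key t td)) else 0%N.
apply: (@interval_uncountable R del del0); apply/countable_injP; exists i.
move=> t t'; rewrite !inE /= => td td'; rewrite /i.
case: pselect => // td1; case: pselect => // td1'.
case: (cid _) => j /= [y By [yt Hy]]; case: (cid _) => j' /= [y' By' [yt' Hy']] jj'.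
subst j'; have [x Bx Ex] := Hy' _ By; have [x' Bx' Ex'] := Hy _ By.
have lD s : `|s| < del -> `|s| < D by move=> /lt_le_trans; apply; rewrite ge_min lexx orbT.
by apply: (PsiI x' x) => //; [exact: lD|exact: lD|rewrite -Ex -Ex'].
Qed.

(** Along the one-parameter curve [c] of [w], the velocity of [pi (c t)] is the translate by [c t]
    of [dpi w = 0]. So [pi (c t)] is constant for small [t], which puts [c] in H. *)
Lemma dpi_ker w : kk w -> dpi w = 0 -> hh w.
Proof.
move=> kw dw; have [e [c [e0 c0 Hc]]] := one_parameter K_lie kw.
have [|pc vc] := Hc 0; first by rewrite normr0.
have push0 (a : K) : push mM (ltrans a) o (0 : tvec R (homspace H)) = 0.
  exact: (is_linear0 (@push_linear R _ _ _ mM (ltrans a) o)).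
have [|e' e'0 He'] := @vel0_constant R _ _ mM (fun t => pi (c t)) e e0.
  move=> t te; have [pt vt] := Hc _ te; have sp := hproj_smooth proj_submersion.
  split; first exact: (msmooth_plot (sp _) pt).
  rewrite -(@push_vel R _ _ _ _ mK mM pi _ c t 1 _ erefl)// vt.
  by rewrite (push_hproj_lmul K_lie proj_submersion) dw.
apply: (curve_in_subgroup e'0 c0 pc).
  by rewrite vc c0; have := push_id kw; congr (_ = w); congr (push mK _ _ w); apply/funext => b; rewrite mul1g.
move=> t te; have := He' _ te; rewrite c0 => /esym/(hproj_eq H_lie).
by rewrite invg1 mul1g.
Qed.

Lemma dpi_kerP w : kk w -> dpi w = 0 <-> hh w.
Proof.
move=> kw; split; first exact: dpi_ker.
exact: (hh_dpi H_lie proj_submersion).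
Qed.

End Kernel.

Local Notation eta := Defs.eta.

(** * Quadruples as linear maps to Minkowski space *)

Section Minkowski.
Context {R : realType} {m : nat}.
Local Notation E := 'rV[R]_m.+2.
Implicit Types a b c : E.
Local Notation ek := (ek R m).
Local Notation el := (el R m).
Local Notation em := (@em R m).
(** The index of the basis vector m_i; the indices 0 and 1 belong to k and l. *)
Definition mx2 (i : 'I_m) : 'I_m.+2 := lift ord0 (lift ord0 i).

Lemma ord_cases (P : 'I_m.+2 -> Prop) : P 0 -> P 1 -> (forall i, P (mx2 i)) -> forall j, P j.
Proof.
move=> P0 P1 Pi j; case: (unliftP ord0 j) => [j'|] ->; last exact: P0.
case: (unliftP ord0 j') => [i|] ->; first exact: Pi.
by rewrite (_ : lift _ _ = 1)//; apply: val_inj.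
Qed.

Lemma rV_ext a b : a 0 0 = b 0 0 -> a 0 1 = b 0 1 ->
  (forall i, a 0 (mx2 i) = b 0 (mx2 i)) -> a = b.
Proof. by move=> h0 h1 hi; apply/rowP; exact: ord_cases. Qed.

Lemma sum_ord2 (V : zmodType) (F : 'I_m.+2 -> V) : \sum_j F j = F 0 + F 1 + \sum_i F (mx2 i).
Proof. by rewrite big_ord_recl big_ord_recl addrA; congr (_ + F _ + _); apply: val_inj. Qed.

Lemma eta_linear c : is_linear (eta c : E -> R).
Proof.
move=> t a b; rewrite /eta !mxE; under eq_bigr do rewrite !mxE mulrDr mulrCA.
by rewrite big_split /= -mulr_sumr -/(R) -[t *: _]/(t * _); ring.
Qed.

Lemma etaC a b : eta a b = eta b a.
Proof.
rewrite /eta; congr (_ + _); first by rewrite addrC mulrC [X in _ + X]mulrC.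
by apply: eq_bigr => i _; rewrite mulrC.
Qed.

Lemma etaDr c t a b : eta c (t *: a + b) = t * eta c a + eta c b.
Proof. exact: eta_linear. Qed.
Lemma etaDl c t a b : eta (t *: a + b) c = t * eta a c + eta b c.
Proof. by rewrite etaC etaDr !(etaC c). Qed.
Lemma eta0r c : eta c 0 = 0.
Proof. exact: (is_linear0 (eta_linear c)). Qed.
Lemma etaZr c t a : eta c (t *: a) = t * eta c a.
Proof. by rewrite -[t *: a]addr0 etaDr eta0r addr0. Qed.
Lemma etaZl c t a : eta (t *: a) c = t * eta a c.
Proof. by rewrite etaC etaZr etaC. Qed.
Lemma mx2_0 i : (mx2 i == 0) = false. Proof. by []. Qed.
Lemma mx2_1 i : (mx2 i == 1) = false. Proof. by []. Qed.
Lemma mx2_eq i j : (mx2 i == mx2 j) = (i == j).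
Proof. by rewrite /mx2 !(inj_eq (@lift_inj _ _)). Qed.
Lemma mx2_0' i : (0 == mx2 i) = false. Proof. by []. Qed.
Lemma mx2_1' i : (1 == mx2 i) = false. Proof. by []. Qed.

Lemma ekE j : ek 0 j = (j == 0)%:R. Proof. by rewrite mxE. Qed.
Lemma elE j : el 0 j = (j == 1)%:R. Proof. by rewrite mxE. Qed.
Lemma emE i j : em i 0 j = (j == mx2 i)%:R. Proof. by rewrite mxE. Qed.

Lemma eta_ek a : eta ek a = a 0 1.
Proof.
rewrite /eta !ekE /= mul1r mul0r addr0 big1 ?addr0// => i _.
by rewrite ekE -/(mx2 i) mx2_0 mul0r.
Qed.
Lemma eta_em i a : eta (em i) a = a 0 (mx2 i).
Proof.
rewrite /eta !emE mx2_0' mx2_1' !mul0r !add0r (bigD1 i)//= emE -/(mx2 i) eqxx mul1r.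
rewrite big1 ?addr0// => j ji; by rewrite emE -/(mx2 j) mx2_eq (negPf ji) mul0r.
Qed.

Lemma kperpE a : kperp a <-> a 0 1 = 0.
Proof. by rewrite /kperp /= eta_ek. Qed.

Lemma kperp_ek : kperp ek. Proof. by rewrite kperpE ekE. Qed.
Lemma kperp_em i : kperp (em i). Proof. by rewrite kperpE emE mx2_1'. Qed.

Lemma kperp_lin t a b : kperp a -> kperp b -> kperp (t *: a + b).
Proof. by rewrite !kperpE !mxE => -> ->; rewrite mulr0 addr0. Qed.

Lemma eta_kperp a b : kperp a -> kperp b -> eta a b = \sum_i a 0 (mx2 i) * b 0 (mx2 i).
Proof. by rewrite !kperpE /eta => -> ->; rewrite mulr0 mul0r !add0r. Qed.

(** On the orthogonal of k the product is the sum of squares of the m-coordinates, which vanishes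
    only on multiples of k. *)
Lemma eta_pos a : kperp a -> (forall t, a <> t *: ek) -> 0 < eta a a.
Proof.
move=> ka na; rewrite eta_kperp// lt0r sumr_ge0 ?andbT; last by move=> i _; rewrite -expr2 sqr_ge0.
apply/negP => /eqP s0; apply: (na (a 0 0)).
have ai i : a 0 (mx2 i) = 0.
  have : a 0 (mx2 i) * a 0 (mx2 i) = 0.
    by apply: (psumr_eq0P _ s0) => // j _; rewrite -expr2 sqr_ge0.
  by move=> /eqP; rewrite mulf_eq0 orbb => /eqP.
apply: rV_ext; rewrite ?mxE ?eqxx /= ?mulr1 ?mulr0//; first exact/kperpE.
by move=> i; rewrite ai mxE mxE /= -/(mx2 i) ?mx2_0 mulr0.
Qed.

Lemma rV_basis a : a = a 0 0 *: ek + (a 0 1 *: el + \sum_i a 0 (mx2 i) *: em i).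
Proof. by rewrite {1}[a](row_sum_delta a) sum_ord2 -addrA. Qed.

(** Condition (3) reads [t * eta k (f a) = eta k a] with [f k = t k], and [t] is non-zero by
    injectivity. *)
Lemma GN_kperp f a : GN f -> kperp a -> kperp (f a).
Proof.
move=> [fl [g fK gK] [t ft] f2 f3] ka; have := f3 a; rewrite ft etaZl.
rewrite (_ : eta ek a = 0)// => /eqP; rewrite mulf_eq0 => /orP[/eqP t0|/eqP//].
exfalso; have f0 : f 0 = 0 by exact: (is_linear0 fl).
have : ek = 0 by rewrite -[ek]fK ft t0 scale0r -f0 fK.
by move=> /rowP/(_ 0); rewrite !mxE eqxx => /eqP; rewrite oner_eq0.
Qed.

Lemma GN_comp f g : @GN R m f -> @GN R m g -> @GN R m (f \o g).
Proof.
move=> Gf Gg; have [fl fb [t ft] f2 f3] := Gf; have [gl gb [s gs] g2 g3] := Gg; split.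
- by move=> r a b /=; rewrite gl fl.
- exact: bij_comp.
- by exists (s * t); rewrite /= gs -[s *: ek]addr0 fl ft (_ : f 0 = 0) ?addr0 ?scalerA//; exact: (is_linear0 fl).
- by move=> w w' kw kw' /=; rewrite f2 ?g2//; exact: GN_kperp.
- move=> z /=; rewrite gs.
  have fZ : f (s *: ek) = s *: f ek.
    by rewrite -[s *: ek]addr0 fl (_ : f 0 = 0) ?addr0//; exact: (is_linear0 fl).
  by rewrite fZ etaZl f3 -etaZl -gs g3.
Qed.

Lemma GN_id : @GN R m id.
Proof. by split=> //; [exists id|exists 1; rewrite scale1r]. Qed.

Lemma GN_inv f g : @GN R m f -> cancel f g -> cancel g f -> @GN R m g.
Proof.
move=> Gf fK gK; have [fl _ [t ft] f2 f3] := Gf.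
have gl : is_linear g by move=> r a b; rewrite -{1}[a]gK -{1}[b]gK -fl fK.
have f0 : f 0 = 0 by exact: (is_linear0 fl).
have g0 : g 0 = 0 by rewrite -f0 fK.
have gZ r a : g (r *: a) = r *: g a by rewrite -[r *: a]addr0 gl g0 addr0.
have t0 : t != 0.
  apply/eqP => t0; have : ek = 0 by rewrite -[ek]fK ft t0 scale0r -f0 fK.
  by move=> /rowP/(_ 0); rewrite !mxE eqxx => /eqP; rewrite oner_eq0.
have gk : g ek = t^-1 *: ek by rewrite -{2}[ek]fK ft gZ scalerA mulVf// scale1r.
have gperp a : kperp a -> kperp (g a).
  move=> ka; rewrite /kperp /= -f3 ft gK etaZl (_ : eta ek a = 0) ?mulr0//.
split=> //; first by exists f.
- by exists t^-1.
- by move=> w w' kw kw'; rewrite -[in RHS](gK w) -[in RHS](gK w') f2//; exact: gperp.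
- by move=> z; rewrite gk etaZl -f3 gK ft etaZl mulrA mulVf ?mul1r.
Qed.

End Minkowski.

(** * The quadruple pulled back by an adapted map *)

Section Quadruples.
Context {R : realType} {m : nat} {V : lmodType R}.
Local Notation E := 'rV[R]_m.+2.
Local Notation ek := (ek R m).
Local Notation el := (el R m).
Local Notation em := (@em R m).
Implicit Types (bot top : set V) (kap : V -> E).

Lemma sub0 (W : set V) : Defs.subspace W -> W 0. Proof. by case. Qed.
Lemma subZ (W : set V) t v : Defs.subspace W -> W v -> W (t *: v).
Proof. by move=> [W0 WL] Wv; have := WL t v 0 Wv W0; rewrite addr0. Qed.
Lemma subD (W : set V) v w : Defs.subspace W -> W v -> W w -> W (v + w).
Proof. by move=> [W0 WL] Wv Ww; have := WL 1 v w Wv Ww; rewrite scale1r. Qed.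
Lemma subN (W : set V) v : Defs.subspace W -> W v -> W (- v).
Proof. by move=> sW Wv; rewrite -scaleN1r; exact: subZ. Qed.
Lemma subB (W : set V) v w : Defs.subspace W -> W v -> W w -> W (v - w).
Proof. by move=> sW Wv Ww; apply: subD => //; exact: subN. Qed.
Lemma sub_sum (W : set V) n (f : 'I_n -> V) : Defs.subspace W ->
  (forall i, W (f i)) -> W (\sum_i f i).
Proof.
move=> sW Wf; elim: n f Wf => [|n IH] f Wf; first by rewrite big_ord0; exact: sub0.
by rewrite big_ord_recr; apply: subD => //; exact: IH.
Qed.

Lemma clsP (W : set V) v w : Defs.subspace W -> W (v - w) <-> cls W v = cls W w.
Proof.
move=> sW; split=> [Wvw|vw].
  apply/seteqP; split=> x; rewrite /cls /= => Wx.
    by rewrite -(subrKA v); apply: subD.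
  by rewrite -(subrKA w); apply: subD => //; rewrite -opprB; exact: subN.
have : cls W v v by rewrite /cls /= subrr; exact: sub0.
by rewrite vw.
Qed.

(* kap induces a linear isomorphism of top / bot with R^n. *)
Definition adapted bot top kap :=
  [/\ Defs.subspace top, bot `<=` top,
    forall (t : R) v w, top v -> top w -> kap (t *: v + w) = t *: kap v + kap w,
    forall v, top v -> (kap v = 0 <-> bot v) &
    forall a, exists2 v, top v & kap v = a].

Section Adapted.
Context {bot top : set V} {kap : V -> E} (ad : adapted bot top kap).

Lemma adD v w : top v -> top w -> kap (v + w) = kap v + kap w.
Proof. by move=> tv tw; case: ad => _ _ L _ _; have := L 1 v w tv tw; rewrite !scale1r. Qed.
Lemma ad0 : kap 0 = 0.
Proof.
have [st _ L _ _] := ad; have t0 := sub0 st.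
by have := L (-1) 0 0 t0 t0; rewrite scaler0 addr0 scaleN1r addNr.
Qed.
Lemma adZ t v : top v -> kap (t *: v) = t *: kap v.
Proof.
move=> tv; have [st _ L _ _] := ad; have t0 := sub0 st.
by rewrite -[t *: v]addr0 L// ad0 addr0.
Qed.
Lemma adB v w : top v -> top w -> kap (v - w) = kap v - kap w.
Proof.
move=> tv tw; have [st _ _ _ _] := ad; rewrite adD//; last exact: subN.
by rewrite -scaleN1r adZ// scaleN1r.
Qed.
Lemma ad_sum n (f : 'I_n -> V) : (forall i, top (f i)) -> kap (\sum_i f i) = \sum_i kap (f i).
Proof.
have [st _ _ _ _] := ad.
elim: n f => [|n IH] f tf; first by rewrite !big_ord0 ad0.
by rewrite !big_ord_recr /= adD ?IH//; apply: sub_sum.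
Qed.
Lemma ad_eq v w : top v -> top w -> kap v = kap w <-> bot (v - w).
Proof.
move=> tv tw; have [st _ _ K _] := ad; have tvw := subB st tv tw.
rewrite -(K _ tvw) adB//; split=> [->|/eqP]; first by rewrite subrr.
by rewrite subr_eq0 => /eqP.
Qed.
Lemma ad_bot : Defs.subspace bot.
Proof.
have [st bt L K _] := ad; split; first by apply/(K _ (sub0 st)); exact: ad0.
move=> t v w bv bw; have [tv tw] := (bt _ bv, bt _ bw).
apply/(K _ (st.2 _ _ _ tv tw)); rewrite L//.
by rewrite ((K _ tv).2 bv) ((K _ tw).2 bw) scaler0 addr0.
Qed.
End Adapted.

Definition lineof top kap : set V := [set v | top v /\ exists t, kap v = t *: ek].
Definition hypof top kap : set V := [set v | top v /\ kperp (kap v)].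
Definition repof (P : set V) (W : set V) (A : set V) : V := xget 0 [set v | P v /\ A = cls W v].
(** Evaluation on chosen representatives of the two classes; the test supplies the value 0 that is
    imposed off the quotients. Independence of the choice is a matter for [Qof_form] and
    [Qof_fun]. *)
Definition quotform (P W P' W' : set V) kap (A A' : set V) : R :=
  if `[< (cls W @` P) A /\ (cls W' @` P') A' >]
  then eta (kap (repof P W A)) (kap (repof P' W' A')) else 0.

Definition Qof bot top kap : quadruple V :=
  let L := lineof top kap in let B := hypof top kap in
  Quadruple L B (quotform B L B L kap) (quotform L bot top B kap).

Lemma repofP (P W : set V) v : P v -> P (repof P W (cls W v)) /\ cls W v = cls W (repof P W (cls W v)).
Proof. by move=> Pv; rewrite /repof; case: xgetP => [x _ []//|/(_ v)]; case. Qed.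

Section QofTheory.
Context {bot top : set V} {kap : V -> E} (ad : adapted bot top kap).
Local Notation L := (lineof top kap).
Local Notation B := (hypof top kap).

Lemma line_sub : Defs.subspace L.
Proof.
have [st _ Lk _ _] := ad; split; first by split; [exact: sub0|exists 0; rewrite (ad0 ad) scale0r].
move=> t v w [tv [a va]] [tw [b wb]]; split; first exact: st.2.
by exists (t * a + b); rewrite Lk// va wb scalerA scalerDl.
Qed.
Lemma hyp_sub : Defs.subspace B.
Proof.
have [st _ Lk _ _] := ad; split.
  by split; [exact: sub0|rewrite (ad0 ad) /kperp /= eta0r].
move=> t v w [tv kv] [tw kw]; split; first exact: st.2.
by rewrite Lk//; exact: kperp_lin.
Qed.
Lemma line_hyp : L `<=` B.
Proof.
move=> v [tv [t vt]]; split=> //; rewrite vt -[t *: _]addr0.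
by apply: kperp_lin; [exact: kperp_ek|rewrite /kperp /= eta0r].
Qed.
Lemma bot_line : bot `<=` L.
Proof.
move=> v bv; have [st bt _ K _] := ad; split; first exact: bt.
by exists 0; rewrite scale0r; apply/K => //; exact: bt.
Qed.

(** Another representative changes [kap] by a multiple of k, which is orthogonal to the whole of
    k^perp, itself included. *)
Lemma Qof_form v w : B v -> B w -> qform (Qof bot top kap) (cls L v) (cls L w) = eta (kap v) (kap w).
Proof.
move=> Bv Bw; rewrite /= /quotform; case: asboolP => [_|[]]; last by split; [exists v|exists w].
have [B1 /(clsP _ _ line_sub) [t1 [s s1]]] := repofP L Bv.
have [B2 /(clsP _ _ line_sub) [t2 [r r1]]] := repofP L Bw.
set x := repof _ _ _ in B1 t1 s1 *; set y := repof _ _ _ in B2 t2 r1 *.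
have [[tv kv] [tw kw] [tx kx] [ty ky]] := And4 Bv Bw B1 B2.
rewrite (adB ad) // in s1; rewrite (adB ad) // in r1.
have -> : kap v = s *: ek + kap x by rewrite -s1 subrK.
have -> : kap w = r *: ek + kap y by rewrite -r1 subrK.
have kk : eta ek ek = 0 := kperp_ek.
rewrite /kperp /= in kx ky.
by rewrite etaDl !etaDr (etaC (kap x) ek) kx ky kk !(mulr0, add0r).
Qed.

(** On the line [kap v] is a multiple of k, so the product depends on [w] only through the
    l-coordinate of [kap w], which is constant on classes modulo the hyperplane. *)
Lemma Qof_fun v w : L v -> top w -> qfun (Qof bot top kap) (cls bot v) (cls B w) = eta (kap v) (kap w).
Proof.
move=> Lv tw; rewrite /= /quotform; case: asboolP => [_|[]]; last by split; [exists v|exists w].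
have [L1 /(clsP _ _ (ad_bot ad)) b1] := repofP bot Lv.
have [t2 /(clsP _ _ hyp_sub) [t3 k3]] := repofP B tw.
set x := repof _ _ _ in L1 b1 *; set y := repof _ _ _ in t2 t3 k3 *.
have [tv [s vs]] := Lv; have [tx _] := L1.
have -> : kap x = kap v by apply/esym/(ad_eq ad).
rewrite (adB ad)// in k3; rewrite vs !etaZl; congr (_ * _).
by move: k3; rewrite kperpE !eta_ek !mxE => /eqP; rewrite subr_eq0 => /eqP.
Qed.

Lemma Qof_is_quadruple : is_quadruple bot top (Qof bot top kap).
Proof.
have [st bt Lk K S] := ad; split.
- by split; [exact: line_sub|exact: hyp_sub|exact: line_hyp].
- split; first exact: bot_line.
  have [v tv vk] := S ek; exists v; split.
  + by split=> //; exists 1; rewrite scale1r.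
  + move=> /(K _ tv).2; rewrite vk => /rowP/(_ 0); rewrite !mxE eqxx => /eqP; rewrite oner_eq0//.
  + move=> w [tw [t wt]]; exists t; apply/(ad_eq ad) => //; first exact: subZ.
    by rewrite wt (adZ ad)// vk.
- split; first by move=> v [].
  have [v tv vl] := S el; exists v; split=> //.
  + by move=> [_ /kperpE]; rewrite vl elE eqxx => /eqP; rewrite oner_eq0.
  + move=> w tw; exists (kap w 0 1); split; first by apply: subB => //; exact: subZ.
    by rewrite (adB ad)// ?(adZ ad)//; [rewrite vl kperpE !mxE eqxx mulr1 subrr|exact: subZ].
- split.
  + by move=> A A' n; rewrite /= /quotform; case: asboolP.
  + move=> t v v' w Bv Bv' Bw; rewrite !Qof_form//; last exact: hyp_sub.2.
    by rewrite Lk ?etaDl//; [case: Bv|case: Bv'].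
  + by move=> v w Bv Bw; rewrite !Qof_form// etaC.
  + move=> v Bv nL; rewrite Qof_form//; apply: eta_pos; first by case: Bv.
    by move=> t vt; apply: nL; split; [case: Bv|exists t].
- split.
  + by move=> A A' n; rewrite /= /quotform; case: asboolP.
  + move=> t v v' w Lv Lv' tw; rewrite !Qof_fun//; last exact: line_sub.2.
    by rewrite Lk ?etaDl//; [case: Lv|case: Lv'].
  + move=> t v w w' Lv tw tw'; rewrite !Qof_fun//; last exact: st.2.
    by rewrite Lk ?etaDr.
  + have [v tv vk] := S ek; have [w tw wl] := S el.
    have Lv : L v by split=> //; exists 1; rewrite scale1r.
    exists v, w; split=> //; rewrite Qof_fun// vk wl eta_ek elE eqxx.
    by move=> /eqP; rewrite oner_eq0.
Qed.

End QofTheory.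

Lemma quadruple_ext bot top (Q Q' : quadruple V) :
  is_quadruple bot top Q -> is_quadruple bot top Q' ->
  qline Q = qline Q' -> qhyp Q = qhyp Q' ->
  (forall v w, qhyp Q v -> qhyp Q w ->
    qform Q (cls (qline Q) v) (cls (qline Q) w) = qform Q' (cls (qline Q) v) (cls (qline Q) w)) ->
  (forall v w, qline Q v -> top w ->
    qfun Q (cls bot v) (cls (qhyp Q) w) = qfun Q' (cls bot v) (cls (qhyp Q) w)) ->
  Q = Q'.
Proof.
case: Q Q' => L B g f [L' B' g' f'] /=.
move=> [_ _ _ [/= g0 _ _ _] [/= f0 _ _ _]] [_ _ _ [/= g0' _ _ _] [/= f0' _ _ _]] /= LL BB.
subst L' B' => gE fE; congr Quadruple; apply/funext => A; apply/funext => A'.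
  have [[[v Bv <-] [w Bw <-]]|n] := pselect ((cls L @` B) A /\ (cls L @` B) A').
    exact: gE.
  by rewrite g0// g0'.
have [[[v Lv <-] [w tw <-]]|n] := pselect ((cls bot @` L) A /\ (cls B @` top) A').
  exact: fE.
by rewrite f0// f0'.
Qed.

Section Transition.
Context {bot top : set V} {kap kap' : V -> E}
  (ad : adapted bot top kap) (ad' : adapted bot top kap').

Let lift (k : V -> E) (a : E) : V := xget (0 : V) [set v | top v /\ k v = a].
Let liftP (k : V -> E) (a : E) : adapted bot top k -> top (lift k a) /\ k (lift k a) = a.
Proof.
move=> [_ _ _ _ S]; have [v tv va] := S a.
by rewrite /lift; case: xgetP => [x _ []//|/(_ v)]; case.
Qed.

(** Both maps have kernel [bot] and are onto, so [kap'] factors through [kap] by a bijection [f].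
    The three hypotheses, read on lifts of vectors of R^n, are the three conditions defining GN. *)
Lemma transition_GN :
  (forall v, lineof top kap v -> lineof top kap' v) ->
  (forall v w, hypof top kap v -> hypof top kap w ->
    eta (kap' v) (kap' w) = eta (kap v) (kap w)) ->
  (forall v w, lineof top kap v -> top w -> eta (kap' v) (kap' w) = eta (kap v) (kap w)) ->
  exists2 f, @GN R m f & forall v, top v -> kap' v = f (kap v).
Proof.
move=> H1 H2 H3; pose f a := kap' (lift kap a); pose g a := kap (lift kap' a).
have fE v : top v -> kap' v = f (kap v).
  move=> tv; have [tl kl] := liftP (kap v) ad.
  by apply/(ad_eq ad') => //; apply/(ad_eq ad).
have gE v : top v -> kap v = g (kap' v).
  move=> tv; have [tl kl] := liftP (kap' v) ad'.
  by apply/(ad_eq ad) => //; apply/(ad_eq ad').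
exists f => //; have [st _ Lk _ S] := ad; have [_ _ Lk' _ S'] := ad'; split.
- move=> t a b; have [v tv <-] := S a; have [w tw <-] := S b.
  by rewrite -Lk// -!fE ?Lk'//; exact: st.2.
- exists g => a; first by have [v tv <-] := S a; rewrite -fE// -gE.
  by have [v tv <-] := S' a; rewrite -gE// -fE.
- have [v tv vk] := S ek; have [|_ [t vt]] := H1 v.
    by split=> //; exists 1; rewrite scale1r.
  by exists t; rewrite -vt -vk fE.
- move=> a b; have [v tv <-] := S a; have [w tw <-] := S b => ka kb.
  by rewrite -!fE// H2.
- move=> z; have [v tv vk] := S ek; have [w tw <-] := S z.
  rewrite -vk -!fE// H3//; split=> //; exists 1; rewrite vk scale1r.
  by [].
Qed.

Lemma Qof_transition : Qof bot top kap = Qof bot top kap' ->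
  exists2 f, @GN R m f & forall v, top v -> kap' v = f (kap v).
Proof.
move=> QQ; have LL : lineof top kap = lineof top kap' := congr1 (@qline _ _) QQ.
have BB : hypof top kap = hypof top kap' := congr1 (@qhyp _ _) QQ.
apply: transition_GN.
- by rewrite LL.
- move=> v w Bv Bw; rewrite -(Qof_form ad)// QQ LL (Qof_form ad')//; by rewrite -BB.
- move=> v w Lv tw; rewrite -(Qof_fun ad)// QQ BB (Qof_fun ad')//; by rewrite -LL.
Qed.

End Transition.

(** Elements of GN and their inverses preserve the line of k, its orthogonal and the two
    restrictions of eta from which the quadruple is built. *)
Lemma GN_Qof bot top kap kap' f : adapted bot top kap -> @GN R m f ->
  (forall v, top v -> kap' v = f (kap v)) ->
  adapted bot top kap' /\ Qof bot top kap' = Qof bot top kap.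
Proof.
move=> ad Gf fE; have [fl fb [t ft] f2 f3] := Gf; have [g fK gK] := fb.
have Gg := GN_inv Gf fK gK; have [st bt Lk K S] := ad.
have f0 : f 0 = 0 by exact: (is_linear0 fl).
have fZ r a : f (r *: a) = r *: f a by rewrite -[r *: a]addr0 fl f0 addr0.
have ad' : adapted bot top kap'.
  split=> //.
  - by move=> r v w tv tw; rewrite !fE ?Lk//; exact: st.2.
  - move=> v tv; rewrite -(K _ tv) fE//; split=> [|->//].
    by move=> /(congr1 g); rewrite fK (_ : g 0 = 0)// -{1}f0 fK.
  - by move=> a; have [v tv vg] := S (g a); exists v => //; rewrite fE// vg gK.
split=> //.
have LL' : lineof top kap' = lineof top kap.
  apply/seteqP; split=> v [tv [s vs]]; split=> //.
    have [_ _ [s' gs'] _ _] := Gg; have gl : is_linear g by case: Gg.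
    exists (s * s'); rewrite -[kap v]fK -fE// vs -[s *: ek]addr0 gl gs' scalerA.
    by rewrite (_ : g 0 = 0) ?addr0// -f0 fK.
  by exists (s * t); rewrite fE// vs fZ ft scalerA.
have BB' : hypof top kap' = hypof top kap.
  apply/seteqP; split=> v [tv kv]; split=> //.
    by rewrite -[kap v]fK -fE//; exact: GN_kperp Gg kv.
  by rewrite fE//; exact: GN_kperp Gf kv.
apply: (quadruple_ext (Qof_is_quadruple ad') (Qof_is_quadruple ad) LL' BB').
  move=> v w Bv Bw; rewrite [LHS](Qof_form ad' Bv Bw).
  have [Bv' Bw'] : hypof top kap' v /\ hypof top kap' w by [].
  move: Bv' Bw'; rewrite BB' => {}Bv {}Bw; change (qline _) with (lineof top kap'); rewrite LL' (Qof_form ad Bv Bw).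
  have [[tv kv] [tw kw]] := conj Bv Bw; by rewrite !fE// f2.
move=> v w Lv tw; rewrite [LHS](Qof_fun ad' Lv tw).
have Lv' : lineof top kap' v by []. move: Lv'; rewrite LL' => {}Lv.
change (qhyp _) with (hypof top kap'); rewrite BB' (Qof_fun ad Lv tw).
have [tv [s vs]] := Lv.
by rewrite !fE// vs fZ !etaZl f3.
Qed.

End Quadruples.

(** * Every quadruple is pulled back by an adapted map *)

Section Complete.
Context {R : realType} {m : nat} {V : lmodType R}.
Local Notation E := 'rV[R]_m.+2.
Local Notation ek := (ek R m).
Local Notation el := (el R m).
Local Notation em := (@em R m).
Implicit Types (bot top : set V) (kap : V -> E).

Lemma codim1_gen (W B : set V) v w : Defs.subspace W -> codim1 W B -> B v -> ~ W v ->
  B w -> exists t : R, W (w - t *: v).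
Proof.
move=> sW [WB [v0 [Bv0 nWv0 gen]]] Bv nWv Bw.
have [s Ws] := gen _ Bv; have [t Wt] := gen _ Bw.
have s0 : s != 0 by apply/eqP => s0; apply: nWv; rewrite s0 scale0r subr0 in Ws.
exists (t / s); rewrite (_ : w - _ = (w - t *: v0) - (t / s) *: (v - s *: v0)).
  by apply: subB => //; exact: subZ.
rewrite scalerBr scalerA mulfVK// opprB addrA; congr (_ - _).
by rewrite subrK.
Qed.

Section WithQ.
Context {bot top : set V} {kap : V -> E} {Q : quadruple V}
  (ad : adapted bot top kap) (qQ : is_quadruple bot top Q).
Local Notation L := (qline Q).
Local Notation B := (qhyp Q).
Local Notation F v w := (qform Q (cls L v) (cls L w)).
Local Notation G v w := (qfun Q (cls bot v) (cls B w)).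

Lemma q_line_sub : Defs.subspace L. Proof. by case: qQ => -[]. Qed.
Lemma q_hyp_sub : Defs.subspace B. Proof. by case: qQ => -[]. Qed.
Lemma q_line_hyp v : L v -> B v. Proof. by case: qQ => -[_ _ H] *; exact: H. Qed.
Lemma q_bot_line v : bot v -> L v. Proof. by case: qQ => _ [H _] *; exact: H. Qed.
Lemma q_hyp_top v : B v -> top v. Proof. by case: qQ => _ _ [H _] *; exact: H. Qed.

Lemma F_lin (t : R) v v' w : B v -> B v' -> B w -> F (t *: v + v') w = t * F v w + F v' w.
Proof. by case: qQ => _ _ _ [_ H _ _] _; exact: H. Qed.
Lemma F_sym v w : B v -> B w -> F v w = F w v.
Proof. by case: qQ => _ _ _ [_ _ H _] _; exact: H. Qed.
Lemma F_0l w : B w -> F 0 w = 0.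
Proof.
move=> Bw; have B0 := sub0 q_hyp_sub; have := F_lin (-1) B0 B0 Bw.
by rewrite scaler0 addr0 mulN1r addNr.
Qed.
Lemma F_line v w : L v -> B w -> F v w = 0.
Proof.
move=> Lv Bw; have -> : cls L v = cls L 0; last exact: F_0l.
by apply/(clsP _ _ q_line_sub); rewrite subr0.
Qed.
Lemma F_Z t v w : B v -> B w -> F (t *: v) w = t * F v w.
Proof. by move=> Bv Bw; rewrite -[t *: v]addr0 F_lin//; [rewrite F_0l// addr0|exact: sub0 q_hyp_sub]. Qed.
Lemma F_D v v' w : B v -> B v' -> B w -> F (v + v') w = F v w + F v' w.
Proof. by move=> Bv Bv' Bw; have := F_lin 1 Bv Bv' Bw; rewrite scale1r mul1r. Qed.
Lemma F_sum n (f : 'I_n -> V) w : (forall i, B (f i)) -> B w -> F (\sum_i f i) w = \sum_i F (f i) w.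
Proof.
move=> Bf Bw; elim: n f Bf => [|n IH] f Bf; first by rewrite !big_ord0 F_0l.
by rewrite !big_ord_recr /= F_D ?IH//; apply: sub_sum => //; exact: q_hyp_sub.
Qed.
Lemma F_pos v : B v -> ~ L v -> 0 < F v v.
Proof. by case: qQ => _ _ _ [_ _ _ H] _; exact: H. Qed.

Lemma G_linl (t : R) v v' w : L v -> L v' -> top w -> G (t *: v + v') w = t * G v w + G v' w.
Proof. by case: qQ => _ _ _ _ [_ H _ _]; exact: H. Qed.
Lemma G_linr (t : R) v w w' : L v -> top w -> top w' -> G v (t *: w + w') = t * G v w + G v w'.
Proof. by case: qQ => _ _ _ _ [_ _ H _]; exact: H. Qed.
Lemma G_bot v w : bot v -> top w -> G v w = 0.
Proof.
move=> bv tw; have -> : cls bot v = cls bot 0 by apply/(clsP _ _ (ad_bot ad)); rewrite subr0.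
have L0 := sub0 q_line_sub; have := G_linl (-1) L0 L0 tw.
by rewrite scaler0 addr0 mulN1r addNr.
Qed.
Lemma G_hyp v w : L v -> B w -> G v w = 0.
Proof.
move=> Lv Bw; have -> : cls B w = cls B 0 by apply/(clsP _ _ q_hyp_sub); rewrite subr0.
have [st _ _ _ _] := ad; have t0 := sub0 st; have := G_linr (-1) Lv t0 t0.
by rewrite scaler0 addr0 mulN1r addNr.
Qed.

Definition orthonormal r (z : 'I_r -> V) :=
  (forall i, B (z i)) /\ forall i j, F (z i) (z j) = (i == j)%:R.

Lemma q_top_sub : Defs.subspace top. Proof. by case: ad. Qed.

(** A pair on which the functional does not vanish, the second vector rescaled: the future preimages
    of k and l. *)
Lemma xy_exist : exists x y, [/\ L x, top y & G x y = 1].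
Proof.
case: qQ => _ _ _ _ [_ _ _ [v [w [Lv tw /eqP Gn]]]].
exists v, ((G v w)^-1 *: w); split=> //; first exact: (subZ _ q_top_sub).
rewrite -[_ *: w]addr0 G_linr//; last exact: sub0 q_top_sub.
by rewrite (G_hyp Lv (sub0 q_hyp_sub)) addr0 mulVf.
Qed.

Section Comb.
Context {r : nat} (x y : V) (z : 'I_r -> V) (Lx : L x) (ty : top y) (Gxy : G x y = 1)
  (oz : orthonormal z).
Definition comb (b : 'rV[R]_r.+2) : V :=
  b 0 0 *: x + (b 0 1 *: y + \sum_i b 0 (mx2 i) *: z i).

Lemma x_bot : ~ bot x.
Proof. by move=> bx; move: Gxy; rewrite G_bot// => /eqP; rewrite eq_sym oner_eq0. Qed.
Lemma y_hyp : ~ B y.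
Proof. by move=> By; move: Gxy; rewrite G_hyp// => /eqP; rewrite eq_sym oner_eq0. Qed.

Lemma zsum_hyp b : B (\sum_i b i *: z i).
Proof. by apply: (sub_sum q_hyp_sub) => i; apply: (subZ _ q_hyp_sub); exact: oz.1. Qed.
Lemma zsum_F b j : F (\sum_i b i *: z i) (z j) = b j.
Proof.
have [Bz zz] := oz; rewrite F_sum//; last by move=> i; exact: (subZ _ q_hyp_sub).
rewrite (bigD1 j)//= F_Z// zz eqxx mulr1 big1 ?addr0// => i ij.
by rewrite F_Z// zz (negPf ij) mulr0.
Qed.
Lemma zsum_FF b c : F (\sum_i b i *: z i) (\sum_i c i *: z i) = \sum_i b i * c i.
Proof.
have [Bz zz] := oz; rewrite F_sum//; last exact: zsum_hyp.
  apply: eq_bigr => i _; rewrite F_Z//; last exact: zsum_hyp.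
  by rewrite F_sym//; [rewrite zsum_F|exact: zsum_hyp].
by move=> i; exact: (subZ _ q_hyp_sub).
Qed.

Lemma comb_top b : top (comb b).
Proof.
have st := q_top_sub; apply: (subD st); first by apply: (subZ _ st); exact/q_hyp_top/q_line_hyp.
by apply: (subD st); [exact: (subZ _ st)|exact/q_hyp_top/zsum_hyp].
Qed.

Lemma comb_hyp b : B (comb b) <-> b 0 1 = 0.
Proof.
have sB := q_hyp_sub; have Bx := q_line_hyp Lx.
split=> [Bb|b1]; last first.
  rewrite /comb b1 scale0r add0r; apply: (subD sB); first exact: (subZ _ sB).
  exact: zsum_hyp.
apply/eqP/negP => /negP b1; apply: y_hyp.
have : B (b 0 1 *: y).
  rewrite (_ : b 0 1 *: y = comb b - b 0 0 *: x - \sum_i b 0 (mx2 i) *: z i).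
    by apply: (subB sB); [apply: (subB sB) => //; exact: (subZ _ sB)|exact: zsum_hyp].
  by rewrite /comb [X in X - _ - _]addrC !addrK.
by move=> /(subZ (b 0 1)^-1 sB); rewrite scalerA mulVf// scale1r.
Qed.

Lemma comb_inj b : bot (comb b) -> b = 0.
Proof.
move=> bb; have sB := q_hyp_sub; have sL := q_line_sub; have Bx := q_line_hyp Lx.
have Lb := q_bot_line bb; have b1 : b 0 1 = 0 by apply/comb_hyp; exact: q_line_hyp.
have bi i : b 0 (mx2 i) = 0.
  rewrite -(zsum_F (fun i => b 0 (mx2 i)) i) F_line//; last exact: oz.1.
  rewrite (_ : \sum_i _ = comb b - b 0 0 *: x); last by rewrite /comb b1 scale0r add0r addrC addKr.
  by apply: (subB sL) => //; exact: (subZ _ sL).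
have cb : comb b = b 0 0 *: x.
  by rewrite /comb b1 scale0r add0r big1 ?addr0// => i _; rewrite bi scale0r.
apply: rV_ext; rewrite ?mxE//; last by move=> i; rewrite mxE.
apply/eqP/negP => /negP b0; apply: x_bot.
have := subZ (b 0 0)^-1 (ad_bot ad) bb; by rewrite cb scalerA mulVf// scale1r.
Qed.

(** The rows are the images of [x], [y] and the [z i], so this is the matrix of [comb] followed by
    [kap]. *)
Definition combmx : 'M[R]_(r.+2, m.+2) := \matrix_j
  (if unlift 0 j is Some j' then if unlift 0 j' is Some i then kap (z i) else kap y else kap x).

Lemma kap_comb b : kap (comb b) = b *m combmx.
Proof.
have st := q_top_sub; have tx := q_hyp_top (q_line_hyp Lx).
have tz i : top (z i) by apply: q_hyp_top; exact: oz.1.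
have e0 : row 0 combmx = kap x by rewrite rowK unlift_none.
have e1 : row 1 combmx = kap y.
  by rewrite rowK (_ : 1 = lift ord0 ord0); [rewrite liftK unlift_none|exact: val_inj].
have ei i : row (mx2 i) combmx = kap (z i) by rewrite rowK /mx2 !liftK.
rewrite mulmx_sum_row sum_ord2 e0 e1 -addrA /comb.
rewrite (adD ad) ?(adD ad) ?(adZ ad) ?(ad_sum ad)//.
- congr (_ + (_ + _)); apply: eq_bigr => i _; by rewrite (adZ ad)// ei.
- by move=> i; exact: (subZ _ st).
- exact: (subZ _ st).
- by apply: (sub_sum st) => i; exact: (subZ _ st).
- exact: (subZ _ st).
- by apply: (subD st); [exact: (subZ _ st)|apply: (sub_sum st) => i; exact: (subZ _ st)].
Qed.

Lemma combmx_free : row_free combmx.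
Proof.
apply: inj_row_free => b; rewrite -kap_comb => k0; apply: comb_inj.
by have [_ _ _ K _] := ad; apply/K => //; exact: comb_top.
Qed.

(** Together with [x] and [y], an orthonormal family is independent modulo [bot], so its [r + 2]
    images are independent in a space of dimension [m + 2]. *)
Lemma orthonormal_bound : (r <= m)%N.
Proof. by have := rank_leq_col combmx; rewrite (eqP combmx_free). Qed.

Hypothesis rmax : forall w : 'I_r.+1 -> V, ~ orthonormal w.

(** A Gram-Schmidt step: a remainder outside the line would have positive square, and after
    normalization it would extend the family beyond its maximal size. *)
Lemma hyp_comb v : B v -> L (v - \sum_i F v (z i) *: z i).
Proof.
move=> Bv; have [Bz zz] := oz; have sB := q_hyp_sub.
set v' := v - _; have Bv' : B v' by apply: (subB sB) => //; exact: zsum_hyp.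
apply: contrapT => nL; have p := F_pos Bv' nL.
have o j : F v' (z j) = 0.
  rewrite /v' -scaleN1r F_D ?F_Z//; [|exact: zsum_hyp|by apply: (subZ _ sB); exact: zsum_hyp].
  by rewrite zsum_F mulN1r subrr.
pose s := (Num.sqrt (F v' v'))^-1; pose w0 := s *: v'.
have Bw0 : B w0 by exact: (subZ _ sB).
have w00 : F w0 w0 = 1.
  rewrite F_Z// F_sym// F_Z// mulrA -expr2 exprVn sqr_sqrtr; last exact: ltW.
  by rewrite mulVf// gt_eqF.
have w0z j : F w0 (z j) = 0 by rewrite F_Z// o mulr0.
apply: (rmax (w := fun i => if unlift ord0 i is Some j then z j else w0)); split.
  by move=> i; case: unliftP => [j|] _.
move=> i j; case: (unliftP ord0 i) => [i'|] ->; case: (unliftP ord0 j) => [j'|] ->.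
- by rewrite zz (inj_eq (@lift_inj _ _)).
- by rewrite F_sym// w0z.
- by rewrite w0z.
- by rewrite w00 eqxx.
Qed.

Lemma comb_surj v : top v -> exists b, bot (v - comb b).
Proof.
move=> tv; have [_ cL cB _ _] := qQ; have sB := q_hyp_sub.
have [b1 B1] := codim1_gen sB cB ty y_hyp tv.
have [b0 B0] := codim1_gen (ad_bot ad) cL Lx x_bot (hyp_comb B1).
exists (\row_j if unlift 0 j is Some j' then if unlift 0 j' is Some i then F (v - b1 *: y) (z i) else b1 else b0).
rewrite /comb !mxE unlift_none (_ : unlift 0 1 = Some ord0); last first.
  by rewrite (_ : 1 = lift ord0 ord0); [rewrite liftK|exact: val_inj].
rewrite unlift_none; under eq_bigr do rewrite mxE /mx2 !liftK.
by move: B0; rewrite !opprD !addrA -!addrA; congr (bot (_ + _)); rewrite !addrA addrC !addrA.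
Qed.

Lemma combmx_full : row_full combmx.
Proof.
rewrite -sub1mx; apply/row_subP => i; have [_ _ _ _ S] := ad.
have [v tv <-] := S (row i 1%:M); have [b bb] := comb_surj tv.
have -> : kap v = b *m combmx.
  by rewrite -kap_comb; apply/(ad_eq ad) => //; exact: comb_top.
exact: submxMl.
Qed.

Lemma orthonormal_card : r = m.
Proof. by have := combmx_full; rewrite /row_full (eqP combmx_free) => /eqP []. Qed.

End Comb.
End WithQ.
End Complete.

Section Qof_complete.
Context {R : realType} {m : nat} {V : lmodType R}.
Local Notation E := 'rV[R]_m.+2.
Local Notation ek := (ek R m).

(** An orthonormal family of maximal size has exactly [m] members. The corresponding matrix [U] is
    then square and invertible, and [kap0] followed by its inverse sends [x], [y], [z i] to k, l,
    m_i; a quadruple is determined by its values on these vectors. *)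
Lemma Qof_complete (bot top : set V) (kap0 : V -> E) (Q : quadruple V) :
  adapted bot top kap0 -> is_quadruple bot top Q ->
  exists kap : V -> E, adapted bot top kap /\ Q = Qof bot top kap.
Proof.
move=> ad qQ; have [x [y [Lx ty Gxy]]] := xy_exist ad qQ.
pose P r := `[< exists z : 'I_r -> V, @orthonormal _ _ Q r z >].
have P0 : exists r, P r.
  by exists 0; apply/asboolP; exists (fun=> 0); split=> -[].
have Pm r : P r -> (r <= m)%N.
  by move=> /asboolP[z oz]; exact: (orthonormal_bound ad qQ Lx ty Gxy oz).
have [r /asboolP [z oz] rmax] := ex_maxnP P0 Pm.
have rmax' : forall w : 'I_r.+1 -> V, ~ @orthonormal _ _ Q _ w.
  move=> w ow; have Pr : P r.+1 by apply/asboolP; exists w.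
  by have := rmax _ Pr; rewrite ltnn.
have rm := orthonormal_card ad qQ Lx ty Gxy oz rmax'.
subst r; pose U := combmx x y z (kap := kap0); have Uu : U \in unitmx.
  by rewrite -row_free_unit; exact: (combmx_free ad qQ Lx ty Gxy oz).
have [st bt Lk K S] := ad; pose kap v := kap0 v *m invmx U.
have ad' : adapted bot top kap.
  split=> //.
  - by move=> t v w tv tw; rewrite /kap Lk// mulmxDl scalemxAl.
  - move=> v tv; rewrite -(K _ tv) /kap; split=> [/(congr1 (mulmx^~ U))|->]; last by rewrite mul0mx.
    by rewrite mulmxKV// mul0mx.
  - by move=> a; have [v tv va] := S (a *m U); exists v => //; rewrite /kap va mulmxK.
have kc b : kap (comb x y z b) = b.
  by rewrite /kap (kap_comb ad qQ Lx ty oz) mulmxK.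
have tc b := comb_top ad qQ Lx ty oz b.
have dec v : top v -> bot (v - comb x y z (kap v)).
  by move=> tv; apply/(ad_eq ad') => //; rewrite kc.
have sL := q_line_sub qQ; have sB := q_hyp_sub qQ.
have tx := q_hyp_top qQ (q_line_hyp qQ Lx).
have kx : kap x = ek.
  rewrite -(kc ek); congr kap; rewrite /comb !ekE eqxx scale1r scale0r add0r big1 ?addr0// => i _.
  by rewrite ekE mx2_0 scale0r.
have lineE v : qline Q v <-> top v /\ exists t, kap v = t *: ek.
  split=> [Lv|[tv [t vt]]].
    have tv := q_hyp_top qQ (q_line_hyp qQ Lv); split=> //.
    have [_ cL _ _ _] := qQ; have [t bt'] := codim1_gen (ad_bot ad) cL Lx (x_bot ad qQ ty Gxy) Lv.
    exists t; rewrite -kx -(adZ ad')//; apply/(ad_eq ad') => //; exact: (subZ _ st).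
  have : bot (v - t *: x).
    by apply/(ad_eq ad') => //; [exact: (subZ _ st)|rewrite (adZ ad')// kx].
  move=> /(q_bot_line qQ) LL; rewrite -(subrK (t *: x) v).
  by apply: (subD sL) => //; exact: (subZ _ sL).
have hypE v : top v -> (qhyp Q v <-> kap v 0 1 = 0).
  move=> tv; rewrite -(comb_hyp ad qQ Lx Gxy oz).
  have Bd := q_line_hyp qQ (q_bot_line qQ (dec v tv)); split=> Bv.
    by rewrite -[comb _ _ _ _](subKr v); apply: (subB sB).
  by rewrite -[v](subrK (comb x y z (kap v))); apply: (subD sB).
have LE : qline Q = lineof top kap by apply/seteqP; split=> v /lineE.
have BE : qhyp Q = hypof top kap.
  apply/seteqP; split=> v.
    by move=> Bv; have tv := q_hyp_top qQ Bv; split=> //; apply/kperpE/hypE.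
  by move=> [tv /kperpE kv]; apply/hypE.
exists kap; split=> //.
apply: (quadruple_ext qQ (Qof_is_quadruple ad') LE BE).
- move=> v w Bv Bw; have [tv tw] := (q_hyp_top qQ Bv, q_hyp_top qQ Bw).
  have v1 := (hypE v tv).1 Bv; have w1 := (hypE w tw).1 Bw.
  rewrite LE (Qof_form ad'); [|by rewrite -BE..].
  rewrite -LE (_ : cls _ v = cls (qline Q) (comb x y z (kap v))); last first.
    by apply/(clsP _ _ sL)/(q_bot_line qQ)/dec.
  rewrite (_ : cls _ w = cls (qline Q) (comb x y z (kap w))); last first.
    by apply/(clsP _ _ sL)/(q_bot_line qQ)/dec.
  rewrite eta_kperp ?kperpE// /comb v1 w1 !scale0r !add0r.
  have Bx := q_line_hyp qQ Lx; have Bs b := zsum_hyp qQ oz b.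
  have Bxs t b : qhyp Q (t *: x + \sum_i b i *: z i) by apply: sB.2.
  have Ls t : qline Q (t *: x) by exact: (subZ _ sL).
  rewrite (F_lin qQ)// (F_line qQ Lx)// mulr0 add0r (F_sym qQ)// (F_lin qQ)//.
  rewrite (F_line qQ Lx)// mulr0 add0r (zsum_FF qQ oz).
  by apply: eq_bigr => i _; rewrite mulrC.
- move=> v w Lv tw; have [tv [t vt]] := (lineE v).1 Lv.
  rewrite BE (Qof_fun ad')//; last by rewrite -LE.
  rewrite -BE vt etaZl eta_ek.
  rewrite (_ : cls bot v = cls bot (t *: x)); last first.
    apply/(clsP _ _ (ad_bot ad)); apply/(ad_eq ad') => //; first exact: (subZ _ st).
    by rewrite (adZ ad')// kx.
  have L0 := sub0 sL; rewrite -[t *: x]addr0 (G_linl qQ)//.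
  rewrite (G_bot ad qQ (v := 0))//; last exact: sub0 (ad_bot ad).
  rewrite addr0; congr (_ * _).
  have ky : kap y 0 1 = 1.
    rewrite -[y](_ : comb x y z (el R m) = y) ?kc ?elE ?eqxx//.
    rewrite /comb !elE eqxx scale1r scale0r add0r big1 ?addr0// => i _.
    by rewrite elE mx2_1 scale0r.
  have By : qhyp Q (w - kap w 0 1 *: y).
    apply/hypE; first by apply: (subB st) => //; exact: (subZ _ st).
    rewrite (adB ad')//; last exact: (subZ _ st).
    have kB (a b : E) (t' : R) : (a - t' *: b) 0 1 = a 0 1 - t' * b 0 1 by rewrite !mxE.
    by rewrite (adZ ad')// kB ky mulr1 subrr.
  rewrite -{1}(subrK (kap w 0 1 *: y) w) addrC (G_linr qQ)//; last exact: (q_hyp_top qQ).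
  by rewrite Gxy mulr1 (G_hyp ad qQ)// addr0.
Qed.

End Qof_complete.

(** * Frames and the quadruples they define *)

Section Frames.
Context {R : realType} {m : nat} {V : lmodType R}.
Local Notation E := 'rV[R]_m.+2.
Local Notation ek := (ek R m).
Local Notation el := (el R m).
Local Notation em := (@em R m).

(** The inverse of the frame [u] on its image, with value 0 elsewhere. *)
Definition coframe (u : E -> V) (v : V) : E := xget 0 [set a | u a = v].

Section OneFrame.
Context {u : E -> V} {top : set V} (ul : is_linear u) (ui : injective u) (ut : u @` setT = top).

Lemma coframeK a : coframe u (u a) = a.
Proof. by rewrite /coframe; case: xgetP => [x _ /ui//|/(_ a) []]. Qed.

Lemma coframe_adapted : adapted [set 0] top (coframe u).
Proof.
have u0 : u 0 = 0 by exact: (is_linear0 ul).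
rewrite -ut; split.
- split; first by exists 0.
  by move=> t _ _ [a _ <-] [b _ <-]; exists (t *: a + b).
- by move=> _ ->; exists 0.
- by move=> t _ _ [a _ <-] [b _ <-]; rewrite -ul !coframeK.
- move=> _ [a _ <-]; rewrite coframeK; split=> [->//|/= ua].
  by apply: ui; rewrite u0.
- by move=> a; exists (u a); [exists a|exact: coframeK].
Qed.

(** The classes of the [u m_i] span the hyperplane modulo the line, and the classes of [u k] and
    [u l] span the other two quotients, so the normalizations at one frame leave no freedom in the
    form and the functional. *)
Lemma Qof_coframeP (N : quadruple V) :
  N = Qof [set 0] top (coframe u) <->
  is_quadruple [set 0] top N /\
      [/\ qline N = [set u (t *: ek) | t in setT],
          qhyp N = u @` @kperp R m,
          forall i j : 'I_m,
            qform N (cls (qline N) (u (em i)))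
                        (cls (qline N) (u (em j))) = (i == j)%:R &
          qfun N (cls [set 0] (u ek)) (cls (qhyp N) (u el))
          = 1].
Proof.
have ad := coframe_adapted.
have tu a : top (u a) by rewrite -ut; exists a.
have LE : lineof top (coframe u) = [set u (t *: ek) | t in setT].
  apply/seteqP; split=> v /=.
    by move=> []; rewrite -ut => -[a _ <-] [t]; rewrite coframeK => ->; exists t.
  by move=> [t _ <-]; split=> //; exists t; rewrite coframeK.
have BE : hypof top (coframe u) = u @` @kperp R m.
  apply/seteqP; split=> v /=.
    by move=> []; rewrite -ut => -[a _ <-]; rewrite coframeK => ka; exists a.
  by move=> [a ka <-]; split=> //; rewrite coframeK.
have hu a : kperp a -> hypof top (coframe u) (u a) by rewrite BE => ka; exists a.
have lu t : lineof top (coframe u) (u (t *: ek)) by rewrite LE; exists t.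
have lu1 : lineof top (coframe u) (u ek) by rewrite -[ek]scale1r.
split=> [->|[qN [L1 B1 f1 g1]]].
  split; first exact: Qof_is_quadruple.
  split=> //.
    move=> i j; rewrite [LHS](Qof_form ad); [|exact/hu/kperp_em..].
    by rewrite !coframeK eta_em emE mx2_eq eq_sym.
  by rewrite [LHS](Qof_fun ad)// !coframeK eta_ek elE.
have u0 : u 0 = 0 by exact: (is_linear0 ul).
have uD a b : u (a + b) = u a + u b by rewrite -[a]scale1r ul !scale1r.
have uZ t a : u (t *: a) = t *: u a by rewrite -[t *: a]addr0 ul u0 addr0.
have uS n (f : 'I_n -> E) : u (\sum_i f i) = \sum_i u (f i).
  elim: n f => [|n IH] f; first by rewrite !big_ord0.
  by rewrite !big_ord_recr /= uD IH.
have sL := q_line_sub qN; have sB := q_hyp_sub qN.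
have Lk : qline N (u ek) by rewrite L1; exists 1; rewrite ?scale1r.
apply: (quadruple_ext qN (Qof_is_quadruple ad)).
- by rewrite L1 -LE.
- by rewrite B1 -BE.
- have on : orthonormal (Q := N) (fun i => u (em i)).
    split=> // i; rewrite B1; exists (em i) => //; exact: kperp_em.
  rewrite {1 2}B1 => _ _ [a ka <-] [b kb <-].
  rewrite L1 -LE (Qof_form ad); [|exact: hu..]; rewrite LE -L1 !coframeK eta_kperp//.
  have cE c : kperp c -> cls (qline N) (u c) = cls (qline N) (\sum_i c 0 (mx2 i) *: u (em i)).
    move=> /kperpE c1; apply/(clsP _ _ sL); rewrite {1}(rV_basis c) c1 scale0r add0r uD uS.
    under eq_bigr do rewrite uZ.
    by rewrite addrK uZ; exact: (subZ _ sL).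
  by rewrite !cE// (zsum_FF qN on).
- rewrite {1}L1 => _ w [t _ <-]; rewrite -{1}ut => -[b _ <-].
  rewrite B1 -BE (Qof_fun ad)// BE -B1 !coframeK etaZl eta_ek.
  rewrite uZ -[t *: _]addr0 (G_linl qN)//; last exact: sub0 sL.
  rewrite (G_bot ad qN (v := 0))// addr0; congr (_ * _).
  have Bb : qhyp N (u (b - b 0 1 *: el)).
    by rewrite B1; exists (b - b 0 1 *: el) => //; apply/kperpE; rewrite !mxE eqxx mulr1 subrr.
  rewrite -{1}(subrK (b 0 1 *: el) b) addrC uD uZ (G_linr qN)//.
  by rewrite g1 mulr1 (G_hyp ad qN)// addr0.
Qed.

End OneFrame.

Lemma coframe_comp (u : E -> V) (f g : E -> E) v : cancel f g -> cancel g f -> injective u ->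
  (u @` setT) v -> coframe (u \o f) v = g (coframe u v).
Proof.
move=> fK gK ui [a _ <-]; rewrite (coframeK ui).
have ufi : injective (u \o f) by move=> x y /ui /(congr1 g); rewrite !fK.
by rewrite -{1}[a]gK; exact: (coframeK ufi).
Qed.

End Frames.

(** * Invariant GN-structures and quadruples *)

Section SmoothFields.
Context {R : realType} {n : nat} {T : Type} (mT : manifold R n T).

Lemma smooth_funP U f : mopen mT U -> smooth_fun mT U f <-> forall x, U x -> smooth_near mT x f.
Proof.
move=> oU; split=> [sf x Ux|sf c ac]; first by exists U.
apply: smooth_atP => y [cy Uy].
have pc := plot_cpsi ac cy.
exact: (smooth_near_plot pc (sf _ Uy)).
Qed.

Lemma smooth_vfieldP U X : mopen mT U -> smooth_vfield mT U X <->
  (forall x, U x -> tangent mT x (X x)) /\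
  forall x f, U x -> smooth_near mT x f -> smooth_near mT x (fun y => X y f).
Proof.
move=> oU; split=> -[tX sX]; split=> //.
  move=> x f Ux sf; have [V [oV Vx HV]] := smooth_near_mopen sf.
  have oW := mopenI oV oU.
  apply: ((smooth_funP _ oW).1 _ x); last by [].
  apply: sX; [exact: oW|by move=> y []|].
  by apply/(smooth_funP _ oW) => y [Vy _]; exact: HV.
move=> W f oW WU /(smooth_funP _ oW) sf; apply/(smooth_funP _ oW) => x Wx.
by apply: sX; [exact: WU|exact: sf].
Qed.

End SmoothFields.

Section Correspondence.
Context {R : realType} {N d m : nat} {K : groupType} (mK : manifold R N K)
  {H : set K} (mH : manifold R d {a : K | H a}) (mM : manifold R m.+2 (homspace H)).
Hypothesis K_lie : lie_group mK.
Hypothesis H_lie : lie_subgroup mK mH.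
Hypothesis proj_submersion : submersion mK mM (@hproj K H).
Local Notation pi := (@hproj K H).
Local Notation kk := (tangent mK (1%g : K)).
Local Notation hh := (sub_lie_algebra mK mH).
Local Notation dpi := (push mM (@hproj K H) 1%g).
Local Notation o := (hproj H (1%g : K)).
Local Notation E := 'rV[R]_m.+2.
Local Notation To := (tangent mM o).
Local Notation V := (tvec R (homspace H)).
Local Notation dL a x := (push mM (ltrans a) x).
Implicit Types (P : homspace H -> set (E -> V)) (u : E -> V).

Lemma ltrans_o a : ltrans a o = pi a. Proof. by rewrite ltrans_hproj mulg1. Qed.

Lemma dL_tangent a x v : tangent mM x v -> tangent mM (ltrans a x) (dL a x v).
Proof. by apply: push_tangent; exact: (msmooth_ltrans K_lie proj_submersion). Qed.

Lemma dLK a x v : tangent mM x v -> dL a^-1 (ltrans a x) (dL a x v) = v.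
Proof. by move=> tv; rewrite (push_ltransM K_lie proj_submersion) mulVg (push_ltrans1 tv). Qed.

Lemma dL_inj a x v w : tangent mM x v -> tangent mM x w -> dL a x v = dL a x w -> v = w.
Proof. by move=> tv tw vw; rewrite -(dLK a tv) vw dLK. Qed.

(** For [h] in H the right factor [h^-1] disappears in K/H: [pi (h b h^-1) = pi (h b)]. *)
Lemma dpi_Ad h v : H h -> kk v -> dpi (Ad mK h v) = dL h o (dpi v).
Proof.
move=> Hh kv; have sp x : msmooth mK mM pi x by exact: (hproj_smooth proj_submersion).
rewrite (push_comp _ _ (mT'' := mM)); last exact: (msmooth_ltrans K_lie proj_submersion).
have E1 : (h * 1 * h^-1 = 1)%g by rewrite mulg1 mulgV.
have := @push_comp R _ _ _ _ _ mK mM (fun b => h * b * h^-1)%g pi 1%g v (sp _).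
rewrite E1 => ->; congr (push mM _ 1%g v); apply/funext => b /=.
by rewrite (hproj_mulr H_lie)// ?ltrans_hproj//; exact: (subV H_lie).
Qed.

Lemma automorphismP P a : automorphism mM P (ltrans a) <->
  forall x u, P x u -> P (ltrans a x) (dL a x \o u).
Proof.
have lK (b : K) : cancel (ltrans (H := H) b) (ltrans b^-1%g).
  by move=> x; rewrite ltransM mulVg ltrans1.
have lV (b : K) : cancel (ltrans (H := H) b^-1%g) (ltrans b).
  by move=> x; rewrite ltransM mulgV ltrans1.
have sl (b : K) : smooth_map mM mM (ltrans b).
  by apply/smooth_mapP => x; exact: (msmooth_ltrans K_lie proj_submersion).
split=> [[]//|HP]; split=> //; first by exists (ltrans a^-1%g).
move=> psi pK Kp; rewrite (_ : psi = ltrans a^-1%g)//.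
by apply/funext => x; rewrite -[in LHS](lV a x) pK.
Qed.

Section Frame.
Context {u : E -> V} (fu : frame mM o u).

Lemma frame_coframe v : To v -> u (coframe u v) = v.
Proof.
have [ul ui ut] := fu; rewrite -ut => -[a _ <-]; by rewrite (coframeK ui).
Qed.

Lemma frame_adapted : adapted [set 0] To (coframe u).
Proof. by have [ul ui ut] := fu; exact: coframe_adapted. Qed.

Lemma dpi_adapted : adapted hh kk (coframe u \o dpi).
Proof.
have [ul ui ut] := fu; have [_ _ L Kr S] := frame_adapted; split.
- exact: tangent_subspace.
- exact: (hh_sub H_lie).
- move=> t v w kv kw /=; rewrite push_linear L//; exact: (dpi_tangent proj_submersion).
- move=> v kv /=; rewrite (Kr _ (dpi_tangent proj_submersion kv)).
  exact: (dpi_kerP K_lie H_lie proj_submersion kv).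
- move=> a; have [w tw wa] := S a; have [v kv vw] := dpi_surj proj_submersion tw.
  by exists v => //=; rewrite vw.
Qed.

(** Pulling back by [dpi] the quadruple of the coframe is the same as taking the quadruple of the
    coframe composed with [dpi]; this removes the null-quadruple from the correspondence. *)
Lemma restricts_frame (Q : quadruple (tvec R K)) :
  let No := Qof [set 0] To (coframe u) in
  Q = Qof hh kk (coframe u \o dpi) <->
  is_quadruple hh kk Q /\
    [/\ qline Q = kk `&` dpi @^-1` qline No,
        qhyp Q = kk `&` dpi @^-1` qhyp No,
        forall v w, qhyp Q v -> qhyp Q w ->
          qform Q (cls (qline Q) v) (cls (qline Q) w) =
          qform No (cls (qline No) (dpi v)) (cls (qline No) (dpi w)) &
        forall v w, qline Q v -> kk w ->
          qfun Q (cls hh v) (cls (qhyp Q) w) =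
          qfun No (cls [set 0] (dpi v)) (cls (qhyp No) (dpi w))].
Proof.
set No := Qof _ _ _; have ad := frame_adapted; have ad' := dpi_adapted.
have dt v : kk v -> To (dpi v) by exact: (dpi_tangent proj_submersion).
have LE : lineof kk (coframe u \o dpi) = kk `&` dpi @^-1` qline No.
  apply/seteqP; split=> v /= [kv Hv]; split=> //; first by split; [exact: dt|].
  by case: Hv.
have BE : hypof kk (coframe u \o dpi) = kk `&` dpi @^-1` qhyp No.
  apply/seteqP; split=> v /= [kv Hv]; split=> //; first by split; [exact: dt|].
  by case: Hv.
have FE v w : hypof kk (coframe u \o dpi) v -> hypof kk (coframe u \o dpi) w ->
    qform No (cls (qline No) (dpi v)) (cls (qline No) (dpi w)) =
    eta (coframe u (dpi v)) (coframe u (dpi w)).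
  by rewrite BE => -[_ Bv] [_ Bw]; exact: (Qof_form ad).
have GE v w : lineof kk (coframe u \o dpi) v -> kk w ->
    qfun No (cls [set 0] (dpi v)) (cls (qhyp No) (dpi w)) =
    eta (coframe u (dpi v)) (coframe u (dpi w)).
  by rewrite LE => -[_ Lv] kw; apply: (Qof_fun ad) => //; exact: dt.
split=> [->|[qQ [L1 B1 f1 g1]]].
  split; first exact: Qof_is_quadruple.
  split=> //.
    by move=> v w Bv Bw; rewrite FE// [LHS](Qof_form ad').
  by move=> v w Lv kw; rewrite GE// [LHS](Qof_fun ad').
rewrite -LE in L1; rewrite -BE in B1.
apply: (quadruple_ext qQ (Qof_is_quadruple ad')) => //.
  move=> v w Bv Bw; rewrite f1// FE//; [|by rewrite -B1..].
  by rewrite L1 (Qof_form ad')// -B1.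
move=> v w Lv kw; rewrite g1// GE//; last by rewrite -L1.
by rewrite B1 (Qof_fun ad')// -L1.
Qed.

End Frame.

Lemma GN_frame x u f : frame mM x u -> @GN R m f -> frame mM x (u \o f).
Proof.
move=> [ul ui ut] [fl [g fK gK] _ _ _]; split.
- by move=> t a b /=; rewrite fl ul.
- by move=> a b /ui /(congr1 g); rewrite !fK.
- rewrite -ut; apply/seteqP; split=> v [a _ <-]; first by exists (f a).
  by exists (g a) => //=; rewrite gK.
Qed.

Lemma orbit_eq x u v P : GN_structure mM P -> P x u -> P x v -> exists2 f, @GN R m f & v = u \o f.
Proof. by move=> [_ _ orb _] Pu; rewrite (orb _ _ Pu) => -[f Gf <-]; exists f. Qed.

Lemma Qof_frame_indep x u v P : GN_structure mM P -> P x u -> P x v ->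
  Qof [set 0] (tangent mM x) (coframe u) = Qof [set 0] (tangent mM x) (coframe v).
Proof.
move=> gP Pu Pv; have [f Gf ->] := orbit_eq gP Pu Pv.
have [ul ui ut] : frame mM x u by case: gP => + _ _ _; apply.
have [fl [g fK gK] _ _ _] := Gf; have Gg := GN_inv Gf fK gK.
have ad := coframe_adapted ul ui ut; apply/esym.
apply: (GN_Qof ad Gg _).2 => w tw; rewrite (coframe_comp fK gK ui)//.
by rewrite ut.
Qed.

Lemma null_quadrupleP P Nq : GN_structure mM P ->
  null_quadruple mM P Nq <->
  forall x u, P x u -> Nq x = Qof [set 0] (tangent mM x) (coframe u).
Proof.
move=> gP; have [fr ne _ _] := gP; split=> [nq x u Pu|nq x].
  have [ul ui ut] := fr _ _ Pu; apply/(Qof_coframeP ul ui ut).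
  by have [q1 q2] := nq x; split=> //; exact: q2.
split.
  have [u Pu] := ne x; have [ul ui ut] := fr _ _ Pu.
  by have [] := (Qof_coframeP ul ui ut (Nq x)).1 (nq x u Pu).
move=> u Pu; have [ul ui ut] := fr _ _ Pu.
by have [] := (Qof_coframeP ul ui ut (Nq x)).1 (nq x u Pu).
Qed.

Lemma null_quadruple_exists P : GN_structure mM P -> exists Nq, null_quadruple mM P Nq.
Proof.
move=> gP; have [fr ne _ _] := gP; pose uu x := xget (fun=> 0) (P x).
have Puu x : P x (uu x) by rewrite /uu; case: xgetP => [u _ //|]; have [u Pu] := ne x; move=> /(_ u).
exists (fun x => Qof [set 0] (tangent mM x) (coframe (uu x))).
by apply/(null_quadrupleP _ gP) => x u Pu; exact: (Qof_frame_indep gP (Puu x) Pu).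
Qed.

Lemma restricts_toP P u Q : GN_structure mM P -> P o u ->
  restricts_to mK mH mM P Q <-> Q = Qof hh kk (coframe u \o dpi).
Proof.
move=> gP Pu; have fu : frame mM o u by case: gP => + _ _ _; apply.
rewrite (restricts_frame fu) /restricts_to /lie_algebra.
split=> [[qQ [Nq nq]]|[qQ HQ]].
  by rewrite ((null_quadrupleP _ gP).1 nq _ _ Pu) => HQ; split.
split=> //; have [Nq nq] := null_quadruple_exists gP; exists Nq => //.
by rewrite ((null_quadrupleP _ gP).1 nq _ _ Pu).
Qed.

(** Any frame of [P] at the origin may be used; the choice is immaterial on GN-structures by
    [origin_quadrupleE]. *)
Definition origin_quadruple P : quadruple (tvec R K) :=
  Qof hh kk (coframe (xget (fun=> 0) (P o)) \o dpi).

Lemma origin_frame P : GN_structure mM P -> P o (xget (fun=> 0) (P o)).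
Proof. by move=> [_ /(_ o)[u Pu] _ _]; case: xgetP => [v _ //|/(_ u)]. Qed.

Lemma origin_quadrupleP P Q : GN_structure mM P ->
  restricts_to mK mH mM P Q <-> Q = origin_quadruple P.
Proof. by move=> gP; exact: (restricts_toP Q gP (origin_frame gP)). Qed.

Lemma origin_quadrupleE P u : GN_structure mM P -> P o u ->
  origin_quadruple P = Qof hh kk (coframe u \o dpi).
Proof.
by move=> gP Pu; apply/(restricts_toP _ gP Pu)/(origin_quadrupleP _ gP).
Qed.

Lemma invariant_fibre P a u : invariant_GN mM P -> P (pi a) u <-> exists2 v, P o v & u = dL a o \o v.
Proof.
move=> [gP iP]; have iP' b := (automorphismP P b).1 (iP b); split=> [Pu|[v Pv ->]]; last first.
  by rewrite -ltrans_o; exact: iP'.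
have := iP' a^-1%g _ _ Pu; rewrite ltrans_hproj mulVg => Pv.
exists (dL a^-1 (pi a) \o u) => //.
have [fr _ _ _] := gP; have [ul ui ut] := fr _ _ Pu.
apply/funext => w /=; have tw : tangent mM (pi a) (u w) by rewrite -ut; exists w.
have := dLK a^-1 tw; rewrite invgK ltrans_hproj mulVg => ->//.
Qed.

(** Left translation by [h] in H fixes the origin, so it carries [u] to another frame of the same
    fibre, [u o f] with [f] in GN. Through [dpi_Ad] this reads [kap (Ad h v) = f (kap v)]. *)
Lemma origin_AdH P : invariant_GN mM P -> AdH_quadruple mK mH (origin_quadruple P).
Proof.
move=> iP; have [gP aP] := iP; have Pu := origin_frame gP; rewrite /origin_quadruple.
set u := xget _ _ in Pu *; have [fr _ _ _] := gP; have fu := fr _ _ Pu; have [ul ui ut] := fu.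
have ad := dpi_adapted fu; split; first exact: Qof_is_quadruple.
move=> h Hh; have Pv : P o (dL h o \o u).
  by have := (automorphismP P h).1 (aP h) _ _ Pu; rewrite ltrans_o (hproj_sub H_lie).
have [f Gf fE] := orbit_eq gP Pu Pv.
have kA v : kk v -> kk (Ad mK h v).
  move=> kv; have := push_tangent (@msmooth_conj _ _ _ _ K_lie h 1%g) kv.
  by rewrite mulg1 mulgV.
have kE v : kk v -> coframe u (dpi (Ad mK h v)) = f (coframe u (dpi v)).
  move=> kv; rewrite dpi_Ad// -[in LHS](frame_coframe fu (dpi_tangent proj_submersion kv)).
  have := congr1 (fun g => g (coframe u (dpi v))) fE => /= ->; by rewrite (coframeK ui).
have [fl fb [t ft] f2 f3] := Gf.
have fZ r b : f (r *: b) = r *: f b.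
  have f0 : f 0 = 0 by exact: (is_linear0 fl).
  by rewrite -[r *: b]addr0 fl f0 addr0.
have LA v : lineof kk (coframe u \o dpi) v -> lineof kk (coframe u \o dpi) (Ad mK h v).
  move=> [kv [s /= vs]]; split; first exact: kA.
  by exists (s * t); rewrite /= kE// vs fZ ft scalerA.
have BA v : hypof kk (coframe u \o dpi) v -> hypof kk (coframe u \o dpi) (Ad mK h v).
  move=> [kv kpv]; split; first exact: kA.
  by rewrite /= kE//; exact: GN_kperp Gf kpv.
split=> //.
- move=> v w Bv Bw; rewrite [LHS](Qof_form ad (BA _ Bv) (BA _ Bw)) [RHS](Qof_form ad Bv Bw) /=.
  by have [[kv kpv] [kw kpw]] := conj Bv Bw; rewrite !kE// f2.
- move=> v w Lv kw; rewrite [LHS](Qof_fun ad (LA _ Lv) (kA _ kw)) [RHS](Qof_fun ad Lv kw) /=.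
  have [kv [s /= vs]] := Lv; rewrite !kE// vs fZ !etaZl f3//.
Qed.

Lemma origin_inj P P' : invariant_GN mM P -> invariant_GN mM P' ->
  origin_quadruple P = origin_quadruple P' -> P = P'.
Proof.
move=> iP iP' QQ; have [[gP aP] [gP' aP']] := conj iP iP'.
have [fr _ orb _] := gP; have [fr' _ orb' _] := gP'.
have Pu := origin_frame gP; have Pu' := origin_frame gP'.
rewrite /origin_quadruple in QQ; set u := xget _ _ in Pu QQ; set u' := xget _ _ in Pu' QQ.
have [fu fu'] := (fr _ _ Pu, fr' _ _ Pu').
have [f Gf fE] := Qof_transition (dpi_adapted fu) (dpi_adapted fu') QQ.
have uE : u = u' \o f.
  apply/funext => a; have [ul ui ut] := fu.
  have ta : To (u a) by rewrite -ut; exists a.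
  have [v kv va] := dpi_surj proj_submersion ta.
  have := fE v kv; rewrite /= va (coframeK ui) => <-.
  by rewrite (frame_coframe fu').
have P'u : P' o u by rewrite (orb' _ _ Pu') uE; exists f.
have oE : P o = P' o by rewrite (orb _ _ Pu) (orb' _ _ P'u).
apply/funext => x; have [a <-] := hproj_surj x; apply/seteqP; split=> w.
  by move=> /(invariant_fibre _ _ iP)[v Pv ->]; apply/(invariant_fibre _ _ iP'); exists v; rewrite -?oE.
by move=> /(invariant_fibre _ _ iP')[v Pv ->]; apply/(invariant_fibre _ _ iP); exists v; rewrite ?oE.
Qed.

Lemma frame_exists : exists u, frame mM o u.
Proof.
have [c ac co] := atlas_cover mM o; have p := plot_cpsi ac (chart_phi_img ac co).
have oK := chart_phiK ac co.
exists (vel mM (cpsi c) (cphi c o)); split.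
- exact: vel_linear.
- by move=> a b; exact: vel_cpsi_inj.
- apply/seteqP; split=> v.
    by move=> [a _ <-]; have := vel_tangent a p; rewrite oK.
  by move=> tv; have [a ->] := tangent_vel tv ac co; exists a.
Qed.

(** A translated vector acts on [f] as a left-invariant field acts on [f o pi]. This is how the
    smoothness of translated frames is reduced to that of left-invariant fields. *)
Lemma frame_lfield a v f : smooth_near mM (pi a) f ->
  dL a o (dpi v) f = lfield mK v (f \o pi) a.
Proof.
by move=> sf; rewrite -(push_hproj_lmul K_lie proj_submersion) /push; case: asboolP.
Qed.

Section Surjectivity.
Context {Q : quadruple (tvec R K)} (AQ : AdH_quadruple mK mH Q).

Lemma origin_surj : exists2 P, invariant_GN mM P & origin_quadruple P = Q.
Proof.
have [qQ HA] := AQ; have [u1 fu1] := frame_exists.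
have [kap [ad QE]] := Qof_complete (dpi_adapted fu1) qQ.
have [st bt Lk Kr S] := ad.
pose lift a := sval (cid2 (S a)).
have lk a : kk (lift a) by rewrite /lift; case: cid2.
have lK a : kap (lift a) = a by rewrite /lift; case: cid2.
(* The maps [kap] and [dpi] have the same kernel in [kk], so the class of the lift modulo [hh], and
   with it [u0 a], depends only on [a]: [u0] is the frame whose coframe composed with [dpi] is
   [kap]. *)
pose u0 a := dpi (lift a).
have dpiE v w : kk v -> kk w -> kap v = kap w -> dpi v = dpi w.
  move=> kv kw /(ad_eq ad kv kw) hvw; have := hh_dpi H_lie proj_submersion hvw.
  have -> : v - w = (-1) *: w + v by rewrite scaleN1r addrC.
  by rewrite push_linear scaleN1r addrC => /eqP; rewrite subr_eq0 => /eqP.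
have u0k v : kk v -> u0 (kap v) = dpi v by move=> kv; apply: dpiE => //; rewrite lK.
have u0l : is_linear u0.
  move=> t a b; rewrite /u0 -push_linear; apply: dpiE => //; first exact: st.2.
  by rewrite Lk// !lK.
have u0i : injective u0.
  move=> a b ab; rewrite -[a]lK -[b]lK; apply/(ad_eq ad) => //.
  apply/(dpi_kerP K_lie H_lie proj_submersion); first exact: (subB st).
  have -> : lift a - lift b = (-1) *: lift b + lift a by rewrite scaleN1r addrC.
  by rewrite push_linear scaleN1r -/(u0 a) -/(u0 b) ab addNr.
have u0t : u0 @` setT = To.
  apply/seteqP; split=> w; first by move=> [a _ <-]; exact: (dpi_tangent proj_submersion).
  move=> /(dpi_surj proj_submersion)[v kv <-]; by exists (kap v) => //; exact: u0k.
have fu0 : frame mM o u0 by [].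
have cof v : kk v -> coframe u0 (dpi v) = kap v.
  by move=> kv; rewrite -u0k// (coframeK u0i).
(* Ad(H)-invariance of [Q] says that [kap] and [kap o Ad h] define the same quadruple data, hence
   differ by an element of GN. *)
have Hf h : H h -> exists2 f, @GN R m f & dL h o \o u0 = u0 \o f.
  move=> Hh; have [A1 A2 A3 A4] := HA _ Hh.
  have kA v : kk v -> kk (Ad mK h v).
    move=> kv; have := push_tangent (@msmooth_conj _ _ _ _ K_lie h 1%g) kv.
    by rewrite mulg1 mulgV.
  have ad' : adapted hh kk (kap \o Ad mK h).
    split=> //.
    - by move=> t v w kv kw /=; rewrite /Ad push_linear Lk//; exact: kA.
    - move=> v kv /=; rewrite (Kr _ (kA _ kv)).
      rewrite -!(dpi_kerP K_lie H_lie proj_submersion)//; last exact: kA.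
      rewrite dpi_Ad//; split=> [d0|->]; last first.
        exact: (is_linear0 (@push_linear R _ _ _ mM (ltrans h) o)).
      apply: (dL_inj (a := h) (x := o)) => //.
      + exact: (dpi_tangent proj_submersion).
      + exact: (tangent_subspace mM o).1.
      + rewrite d0; exact: (esym (is_linear0 (@push_linear R _ _ _ mM (ltrans h) o))).
    - move=> a; pose w := dL h^-1%g o (u0 a).
      have tu : To (u0 a) by rewrite -u0t; exists a.
      have Hh' := subV H_lie Hh.
      have tw : To w by have := dL_tangent h^-1%g tu; rewrite ltrans_o (hproj_sub H_lie).
      have [v kv vw] := dpi_surj proj_submersion tw.
      exists v => //=; rewrite -(lK a); apply/(ad_eq ad) => //; first exact: kA.
      apply/(dpi_kerP K_lie H_lie proj_submersion); first by apply: (subB st) => //; exact: kA.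
      have -> : Ad mK h v - lift a = (-1) *: lift a + Ad mK h v by rewrite scaleN1r addrC.
      rewrite push_linear dpi_Ad// vw /w.
      have := dLK h^-1%g tu; rewrite invgK ltrans_o (hproj_sub H_lie)// => ->.
      by rewrite scaleN1r addNr.
  have LE : qline Q = lineof kk kap by rewrite QE.
  have BE : qhyp Q = hypof kk kap by rewrite QE.
  have [f Gf fE] : exists2 f, @GN R m f & forall v, kk v -> (kap \o Ad mK h) v = f (kap v).
    apply: (transition_GN ad ad').
    - by move=> v; rewrite -LE => Lv; have := A1 _ Lv; rewrite LE => -[_ Lv']; split=> //; rewrite LE in Lv; case: Lv.
    - move=> v w; rewrite -BE => Bv Bw; have := A3 _ _ Bv Bw.
      have := A2 _ Bv; have := A2 _ Bw; move: Bv Bw; rewrite QE => Bv Bw Bw' Bv'.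
      by rewrite (Qof_form ad Bv' Bw') (Qof_form ad Bv Bw).
    - move=> v w; rewrite -LE => Lv kw; have := A4 _ _ Lv kw.
      have := A1 _ Lv; move: Lv; rewrite QE => Lv Lv'.
      by rewrite (Qof_fun ad Lv' (kA _ kw)) (Qof_fun ad Lv kw).
  exists f => //; apply/funext => a /=; rewrite -{1}[a]lK u0k// -dpi_Ad// -u0k; last exact: kA.
  by have /= -> := fE _ (lk a); rewrite lK.
pose P x : set (E -> V) := [set w | exists a f, [/\ pi a = x, @GN R m f & w = dL a o \o u0 \o f]].
have P0 : P o u0.
  exists 1%g, id; split=> //; first exact: GN_id.
  apply/funext => a /=; rewrite (push_ltrans1 (mM := mM))//; by rewrite -u0t; exists a.
have frP x w : P x w -> frame mM x w.
  move=> [a [f [<- Gf ->]]]; apply: GN_frame => //; split.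
  - by move=> t b c /=; rewrite u0l push_linear.
  - move=> b c /= /dL_inj e; apply: u0i; apply: e; rewrite -u0t; [by exists b|by exists c].
  - apply/seteqP; split=> w'.
      move=> [b _ <-] /=; have tb : To (u0 b) by rewrite -u0t; exists b.
      by have := dL_tangent a tb; rewrite ltrans_o.
    move=> tw; have := dL_tangent a^-1%g tw; rewrite ltrans_hproj mulVg -u0t => -[b _ bE].
    exists b => //=; rewrite bE; have := dLK a^-1%g tw; rewrite invgK ltrans_hproj mulVg => ->//.
have gP : GN_structure mM P.
  split=> //.
  - by move=> x; have [a <-] := hproj_surj x; exists (dL a o \o u0 \o id), a, id; split=> //; exact: GN_id.
  - move=> x w [a [f [ax Gf ->]]]; apply/seteqP; split=> w'.
      move=> [b [g [bx Gg ->]]].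
      have Hh : H (a^-1 * b)%g by apply: (hproj_eq H_lie); rewrite ax bx.
      have [fh Gfh fhE] := Hf _ Hh.
      have [fl [fi fK fiK] _ _ _] := Gf; have Gfi := GN_inv Gf fK fiK.
      exists (fi \o fh \o g).
        by apply: GN_comp => //; exact: GN_comp.
      apply/funext => c /=; rewrite fiK -[u0 (fh _)]/((u0 \o fh) (g c)) -fhE /=.
      have := push_ltransM K_lie proj_submersion a (a^-1 * b)%g o (u0 (g c)).
      by rewrite ltrans_o (hproj_sub H_lie)// mulgA mulgV mul1g.
    move=> [g Gg <-]; exists a, (f \o g); split=> //; exact: GN_comp.
  - move=> x; have [a ax] := hproj_surj x.
    have [U [s [oU Ua sa Hs sp]]] := local_section proj_submersion a.
    (* A smooth local section of [pi] selects one translated frame at each point. *)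
    exists U, (fun y => dL (s y) o \o u0); split=> //; first by rewrite -ax.
      by move=> y Uy; exists (s y), id; split=> //; [exact: Hs|exact: GN_id].
    move=> b; apply/(smooth_vfieldP _ oU); split=> [y Uy|y f Uy sf].
      have tb : To (u0 b) by rewrite -u0t; exists b.
      by have := dL_tangent (s y) tb; rewrite ltrans_o Hs.
    have sf' : smooth_near mK (s y) (f \o pi).
      have sp' : msmooth mK mM pi (s y) by exact: (hproj_smooth proj_submersion).
      by apply: (@msmooth_near R _ _ _ _ mK mM pi (s y) f sp'); rewrite Hs.
    have sl := smooth_near_lfield K_lie (lk b) sf'.
    have [W [oW Wy HW]] := smooth_near_mopen sf.
    apply: (eq_smooth_near (mopenI oU oW) (f := fun z => lfield mK (lift b) (f \o pi) (s z))).
    + by [].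
    + by move=> z [Uz Wz] /=; rewrite frame_lfield// Hs//; exact: HW.
    + apply: smooth_nearP => g z gz pg.
      apply: (@smooth_near_plot R _ _ mK _ (fun z => s (g z))); last by rewrite gz.
      by apply: sp => //; rewrite gz.
have iP : invariant_GN mM P.
  split=> // a; apply/automorphismP => x w [b [f [<- Gf ->]]].
  exists (a * b)%g, f; split=> //; first by rewrite ltrans_hproj.
  apply/funext => c /=; have := push_ltransM K_lie proj_submersion a b o (u0 (f c)).
  by rewrite ltrans_o.
exists P => //; rewrite (origin_quadrupleE gP P0) QE.
apply: (GN_Qof ad (@GN_id R m) _).2 => v kv; exact: cof.
Qed.

End Surjectivity.

End Correspondence.

(** * Product coordinates on K/H *)

Section LeftVelocity.
Context {R : realType} {N : nat} {K : groupType} (mK : manifold R N K).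
Hypothesis K_lie : lie_group mK.
Implicit Types E F : normedModType R.
Local Notation kk := (tangent mK (1%g : K)).

Lemma vel_mul1 E (g h : E -> K) y a : findim E -> g y = 1%g -> h y = 1%g ->
  plot mK g y -> plot mK h y ->
  vel mK (fun s => g s * h s)%g y a = vel mK g y a + vel mK h y a.
Proof.
move=> fE gy hy pg ph; rewrite -(vel_mul_id K_lie a a fE fE gy hy pg ph).
have sd : smooth_at (fun s : E => (s, s)) y.
  by apply: smooth_at_pair; exact: smooth_at_id.
have pp := plot_mul2 K_lie fE fE pg ph.
rewrite (@vel_comp R _ _ mK _ _ (fun s : E => (s, s)) (fun p => g p.1 * h p.2)%g y a sd pp).
congr (vel mK _ _ _); have dd := smooth_at_diff sd.
rewrite (deriveE _ dd) (@diff_pair R _ _ _ id id) //; try exact: (smooth_at_diff (smooth_at_id y)).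
by rewrite -(deriveE _ (smooth_at_diff (smooth_at_id y))) derive_id.
Qed.

Lemma Ad_tangent h w : kk w -> kk (Ad mK h w).
Proof.
move=> kw; have := push_tangent (@msmooth_conj _ _ _ _ K_lie h 1%g) kw.
by rewrite mulg1 mulgV.
Qed.

Lemma Ad_vel h E (k : E -> K) y b : k y = 1%g -> plot mK k y ->
  Ad mK h (vel mK k y b) = vel mK (fun s => h * k s * h^-1)%g y b.
Proof.
move=> ky pk; apply: (@push_vel R _ _ _ _ mK mK (fun b => h * b * h^-1)%g) => //.
exact: (msmooth_conj K_lie).
Qed.

Lemma Ad_mul h h' w : kk w -> Ad mK (h * h')%g w = Ad mK h (Ad mK h' w).
Proof.
move=> kw; have e : (h' * 1 * h'^-1 = 1)%g by rewrite mulg1 mulgV.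
have cj x : msmooth mK mK (fun b => h * b * h^-1)%g x by exact: (msmooth_conj K_lie).
have := @push_comp R _ _ _ _ _ mK mK (fun b => h' * b * h'^-1)%g (fun b => h * b * h^-1)%g 1%g w.
rewrite e => /(_ (cj _)); rewrite -/(Ad mK h' w) -/(Ad mK h _) => ->.
congr (push mK _ _ _); apply/funext => b /=.
by rewrite invgM !mulgA.
Qed.

Lemma Ad1 w : kk w -> Ad mK 1%g w = w.
Proof.
move=> kw; rewrite -[RHS](push_id kw); congr (push mK _ _ _); apply/funext => b.
by rewrite mul1g invg1 mulg1.
Qed.

Lemma Ad_linear h : is_linear (Ad mK h). Proof. exact: push_linear. Qed.

(* The left logarithmic derivative g^-1 dg. *)
Definition theta E (g : E -> K) (t b : E) : tvec R K :=
  vel mK (fun s => (g t)^-1 * g s)%g t b.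

Lemma theta_plot E (g : E -> K) t : plot mK g t -> plot mK (fun s => (g t)^-1 * g s)%g t.
Proof. by move=> pg; apply: (plot_mul K_lie) => //; exact: plot_cst. Qed.

Lemma theta_tangent E (g : E -> K) t b : plot mK g t -> kk (theta g t b).
Proof. by move=> pg; have := vel_tangent b (theta_plot pg); rewrite mulVg. Qed.

Lemma theta_linear E (g : E -> K) t : plot mK g t -> is_linear (theta g t).
Proof. by move=> pg; exact: (vel_linear (theta_plot pg)). Qed.

Lemma theta_cst E (a : K) (t b : E) : theta (fun=> a) t b = 0.
Proof.
apply/funext => f; rewrite /theta /vel; case: asboolP => // _.
exact: derive_cst.
Qed.

(** The product rule for logarithmic derivatives, [(g h)^-1 d(g h) = h^-1 (g^-1 dg) h + h^-1 dh]. *)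
Lemma theta_mul E (g h : E -> K) t b : findim E -> plot mK g t -> plot mK h t ->
  theta (fun s => g s * h s)%g t b = Ad mK (h t)^-1 (theta g t b) + theta h t b.
Proof.
move=> fE pg ph; rewrite /theta Ad_vel ?mulVg//; last exact: theta_plot.
rewrite -vel_mul1//; first last.
- exact: theta_plot.
- have cj x : msmooth mK mK (fun b => (h t)^-1 * b * ((h t)^-1)^-1)%g x by exact: (msmooth_conj K_lie).
  exact: (msmooth_plot (cj _) (theta_plot pg)).
- by rewrite mulVg.
- by rewrite mulVg mulg1 mulgV.
congr (vel mK _ _ _); apply/funext => s.
by rewrite invgM invgK -!mulgA (mulgA (h t) (h t)^-1%g) mulgV mul1g.
Qed.

Lemma vel_theta E (g : E -> K) t b : plot mK g t ->
  vel mK g t b = push mK (fun x => g t * x)%g 1%g (theta g t b).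
Proof.
move=> pg; rewrite /theta (@push_vel R _ _ _ _ mK mK (fun x => g t * x)%g) ?mulVg//.
  by apply: eq_vel; apply: nearW => s; rewrite mulgA mulgV mul1g.
exact: (msmooth_lmul K_lie).
Qed.

Lemma theta_smooth E (g : E -> K) t b f : findim E -> plot mK g t -> smooth_near mK 1%g f ->
  smooth_at (fun s => theta g s b f) t.
Proof.
move=> fE pg sf; pose Psi (p : E * E) := f ((g p.1)^-1 * g p.2)%g.
have sP : smooth_at Psi (t, t).
  apply: (@smooth_near_plot R _ _ mK _ (fun p : E * E => (g p.1)^-1 * g p.2)%g).
    exact: (plot_mul2 K_lie fE fE (plot_inv K_lie pg) pg).
  by rewrite /= mulVg.
have : smooth_at (fun s => 'D_(0, b) Psi (s, s)) t.
  apply: (@smooth_at_comp R _ _ _ (fun s : E => (s, s)) (fun p => 'D_(0, b) Psi p)).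
  - exact: findim_prod.
  - by apply: smooth_at_pair; exact: smooth_at_id.
  - exact: smooth_at_derive.
apply: smooth_at_near; apply: filterS (plot_near pg) => s ps.
rewrite -(derive_snd (fun p => Psi p)) /theta velE ?mulVg//.
Qed.

Section Curve.
Context {c : R -> K} {e : R} {v : tvec R K} (kv : kk v)
  (c0 : c 0 = 1%g) (cp : forall t : R, `|t| < e -> plot mK c t)
  (cv : forall t : R, `|t| < e -> vel mK c t 1 = push mK (fun x => c t * x)%g 1%g v).

Lemma theta_curve0 (t : R) : `|t| < e -> theta c t 1 = v.
Proof.
move=> te; have pc := cp te.
have ml a x : msmooth mK mK (fun b => a * b)%g x by exact: (msmooth_lmul K_lie).
have -> : theta c t 1 = push mK (fun x => (c t)^-1 * x)%g (c t) (vel mK c t 1).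
  by rewrite (@push_vel R _ _ _ _ mK mK).
rewrite cv//; have := @push_comp R _ _ _ _ _ mK mK (fun x => c t * x)%g (fun x => (c t)^-1 * x)%g 1%g v (ml _ _).
rewrite mulg1 => ->; rewrite -[RHS](push_id kv); congr (push mK _ _ _).
by apply/funext => x; rewrite mulKg.
Qed.

Lemma theta_curve n (t b : 'rV[R]_n) j : `|t 0 j| < e ->
  theta (fun s : 'rV[R]_n => c (s 0 j)) t b = b 0 j *: v.
Proof.
move=> te; have pc := theta_plot (cp te).
rewrite /theta.
have sj : smooth_at (fun s : 'rV[R]_n => s 0 j) t by exact: (smooth_at_coord 0 j (smooth_at_id t)).
rewrite (@vel_comp R _ _ mK _ _ (fun s : 'rV[R]_n => s 0 j) (fun x => (c (t 0 j))^-1 * c x)%g t b sj pc).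
have -> : 'D_b (fun s : 'rV[R]_n => s 0 j) t = b 0 j *: (1 : R) + 0.
  by rewrite addr0 -[RHS]/(b 0 j * 1) mulr1 -derive_entry ?derive_id//; exact: (smooth_at_diff (smooth_at_id t)).
by rewrite (vel_linear pc) (vel0 pc) addr0 -/(theta c (t 0 j) 1) theta_curve0.
Qed.

(** With [g s = (c s)^-1 c t], a curve passing through 1 at [s = t], one has
    [Ad (c s)^-1 w = Ad (g s) (Ad (c t)^-1 w)], and [derive_Ad] applies. *)
Lemma derive_Ad_curve (t : R) w f : `|t| < e -> kk w -> smooth_near mK 1%g f ->
  smooth_at (fun s : R => Ad mK (c s)^-1 w f) t /\
  'D_(1 : R) (fun s : R => Ad mK (c s)^-1 w f) t = - lie_bracket mK v (Ad mK (c t)^-1 w) f.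
Proof.
move=> te kw sf; have pc := cp te.
pose g (s : R) := ((c s)^-1 * c t)%g.
have pg : plot mK g t.
  by apply: (plot_mul K_lie); [exact: (plot_inv K_lie)|exact: plot_cst].
have g1 : g t = 1%g by rewrite /g mulVg.
have kw' := Ad_tangent (c t)^-1 kw.
have E1 : (fun s : R => Ad mK (c s)^-1 w f) = fun s => Ad mK (g s) (Ad mK (c t)^-1 w) f.
  by apply/funext => s; rewrite -Ad_mul// /g -mulgA mulgV mulg1.
(* The product of [g s] with [(c t)^-1 c s] is constantly 1, and the second factor has velocity
   [v]. *)
have gv : vel mK g t 1 = - v.
  have /= := vel_mul1 (1 : R) findimR g1 _ pg (theta_plot pc).
  rewrite mulVg => /(_ erefl); rewrite -/(theta c t 1) theta_curve0//.
  rewrite (_ : vel mK _ t 1 = 0); first by move/eqP; rewrite eq_sym addr_eq0 => /eqP.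
  apply/funext => F; rewrite /vel; case: asboolP => // _.
  rewrite (_ : (fun z : R => _) = cst (F 1%g)) ?derive_cst//.
  by apply/funext => s; rewrite /g -mulgA (mulgA (c t)) mulgV mul1g mulVg.
have [s1 s2] := derive_Ad K_lie (1 : R) findimR g1 pg kw' sf.
rewrite E1; split=> //; rewrite s2 gv.
have -> : - v = (-1) *: v + 0 by rewrite addr0 scaleN1r.
have k0 : kk 0 by exact: (tangent_subspace mK 1%g).1.
rewrite (lie_bracketDl K_lie)//.
have L0 : lie_bracket mK 0 (Ad mK (c t)^-1 w) = 0.
  have := lie_bracketDl K_lie (-1) k0 k0 kw'; by rewrite scaler0 addr0 scaleN1r addNr.
by rewrite L0 addr0 scaleN1r.
Qed.

End Curve.
End LeftVelocity.

(** * Antiderivatives along one coordinate *)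

Section DirectionalAntiderivative.
Context {R : realType} {n : nat}.
Implicit Types (w : 'rV[R]_n -> R) (t : 'rV[R]_n).
Local Notation e j := (delta_mx 0 j : 'rV[R]_n).

(** Multiplies coordinate [j] by [p.1] and keeps the others, thus describing the segment from the
    hyperplane where this coordinate is 0 to the point [p.2]. *)
Definition contract j (p : R * 'rV[R]_n) : 'rV[R]_n := p.2 + ((p.1 - 1) * p.2 0 j) *: e j.

Lemma contract_coord j u t i : contract j (u, t) 0 i = if i == j then u * t 0 j else t 0 i.
Proof.
rewrite /contract !mxE /=; case: eqVneq => [->|_]; rewrite ?mulr1 ?mulr0 ?addr0//.
by rewrite mulrBl mul1r addrC subrK.
Qed.

Lemma contract_mx j u t : contract j (u, t) = t *m (1%:M + (u - 1) *: delta_mx j j).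
Proof.
rewrite mulmxDr mulmx1 -scalemxAr /contract /= -scalerA; congr (_ + _ *: _).
apply/rowP => i; rewrite !mxE (bigD1 j)//= big1 ?addr0.
  by rewrite !mxE eqxx.
by move=> k kj; rewrite !mxE (negPf kj) mulr0.
Qed.

Lemma contract_norm j u t : 0 <= u <= 1 -> `|contract j (u, t)| <= `|t|.
Proof.
move=> /andP[u0 u1]; apply: rV_normP => // i; rewrite contract_coord.
case: eqVneq => [_|_]; last exact: rV_coord_le.
rewrite normrM (ger0_norm u0) (le_trans _ (rV_coord_le t j))//.
by rewrite ler_piMl.
Qed.

Lemma contract1 j t : contract j (1, t) = t.
Proof. by rewrite /contract /= subrr mul0r scale0r addr0. Qed.

Lemma smooth_contract j (p : R * 'rV[R]_n) : smooth_at (contract j) p.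
Proof.
apply: smooth_at_add; first exact: smooth_at_snd.
apply: smooth_at_scale; last exact: smooth_at_cst.
apply: smooth_at_mul.
  by apply: smooth_at_sub; [exact: smooth_at_fst|exact: smooth_at_cst].
by apply: (@smooth_at_coord R _ _ _ snd 0 j); exact: smooth_at_snd.
Qed.

(** Take [tau t = t_j] times the integral of [F (u, t) = w (contract j (u, t))] over [u] in
    [[0, 1]]. Since [t_j] times the j-th partial derivative of [F] is [u] times its derivative in
    [u], the j-th derivative of [tau] is the integral of the derivative of [u F (u, t)], namely
    [F (1, t) = w t]. *)
Lemma dir_antiderivative w j (r : R) : (forall t, `|t| < r -> smooth_at w t) ->
  exists tau, forall t, `|t| < r -> [/\ smooth_at tau t, 'D_(e j) tau t = w t &
    (t 0 j = 0 -> tau t = 0)].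
Proof.
move=> sw; pose F p := w (contract j p).
pose V := ball (0 : 'rV[R]_n) r.
have VE t : V t <-> `|t| < r by rewrite /V -ball_normE /= sub0r normrN.
have oV : open V by exact: ball_open.
have sF : smooth_strip F V.
  move=> u x u01 /VE xr; apply: (@smooth_at_comp R _ _ _ (contract j) w).
  - exact: findim_rV.
  - exact: smooth_contract.
  - by apply: sw; exact: le_lt_trans (contract_norm j x u01) xr.
exists (fun t => t 0 j * pint F t) => t tr; have Vt := (VE t).2 tr.
have sc : smooth_at (fun t : 'rV[R]_n => t 0 j) t by exact: (smooth_at_coord 0 j (smooth_at_id t)).
have sp : smooth_at (pint F) t by apply: smooth_on_at Vt => //; exact: smooth_pint.
split; [exact: smooth_at_mul| |by move=> ->; rewrite mul0r].
have dc : 'D_(e j) (fun t : 'rV[R]_n => t 0 j) t = 1.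
  rewrite -derive_entry ?derive_id; first by rewrite mxE !eqxx.
  exact: (smooth_at_diff (smooth_at_id t)).
have [dp /(_ (e j)) dpE] := pint_diff oV sF Vt.
have -> : 'D_(e j) (fun t => t 0 j * pint F t) t =
    pint F t + t 0 j * pint (fun p => 'D_((0 : R), e j) F p) t.
  rewrite -dpE -[LHS]/('D_(e j) ((fun t : 'rV[R]_n => t 0 j) * pint F) t).
  rewrite deriveM; [|exact/diff_derivable/smooth_at_diff..].
  by rewrite dc addrC; congr (_ + _); exact: mulr1.
pose F' p := 'D_((0 : R), e j) F p.
have sF' : smooth_strip F' V by exact: smooth_strip_derive.
pose f1 u := F (`|clamp 1 u|, t); pose f2 u := F' (`|clamp 1 u|, t).
have [p10 dp1] := primP (pint_integrand_continuous sF Vt).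
have [p20 dp2] := primP (pint_integrand_continuous sF' Vt).
have cl u : 0 <= u <= 1 -> `|clamp 1 u| = u.
  by move=> /andP[u0 u1]; rewrite clamp_id ?ger0_norm.
have lt2 u : 0 <= u <= 1 -> `|u| < 2 :> R.
  by move=> /andP[u0 u1]; rewrite ger0_norm// (le_lt_trans u1)// ltr1n.
pose G u := prim f1 u + t 0 j * prim f2 u.
have dG (u : R) : 0 <= u <= 1 -> is_derive u 1 G (f1 u + t 0 j * f2 u).
  move=> u01; have d1 := dp1 u (lt2 _ u01); have d2 := dp2 u (lt2 _ u01).
  exact: (is_deriveD d1 (is_deriveZ (t 0 j) d2)).
have dFu (u : R) : 0 <= u <= 1 ->
    is_derive u 1 (fun u => F (u, t)) (t 0 j * 'D_(e j) w (contract j (u, t))).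
  move=> u01; have sFu := sF u t u01 Vt.
  have dF := smooth_at_diff sFu.
  have sw' : smooth_at w (contract j (u, t)).
    by apply: sw; exact: le_lt_trans (contract_norm j t u01) tr.
  have E1 : (fun u => F (u, t)) = fun s : R => w ((s * t 0 j) *: e j + contract j (0, t)).
    apply/funext => s; rewrite /F; congr w; apply/rowP => i.
    rewrite [in RHS]mxE !contract_coord !mxE; case: eqVneq => [_|_] /=.
      by rewrite mul0r addr0 mulr1.
    by rewrite mulr0 add0r.
  have E2 : contract j (u, t) = (u * t 0 j) *: e j + contract j (0, t).
    apply/rowP => i; rewrite [in RHS]mxE !contract_coord !mxE; case: eqVneq => [_|_] /=.
      by rewrite mul0r addr0 mulr1.
    by rewrite mulr0 add0r.
  have dl : is_derive (u * t 0 j) 1 (fun s : R => w (s *: e j + contract j (0, t)))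
      ('D_(e j) w (contract j (u, t))).
    rewrite E2 -derive_line; apply: derivableP; apply/derivable_line.
    by rewrite -E2; apply/diff_derivable/smooth_at_diff.
  have dm : is_derive u 1 (fun s : R => s * t 0 j) (t 0 j).
    have := is_deriveZ (t 0 j) (is_derive_id u (1 : R)).
    rewrite -[_ *: 1]/(t 0 j * 1) mulr1.
    rewrite (_ : _ \*: _ = fun s : R => s * t 0 j)//; by apply/funext => s; exact: mulrC.
  rewrite E1; have := @is_derive1_comp R (fun s : R => w (s *: e j + contract j (0, t))) (fun s : R => s * t 0 j) u _ _ dl dm.
  by rewrite mulrC.
have dPhi (u : R) : 0 <= u <= 1 -> is_derive u 1 (fun u => u * F (u, t))
    (F (u, t) + u * (t 0 j * 'D_(e j) w (contract j (u, t)))).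
  move=> u01; have := is_deriveM (is_derive_id u (1 : R)) (dFu u u01).
  rewrite -[_ *: 1]/(F (u, t) * 1) mulr1 addrC.
  exact.
have E3 (u : R) : 0 < u -> u < 1 -> f1 u + t 0 j * f2 u =
    F (u, t) + u * (t 0 j * 'D_(e j) w (contract j (u, t))).
  move=> u0 u1; have u01 : 0 <= u <= 1 by rewrite !ltW.
  have sw' : smooth_at w (contract j (u, t)).
    by apply: sw; exact: le_lt_trans (contract_norm j t u01) tr.
  rewrite /f1 /f2 cl// mulrCA; congr (_ + t 0 j * _).
  rewrite /F' -derive_snd /F.
  have sct : smooth_at (fun t => contract j (u, t)) t.
    apply: (@smooth_at_comp R _ _ _ (fun t => (u, t)) (contract j)).
    - by apply: findim_prod; [exact: findimR|exact: findim_rV].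
    - by apply: smooth_at_pair; [exact: smooth_at_cst|exact: smooth_at_id].
    - exact: smooth_contract.
  rewrite (@derive_comp R _ _ _ (fun t => contract j (u, t)) w); [|exact: smooth_at_diff..].
  have -> : 'D_(e j) (fun t => contract j (u, t)) t = u *: e j.
    rewrite (_ : (fun t => _) = fun t : 'rV[R]_n => t *m (1%:M + (u - 1) *: delta_mx j j)); last first.
      by apply/funext => y; exact: contract_mx.
    have [_ ->] := derive_mulmxr (1%:M + (u - 1) *: delta_mx j j) (e j) (smooth_at_diff (smooth_at_id t)).
    rewrite derive_id -contract_mx; apply/rowP => i; rewrite contract_coord !mxE !eqxx mulr1.
    by case: eqVneq; rewrite ?mulr1 ?mulr0.
  have Dl := derive_lin (smooth_at_diff sw') u (e j) 0.
  have D0 : 'D_(0 : 'rV[R]_n) w (contract j (u, t)) = 0.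
    exact: (is_linear0 (derive_lin (smooth_at_diff sw'))).
  by move: Dl; rewrite addr0 D0 addr0 => ->.
have := antideriv_unique01 dG dPhi E3.
rewrite /G p10 p20 mulr0 addr0 subr0 mul0r subr0 mul1r => ->.
by rewrite /F contract1.
Qed.

End DirectionalAntiderivative.

(** * Straightening a multiple of a coordinate field *)

Section Straighten.
Context {R : realType} {m : nat}.
Local Notation E := 'rV[R]_m.+2.
Local Notation ek := (ek R m).

Lemma near_norm_lt (n : nat) (t : 'rV[R]_n) (r : R) : `|t| < r -> \forall s \near t, `|s| < r.
Proof.
move=> tr; have cn : {for t, continuous (fun s : 'rV[R]_n => `|s|)} by exact: norm_continuous.
exact: (cn _ (open_nbhs_nbhs (conj (@open_lt R r) tr))).
Qed.

Lemma smooth_line0 (F : normedModType R) (b : F) (r : R) : smooth_at (fun r : R => r *: b) r.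
Proof. by apply: smooth_at_scale; [exact: smooth_at_id|exact: smooth_at_cst]. Qed.

(** If [T] is an antiderivative of [1/h] along the k-coordinate, replacing that coordinate by [T]
    turns [h d/dt_k] into the coordinate field; [q] is the inverse of this change. It alters vectors
    only by multiples of k. The last clause says that a nearby point [rho k] of the axis is reached
    at the small parameter [s = T (rho k)]. *)
Lemma straighten (h : E -> R) (r : R) : 0 < r ->
  (forall t, `|t| < r -> smooth_at h t /\ h t != 0) ->
  exists (q : E -> E) (V0 : set E), [/\ open V0 /\ V0 0,
    q 0 = 0 /\ (forall y, V0 y -> `|q y| < r),
    forall y, V0 y -> smooth_at q y /\ (forall b, exists c, 'D_b q y = b + c *: ek),
    forall y, V0 y -> 'D_ek q y = h (q y) *: ek &
    forall e : R, 0 < e -> \forall rho \near (0 : R), exists s : R,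
      [/\ `|s| < e, V0 (s *: ek) & q (s *: ek) = rho *: ek]].
Proof.
move=> rp hh.
have shi t : `|t| < r -> smooth_at (fun t => (h t)^-1) t.
  by move=> /hh[sh h0]; exact: smooth_at_inv.
have [T HT] := @dir_antiderivative R _ (fun t => (h t)^-1) 0 r shi.
pose f (t : E) := t + (T t - t 0 0) *: ek.
have s0 (t : E) : smooth_at (fun t : E => t 0 0) t by exact: (smooth_at_coord 0 0 (smooth_at_id t)).
have sf t : `|t| < r -> smooth_at f t.
  move=> tr; apply: smooth_at_add; first exact: smooth_at_id.
  apply: smooth_at_scale; last exact: smooth_at_cst.
  by apply: smooth_at_sub; [have [] := HT _ tr|exact: s0].
have df t b : `|t| < r -> 'D_b f t = b + ('D_b T t - b 0 0) *: ek.
  move=> tr; have [sT _ _] := HT _ tr; have dT := smooth_at_diff sT.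
  apply/rowP => j; rewrite derive_entry; last exact/smooth_at_diff/sf.
  have d0 : differentiable (fun t : E => t 0 0) t by exact/smooth_at_diff/s0.
  have E0 i : 'D_b (fun t : E => t 0 i) t = b 0 i.
    by rewrite -derive_entry ?derive_id//; exact: (smooth_at_diff (smooth_at_id t)).
  have [->|j0] := eqVneq j 0.
    rewrite (_ : (fun y => f y 0 0) = T); last first.
      by apply/funext => y; rewrite !mxE eqxx mulr1 addrC subrK.
    by rewrite !mxE eqxx mulr1 addrC subrK.
  rewrite (_ : (fun y => f y 0 j) = fun y : E => y 0 j); last first.
    by apply/funext => y; rewrite !mxE (negPf j0) mulr0 addr0.
  by rewrite E0 !mxE (negPf j0) mulr0 addr0.
have r0 : `|0 : E| < r by rewrite normr0.
have f0 : f 0 = 0.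
  have [_ _ T0] := HT _ r0; by rewrite /f T0 !mxE// subrr scale0r addr0.
have inj b : 'D_b f 0 = 0 -> b = 0.
  rewrite df// => b0; have [sT DT _] := HT _ r0; have [_ h0] := hh _ r0.
  set c := _ - _ in b0; have bE : b = - c *: ek by apply/eqP; rewrite scaleNr -addr_eq0; apply/eqP.
  have D00 : 'D_(0 : E) T 0 = 0.
    exact: (is_linear0 (derive_lin (smooth_at_diff sT))).
  have Db : 'D_b T 0 = - c * (h 0)^-1.
    by have := derive_lin (smooth_at_diff sT) (- c) ek 0; rewrite !addr0 D00 addr0 -bE DT.
  have b00 : b 0 0 = - c by rewrite bE !mxE eqxx mulr1.
  have : c = - c * (h 0)^-1 + c by rewrite {1}/c Db b00 opprK.
  move/eqP; rewrite -subr_eq subrr eq_sym mulf_eq0 invr_eq0 (negPf h0) orbF oppr_eq0 => /eqP c0.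
  by rewrite bE c0 oppr0 scale0r.
have [U [V [q [[oU U0] [oV V0] sU sV [H1 H2]]]]] := inverse_function (sf _ r0) inj.
rewrite f0 in V0.
have sq y : V y -> smooth_at q y by move=> Vy; exact: smooth_on_at oV sV Vy.
have q0 : q 0 = 0 by rewrite -{1}f0; have [_ ->] := H1 _ U0.
pose W : set E := [set y | V y /\ `|q y| < r].
have nV y : V y -> \forall z \near y, V z by move=> Vy; exact: (open_nbhs_nbhs (conj oV Vy)).
have oW : open W.
  rewrite openE => y [Vy qy].
  exact: (filterI (nV _ Vy) (smooth_at_cont (sq _ Vy) (near_norm_lt qy))).
have Dq y b : W y -> let be := 'D_b q y in b = be + ('D_be T (q y) - be 0 0) *: ek.
  move=> [Vy qr] be; rewrite -df//.
  have <- : 'D_b (fun z => f (q z)) y = b.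
    rewrite (near_eq_derive (g := id)) ?derive_id//.
    by apply: filterS (nV _ Vy) => z Vz; have [_ ->] := H2 _ Vz.
  by rewrite (@derive_comp R _ _ _ q f)//; [exact/smooth_at_diff/sq|exact/smooth_at_diff/sf].
exists q, W; split.
- by split=> //; split=> //; rewrite q0.
- by split=> // y [].
- move=> y Wy; split; first by apply: sq; case: Wy.
  move=> b; exists (- ('D_('D_b q y) T (q y) - 'D_b q y 0 0)).
  by rewrite {2}(Dq y b Wy) scaleNr addrK.
- move=> y Wy; have [Vy qr] := Wy; have [sT DT _] := HT _ qr; have [_ h0] := hh _ qr.
  have := Dq y ek Wy => /=; set be := 'D_ek q y; set c := _ - _ => eE.
  have bE : be = (1 - c) *: ek by rewrite scalerBl scale1r {1}eE addrK.
  have D00 : 'D_(0 : E) T (q y) = 0.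
    exact: (is_linear0 (derive_lin (smooth_at_diff sT))).
  have Db : 'D_be T (q y) = (1 - c) * (h (q y))^-1.
    by have := derive_lin (smooth_at_diff sT) (1 - c) ek 0; rewrite !addr0 D00 addr0 -bE DT.
  have b00 : be 0 0 = 1 - c by rewrite bE !mxE eqxx mulr1.
  have cE : c = (1 - c) * (h (q y))^-1 - (1 - c) by rewrite {1}/c Db b00.
  rewrite bE; congr (_ *: _).
  have : (1 - c) * (h (q y))^-1 = 1 by rewrite -[LHS](subrK (1 - c)) -cE addrC subrK.
  by move=> /(congr1 (fun x => x * h (q y))); rewrite mulfVK// mul1r.
- move=> e e0.
  have sl := smooth_line0 ek (0 : R); have cl := smooth_at_cont sl.
  have l0 : (0 : R) *: ek = 0 by rewrite scale0r.
  have nU : \forall rho \near (0 : R), U (rho *: ek).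
    have n0 : nbhs ((0 : R) *: ek) U by rewrite l0; exact: (open_nbhs_nbhs (conj oU U0)).
    exact: (cl _ n0).
  have nr : \forall rho \near (0 : R), `|rho *: ek| < r.
    have n0 : nbhs ((0 : R) *: ek) [set z : E | `|z| < r] by rewrite l0; exact: near_norm_lt.
    exact: (cl _ n0).
  have [sT _ T0] := HT _ r0.
  have nT : \forall rho \near (0 : R), `|T (rho *: ek)| < e.
    have sTl : smooth_at (fun rho : R => T (rho *: ek)) 0.
      apply: (@smooth_at_comp R _ _ _ (fun rho : R => rho *: ek) T) => //; first exact: findim_rV.
      by rewrite l0.
    have cT := smooth_at_cont sTl.
    have ne : \forall s \near (0 : R), `|s| < e by apply: near_abs_lt; rewrite normr0.
    have n0 : nbhs (T ((0 : R) *: ek)) [set s : R | `|s| < e] by rewrite l0 T0 ?mxE.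
    exact: (cT _ n0).
  apply: filterS3 nU nr nT => rho Ur rr Te; exists (T (rho *: ek)).
  have fE : f (rho *: ek) = T (rho *: ek) *: ek.
    by rewrite /f !mxE eqxx mulr1 -scalerDl addrC subrK.
  have [Vf qf] := H1 _ Ur; rewrite fE in Vf qf.
  by split=> //; split=> //; rewrite qf.
Qed.

End Straighten.

(** * Coordinates from products of one-parameter curves *)

Section ProductCoordinates.
Context {R : realType} {N d m : nat} {K : groupType} (mK : manifold R N K)
  {H : set K} (mH : manifold R d {a : K | H a}) (mM : manifold R m.+2 (homspace H)).
Hypothesis K_lie : lie_group mK.
Hypothesis H_lie : lie_subgroup mK mH.
Hypothesis proj_submersion : submersion mK mM (@hproj K H).
Local Notation pi := (@hproj K H).
Local Notation kk := (tangent mK (1%g : K)).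
Local Notation hh := (sub_lie_algebra mK mH).
Local Notation dpi := (push mM (@hproj K H) 1%g).
Local Notation o := (hproj H (1%g : K)).
Local Notation E := 'rV[R]_m.+2.
Local Notation To := (tangent mM o).
Local Notation V := (tvec R (homspace H)).
Local Notation dL a x := (push mM (ltrans a) x).
Local Notation ek := (ek R m).
Local Notation el := (el R m).
Local Notation br := (lie_bracket mK).
Context {u : E -> V} (fu : frame mM o u).
Local Notation kap := (coframe u \o dpi).
Let ad := dpi_adapted K_lie H_lie proj_submersion fu.

Let entB (x y : E) t j : (x - t *: y) 0 j = x 0 j - t * y 0 j. Proof. by rewrite !mxE. Qed.
Let entD (x y : E) t j : (t *: x + y) 0 j = t * x 0 j + y 0 j. Proof. by rewrite !mxE. Qed.

Lemma pi_smooth x : msmooth mK mM pi x. Proof. exact: (hproj_smooth proj_submersion). Qed.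

(** Chart coordinates recombined by the inverse of the matrix of [u]. With them every component of
    [kap v] is the value of [v] on a fixed function, so statements about derivatives of tangent
    vectors become statements about components of [kap]. *)
Lemma coordinate_functions : exists f : 'I_m.+2 -> homspace H -> R,
  (forall j, smooth_near mM o (f j)) /\ forall j a, u a (f j) = a 0 j.
Proof.
have [c ac co] := atlas_cover mM o; have ci := chart_phi_img ac co.
have p := plot_cpsi ac ci; have oK := chart_phiK ac co; have [ul ui ut] := fu.
have ex i : exists b, u (delta_mx 0 i) = vel mM (cpsi c) (cphi c o) b.
  by apply: (tangent_vel _ ac co); rewrite -ut; exists (delta_mx 0 i).
pose B : 'M[R]_m.+2 := \matrix_i sval (cid (ex i)).
have uE a : u a = vel mM (cpsi c) (cphi c o) (a *m B).
  pose Mu := GRing.isLinear.Build R _ _ _ u ul; pose Mv := GRing.isLinear.Build R _ _ _ _ (vel_linear p).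
  pose Lu : {linear E -> V} := HB.pack u Mu; pose Lv : {linear E -> V} := HB.pack (vel mM (cpsi c) (cphi c o)) Mv.
  rewrite -[u]/(Lu : _ -> _) -[vel _ _ _]/(Lv : _ -> _) {1}(row_sum_delta a) linear_sum mulmx_sum_row linear_sum.
  apply: eq_bigr => i _; rewrite !linearZ /= rowK; congr (_ *: _); exact: (svalP (cid (ex i))).
have Bu : B \in unitmx.
  rewrite -row_free_unit; apply: inj_row_free => a aB; apply: ui.
  by rewrite !uE aB mul0mx.
pose f j x := (cphi c x *m invmx B) 0 j.
have sf j y : smooth_at (fun z : E => (z *m invmx B) 0 j) y.
  apply: (@smooth_at_coord R _ _ _ (fun z : E => z *m invmx B) 0 j).
  by apply: smooth_at_mulmx; [exact: smooth_at_id|exact: smooth_at_cst].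
have nE j : \forall z \near cphi c o, f j (cpsi c z) = (z *m invmx B) 0 j.
  have nc : \forall z \near cphi c o, cimg c z.
    by apply: open_nbhs_nbhs; split=> //; exact: (chart_img_open ac).
  by apply: filterS nc => z cz; rewrite /f (chart_psiK ac cz).
have snf j : smooth_near mM o (f j).
  apply: (chart_smooth_near ac co); apply: smooth_at_near (sf j (cphi c o)).
  by apply: filterS (nE j) => z ->.
exists f; split=> // j a; rewrite uE velE ?oK//.
rewrite (near_eq_derive _ (nE j)).
have [d1 d2] := derive_mulmxr (invmx B) (a *m B) (smooth_at_diff (smooth_at_id (cphi c o))).
by rewrite -derive_entry// d2 derive_id mulmxK.
Qed.

Definition cfun j : homspace H -> R := sval (cid coordinate_functions) j.
Lemma cfun_smooth j : smooth_near mM o (cfun j).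
Proof. by rewrite /cfun; case: cid => f []. Qed.
Lemma cfun_frame j a : u a (cfun j) = a 0 j.
Proof. by rewrite /cfun; case: cid => f []. Qed.

Lemma cfunK_smooth j : smooth_near mK 1%g (cfun j \o pi).
Proof. exact: (msmooth_near (pi_smooth (x := 1%g)) (cfun_smooth j)). Qed.

Lemma kap_cfun j v : kk v -> kap v 0 j = v (cfun j \o pi).
Proof.
move=> kv; rewrite -cfun_frame /= (frame_coframe fu (dpi_tangent proj_submersion kv)).
by rewrite /push; case: asboolP => // -[]; exact: cfun_smooth.
Qed.

Lemma kap_lift a : exists2 v, kk v & kap v = a. Proof. by case: ad. Qed.
Definition basis_lift j := sval (cid2 (kap_lift (delta_mx 0 j))).
Lemma basis_lift_kk j : kk (basis_lift j). Proof. by rewrite /basis_lift; case: cid2. Qed.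
Lemma basis_lift_kap j : kap (basis_lift j) = delta_mx 0 j. Proof. by rewrite /basis_lift; case: cid2. Qed.

Local Notation bb := (hypof kk kap).
Local Notation aa := (lineof kk kap).

Lemma bbP v : kk v -> (bb v <-> kap v 0 1 = 0).
Proof. by move=> kv; rewrite /hypof /=; split=> [[_ /kperpE]|/kperpE]. Qed.

Lemma br_kk v w : kk v -> kk w -> kk (br v w). Proof. exact: (lie_bracket_tangent K_lie). Qed.

Section Invariance.
Hypothesis bb_sub : forall v w, bb v -> bb w -> bb (br v w).

(* As bb is the kernel in kk of the functional lam = (kap _) 0 1, stability of bb
   under the bracket makes lam [v, z] a multiple of lam z, so lam (Ad (c t)^-1 w)
   solves a homogeneous scalar linear equation. *)
Lemma Ad_curve_bb v (c : R -> K) e t w : bb v -> c 0 = 1%g ->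
  (forall t : R, `|t| < e -> plot mK c t) ->
  (forall t : R, `|t| < e -> vel mK c t 1 = push mK (fun x => c t * x)%g 1%g v) ->
  `|t| < e -> bb w -> bb (Ad mK (c t)^-1 w).
Proof.
move=> bv c0 cp cv te bw; have [kv _] := bv; have [kw kw1] := bw.
have kz s : kk (Ad mK (c s)^-1 w) by exact: (Ad_tangent K_lie).
apply/bbP => //; pose y (s : R) := kap (Ad mK (c s)^-1 w) 0 1.
pose l := basis_lift 1; pose mu := kap (br v l) 0 1.
have kl : kk l by exact: basis_lift_kk.
have key z : kk z -> kap (br v z) 0 1 = mu * kap z 0 1.
  move=> kz'; pose b := z - kap z 0 1 *: l.
  have kb : kk b by apply: (subB (tangent_subspace mK 1%g)) => //; exact: (subZ _ (tangent_subspace mK 1%g)).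
  have Bb : bb b.
    apply/bbP => //; rewrite (adB ad) ?(adZ ad)//; last exact: (subZ _ (tangent_subspace mK 1%g)).
    by rewrite entB basis_lift_kap mxE !eqxx mulr1 subrr.
  have -> : br v z = kap z 0 1 *: br v l + br v b.
    by rewrite -(lie_bracketDr K_lie)// /b addrC subrK.
  rewrite (adD ad) ?(adZ ad)//; try (by exact: br_kk).
    have [_ /kperpE b1] := bb_sub bv Bb.
    by rewrite entD b1 addr0 mulrC.
  by apply: (subZ _ (tangent_subspace mK 1%g)); exact: br_kk.
have dy (s : R) : `|s| < e -> is_derive s 1 y ((- mu) * y s).
  move=> se; have [s1 s2] := derive_Ad_curve K_lie kv cp cv se kw (cfunK_smooth 1).
  have -> : y = fun s : R => Ad mK (c s)^-1 w (cfun 1 \o pi).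
    by apply/funext => r; exact: kap_cfun.
  rewrite -kap_cfun// mulNr -key// kap_cfun; last exact: br_kk.
  rewrite -s2; apply: derivableP; exact/diff_derivable/smooth_at_diff.
have bnd (s : R) : Num.min 0 t <= s <= Num.max 0 t -> `|s| < e.
  move=> /andP[s0 s1]; apply: le_lt_trans te.
  have [t0|t0] := leP 0 t.
    rewrite min_l// in s0; rewrite max_r// in s1.
    by rewrite !ger0_norm.
  rewrite min_r ?(ltW t0)// in s0; rewrite max_l ?(ltW t0)// in s1.
  by rewrite !ler0_norm ?(ltW t0)// lerN2.
apply: (@gronwall_zero R y (fun=> - mu) `|mu| t).
- by move=> s /bnd; exact: dy.
- by move=> s _; rewrite normrN.
- by rewrite /y c0 invg1 Ad1//; apply/(bbP kw).
Qed.

End Invariance.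

Definition basis_curve j := cid (one_parameter K_lie (basis_lift_kk j)).
Definition basis_rad j : R := sval (basis_curve j).
Definition bcurve j : R -> K := sval (cid (svalP (basis_curve j))).

Lemma bcurveP j : [/\ 0 < basis_rad j, bcurve j 0 = 1%g & forall t : R, `|t| < basis_rad j ->
  plot mK (bcurve j) t /\ vel mK (bcurve j) t (1 : R) = push mK (fun b => bcurve j t * b)%g 1%g (basis_lift j)].
Proof. by rewrite /bcurve /basis_rad; case: cid. Qed.

Definition crad : R := \big[Num.min/1]_j basis_rad j.
Lemma crad_gt0 : 0 < crad.
Proof. by rewrite /crad; apply: lt_bigmin => // j _; case: (bcurveP j). Qed.
Lemma crad_le j : crad <= basis_rad j. Proof. exact: bigmin_le. Qed.

Lemma bcurve_coord j (t : E) : `|t| < crad -> `|t 0 j| < basis_rad j.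
Proof. by move=> tr; exact: le_lt_trans (rV_coord_le t j) (lt_le_trans tr (crad_le j)). Qed.

Section Products.
Context (a : K).

Definition cprod (s : seq 'I_m.+2) (t : E) : K := foldl (fun k j => k * bcurve j (t 0 j))%g a s.

Lemma cprod_rcons s j : cprod (rcons s j) = fun t => (cprod s t * bcurve j (t 0 j))%g.
Proof. by apply/funext => t; rewrite /cprod foldl_rcons. Qed.

Lemma cprod0 s : cprod s 0 = a.
Proof.
elim/last_ind: s => [//|s j IH]; rewrite cprod_rcons IH mxE.
by have [_ -> _] := bcurveP j; rewrite mulg1.
Qed.

Lemma bcurve_plot j (t : E) : `|t| < crad -> plot mK (fun s : E => bcurve j (s 0 j)) t.
Proof.
move=> tr; apply: (@plot_comp R _ _ mK _ _ (fun s : E => s 0 j) (bcurve j)).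
- exact: findimR.
- exact: (smooth_at_coord 0 j (smooth_at_id t)).
- by have [_ _ H'] := bcurveP j; case: (H' _ (bcurve_coord j tr)).
Qed.

Lemma cprod_plot s (t : E) : `|t| < crad -> plot mK (cprod s) t.
Proof.
move=> tr; elim/last_ind: s => [|s j IH]; first exact: plot_cst.
by rewrite cprod_rcons; apply: (plot_mul K_lie) => //; exact: bcurve_plot.
Qed.

Lemma theta_rcons s j (t b : E) : `|t| < crad ->
  theta mK (cprod (rcons s j)) t b =
  Ad mK (bcurve j (t 0 j))^-1 (theta mK (cprod s) t b) + b 0 j *: basis_lift j.
Proof.
move=> tr; rewrite cprod_rcons.
rewrite (theta_mul K_lie b (findim_rV _) (cprod_plot s tr) (bcurve_plot j tr)).
have [_ _ H'] := bcurveP j; congr (_ + _).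
apply: (theta_curve K_lie (e := basis_rad j)).
- exact: basis_lift_kk.
- by move=> r /H'[].
- by move=> r /H'[].
- exact: bcurve_coord.
Qed.

Lemma theta_nil (t b : E) : theta mK (cprod [::]) t b = 0. Proof. exact: theta_cst. Qed.

Let Ad0 h : Ad mK h 0 = 0.
Proof. exact: (is_linear0 (Ad_linear mK h)). Qed.

Lemma theta0 s (b : E) : theta mK (cprod s) 0 b = \sum_(j <- s) b 0 j *: basis_lift j.
Proof.
have r0 : `|0 : E| < crad by rewrite normr0 crad_gt0.
elim/last_ind: s => [|s j IH]; first by rewrite theta_nil big_nil.
rewrite theta_rcons// -cats1 big_cat big_seq1 -IH mxE.
have [_ -> _] := bcurveP j; rewrite invg1 (Ad1 (theta_tangent K_lie b (cprod_plot s r0)))//.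
Qed.

Lemma theta_notin s (t : E) j : `|t| < crad -> j \notin s -> theta mK (cprod s) t (delta_mx 0 j) = 0.
Proof.
move=> tr; elim/last_ind: s => [|s i IH]; first by rewrite theta_nil.
rewrite mem_rcons inE negb_or => /andP[ji js]; rewrite theta_rcons// IH// Ad0 add0r.
by rewrite mxE eqxx /= eq_sym (negPf ji) scale0r.
Qed.

Definition init_seq : seq 'I_m.+2 := 1 :: [seq mx2 i | i <- enum 'I_m].
Definition gc := cprod (rcons init_seq 0).
Definition g1c := cprod init_seq.
Definition Gc t := pi (gc t).
Local Notation th := (theta mK gc).
Definition Mc (t b : E) : E := kap (th t b).

Lemma gc0 : gc 0 = a. Proof. exact: cprod0. Qed.
Lemma gc_plot (t : E) : `|t| < crad -> plot mK gc t. Proof. exact: cprod_plot. Qed.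
Lemma th_kk (t b : E) : `|t| < crad -> kk (th t b).
Proof. by move=> tr; apply: (theta_tangent K_lie); exact: gc_plot. Qed.

Lemma Mc_linear (t : E) : `|t| < crad -> is_linear (Mc t).
Proof.
move=> tr r b b'; rewrite /Mc (theta_linear K_lie (gc_plot tr)).
by have [_ _ L _ _] := ad; rewrite L//; exact: th_kk.
Qed.

Lemma theta_init_ek (t : E) : `|t| < crad -> theta mK g1c t ek = 0.
Proof.
move=> tr; apply: theta_notin => //; rewrite inE negb_or /=.
by apply/mapP => -[i _ /eqP]; rewrite mx2_0'.
Qed.

Lemma th_ek (t : E) : `|t| < crad -> th t ek = basis_lift 0.
Proof. by move=> tr; rewrite theta_rcons// theta_init_ek// Ad0 add0r mxE !eqxx scale1r. Qed.

Lemma Mc_ek (t : E) : `|t| < crad -> Mc t ek = ek.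
Proof. by move=> tr; rewrite /Mc th_ek// basis_lift_kap. Qed.

Lemma Mc0 b : Mc 0 b = b.
Proof.
rewrite /Mc theta0 -cats1 big_cat big_seq1 big_cons big_map.
have -> : \sum_(i <- enum 'I_m) b 0 (mx2 i) *: basis_lift (mx2 i) = \sum_i b 0 (mx2 i) *: basis_lift (mx2 i).
  by rewrite big_enum; apply: eq_bigl.
have tk := tangent_subspace mK (1%g : K).
have kz j c : kk (c *: basis_lift j) by apply: (subZ _ tk); exact: basis_lift_kk.
have ks : kk (\sum_i b 0 (mx2 i) *: basis_lift (mx2 i)) by exact: sub_sum.
rewrite (adD ad) ?(adD ad) ?(ad_sum ad) ?(adZ ad)//; try exact: basis_lift_kk; last by apply: (subD tk).
rewrite !basis_lift_kap addrC [RHS]rV_basis; congr (_ + (_ + _)).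
by apply: eq_bigr => i _; rewrite (adZ ad) ?basis_lift_kap//; exact: basis_lift_kk.
Qed.

Lemma Mc_smooth (t b : E) j : `|t| < crad -> smooth_at (fun t => Mc t b 0 j) t.
Proof.
move=> tr; have := theta_smooth K_lie b (findim_rV _) (gc_plot tr) (cfunK_smooth j).
apply: smooth_at_near; have nr : \forall s \near t, `|s| < crad.
  have cn : {for t, continuous (fun s : E => `|s|)} by exact: norm_continuous.
  exact: (cn _ (open_nbhs_nbhs (conj (@open_lt R crad) tr))).
by apply: filterS nr => s sr; rewrite /Mc kap_cfun//; exact: th_kk.
Qed.

Lemma vel_Gc (t b : E) : `|t| < crad -> vel mM Gc t b = dL (gc t) o (u (Mc t b)).
Proof.
move=> tr; have pg := gc_plot tr.
rewrite /Mc /= (frame_coframe fu (dpi_tangent proj_submersion (th_kk b tr))).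
rewrite -(push_hproj_lmul K_lie proj_submersion) -(vel_theta K_lie b pg).
by rewrite (@push_vel R _ _ _ _ mK mM pi _ gc t b (gc t))//; exact: pi_smooth.
Qed.

Lemma Gc_plot (t : E) : `|t| < crad -> plot mM Gc t.
Proof. by move=> tr; apply: (msmooth_plot _ (gc_plot tr)); exact: pi_smooth. Qed.

(** Induction along the product: the l-factor contributes nothing since [b 0 1 = 0], every further
    factor adds a multiple of a vector of [bb], and its Ad preserves [bb] by [Ad_curve_bb]. *)
Lemma th_bb (t b : E) : (forall v w, bb v -> bb w -> bb (br v w)) ->
  `|t| < crad -> b 0 1 = 0 -> bb (th t b).
Proof.
move=> bs tr b1; rewrite /gc /init_seq rcons_cons.
have bb0 : bb 0.
  apply/bbP; first exact: (tangent_subspace mK 1%g).1.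
  by rewrite (ad0 ad) mxE.
have Bj j : j != 1 -> bb (basis_lift j).
  by move=> j1; apply/bbP; [exact: basis_lift_kk|rewrite basis_lift_kap mxE eqxx /= eq_sym (negPf j1)].
have : all (fun j => j != 1) (rcons [seq mx2 i | i <- enum 'I_m] 0).
  rewrite all_rcons /=; apply/allP => j /mapP[i _ ->]; exact: negbT (mx2_1 i).
elim/last_ind: (rcons _ _) => [_|s j IH].
  rewrite (_ : [:: 1] = rcons [::] 1)// theta_rcons// theta_nil Ad0 b1 scale0r addr0//.
rewrite all_rcons => /andP[j1 /IH bs1]; rewrite -rcons_cons theta_rcons//.
have sB := hyp_sub ad; apply: (subD sB); last by apply: (subZ _ sB); exact: Bj.
have [_ c0 H'] := bcurveP j.
apply: (@Ad_curve_bb bs (basis_lift j) (bcurve j) (basis_rad j)) => //.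
- exact: Bj.
- by move=> r /H'[].
- by move=> r /H'[].
- exact: bcurve_coord.
Qed.

Lemma cprod_shift s (t : E) (r : R) j : j \notin s -> cprod s (r *: delta_mx 0 j + t) = cprod s t.
Proof.
elim/last_ind: s => [//|s i IH]; rewrite mem_rcons inE negb_or => /andP[ji js].
by rewrite !cprod_rcons IH// !mxE eqxx /= eq_sym (negPf ji) mulr0 add0r.
Qed.

Lemma theta_init_shift (t b : E) (r : R) : theta mK g1c (r *: ek + t) b = theta mK g1c t b.
Proof.
have ni : 0 \notin init_seq.
  by rewrite inE negb_or /=; apply/mapP => -[i _ /eqP]; rewrite mx2_0'.
apply/funext => f; rewrite /theta /vel /g1c !cprod_shift// !mulVg; case: asboolP => // _.
rewrite addrC -derive_shift_arg; congr ('D_b _ t); apply/funext => s.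
by rewrite addrC cprod_shift.
Qed.

(** Along k only the last factor of the product moves: [th] is [Ad (c t_k)^-1 w + b_k v0], where [c]
    is the curve of [v0] and [w] does not depend on [t_k]. Since [[v0, v0] = 0], the bracket with
    the first summand is the bracket with all of [th]. *)
Lemma derive_th (t b : E) f : `|t| < crad -> smooth_near mK 1%g f ->
  'D_ek (fun t => th t b f) t = - br (basis_lift 0) (th t b) f.
Proof.
move=> tr sf; have kb := basis_lift_kk 0; have pg := gc_plot tr.
have [_ c0 H'] := bcurveP 0; have t0r := bcurve_coord 0 tr.
set w := theta mK g1c t b; have kw : kk w by apply: (theta_tangent K_lie); exact: cprod_plot.
pose F (s : R) := Ad mK (bcurve 0 s)^-1 w f.
have [s1 s2] := @derive_Ad_curve _ _ _ _ K_lie (bcurve 0) (basis_rad 0) (basis_lift 0) kb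
  (fun r rr => (H' r rr).1) (fun r rr => (H' r rr).2) _ _ _ t0r kw sf.
have nr : \forall s \near (0 : R), `|s *: ek + t| < crad.
  have H2 : \forall z \near t, `|z| < crad; last first.
    have [e e0 He] := near_line ek H2.
    have ne : \forall s \near (0 : R), `|s| < e by apply: near_abs_lt; rewrite normr0.
    by apply: filterS ne => s se; rewrite addrC; exact: He.
  have cn : {for t, continuous (fun s : E => `|s|)} by exact: norm_continuous.
  exact: (cn _ (open_nbhs_nbhs (conj (@open_lt R crad) tr))).
have E1 : 'D_ek (fun t => th t b f) t = 'D_1 (fun s : R => th (s *: ek + t) b f) 0.
  by have := derive_line (fun t => th t b f) t ek (0 : R); rewrite scale0r add0r => <-.
rewrite E1 (near_eq_derive (g := fun s : R => F (s + t 0 0) + b 0 0 * basis_lift 0 f)); last first.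
  apply: filterS nr => s sr; have e0 : (s *: ek + t) 0 0 = s + t 0 0 by rewrite entD ekE eqxx mulr1.
  by rewrite /gc (theta_rcons init_seq 0 b sr) -/g1c theta_init_shift e0.
have sF : smooth_at (fun s : R => F (s + t 0 0)) 0.
  apply: (@smooth_at_comp R _ _ _ (fun s : R => s + t 0 0) F).
  - exact: findimR.
  - by apply: smooth_at_add; [exact: smooth_at_id|exact: smooth_at_cst].
  - by rewrite add0r.
have -> : 'D_1 (fun s : R => F (s + t 0 0) + b 0 0 * basis_lift 0 f) 0 = 'D_1 F (t 0 0).
  rewrite -[LHS]/('D_1 ((fun s : R => F (s + t 0 0)) + cst (b 0 0 * basis_lift 0 f)) 0).
  rewrite deriveD; [|exact/diff_derivable/smooth_at_diff|exact: derivable_cst].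
  by rewrite derive_cst addr0 (derive_shift_arg F) add0r.
rewrite s2; congr (- _).
have thE : th t b = Ad mK (bcurve 0 (t 0 0))^-1 w + b 0 0 *: basis_lift 0 :=
  theta_rcons init_seq 0 b tr.
have kA : kk (Ad mK (bcurve 0 (t 0 0))^-1 w) := Ad_tangent K_lie _ kw.
have brE := lie_bracketDr K_lie (b 0 0) kb kb kA.
have thE' : th t b = b 0 0 *: basis_lift 0 + Ad mK (bcurve 0 (t 0 0))^-1 w.
  by apply: (etrans thE); exact: addrC.
rewrite thE' brE.
have -> : br (basis_lift 0) (basis_lift 0) = 0.
  apply/eqP; have := lie_bracketC mK (basis_lift 0) (basis_lift 0).
  by move/eqP; rewrite -addr_eq0 -mulr2n -scaler_nat scaler_eq0 pnatr_eq0.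
by rewrite scaler0 add0r.
Qed.

Lemma derive_Mc (t b : E) j : `|t| < crad ->
  'D_ek (fun t => Mc t b 0 j) t = - kap (br (basis_lift 0) (th t b)) 0 j.
Proof.
move=> tr; rewrite kap_cfun; last by apply: br_kk; [exact: basis_lift_kk|exact: th_kk].
rewrite -derive_th//; last exact: cfunK_smooth.
have nr : \forall s \near t, `|s| < crad.
  have cn : {for t, continuous (fun s : E => `|s|)} by exact: norm_continuous.
  exact: (cn _ (open_nbhs_nbhs (conj (@open_lt R crad) tr))).
by apply: near_eq_derive; apply: filterS nr => s sr; rewrite /Mc kap_cfun//; exact: th_kk.
Qed.

End Products.

(* Interface of the coordinates G = pi o g around pi a: in the frame field
   dL_{g t} o u the velocities of G are given by the matrix M t, which is the
   image of the left velocity th of g. *)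
Record coord_data (a : K) (r : R) (g : E -> K) (M : E -> E -> E) (v0 : tvec R K)
    (th : E -> E -> tvec R K) : Prop := CoordData {
  cd_rad : 0 < r;
  cd_g0 : g 0 = a;
  cd_plot : forall t : E, `|t| < r -> plot mM (fun t => pi (g t)) t;
  cd_lin : forall t : E, `|t| < r -> is_linear (M t);
  cd_ek : forall t : E, `|t| < r -> M t ek = ek;
  cd_M0 : forall b, M 0 b = b;
  cd_smooth : forall (t b : E) j, `|t| < r -> smooth_at (fun t => M t b 0 j) t;
  cd_vel : forall t b : E, `|t| < r -> vel mM (fun t => pi (g t)) t b = dL (g t) o (u (M t b));
  cd_v0 : kk v0 /\ kap v0 = ek;
  cd_th : forall t b : E, `|t| < r -> kk (th t b) /\ M t b = kap (th t b);
  cd_bb : forall t b : E, (forall v w, bb v -> bb w -> bb (br v w)) -> `|t| < r ->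
    b 0 1 = 0 -> bb (th t b);
  cd_derive : forall (t b : E) j, `|t| < r ->
    'D_ek (fun t => M t b 0 j) t = - kap (br v0 (th t b)) 0 j }.

Lemma product_coordinates a : exists r g M v0 th, coord_data a r g M v0 th.
Proof.
exists crad, (gc a), (Mc a), (basis_lift 0), (theta mK (gc a)); split.
- exact: crad_gt0.
- exact: gc0.
- exact: Gc_plot.
- exact: Mc_linear.
- exact: Mc_ek.
- exact: Mc0.
- exact: Mc_smooth.
- exact: vel_Gc.
- by split; [exact: basis_lift_kk|exact: basis_lift_kap].
- by move=> t b tr; split=> //; exact: th_kk.
- by move=> t b bs tr b1; exact: th_bb.
- exact: derive_Mc.
Qed.

End ProductCoordinates.

(** * Integral manifolds *)

Section OneChart.
Context {R : realType} {n : nat} {T : Type} (V : set 'rV[R]_n) (psi : 'rV[R]_n -> T)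
  (phi : T -> 'rV[R]_n).
Hypothesis oV : open V.
Hypothesis phiV : forall x, V (phi x) /\ psi (phi x) = x.
Hypothesis psiK : forall y, V y -> phi (psi y) = y.

Let c0 : chart R n T := Chart setT V phi psi.
(** The maximal atlas generated by the single chart: everything compatible with it in both
    directions. *)
Let atl : set (chart R n T) := [set c | chart_ok c /\ (chart_compat c c0 /\ chart_compat c0 c)].

Let ok0 : chart_ok c0.
Proof. by split=> //= y Vy; split=> //; exact: psiK. Qed.

Let near_V y : V y -> \forall z \near y, V z.
Proof. by move=> Vy; exact: (open_nbhs_nbhs (conj oV Vy)). Qed.

Let compat0 : chart_compat c0 c0.
Proof.
split=> /=; first by rewrite (_ : [set y | V y /\ _] = V)//; apply/seteqP; split=> y // [].
apply: smooth_atP => y [Vy _]; apply: smooth_at_near (smooth_at_id y).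
by apply: filterS (near_V Vy) => z Vz /=; rewrite psiK.
Qed.

Let to0 c y : atl c -> cimg c y -> smooth_at (fun z => phi (cpsi c z)) y /\ \forall z \near y, cimg c z.
Proof.
move=> [[oc _ _] [[oD sD] _]] cy; split; last exact: (open_nbhs_nbhs (conj oc cy)).
by apply: smooth_on_at oD sD _.
Qed.

Let open0 B : open B -> atlas_open atl [set z | B (phi z)].
Proof.
move=> oB c ac; rewrite openE => y [cy By]; have [sy ny] := to0 ac cy.
have nB : \forall w \near phi (cpsi c y), B w by exact: (open_nbhs_nbhs (conj oB By)).
by apply: filterS2 ny (smooth_at_cont sy nB).
Qed.

(** Compatibility of two charts is obtained by passing through [c0]; separation and the countable
    basis are pulled back from the row space by the global coordinate [phi]. This supplies the
    manifold structure of integral submanifolds. *)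
Lemma one_chart_manifold : exists mT : manifold R n T, atlas mT c0.
Proof.
have a0 : atl c0 by split; [exact: ok0|split; exact: compat0].
have acov x : exists2 c, atl c & cdom c x by exists c0.
have acomp c d : atl c -> atl d -> chart_compat c d.
  move=> ac ad; have [[od _ _] [_ [oD sD]]] := ad.
  pose D1 := [set y | V y /\ cdom d (psi y)].
  have key y : cimg c y -> cdom d (cpsi c y) -> D1 (phi (cpsi c y)).
    by move=> cy dy; have [Vy pK] := phiV (cpsi c y); split=> //; rewrite pK.
  split.
    rewrite openE => y [cy dy]; have [sy ny] := to0 ac cy.
    have nD : \forall w \near phi (cpsi c y), D1 w by exact: (open_nbhs_nbhs (conj oD (key _ cy dy))).
    apply: filterS2 ny (smooth_at_cont sy nD) => z cz [Vz dz]; split=> //.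
    by move: dz; rewrite (phiV _).2.
  apply: smooth_atP => y [cy dy]; have [sy ny] := to0 ac cy.
  have : smooth_at (fun z => (cphi d \o psi) (phi (cpsi c z))) y.
    apply: (@smooth_at_comp R _ _ _ (fun z => phi (cpsi c z)) (cphi d \o psi)) => //.
      exact: findim_rV.
    by apply: smooth_on_at oD sD _; exact: key.
  by apply: smooth_at_near; apply: filterS ny => z _ /=; rewrite (phiV _).2.
have amax c : chart_ok c -> (forall d, atl d -> chart_compat c d /\ chart_compat d c) -> atl c.
  by move=> okc H; split=> //; exact: H.
have ahaus (x y : T) : x <> y -> exists U W : set T,
    [/\ atlas_open atl U, atlas_open atl W, U x, W y & U `&` W = set0].
  move=> xy; have pxy : phi x != phi y.
    by apply/eqP => e; apply: xy; rewrite -(phiV x).2 e (phiV y).2.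
  pose r := `|phi x - phi y| / 2.
  have r0 : 0 < r by rewrite divr_gt0// normr_gt0 subr_eq0.
  exists [set z | ball (phi x) r (phi z)], [set z | ball (phi y) r (phi z)]; split.
  - exact/open0/ball_open.
  - exact/open0/ball_open.
  - exact: ballxx.
  - exact: ballxx.
  - apply/seteqP; split=> z //= []; rewrite -!ball_normE /= => b1 b2.
    have := ler_distD (phi z) (phi x) (phi y); rewrite leNgt => /negP; apply.
    rewrite [`|phi z - phi y|]distrC (lt_le_trans (ltrD b1 b2))// /r -splitr//.
have asec : exists B : nat -> set T, (forall i, atlas_open atl (B i)) /\
    forall U x, atlas_open atl U -> U x -> exists i, B i x /\ B i `<=` U.
  have [B [oB HB]] := @rV_second_countable R n; exists (fun i => [set z | B i (phi z)]).
  split=> [i|U x oU Ux]; first exact: open0.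
  have oW := oU _ a0; have Wx : [set y | V y /\ U (psi y)] (phi x).
    by have [Vx pK] := phiV x; split=> //; rewrite pK.
  have [i [Bi BW]] := HB _ _ oW Wx.
  exists i; split=> // z /BW[_ /=]; by rewrite (phiV _).2.
have aok c : atl c -> chart_ok c by case.
by exists (@Manifold R n T atl aok acov acomp amax ahaus asec).
Qed.

End OneChart.

Section LocalCoordinates.
Context {R : realType}.

Definition local_coord n T (mT : manifold R n T) (G : 'rV[R]_n -> T) O U (Gi : T -> 'rV[R]_n) :=
  [/\ open O, mopen mT U,
    forall t, O t -> [/\ plot mT G t, U (G t) & Gi (G t) = t],
    forall x, U x -> O (Gi x) /\ G (Gi x) = x &
    forall (E : normedModType R) (h : E -> T) z, plot mT h z -> U (h z) ->
      smooth_at (fun z => Gi (h z)) z].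

Section OneManifold.
Context {n : nat} {T : Type} {mT : manifold R n T} {G : 'rV[R]_n -> T} {O U Gi}
  (lc : local_coord mT G O U Gi).

Lemma local_coord_near x j : U x -> smooth_near mT x (fun y => Gi y 0 j).
Proof.
move=> Ux; apply: smooth_nearP => h y hy ph; have [_ _ _ _ sG] := lc.
by apply: (smooth_at_coord 0 j); apply: sG => //; rewrite hy.
Qed.

Lemma local_coord_fun x (F : 'rV[R]_n -> R) : U x -> smooth_at F (Gi x) ->
  smooth_near mT x (fun y => F (Gi y)).
Proof.
move=> Ux sF; apply: smooth_nearP => h y hy ph; have [_ _ _ _ sG] := lc.
apply: (@smooth_at_comp R _ _ _ (fun z => Gi (h z)) F); first exact: findim_rV.
  by apply: sG => //; rewrite hy.
by rewrite hy.
Qed.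

Lemma near_O t : O t -> \forall s \near t, O s.
Proof. by move=> Ot; have [oO _ _ _ _] := lc; exact: (open_nbhs_nbhs (conj oO Ot)). Qed.

Lemma vel_local t b F : O t -> smooth_at F t -> vel mT G t b (fun x => F (Gi x)) = 'D_b F t.
Proof.
move=> Ot sF; have [_ _ HO _ _] := lc; have [pt Ut Gt] := HO _ Ot.
rewrite velE; last by apply: local_coord_fun => //; rewrite Gt.
by apply: near_eq_derive; apply: filterS (near_O Ot) => s /HO[_ _ ->].
Qed.

Lemma vel_local_coord t b j : O t -> vel mT G t b (fun x => Gi x 0 j) = b 0 j.
Proof.
move=> Ot; rewrite (vel_local b (F := fun t => t 0 j) Ot); last exact: (smooth_at_coord 0 j (smooth_at_id t)).
by rewrite -derive_entry ?derive_id//; exact: (smooth_at_diff (smooth_at_id t)).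
Qed.

Lemma vel_local_inj t a b : O t -> vel mT G t a = vel mT G t b -> a = b.
Proof.
move=> Ot ab; apply/rowP => j; rewrite -(vel_local_coord a j Ot) ab.
exact: vel_local_coord.
Qed.

Lemma vel_local_full t v : O t -> tangent mT (G t) v -> exists a, vel mT G t a = v.
Proof.
move=> Ot; have [_ _ HO _ _] := lc; have [pt Ut Gt] := HO _ Ot.
apply: vel_full => // a a0; apply: (vel_local_inj Ot); by rewrite a0 (vel0 pt).
Qed.

End OneManifold.

Section Plaque.
Context {m : nat} {T : Type} {mT : manifold R m.+2 T} {G : 'rV[R]_m.+2 -> T} {O U Gi}
  (lc : local_coord mT G O U Gi).

(* Its transpose embeds R^(m+1) as the hyperplane where coordinate 1, the
   coefficient of l, vanishes. *)
Definition dropmx : 'M[R]_(m.+2, m.+1) := \matrix_(i, j) (i == lift 1 j)%:R.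

Lemma dropE (t : 'rV[R]_m.+2) j : (t *m dropmx) 0 j = t 0 (lift 1 j).
Proof.
rewrite mxE (bigD1 (lift 1 j))//= big1 ?addr0; first by rewrite mxE eqxx mulr1.
by move=> i ij; rewrite mxE (negPf ij) mulr0.
Qed.

Lemma embE (y : 'rV[R]_m.+1) j : (y *m dropmx^T) 0 (lift 1 j) = y 0 j.
Proof.
rewrite mxE (bigD1 j)//= big1 ?addr0; first by rewrite !mxE eqxx mulr1.
by move=> i ij; rewrite !mxE (inj_eq (@lift_inj _ _)) eq_sym (negPf ij) mulr0.
Qed.

Lemma emb1 (y : 'rV[R]_m.+1) : (y *m dropmx^T) 0 1 = 0.
Proof.
rewrite mxE big1// => i _; rewrite !mxE (_ : (1 == lift 1 i) = false) ?mulr0//.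
by apply/negbTE; exact: neq_lift.
Qed.

Lemma embK (y : 'rV[R]_m.+1) : y *m dropmx^T *m dropmx = y.
Proof. by apply/rowP => j; rewrite dropE embE. Qed.

Lemma dropK (t : 'rV[R]_m.+2) : t 0 1 = 0 -> t *m dropmx *m dropmx^T = t.
Proof.
move=> t1; apply/rowP => i; case: (unliftP 1 i) => [j|] ->; first by rewrite embE dropE.
by rewrite emb1 t1.
Qed.

Lemma smooth_mulmxr k l (B : 'M[R]_(k, l)) (y : 'rV[R]_k) : smooth_at (fun y : 'rV[R]_k => y *m B) y.
Proof. by apply: smooth_at_mulmx; [exact: smooth_at_id|exact: smooth_at_cst]. Qed.

Lemma derive_mulmxr_id k l (B : 'M[R]_(k, l)) (y a : 'rV[R]_k) :
  'D_a (fun y : 'rV[R]_k => y *m B) y = a *m B.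
Proof.
by have [_ ->] := derive_mulmxr B a (smooth_at_diff (smooth_at_id y)); rewrite derive_id.
Qed.

(** The slice of the coordinates where the l-coordinate is 0, with [Gi] followed by dropping that
    coordinate as its only chart. *)
Lemma plaque t0 : O t0 -> t0 0 1 = 0 ->
  exists (S : set T) (mS : manifold R m.+1 {x : T | S x}),
    [/\ S (G t0) /\ S `<=` U, immersion mS mT sval &
      forall y, push mT sval y @` tangent mS y =
        vel mT G (Gi (sval y)) @` [set b : 'rV[R]_m.+2 | b 0 1 = 0]].
Proof.
move=> Ot0 t01; have [oO oU HO HU sG] := lc.
pose S := [set x | exists t, [/\ O t, t 0 1 = 0 & x = G t]].
have S0 : S (G t0) by exists t0.
pose Vs := [set y : 'rV[R]_m.+1 | O (y *m dropmx^T)].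
(* A chart needs a total inverse; the point [S0] is the value outside [Vs]. *)
pose psi (y : 'rV[R]_m.+1) : {x : T | S x} :=
  match pselect (S (G (y *m dropmx^T))) with left s => exist _ _ s | right _ => exist _ _ S0 end.
pose phi (z : {x : T | S x}) := Gi (sval z) *m dropmx.
have psiE y : Vs y -> sval (psi y) = G (y *m dropmx^T).
  move=> Vy; rewrite /psi; case: pselect => // nS; exfalso; apply: nS.
  by exists (y *m dropmx^T); split=> //; exact: emb1.
have SE (z : {x : T | S x}) : exists t, [/\ O t, t 0 1 = 0, sval z = G t & Gi (sval z) = t].
  have [t [Ot t1 zt]] : S (sval z) := svalP z.
  by exists t; split=> //; rewrite zt; case: (HO _ Ot).
have sub_eq (z z' : {x : T | S x}) : sval z = sval z' -> z = z'.
  by case: z z' => [z hz] [z' hz'] /= e; subst z'; congr exist; exact: Prop_irrelevance.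
have oVs : open Vs.
  rewrite openE => y Vy.
  exact: (smooth_at_cont (smooth_mulmxr dropmx^T y) (near_O lc Vy)).
have phiV (z : {x : T | S x}) : Vs (phi z) /\ psi (phi z) = z.
  have [t [Ot t1 zt Gz]] := SE z.
  have Vz : Vs (phi z) by rewrite /Vs /= /phi Gz dropK.
  by split=> //; apply: sub_eq; rewrite psiE// /phi Gz dropK.
have psiK y : Vs y -> phi (psi y) = y.
  by move=> Vy; rewrite /phi psiE//; have [_ _ ->] := HO _ Vy; rewrite embK.
have [mS ac] := one_chart_manifold oVs phiV psiK.
have ppsi (z : {x : T | S x}) : plot mS psi (phi z) by exact: (plot_cpsi ac (phiV z).1).
have nearV (z : {x : T | S x}) : \forall y \near phi z, Vs y by exact: (open_nbhs_nbhs (conj oVs (phiV z).1)).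
have pG (z : {x : T | S x}) : plot mT (fun y => G (y *m dropmx^T)) (phi z).
  apply: (@plot_comp R _ _ mT _ _ (fun y : 'rV[R]_m.+1 => y *m dropmx^T) G).
  - exact: findim_rV.
  - exact: smooth_mulmxr.
  - by have [] := HO _ (phiV z).1.
have sv (z : {x : T | S x}) : msmooth mS mT sval z.
  apply: (@msmoothP R _ _ _ _ mS mT sval z _ ac) => //.
  by apply: eq_plot (pG z); apply: filterS (nearV z) => y /psiE /= ->.
have tE (z : {x : T | S x}) v : tangent mS z v -> exists a, v = vel mS psi (phi z) a.
  by move=> tv; exact: (tangent_vel tv ac).
have embz (z : {x : T | S x}) : phi z *m dropmx^T = Gi (sval z).
  by have [t [Ot t1 zt Gz]] := SE z; rewrite /phi Gz dropK.
have Oz (z : {x : T | S x}) : O (Gi (sval z)) by have [t [Ot t1 zt ->]] := SE z.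
have pushE (z : {x : T | S x}) a : push mT sval z (vel mS psi (phi z) a) = vel mT G (Gi (sval z)) (a *m dropmx^T).
  rewrite (@push_vel R _ _ _ _ mS mT sval _ psi (phi z) a z (phiV z).2 (sv z)).
  have -> : vel mT (fun y => sval (psi y)) (phi z) a = vel mT (fun y => G (y *m dropmx^T)) (phi z) a.
    by apply: eq_vel; apply: filterS (nearV z) => y /psiE.
  have pGz : plot mT G (phi z *m dropmx^T) by rewrite embz; case: (HO _ (Oz z)).
  rewrite (@vel_comp R _ _ mT _ _ (fun y : 'rV[R]_m.+1 => y *m dropmx^T) G (phi z) a (smooth_mulmxr _ _) pGz).
  by rewrite derive_mulmxr_id embz.
exists S, mS; split=> //.
- by split=> // x [t [Ot _ ->]]; case: (HO _ Ot).
- split; first by apply/smooth_mapP.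
  move=> z v w /tE[a ->] /tE[b ->]; rewrite !pushE => /(vel_local_inj lc (Oz z)) /(congr1 (mulmx^~ dropmx)).
  by rewrite /= !embK => ->.
- move=> z; apply/seteqP; split=> v.
  by move=> [w /tE[a ->] <-]; rewrite pushE; exists (a *m dropmx^T) => //=; exact: emb1.
move=> [b b1 <-]; exists (vel mS psi (phi z) (b *m dropmx)).
  by have := vel_tangent (b *m dropmx) (ppsi z); rewrite (phiV z).2.
by rewrite pushE dropK.
Qed.

End Plaque.
End LocalCoordinates.

(** * Kundt structures *)

Section Flows.
Context {R : realType} {n : nat} {T : Type} (mT : manifold R n T).
Context {U : set T} {X : T -> tvec R T} {e : R} {W : set T} {Phi : R -> T -> T}.
Hypothesis lf : local_flow mT U X e W Phi.

Lemma flow_plot (E : normedModType R) (h : E -> T) z (s : R) : findim E -> plot mT h z ->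
  `|s| < e -> W (h z) -> plot mT (fun p : R * E => Phi p.1 (h p.2)) (s, z).
Proof.
move=> fE ph se Wz; have [[e0 oW WU] [P0 PU PD PS]] := lf.
have [c [ac nc sc]] := ph; have cz := nbhs_singleton nc.
have [d ad dz] := atlas_cover mT (Phi s (h z)).
have [oD sD] := PS c d ac ad; set D := [set p | _] in oD sD.
pose k (p : R * E) : R * 'rV[R]_n := (p.1, cphi c (h p.2)).
have sk : smooth_at k (s, z).
  apply: smooth_at_pair; first exact: smooth_at_fst.
  apply: (@smooth_at_comp R _ _ _ (snd : R * E -> E) (fun z => cphi c (h z))) => //.
  exact: smooth_at_snd.
have Dk : D (k (s, z)).
  rewrite /D /k /= (chart_phiK ac cz); split=> //; exact: (chart_phi_img ac cz).
have nD : \forall p \near (s, z), D (k p).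
  exact: (smooth_at_cont sk (open_nbhs_nbhs (conj oD Dk))).
have np : \forall p \near (s, z), cdom c (h p.2).
  exact: (smooth_at_cont (smooth_at_snd (s, z)) nc).
exists d; split=> //.
  by apply: filterS2 nD np => p [_ _ _ /= dp] cp; move: dp; rewrite (chart_phiK ac cp).
have sc' : smooth_at (fun p => (cphi d \o (fun p : R * 'rV[R]_n => Phi p.1 (cpsi c p.2))) (k p)) (s, z).
  apply: (@smooth_at_comp R _ _ _ k (cphi d \o (fun p : R * 'rV[R]_n => Phi p.1 (cpsi c p.2)))) => //.
    by apply: findim_prod; [exact: findimR|exact: findim_rV].
  exact: smooth_on_at oD sD Dk.
by apply: smooth_at_near sc'; apply: filterS np => p cp /=; rewrite (chart_phiK ac cp).
Qed.

Lemma flow_msmooth s x : `|s| < e -> W x -> msmooth mT mT (Phi s) x.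
Proof.
move=> se Wx; have [c ac cx] := atlas_cover mT x.
have pc := plot_cpsi ac (chart_phi_img ac cx); apply: (msmoothP ac cx).
have Wc : W (cpsi c (cphi c x)) by rewrite (chart_phiK ac cx).
have pp := flow_plot (findim_rV _) pc se Wc.
apply: (@plot_comp R _ _ mT _ _ (fun z : 'rV[R]_n => (s, z)) (fun p => Phi p.1 (cpsi c p.2))) => //.
  by apply: findim_prod; [exact: findimR|exact: findim_rV].
by apply: smooth_at_pair; [exact: smooth_at_cst|exact: smooth_at_id].
Qed.

(** The function [F (Phi s x) - c s] has derivative zero in [s]. It serves with [c = 0] for the
    coordinates left fixed by a flow and with [c = 1] for the one that measures time. *)
Lemma flow_affine (F : T -> R) (c s : R) x : (forall y, U y -> smooth_near mT y F /\ X y F = c) ->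
  W x -> `|s| < e -> F (Phi s x) = F x + c * s.
Proof.
move=> HF Wx se; have [[e0 oW WU] [P0 PU PD PS]] := lf.
have dF (r : R) : `|r| < e -> is_derive r 1 (fun r => F (Phi r x) - c * r) 0.
  move=> re; have [sF XF] := HF _ (PU r x re Wx).
  have d1 := PD r x F re Wx sF; rewrite XF in d1.
  have d2 := is_deriveZ c (is_derive_id r (1 : R)).
  have := is_deriveB d1 d2; rewrite -[c *: 1]/(c * 1) mulr1 subrr; exact.
have bd (u : R) : Num.min 0 s <= u <= Num.max 0 s -> `|(0 : R)| <= 0 by rewrite normr0.
have := @derive_increment_bound R (fun r => F (Phi r x) - c * r) (fun=> 0) 0 0 s e dF.
rewrite {1}normr0 => /(_ e0 se bd).
rewrite mul0r normr_le0 P0// mulr0 subr0 => /eqP H0; lra.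
Qed.

End Flows.

(** * The velocity matrix along the k-coordinate *)

Section ProductFlow.
Context {R : realType} {N d m : nat} {K : groupType} {mK : manifold R N K}
  {H : set K} {mH : manifold R d {a : K | H a}} {mM : manifold R m.+2 (homspace H)}.
Hypothesis K_lie : lie_group mK.
Hypothesis H_lie : lie_subgroup mK mH.
Hypothesis proj_submersion : submersion mK mM (@hproj K H).
Local Notation pi := (@hproj K H).
Local Notation kk := (tangent mK (1%g : K)).
Local Notation hh := (sub_lie_algebra mK mH).
Local Notation dpi := (push mM (@hproj K H) 1%g).
Local Notation o := (hproj H (1%g : K)).
Local Notation E := 'rV[R]_m.+2.
Local Notation To := (tangent mM o).
Local Notation V := (tvec R (homspace H)).
Local Notation dL a x := (push mM (ltrans a) x).
Local Notation ek := (ek R m).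
Local Notation el := (el R m).
Local Notation br := (lie_bracket mK).
Context {u : E -> V} (fu : frame mM o u).
Local Notation kap := (coframe u \o dpi).
Local Notation bb := (hypof kk kap).
Local Notation aa := (lineof kk kap).
Let ad := dpi_adapted K_lie H_lie proj_submersion fu.
Context {a : K} {r0 : R} {g : E -> K} {M : E -> E -> E} {v0 : tvec R K} {th : E -> E -> tvec R K}
  (cd : coord_data mK mM (u := u) a r0 g M v0 th).
Local Notation G := (fun t => pi (g t)).
Local Notation FR t := (dL (g t) o \o u).

Let M0 b : M 0 b = b := cd_M0 cd b.
Let Mlin t : `|t| < r0 -> is_linear (M t) := @cd_lin _ _ _ _ _ _ _ _ _ _ _ _ _ _ cd t.
Let Msmooth t b j : `|t| < r0 -> smooth_at (fun t => M t b 0 j) t := @cd_smooth _ _ _ _ _ _ _ _ _ _ _ _ _ _ cd t b j.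
Let r00 : `|0 : E| < r0. Proof. by rewrite normr0; exact: (cd_rad cd). Qed.

Let entD (x y : E) t j : (t *: x + y) 0 j = t * x 0 j + y 0 j. Proof. by rewrite !mxE. Qed.
Let entB (x y : E) t j : (x - t *: y) 0 j = x 0 j - t * y 0 j. Proof. by rewrite !mxE. Qed.

Lemma segment_ball (t t' : E) (r c : R) : 0 <= c <= 1 -> `|t| < r -> `|t'| < r ->
  `|t + c *: (t' - t)| < r.
Proof.
move=> /andP[c0 c1] tr tr'; have -> : t + c *: (t' - t) = (1 - c) *: t + c *: t'.
  by rewrite scalerBr scalerBl scale1r addrCA addrA addrC -addrA addrA addrC.
apply: le_lt_trans (ler_normD _ _) _; rewrite !normrZ (ger0_norm c0) ger0_norm ?subr_ge0//.
have [c0'|c0'] := eqVneq c 0; first by rewrite c0' subr0 mul1r mul0r addr0.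
have cp : 0 < c by rewrite lt0r c0' c0.
have h1 : (1 - c) * `|t| <= (1 - c) * r by rewrite ler_wpM2l ?subr_ge0// ltW.
have h2 : c * `|t'| < c * r by rewrite ltr_pM2l.
by have -> : r = (1 - c) * r + c * r by [ring]; exact: ler_ltD.
Qed.

Lemma FR_frame t : frame mM (G t) (FR t).
Proof.
have [ul ui ut] := fu; have tu b : To (u b) by rewrite -ut; exists b.
have GE : ltrans (g t) o = G t by rewrite ltrans_o.
split.
- by move=> c b b' /=; rewrite ul push_linear.
- by move=> b b' /= /(dL_inj K_lie proj_submersion (tu b) (tu b')) /ui.
- apply/seteqP; split=> w.
    by move=> [b _ <-] /=; rewrite -GE; exact: (dL_tangent K_lie proj_submersion).
  move=> tw; have := dL_tangent K_lie proj_submersion (g t)^-1%g tw.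
  rewrite -GE ltransM mulVg ltrans1 -ut => -[b _ bE]; exists b => //=; rewrite bE.
  have := dLK K_lie proj_submersion (g t)^-1%g tw.
  by rewrite invgK -{1 2}GE ltransM mulVg ltrans1 GE.
Qed.

Lemma vel_FR (t b : E) : `|t| < r0 -> vel mM G t b = FR t (M t b).
Proof. exact: (cd_vel cd). Qed.

Lemma G_coord (A : set E) : nbhs (0 : E) A -> exists O U Gi,
  [/\ local_coord mM G O U Gi, O 0 & forall t, O t -> A t /\ `|t| < r0].
Proof.
move=> nA; have [ul ui ut] := fu; have tu b : To (u b) by rewrite -ut; exists b.
have u0 : u 0 = 0 by exact: (is_linear0 ul).
have inj (b : E) : vel mM G 0 b = 0 -> b = 0.
  move=> b0; have [fl fi _] := FR_frame 0; apply: fi.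
  rewrite -{1}(M0 b) -(vel_FR _ r00) b0.
  by exact: (esym (is_linear0 fl)).
have nA' : nbhs (0 : E) (A `&` [set t | `|t| < r0]).
  by apply: filterI => //; exact: near_norm_lt.
have [D0 [U [Gi [[[oO O0] OA] oU HO HU sG]]]] := inverse_plot (cd_plot cd r00) inj nA'.
by exists D0, U, Gi; split.
Qed.

Section Hyp.
Hypothesis bs : forall v w, bb v -> bb w -> bb (br v w).

Definition omega (t : E) : R := M t el 0 1.

Lemma omega_smooth t : `|t| < r0 -> smooth_at omega t.
Proof. exact: Msmooth. Qed.

Lemma omega0 : omega 0 = 1.
Proof. by rewrite /omega M0 elE eqxx. Qed.

Lemma near_omega : \forall t \near (0 : E), omega t != 0.
Proof.
have c := smooth_at_cont (omega_smooth r00).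
apply: (c (fun x => x != 0)); rewrite omega0; apply: open_nbhs_nbhs; split; last exact: oner_neq0.
exact: open_neq.
Qed.

Lemma M_kperp t b : `|t| < r0 -> kperp b -> kperp (M t b).
Proof.
move=> tr /kperpE b1; have [_ ->] := cd_th cd b tr.
by have [] := cd_bb cd bs tr b1.
Qed.

(** Since [M t] preserves k^perp when [bb] is a subalgebra, the l-component of [M t b] only sees the
    l-component of [b]. *)
Lemma M_1 t b : `|t| < r0 -> M t b 0 1 = b 0 1 * omega t.
Proof.
move=> tr; have Ml := Mlin tr; pose b' := b - b 0 1 *: el.
have k' : kperp b' by apply/kperpE; rewrite entB elE eqxx mulr1 subrr.
have /kperpE e1 := M_kperp tr k'.
have E1 : M t b = b 0 1 *: M t el + M t b' by rewrite -Ml /b' addrC subrK.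
by rewrite E1 entD e1 addr0.
Qed.

Lemma v0_aa : aa v0.
Proof.
have [kv vk] := cd_v0 cd; split=> //; exists 1; by rewrite scale1r.
Qed.

Definition M_form (b b' s : E) : R := \sum_i M s b 0 (mx2 i) * M s b' 0 (mx2 i).

Lemma M_formE s b b' : `|s| < r0 -> kperp b -> kperp b' -> eta (M s b) (M s b') = M_form b b' s.
Proof. by move=> sr kb kb'; rewrite eta_kperp//; exact: M_kperp. Qed.

(** Along k the derivative of the Gram form is minus the symmetrized pairing whose vanishing is
    skewness of [ad v0]. One implication integrates this identity, the other evaluates it at 0. *)
Lemma M_form_derive s b b' : `|s| < r0 -> kperp b -> kperp b' -> differentiable (M_form b b') s /\
  'D_ek (M_form b b') s = - (eta (kap (th s b)) (kap (br v0 (th s b'))) +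
                            eta (kap (br v0 (th s b))) (kap (th s b'))).
Proof.
move=> sr kb kb'.
have sM c i : differentiable (fun s => M s c 0 i) s by exact/smooth_at_diff/Msmooth.
have FE' : M_form b b' = \sum_i ((fun s => M s b 0 (mx2 i)) * (fun s => M s b' 0 (mx2 i))).
  by apply/funext => y; rewrite fct_sumE.
have dm i : differentiable ((fun s => M s b 0 (mx2 i)) * (fun s => M s b' 0 (mx2 i))) s.
  by apply: differentiableM; exact: sM.
split; first by rewrite FE'; apply: differentiable_sum.
rewrite FE' derive_sum; last by move=> i; exact: diff_derivable.
have Bv := v0_aa; have B0 := line_hyp Bv.
have /kperpE b1 := kb; have /kperpE b1' := kb'.
have Bt := cd_bb cd bs sr b1; have Bt' := cd_bb cd bs sr b1'.
have [_ Mt] := cd_th cd b sr; have [_ Mt'] := cd_th cd b' sr.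
have [[kt kt1] [kt' kt1']] := conj Bt Bt'.
have [[kb0 kb1] [kb0' kb1']] := conj (bs B0 Bt) (bs B0 Bt').
rewrite (eta_kperp kb1 kt1') (eta_kperp kt1 kb1').
have Di i : 'D_ek ((fun s => M s b 0 (mx2 i)) * (fun s => M s b' 0 (mx2 i))) s =
    - (kap (th s b) 0 (mx2 i) * kap (br v0 (th s b')) 0 (mx2 i)) -
    kap (br v0 (th s b)) 0 (mx2 i) * kap (th s b') 0 (mx2 i).
  rewrite deriveM; [|exact/diff_derivable/sM..].
  rewrite (cd_derive cd b _ sr) (cd_derive cd b' _ sr).
  rewrite -[X in X + _]/(M s b 0 (mx2 i) * - kap (br v0 (th s b')) 0 (mx2 i)).
  rewrite -[X in _ + X]/(M s b' 0 (mx2 i) * - kap (br v0 (th s b)) 0 (mx2 i)).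
  by rewrite Mt Mt' !mulrN; congr (_ - _); exact: mulrC.
by rewrite (eq_bigr _ (fun i _ => Di i)) sumrB sumrN opprD.
Qed.

Section Skew.
Hypothesis sk : forall v w z, aa v -> bb w -> bb z ->
  eta (kap (br v w)) (kap z) = - eta (kap w) (kap (br v z)).

(** Under skewness the Gram form has derivative zero along k, hence is constant on segments in that
    direction by the mean value theorem. *)
Lemma M_isometry (t b b' : E) (r : R) : `|t| < r0 -> `|r *: ek + t| < r0 -> kperp b -> kperp b' ->
  eta (M (r *: ek + t) b) (M (r *: ek + t) b') = eta (M t b) (M t b').
Proof.
move=> tr tr' kb kb'; rewrite !M_formE//; set F := M_form b b'.
have /kperpE b1 := kb; have /kperpE b1' := kb'.
have dsum s : `|s| < r0 -> differentiable F s /\ 'D_ek F s = 0.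
  move=> sr; have [dF ->] := M_form_derive sr kb kb'; split=> //.
  by rewrite (sk v0_aa (cd_bb cd bs sr b1) (cd_bb cd bs sr b1')) subrr oppr0.
have [|c c01] := @mvt_segment R E F t (r *: ek).
  move=> c c01; apply: (dsum _ _).1.
  have := segment_ball c01 tr tr'; by rewrite addrK.
have sb := segment_ball c01 tr tr'; rewrite addrK in sb.
have [dF D0] := dsum _ sb.
have -> : 'D_(r *: ek) F (t + c *: (r *: ek)) = 0.
  have Fz : 'D_(0 : E) F (t + c *: (r *: ek)) = 0.
    exact: (is_linear0 (derive_lin dF)).
  have := derive_lin dF r ek 0; by rewrite addr0 D0 Fz scaler0 addr0.
by move=> /eqP; rewrite subr_eq0 [t + _]addrC => /eqP.
Qed.

End Skew.
End Hyp.
End ProductFlow.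

(** * From the algebraic conditions to a Kundt structure *)

Section BijectiveFromConditions.
Context {R : realType} {m : nat}.
Local Notation E := 'rV[R]_m.+2.
Local Notation ek := (ek R m).

(** For bijectivity, a kernel vector has l-component 0 by the last hypothesis, so it lies in k^perp
    and is isotropic, hence a multiple of k; and [al] cannot vanish. *)
Lemma GN_of_scaling (A : E -> E) (al : R) : is_linear A -> A ek = al *: ek ->
  (forall w w', kperp w -> kperp w' -> eta (A w) (A w') = eta w w') ->
  (forall z, al * A z 0 1 = z 0 1) -> @GN R m A.
Proof.
move=> Al Ak Ae A1.
have A3 z : eta (A ek) (A z) = eta ek z by rewrite Ak etaZl !eta_ek A1.
have al0 : al != 0.
  apply/eqP => a0; have := A1 (el R m); rewrite a0 mul0r elE eqxx => /eqP.
  by rewrite eq_sym oner_eq0.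
have A0 : A 0 = 0 by exact: (is_linear0 Al).
have AZ c : A (c *: ek) = (c * al) *: ek by rewrite -[c *: ek]addr0 Al A0 addr0 Ak scalerA.
have inj z : A z = 0 -> z = 0.
  move=> Az; have kz : kperp z by apply/kperpE; rewrite -A1 Az mxE mulr0.
  apply: contrapT => z0.
  have : 0 < eta z z.
    apply: eta_pos => // t zt; apply: z0; move: Az; rewrite zt AZ.
    move=> /rowP/(_ 0); rewrite mxE ekE eqxx mulr1 mxE => /eqP.
    by rewrite mulf_eq0 (negPf al0) orbF => /eqP ->; rewrite scale0r.
  by rewrite -Ae// Az eta0r ltxx.
split=> //; last by exists al.
pose MA := GRing.isLinear.Build R _ _ _ A Al; pose LA : {linear E -> E} := HB.pack A MA.
pose B := lin1_mx LA; have AE z : A z = z *m B by rewrite (mul_rV_lin1 LA).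
have Bu : B \in unitmx.
  by rewrite -row_free_unit; apply: inj_row_free => z; rewrite -AE; exact: inj.
by exists (mulmx^~ (invmx B)) => z; rewrite AE ?mulmxK ?mulmxKV.
Qed.

End BijectiveFromConditions.

Section KundtFromConditions.
Context {R : realType} {N d m : nat} {K : groupType} {mK : manifold R N K}
  {H : set K} {mH : manifold R d {a : K | H a}} {mM : manifold R m.+2 (homspace H)}.
Hypothesis K_lie : lie_group mK.
Hypothesis H_lie : lie_subgroup mK mH.
Hypothesis proj_submersion : submersion mK mM (@hproj K H).
Local Notation pi := (@hproj K H).
Local Notation kk := (tangent mK (1%g : K)).
Local Notation hh := (sub_lie_algebra mK mH).
Local Notation dpi := (push mM (@hproj K H) 1%g).
Local Notation o := (hproj H (1%g : K)).
Local Notation E := 'rV[R]_m.+2.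
Local Notation To := (tangent mM o).
Local Notation V := (tvec R (homspace H)).
Local Notation dL a x := (push mM (ltrans a) x).
Local Notation ek := (ek R m).
Local Notation el := (el R m).
Local Notation br := (lie_bracket mK).
Context {u : E -> V} (fu : frame mM o u).
Local Notation kap := (coframe u \o dpi).
Local Notation bb := (hypof kk kap).
Local Notation aa := (lineof kk kap).
Let ad := dpi_adapted K_lie H_lie proj_submersion fu.
Context {a : K} {r0 : R} {g : E -> K} {M : E -> E -> E} {v0 : tvec R K} {th : E -> E -> tvec R K}
  (cd : coord_data mK mM (u := u) a r0 g M v0 th).
Local Notation G := (fun t => pi (g t)).
Local Notation FR t := (dL (g t) o \o u).

Let entD (x y : E) t j : (t *: x + y) 0 j = t * x 0 j + y 0 j. Proof. by rewrite !mxE. Qed.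

Hypothesis bs : forall v w, bb v -> bb w -> bb (br v w).
Local Notation om := (omega (M := M)).

Section Coordinates.
Context {D0 : set E} {U : set (homspace H)} {Gi : homspace H -> E}.
Hypothesis lc : local_coord mM G D0 U Gi.
Hypothesis D0r : forall t, D0 t -> `|t| < r0 /\ om t != 0.

Lemma D0_full t z : D0 t -> exists b, z = M t b.
Proof.
move=> Dt; have [tr _] := D0r Dt; have [fl fi ft] := FR_frame K_lie proj_submersion fu (g := g) t.
have tz : tangent mM (G t) (FR t z) by rewrite -ft; exists z.
have [b bz] := vel_local_full lc Dt tz; exists b; apply: fi.
by rewrite -bz (vel_FR cd).
Qed.

Lemma D0_kperp t b : D0 t -> kperp (M t b) -> kperp b.
Proof.
move=> Dt /kperpE; have [tr o0] := D0r Dt; rewrite (M_1 cd bs b tr) => /eqP.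
by rewrite mulf_eq0 (negPf o0) orbF => /eqP /kperpE.
Qed.

Lemma D0_hyp t : D0 t -> FR t @` @kperp R m = vel mM G t @` [set b : E | b 0 1 = 0].
Proof.
move=> Dt; have [tr _] := D0r Dt; apply/seteqP; split=> w.
  move=> [z kz <-]; have [b zb] := D0_full z Dt; rewrite zb in kz *; exists b.
    by apply/kperpE; exact: D0_kperp Dt kz.
  by rewrite (vel_FR cd).
move=> [b /kperpE kb <-]; exists (M t b); first exact: (M_kperp cd bs).
by rewrite (vel_FR cd).
Qed.

Definition kundt_field (y : homspace H) : V := vel mM G (Gi y) ((om (Gi y))^-1 *: ek).

Lemma kundt_fieldE t : D0 t -> kundt_field (G t) = FR t ((om t)^-1 *: ek).
Proof.
move=> Dt; have [_ _ /(_ _ Dt)[_ _ Gt] _ _] := lc; have [tr _] := D0r Dt.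
rewrite /kundt_field Gt (vel_FR cd)//; congr (FR t _).
have M00 : M t 0 = 0.
  exact: (is_linear0 (cd_lin cd tr)).
by rewrite -[_ *: ek]addr0 (cd_lin cd)// (cd_ek cd)// M00.
Qed.

Lemma kundt_field_smooth : smooth_vfield mM U kundt_field.
Proof.
have [oD oU HO HU sG] := lc; apply/smooth_vfieldP => //; split=> [y Uy|y f Uy sf].
  have [Dt Gt] := HU _ Uy; have [pt _ _] := HO _ Dt.
  have := vel_tangent ((om (Gi y))^-1 *: ek) pt; by rewrite Gt.
have [Dt Gt] := HU _ Uy; have [W [oW Wy HW]] := smooth_near_mopen sf.
pose F (t : E) := (om t)^-1 * 'D_ek (fun t => f (G t)) t.
have [tr o0] := D0r Dt.
apply: (eq_smooth_near (mopenI oU oW) (f := fun y => F (Gi y))); first by [].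
  move=> z [Uz Wz]; have [Dz Gz] := HU _ Uz; have [pz _ _] := HO _ Dz.
  have sfz : smooth_near mM (G (Gi z)) f by rewrite Gz; exact: HW.
  have dz := smooth_at_diff (smooth_near_plot pz sfz).
  have D00 : 'D_(0 : E) (fun t => f (G t)) (Gi z) = 0.
    exact: (is_linear0 (derive_lin dz)).
  rewrite /kundt_field velE//; have := derive_lin dz (om (Gi z))^-1 ek 0.
  by rewrite addr0 D00 addr0 => ->.
apply: (local_coord_fun lc Uy); have [pt _ _] := HO _ Dt.
apply: smooth_at_mul.
  by apply: smooth_at_inv => //; exact: (omega_smooth cd).
apply: smooth_at_derive; apply: (smooth_near_plot pt).
by rewrite Gt.
Qed.

Section Flow.
Hypothesis sk : forall v w z, aa v -> bb w -> bb z ->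
  eta (kap (br v w)) (kap z) = - eta (kap w) (kap (br v z)).
Context {e : R} {W : set (homspace H)} {Phi : R -> homspace H -> homspace H}.
Hypothesis lf : local_flow mM U kundt_field e W Phi.

(** In coordinates the flow fixes every [t_j] with [j] other than the k-index and advances the
    antiderivative [T] of [omega] at unit speed. Its differential is thus the identity up to
    multiples of k, and in the frames it becomes [A (M t b) = M t' b + cc b *: k]. Multiples of k do
    not affect eta on k^perp, where [A] is an isometry by [M_isometry]; condition (3) of GN is the
    identity [cek]. *)
Lemma flow_GN s x : `|s| < e -> W x ->
  exists t t' A, [/\ D0 t, D0 t', x = G t, Phi s x = G t' & @GN R m A /\
    push mM (Phi s) x \o FR t = FR t' \o A].
Proof.
move=> se Wx; have [oD oU HO HU sG] := lc.
have [[e0 oW WU] [P0 PU PD PS]] := lf.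
have [T HT] := @dir_antiderivative R _ om 0 r0 (fun t tr => omega_smooth cd tr).
have Dlin (F : E -> R) t (c : R) : differentiable F t -> 'D_(c *: ek) F t = c * 'D_ek F t.
  move=> dF; have D00 : 'D_(0 : E) F t = 0.
    exact: (is_linear0 (derive_lin dF)).
  by have := derive_lin dF c ek 0; rewrite addr0 D00 addr0.
have fl_j j y : j != 0 -> W y -> Gi (Phi s y) 0 j = Gi y 0 j.
  move=> j0 Wy; have := @flow_affine _ _ _ _ _ _ _ _ _ lf (fun y => Gi y 0 j) 0 s y.
  rewrite mul0r addr0; apply=> // z Uz; split; first exact: (local_coord_near lc).
  have [Dz _] := HU _ Uz; rewrite /kundt_field (vel_local_coord lc)//.
  by rewrite !mxE (negPf j0) mulr0.
have fl_T y : W y -> T (Gi (Phi s y)) = T (Gi y) + s.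
  move=> Wy; have := @flow_affine _ _ _ _ _ _ _ _ _ lf (fun y => T (Gi y)) 1 s y.
  rewrite mul1r; apply=> // z Uz; have [Dz _] := HU _ Uz; have [zr zo] := D0r Dz.
  have [sT DT _] := HT _ zr; split; first exact: (local_coord_fun lc).
  rewrite /kundt_field (vel_local lc)// Dlin; last exact: smooth_at_diff.
  by rewrite DT mulVf.
have Ux := WU _ Wx; have [Dt Gt] := HU _ Ux; set t := Gi x in Dt Gt.
have UPx := PU _ _ se Wx; have [Dt' Gt'] := HU _ UPx; set t' := Gi (Phi s x) in Dt' Gt'.
have [tr o0] := D0r Dt; have [tr' o0'] := D0r Dt'; have [pt _ _] := HO _ Dt; have [pt' _ _] := HO _ Dt'.
pose phi (z : E) := Gi (Phi s (G z)).
have Wt : W (G t) by rewrite Gt.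
have ms : msmooth mM mM (Phi s) (G t) by exact: (flow_msmooth lf).
have pP : plot mM (fun z : E => Phi s (G z)) t by exact: (msmooth_plot ms pt).
have sphi : smooth_at phi t by apply: sG => //; rewrite Gt.
have nW : \forall z \near t, D0 z /\ W (G z).
  exact: (filterI (near_O lc Dt) (plot_mopen pt oW Wt)).
have phit : phi t = t' by rewrite /phi Gt.
have dphi := smooth_at_diff sphi.
pose cc (b : E) := ('D_b phi t) 0 0 - b 0 0.
have Dphi b : 'D_b phi t = b + cc b *: ek.
  apply/rowP => j; have [->|j0] := eqVneq j 0.
    by rewrite [RHS]mxE [(_ *: ek) 0 0]mxE ekE eqxx mulr1 /cc addrC subrK.
  rewrite [RHS]mxE [(_ *: ek) 0 j]mxE ekE (negPf j0) mulr0 addr0 derive_entry//.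
  rewrite (near_eq_derive (g := fun z : E => z 0 j)).
    by rewrite -derive_entry ?derive_id//; exact: (smooth_at_diff (smooth_at_id t)).
  by apply: filterS nW => z [Dz Wz]; rewrite /phi fl_j//; have [_ _ ->] := HO _ Dz.
have tt' : t' = (t' 0 0 - t 0 0) *: ek + t.
  apply/rowP => j; rewrite entD ekE; have [->|j0] := eqVneq j 0; first by rewrite mulr1 subrK.
  by rewrite mulr0 add0r /t' fl_j.
have [sT DT _] := HT _ tr; have [sT' DT' _] := HT _ tr'.
(* Obtained by differentiating [T (phi z) = T z + s] in direction k, with [omega] the k-derivative
   of [T] at both ends. *)
have cek : (1 + cc ek) * om t' = om t.
  have : 'D_ek (fun z => T (phi z)) t = om t.
    rewrite (near_eq_derive (g := T + cst s)).
      rewrite deriveD; [|exact/diff_derivable/smooth_at_diff|exact: derivable_cst].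
      by rewrite derive_cst addr0 DT.
    by apply: filterS nW => z [Dz Wz]; rewrite /phi fl_T//; have [_ _ ->] := HO _ Dz.
  rewrite (@derive_comp R _ _ _ phi T)//; last by rewrite phit; exact: smooth_at_diff.
  rewrite phit Dphi -[X in X + _]scale1r -scalerDl Dlin ?DT'//; exact: smooth_at_diff.
have pushE b : push mM (Phi s) x (vel mM G t b) = vel mM G t' (b + cc b *: ek).
  have ms' : msmooth mM mM (Phi s) x by rewrite -Gt.
  rewrite (@push_vel R _ _ _ _ mM mM (Phi s) _ G t b x Gt ms').
  have -> : vel mM (fun z : E => Phi s (G z)) t b = vel mM (fun z => G (phi z)) t b.
    apply: eq_vel; apply: filterS nW => z [Dz Wz]; rewrite /phi.
    by have [_ ->] := HU _ (PU s (G z) se Wz).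
  have pG : plot mM G (phi t) by rewrite phit.
  by rewrite (@vel_comp R _ _ mM _ _ phi G t b sphi pG) Dphi phit.
have [fl fi ft] := FR_frame K_lie proj_submersion fu (g := g) t.
have [fl' fi' ft'] := FR_frame K_lie proj_submersion fu (g := g) t'.
pose A z := coframe (FR t') (push mM (Phi s) x (FR t z)).
have ftA z : FR t' (A z) = push mM (Phi s) x (FR t z).
  have [b ->] := D0_full z Dt; rewrite /A -(vel_FR cd)// pushE (vel_FR cd)//.
  by rewrite (coframeK fi').
have AM b : A (M t b) = M t' b + cc b *: ek.
  rewrite /A -(vel_FR cd)// pushE (vel_FR cd)// (coframeK fi').
  by rewrite addrC (cd_lin cd)// (cd_ek cd)// addrC.
have eta_kk c c' w w' : kperp w -> kperp w' -> eta (w + c *: ek) (w' + c' *: ek) = eta w w'.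
  move=> kw kw'; rewrite [w + _]addrC [w' + _]addrC etaDl !etaDr !(etaC w).
  have /= -> : eta ek ek = 0 := kperp_ek.
  rewrite /kperp /= in kw kw'.
  by rewrite kw kw' !(mulr0, add0r).
exists t, t', A; split=> //; split; last by apply/funext => z; exact: (esym (ftA z)).
apply: (@GN_of_scaling _ _ A (1 + cc ek)).
- by move=> c z z'; apply: fi'; rewrite fl' !ftA fl push_linear.
- have AMek := AM ek; rewrite (cd_ek cd tr) (cd_ek cd tr') in AMek.
  by rewrite AMek [RHS]scalerDl scale1r.
- move=> z z'; have [b ->] := D0_full z Dt; have [b' ->] := D0_full z' Dt.
  move=> /(D0_kperp Dt) kb /(D0_kperp Dt) kb'; rewrite !AM eta_kk; [|exact: (M_kperp cd bs)..].
  rewrite tt'; apply: (M_isometry cd bs sk) => //; by rewrite -tt'.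
- move=> z; have [b ->] := D0_full z Dt; rewrite AM [M t' b + _]addrC entD ekE mulr0 add0r.
  by rewrite !(M_1 cd bs)// mulrCA cek.
Qed.

End Flow.
End Coordinates.
End KundtFromConditions.

Section KundtStructures.
Context {R : realType} {N d m : nat} {K : groupType} {mK : manifold R N K}
  {H : set K} {mH : manifold R d {a : K | H a}} {mM : manifold R m.+2 (homspace H)}.
Hypothesis K_lie : lie_group mK.
Hypothesis H_lie : lie_subgroup mK mH.
Hypothesis proj_submersion : submersion mK mM (@hproj K H).
Local Notation pi := (@hproj K H).
Local Notation kk := (tangent mK (1%g : K)).
Local Notation hh := (sub_lie_algebra mK mH).
Local Notation dpi := (push mM (@hproj K H) 1%g).
Local Notation o := (hproj H (1%g : K)).
Local Notation E := 'rV[R]_m.+2.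
Local Notation To := (tangent mM o).
Local Notation V := (tvec R (homspace H)).
Local Notation dL a x := (push mM (ltrans a) x).
Local Notation ek := (ek R m).
Local Notation el := (el R m).
Local Notation br := (lie_bracket mK).

Context {P : homspace H -> set (E -> V)} (iP : invariant_GN mM P) {u : E -> V} (Pu : P o u).
Local Notation kap := (coframe u \o dpi).
Local Notation bb := (hypof kk kap).
Local Notation aa := (lineof kk kap).

Lemma inv_GN : GN_structure mM P. Proof. by case: iP. Qed.
Lemma inv_frame x w : P x w -> frame mM x w. Proof. by case: inv_GN => + _ _ _; apply. Qed.
Let fu : frame mM o u := inv_frame Pu.
Let ad := dpi_adapted K_lie H_lie proj_submersion fu.

Lemma inv_FR a : P (pi a) (dL a o \o u).
Proof. by apply/(invariant_fibre K_lie proj_submersion _ _ iP); exists u. Qed.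

Section NullQuadruple.
Context {Nq : homspace H -> quadruple V} (nq : null_quadruple mM P Nq).

Lemma null_hyp x w : P x w -> qhyp (Nq x) = w @` @kperp R m.
Proof. by move=> Pw; have [_ /(_ _ Pw)[]] := nq x. Qed.

Lemma null_line x w : P x w -> qline (Nq x) = [set w (t *: ek) | t in setT].
Proof. by move=> Pw; have [_ /(_ _ Pw)[]] := nq x. Qed.

End NullQuadruple.

Lemma Kundt_of_conditions : (forall v w, bb v -> bb w -> bb (br v w)) ->
  (forall v w z, aa v -> bb w -> bb z ->
    eta (kap (br v w)) (kap z) = - eta (kap w) (kap (br v z))) ->
  Kundt_structure mM P.
Proof.
move=> bs sk; have gP := inv_GN; split=> //.
have [Nq nq] := null_quadruple_exists gP; exists Nq => //.
have loc x : exists D0 U Gi r g M, exists v0 : tvec R K, exists th,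
    [/\ coord_data mK mM (u := u) (g 0) r g M v0 th,
     local_coord mM (fun t => pi (g t)) D0 U Gi,
     forall t, D0 t -> `|t| < r /\ omega (M := M) t != 0, D0 0 & pi (g 0) = x].
  have [a ax] := hproj_surj x.
  have [r [g [M [v0 [th cd]]]]] := product_coordinates K_lie H_lie proj_submersion fu a.
  have [D0 [U [Gi [lc D00 D0A]]]] := G_coord K_lie proj_submersion fu cd (near_omega cd).
  exists D0, U, Gi, r, g, M, v0, th; split=> //; first by rewrite (cd_g0 cd).
    by move=> t /D0A[].
  by rewrite (cd_g0 cd).
split=> x; have [D0 [U [Gi [r [g [M [v0 [th [cd lc D0r D00 gx]]]]]]]]] := loc x.
  have [S [mS [[S0 SU] iS tS]]] := plaque lc D00 (mxE _ _ _ _).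
  exists S, mS; split=> //; first by rewrite -gx.
  move=> y; rewrite tS; have [_ _ _ HU _] := lc; have [Dt Gt] := HU _ (SU _ (svalP y)).
  have PF := inv_FR (g (Gi (sval y))); rewrite Gt in PF.
  rewrite (null_hyp nq PF); apply/esym.
  exact: (D0_hyp K_lie proj_submersion fu cd bs lc D0r Dt).
have [oD oU HO HU sG] := lc.
exists U, (kundt_field (mM := mM) (g := g) (M := M) (Gi := Gi)); split=> //.
- by have [_ U0 _] := HO _ D00; rewrite -gx.
- split; first exact: (kundt_field_smooth cd lc D0r).
  move=> e W Phi lf s y w se Wy Pw.
  have [t [t' [A [Dt Dt' yt Pyt [GA EA]]]]] := flow_GN K_lie proj_submersion fu cd bs lc D0r sk lf se Wy.
  have PF : P y (dL (g t) o \o u) by rewrite yt; exact: inv_FR.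
  have [f Gf wE] := orbit_eq gP PF Pw.
  have PF' : P (Phi s y) (dL (g t') o \o u) by rewrite Pyt; exact: inv_FR.
  have [_ _ orb _] := gP; rewrite (orb _ _ PF'); exists (A \o f); first exact: GN_comp.
  by apply/funext => z; rewrite wE; exact: (esym (congr1 (fun F => F (f z)) EA)).
- move=> y Uy; have [Dt Gt] := HU _ Uy; have [tr o0] := D0r _ Dt.
  have PF := inv_FR (g (Gi y)); rewrite Gt in PF.
  have := kundt_fieldE cd lc D0r Dt; rewrite Gt => XE; rewrite XE; split.
    have [fl fi ft] := inv_frame PF.
    have F0 : (dL (g (Gi y)) o \o u) 0 = 0.
      exact: (is_linear0 fl).
    move=> X0; have : (omega (M := M) (Gi y))^-1 *: ek = 0 by apply: fi; rewrite X0 F0.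
    move=> /rowP/(_ 0); rewrite mxE ekE eqxx mulr1 mxE => /eqP.
    by rewrite invr_eq0 (negPf o0).
  by rewrite (null_line nq PF); exists (omega (M := M) (Gi y))^-1.
Qed.

(** A straight line in a chart of H. It stays in H for all parameters, even after leaving the image
    of the chart, because the inverse chart is a total map into H. *)
Lemma hh_curve v : hh v -> exists c : R -> K,
  [/\ plot mK c 0, c 0 = 1%g, vel mK c 0 1 = v & forall r, H (c r)].
Proof.
move=> [e e1 [w tw wv]]; have [c ac ce] := atlas_cover mH e.
have eK := chart_phiK ac ce; have pc := plot_cpsi ac (chart_phi_img ac ce).
have [b wb] := tangent_vel tw ac ce.
pose k (r : R) := cphi c e + r *: b.
have sk r : smooth_at k r.
  apply: smooth_at_add; first exact: smooth_at_cst.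
  by apply: smooth_at_scale; [exact: smooth_at_id|exact: smooth_at_cst].
have k0 : k 0 = cphi c e by rewrite /k scale0r addr0.
have ss := @sval_smooth _ _ _ _ mK H mH H_lie.
have psv : plot mK (fun y => sval (cpsi c y)) (cphi c e).
  by apply: (msmooth_plot _ pc); exact: ss.
have dk : 'D_1 k 0 = b.
  rewrite /k -[LHS]/('D_1 (cst (cphi c e) \+ (fun r : R => r *: b)) 0) deriveD; [|exact: derivable_cst|].
    rewrite derive_cst add0r.
    have lc' := @derive_line R _ _ id (0 : 'rV[R]_d) b (0 : R).
    rewrite derive_id in lc'.
    rewrite (_ : (fun r : R => r *: b) = fun s : R => s *: b + 0); last by apply/funext => r; rewrite addr0.
    exact: lc'.
  apply/diff_derivable/smooth_at_diff.
  by apply: smooth_at_scale; [exact: smooth_at_id|exact: smooth_at_cst].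
exists (fun r => sval (cpsi c (k r))); split.
- apply: (@plot_comp R _ _ mK _ _ k (fun y => sval (cpsi c y))); first exact: findim_rV.
    exact: sk.
  by rewrite k0.
- by rewrite k0 eK.
- have psv' : plot mK (fun y => sval (cpsi c y)) (k 0) by rewrite k0.
  rewrite (@vel_comp R _ _ mK _ _ k (fun y => sval (cpsi c y)) 0 1 (sk 0) psv') k0 dk.
  rewrite -wv wb; apply/esym.
  exact: (@push_vel R _ _ _ _ mH mK sval _ (cpsi c) (cphi c e) b e eK (ss e)).
- by move=> r; exact: (svalP (cpsi c (k r))).
Qed.

End KundtStructures.

(** * From a Kundt structure to the subalgebra condition *)

Section Lines.
Context {R : realType}.

Lemma smooth_line (F : normedModType R) (p b : F) (r : R) : smooth_at (fun r : R => p + r *: b) r.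
Proof.
apply: smooth_at_add; first exact: smooth_at_cst.
by apply: smooth_at_scale; [exact: smooth_at_id|exact: smooth_at_cst].
Qed.

Lemma derive_line_id (F : normedModType R) (p b : F) (r : R) : 'D_1 (fun r : R => p + r *: b) r = b.
Proof.
rewrite (_ : (fun r : R => _) = fun s : R => s *: b + p); last by apply/funext => s; rewrite addrC.
by have := @derive_line R _ _ id p b r; rewrite derive_id.
Qed.

End Lines.

Section SubalgebraFromKundt.
Context {R : realType} {N d m : nat} {K : groupType} {mK : manifold R N K}
  {H : set K} {mH : manifold R d {a : K | H a}} {mM : manifold R m.+2 (homspace H)}.
Hypothesis K_lie : lie_group mK.
Hypothesis H_lie : lie_subgroup mK mH.
Hypothesis proj_submersion : submersion mK mM (@hproj K H).
Local Notation pi := (@hproj K H).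
Local Notation kk := (tangent mK (1%g : K)).
Local Notation hh := (sub_lie_algebra mK mH).
Local Notation dpi := (push mM (@hproj K H) 1%g).
Local Notation o := (hproj H (1%g : K)).
Local Notation E := 'rV[R]_m.+2.
Local Notation To := (tangent mM o).
Local Notation V := (tvec R (homspace H)).
Local Notation dL a x := (push mM (ltrans a) x).
Local Notation ek := (ek R m).
Local Notation el := (el R m).
Local Notation br := (lie_bracket mK).

Context {P : homspace H -> set (E -> V)} (iP : invariant_GN mM P) {u : E -> V} (Pu : P o u).
Local Notation kap := (coframe u \o dpi).
Local Notation bb := (hypof kk kap).
Let fu : frame mM o u := inv_frame iP Pu.
Let ad := dpi_adapted K_lie H_lie proj_submersion fu.
Context {Nq : homspace H -> quadruple V} (nq : null_quadruple mM P Nq).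
Hypothesis itg : Defs.integrable m.+1 mM (fun x => qhyp (Nq x)).

(* f is the coordinate transverse to an integral manifold gam in a chart obtained
   by extending gam to a local diffeomorphism. *)
Lemma defining_function : exists (gam : 'rV[R]_m.+1 -> homspace H) (p : 'rV[R]_m.+1) (f : homspace H -> R),
  [/\ plot mM gam p /\ gam p = o, smooth_near mM o f,
    forall w, qhyp (Nq o) w -> exists b, w = vel mM gam p b,
    \forall y \near p, forall w, qhyp (Nq (gam y)) w -> w f = 0 &
    forall w, To w -> w f = 0 -> qhyp (Nq o) w].
Proof.
have [S [mS [So [/smooth_mapP si ii] tS]]] := itg o.
pose e0 : {x | S x} := exist _ o So.
have [c ac ce] := atlas_cover mS e0; set p := cphi c e0.
have cp : cimg c p by exact: (chart_phi_img ac ce).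
have eK : cpsi c p = e0 by exact: (chart_phiK ac ce).
have pc : plot mS (cpsi c) p by exact: (plot_cpsi ac cp).
pose gam (y : 'rV[R]_m.+1) := sval (cpsi c y).
have pg : plot mM gam p by apply: (msmooth_plot _ pc); exact: si.
have gp : gam p = o by rewrite /gam eK.
have pushE y b : cimg c y -> push mM sval (cpsi c y) (vel mS (cpsi c) y b) = vel mM gam y b.
  by move=> cy; rewrite (@push_vel R _ _ _ _ mS mM sval _ (cpsi c) y b _ erefl (si _)).
have qE y w : cimg c y -> qhyp (Nq (gam y)) w -> exists b, w = vel mM gam y b.
  move=> cy; rewrite /gam -tS => -[v tv <-].
  have [b ->] := tangent_vel tv ac (chart_psi_dom ac cy).
  by rewrite (chart_psiK ac cy); exists b; rewrite pushE.
have qo b : qhyp (Nq o) (vel mM gam p b).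
  rewrite -(tS e0); exists (vel mS (cpsi c) p b); last by rewrite -pushE// eK.
  by have := vel_tangent b pc; rewrite eK.
have [c' ad' co] := atlas_cover mM o; set q := cphi c' o.
have cq : cimg c' q by exact: (chart_phi_img ad' co).
have oK : cpsi c' q = o by exact: (chart_phiK ad' co).
have pc' : plot mM (cpsi c') q by exact: (plot_cpsi ad' cq).
have [ul ui ut] := fu.
have tul : To (u el) by rewrite -ut; exists el.
have [bl ulE] := tangent_vel tul ad' co; rewrite -/q in ulE.
have cgp : cdom c' (gam p) by rewrite gp.
have [ngam sgam] := plot_chart pg ad' cgp.
pose A : 'M[R]_(m.+2, m.+1) := dropmx.
(* Dropping the l-coordinate leads to the parameters of the integral manifold, centred at [p]. *)
pose aff (t : E) := p + t *m A.
have saff t : smooth_at aff t by apply: smooth_at_add; [exact: smooth_at_cst|exact: smooth_mulmxr].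
have aff0 : aff 0 = p by rewrite /aff mul0mx addr0.
have daff b : 'D_b aff 0 = b *m A.
  rewrite -[LHS]/('D_b (cst p \+ (fun t : E => t *m A)) 0) deriveD; [|exact: derivable_cst|].
    by rewrite derive_cst add0r derive_mulmxr_id.
  exact/diff_derivable/smooth_at_diff/smooth_mulmxr.
pose gc (t : E) := cphi c' (gam (aff t)).
have sgc : smooth_at gc 0.
  apply: (@smooth_at_comp R _ _ _ aff (fun y => cphi c' (gam y))) => //; first exact: findim_rV.
  by rewrite aff0.
pose ln (t : E) := t 0 1 *: bl.
have s1 (t : E) : smooth_at (fun t : E => t 0 1) t by exact: (smooth_at_coord 0 1 (smooth_at_id t)).
have sln t : smooth_at ln t by apply: smooth_at_scale; [exact: s1|exact: smooth_at_cst].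
have dln b : 'D_b ln 0 = b 0 1 *: bl.
  have lnE : ln = fun t : E => t *m (\matrix_(i, j) ((i == 1)%:R * bl 0 j)).
    apply/funext => t; apply/rowP => j; rewrite !mxE (bigD1 1)//= big1 ?addr0.
      by rewrite mxE eqxx mul1r.
    by move=> i i1; rewrite mxE (negPf i1) mul0r mulr0.
  by rewrite lnE derive_mulmxr_id -[RHS]/(ln b) lnE.
(* The dropped coordinate is used to move in the direction [bl], which represents [u el] in the
   chart of K/H. *)
pose Fc (t : E) := gc t + ln t.
have sFc : smooth_at Fc 0 by exact: smooth_at_add.
have Fc0 : Fc 0 = q by rewrite /Fc /gc /ln aff0 gp mxE scale0r addr0.
pose F t := cpsi c' (Fc t).
have F0 : F 0 = o by rewrite /F Fc0.
have pF : plot mM F 0.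
  apply: (@plot_comp R _ _ mM _ _ Fc (cpsi c')) => //; first exact: findim_rV.
  by rewrite Fc0.
have velF b : vel mM F 0 b = vel mM gam p (b *m A) + b 0 1 *: u el.
  rewrite (@vel_comp R _ _ mM _ _ Fc (cpsi c') 0 b sFc); last by rewrite Fc0.
  have -> : 'D_b Fc 0 = b 0 1 *: bl + 'D_b gc 0.
    rewrite -[LHS]/('D_b (gc \+ ln) 0) deriveD; [|exact/diff_derivable/smooth_at_diff..].
    by rewrite dln addrC.
  rewrite Fc0 (vel_linear pc') -ulE addrC; congr (_ + _).
  have cg0 : cdom c' (gam (aff 0)) by rewrite aff0.
  have pga : plot mM (fun t => gam (aff t)) 0.
    apply: (@plot_comp R _ _ mM _ _ aff gam) => //; first exact: findim_rV.
    by rewrite aff0.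
  have := vel_chart b pga ad' cg0; rewrite -/(gc 0).
  have -> : gc 0 = q by rewrite /gc aff0 gp.
  move=> <-; have pga' : plot mM gam (aff 0) by rewrite aff0.
  by rewrite (@vel_comp R _ _ mM _ _ aff gam 0 b (saff 0) pga') aff0 daff.
have qo' : qhyp (Nq o) = u @` @kperp R m by exact: (null_hyp nq Pu).
(* The vector [u el] is transverse to the hyperplane, the image of k^perp under [u]; what remains is
   injective because the integral manifold is immersed. *)
have injF b : vel mM F 0 b = 0 -> b = 0.
  rewrite velF => b0.
  have b1 : b 0 1 = 0.
    have := qo (b *m A); rewrite qo' => -[k kk' kE]; rewrite -kE in b0.
    have : b 0 1 *: el + k = 0.
      apply: ui; rewrite ul addrC b0.
      by exact: (esym (is_linear0 ul)).
    move=> /rowP/(_ 1); rewrite !mxE eqxx mulr1; move/kperpE: kk' => ->.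
    by rewrite addr0.
  rewrite b1 scale0r addr0 in b0.
  have v0 : vel mS (cpsi c) p (b *m A) = vel mS (cpsi c) p 0.
    have p0 : plot mS (cpsi c) (cphi c (cpsi c p)) by rewrite (chart_psiK ac cp).
    apply: (ii e0).
    - by have := vel_tangent (b *m A) pc; rewrite eK.
    - by have := vel_tangent 0 pc; rewrite eK.
    - by rewrite -eK !pushE// b0 (vel0 pg).
  have bA : b *m A = 0 by apply: (vel_cpsi_inj ac ce); exact: v0.
  by rewrite -(dropK b1) -/A bA mul0mx.
have [D0 [U [Gi [[[oD D00] _] oU HO HU sG]]]] := inverse_plot pF injF filterT.
have lc : local_coord mM F D0 U Gi by split.
have Uo : U o by have [_ U0 _] := HO _ D00; rewrite -F0.
exists gam, p, (fun x => Gi x 0 1); split=> //.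
- exact: (local_coord_near lc).
- by move=> w; rewrite -{1}gp; exact: qE.
- pose lift (y : 'rV[R]_m.+1) : E := (y - p) *m A^T.
  have slift : smooth_at lift p.
    apply: smooth_at_mulmx; last exact: smooth_at_cst.
    by apply: smooth_at_sub; [exact: smooth_at_id|exact: smooth_at_cst].
  have Dl : D0 (lift p) by rewrite /lift subrr mul0mx.
  have n1 : \forall y \near p, D0 (lift y) by exact: (smooth_at_cont slift (near_O lc Dl)).
  have n2 : \forall y \near p, cimg c y by apply: open_nbhs_nbhs; split=> //; exact: (chart_img_open ac).
  have z : \forall y \near p, Gi (gam y) 0 1 = 0.
    apply: filterS2 n1 ngam => y Dy cy.
    have -> : gam y = F (lift y).
      rewrite /F /Fc /gc /ln emb1 scale0r addr0 /aff /lift embK addrC subrK.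
      by rewrite (chart_phiK ad' cy).
    by have [_ _ ->] := HO _ Dy; exact: emb1.
  (* The function vanishes along the integral manifold around every nearby parameter, not only at
     it, so it is killed by the velocities there. *)
  have z' : \forall y \near p, \forall x \near y, Gi (gam x) 0 1 = 0 by exact: near_join z.
  apply: filterS2 n2 z' => y cy zy w /(qE _ _ cy)[b ->].
  rewrite /vel; case: asboolP => // _.
  by rewrite (near_eq_derive (g := cst 0)) ?derive_cst.
- move=> w tw w0; have tw' : tangent mM (F 0) w by rewrite F0.
  have [b wb] := vel_local_full lc D00 tw'.
  have b1 : b 0 1 = 0 by rewrite -(vel_local_coord lc b 1 D00) wb.
  by rewrite -wb velF b1 scale0r addr0; exact: qo.
Qed.

(** A local section lifts a curve of the integral manifold, with a velocity correct only modulo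
    [hh]. Multiplying on the right by a curve in H corrects the velocity to [v] without changing the
    projection. *)
Lemma bb_curve gam (p : 'rV[R]_m.+1) v : plot mM gam p -> gam p = o ->
  (forall w, qhyp (Nq o) w -> exists b, w = vel mM gam p b) -> bb v ->
  exists (c : R -> K) b, [/\ plot mK c 0, c 0 = 1%g, vel mK c 0 1 = v &
    \forall r \near (0 : R), pi (c r) = gam (p + r *: b)].
Proof.
move=> pg gp qE [kv kpv].
have tdv := dpi_tangent proj_submersion kv.
have [b vb] : exists b, dpi v = vel mM gam p b.
  apply: qE; rewrite (null_hyp nq Pu); exists (kap v) => //.
  exact: (frame_coframe fu tdv).
have [U [s [oU Uo s1 Hs sp]]] := local_section proj_submersion (1%g : K).
pose k (r : R) := p + r *: b.
have k0 : k 0 = p by rewrite /k scale0r addr0.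
have pk : plot mM (fun r => gam (k r)) 0.
  apply: (@plot_comp R _ _ mM _ _ k gam); first exact: findim_rV.
    exact: smooth_line.
  by rewrite k0.
have gk0 : gam (k 0) = o by rewrite k0.
have U0 : U (gam (k 0)) by rewrite gk0.
have nU := plot_mopen pk oU U0.
pose c1 (r : R) := s (gam (k r)).
have pc1 : plot mK c1 0 by exact: sp.
have c10 : c1 0 = 1%g by rewrite /c1 gk0.
have kv1 : kk (vel mK c1 0 1) by have := vel_tangent (1 : R) pc1; rewrite c10.
have dv1 : dpi (vel mK c1 0 1) = dpi v.
  rewrite (@push_vel R _ _ _ _ mK mM pi _ c1 0 1 1%g c10 (hproj_smooth proj_submersion (x := 1%g))).
  rewrite vb; have pgk : plot mM gam (k 0) by rewrite k0.
  have := @vel_comp R _ _ mM _ _ k gam 0 1 (smooth_line p b 0) pgk.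
  rewrite k0 derive_line_id => <-; apply: eq_vel.
  by apply: filterS nU => r Ur; rewrite /c1 Hs.
have hv : hh (v - vel mK c1 0 1).
  apply/(dpi_kerP K_lie H_lie proj_submersion).
    exact: (subB (tangent_subspace mK 1%g)).
  have -> : v - vel mK c1 0 1 = (-1) *: vel mK c1 0 1 + v by rewrite scaleN1r addrC.
  by rewrite push_linear dv1 scaleN1r addNr.
have [c2 [pc2 c20 vc2 Hc2]] := hh_curve H_lie hv.
exists (fun r => c1 r * c2 r)%g, b; split.
- exact: (plot_mul K_lie).
- by rewrite c10 c20 mulg1.
- rewrite (vel_mul1 K_lie (1 : R) findimR c10 c20 pc1 pc2) vc2 addrC; exact: subrK.
- by apply: filterS nU => r Ur; rewrite (hproj_mulr H_lie)// /c1 Hs.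
Qed.

Lemma bb_subalgebra v w : bb v -> bb w -> bb (br v w).
Proof.
move=> bv bw; have [gam [p [f [[pg gp] sf qE nf kf]]]] := defining_function.
have [kv _] := bv; have [kw _] := bw; have kvw := lie_bracket_tangent K_lie kv kw.
have spi : msmooth mK mM pi 1%g by exact: (hproj_smooth proj_submersion).
have sfp : smooth_near mK 1%g (f \o pi) by exact: (msmooth_near spi sf).
(* Along the curve [c] of [v'] the projection stays in the integral manifold. There the
   left-invariant field of [w'] projects into the hyperplanes, whose vectors kill [f]. So
   [lfield w' (f o pi)] vanishes along [c], and both terms of the bracket are zero on [f o pi]. *)
have key v' w' : bb v' -> bb w' -> v' (lfield mK w' (f \o pi)) = 0.
  move=> bv' [kw' kpw'].
  have [c [b [pc c0 vc nc]]] := bb_curve pg gp qE bv'.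
  rewrite -vc /vel; case: asboolP => // _.
  have [W [oW Wo HW]] := smooth_near_mopen sf.
  have ppc : plot mM (fun r => pi (c r)) 0.
    by apply: (msmooth_plot _ pc); exact: (hproj_smooth proj_submersion).
  have Wc : W (pi (c 0)) by rewrite c0.
  have nW := plot_mopen ppc oW Wc.
  have k0 : p + (0 : R) *: b = p by rewrite scale0r addr0.
  have nf' : \forall r \near (0 : R), forall w, qhyp (Nq (gam (p + r *: b))) w -> w f = 0.
    have ck := smooth_at_cont (smooth_line p b 0).
    have nf0 : nbhs (p + (0 : R) *: b) (fun y => forall w, qhyp (Nq (gam y)) w -> w f = 0) by rewrite k0.
    exact: (ck _ nf0).
  rewrite (near_eq_derive (g := cst 0)) ?derive_cst//.
  apply: filterS3 nW nc nf' => r Wr cr fr.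
  rewrite -(frame_lfield K_lie proj_submersion w'); last exact: HW.
  apply: fr; rewrite -cr (null_hyp nq (inv_FR K_lie proj_submersion iP Pu (c r))).
  by exists (kap w') => //=; rewrite (frame_coframe fu (dpi_tangent proj_submersion kw')).
have dt := dpi_tangent proj_submersion kvw.
have : qhyp (Nq o) (dpi (br v w)).
  apply: kf => //; rewrite /push; case: asboolP => // _.
  by rewrite lie_bracketE// !key// subrr.
rewrite (null_hyp nq Pu) => -[k hk kE]; split=> //.
have [ul ui ut] := fu.
by rewrite /= -kE (coframeK ui).
Qed.

End SubalgebraFromKundt.

(** * From a Kundt structure to the skewness condition *)

Section SkewFromKundt.
Context {R : realType} {N d m : nat} {K : groupType} {mK : manifold R N K}
  {H : set K} {mH : manifold R d {a : K | H a}} {mM : manifold R m.+2 (homspace H)}.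
Hypothesis K_lie : lie_group mK.
Hypothesis H_lie : lie_subgroup mK mH.
Hypothesis proj_submersion : submersion mK mM (@hproj K H).
Local Notation pi := (@hproj K H).
Local Notation kk := (tangent mK (1%g : K)).
Local Notation hh := (sub_lie_algebra mK mH).
Local Notation dpi := (push mM (@hproj K H) 1%g).
Local Notation o := (hproj H (1%g : K)).
Local Notation E := 'rV[R]_m.+2.
Local Notation To := (tangent mM o).
Local Notation V := (tvec R (homspace H)).
Local Notation dL a x := (push mM (ltrans a) x).
Local Notation ek := (ek R m).
Local Notation el := (el R m).
Local Notation br := (lie_bracket mK).

Context {P : homspace H -> set (E -> V)} (iP : invariant_GN mM P) {u : E -> V} (Pu : P o u).
Local Notation kap := (coframe u \o dpi).
Local Notation bb := (hypof kk kap).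
Local Notation aa := (lineof kk kap).
Let fu : frame mM o u := inv_frame iP Pu.
Let ad := dpi_adapted K_lie H_lie proj_submersion fu.
Hypothesis bs : forall v w, bb v -> bb w -> bb (br v w).

Let entD (x y : E) t j : (t *: x + y) 0 j = t * x 0 j + y 0 j. Proof. by rewrite !mxE. Qed.

Definition skew_defect v w z : R := eta (kap (br v w)) (kap z) + eta (kap w) (kap (br v z)).

(** Ad(H)-invariance of the inner product makes [eta (kap (Ad (c s) w)) (kap (Ad (c s) z))] constant
    along a curve [c] of H with velocity [v]; its derivative at 0 is the defect. *)
Lemma skew_hh v w z : hh v -> bb w -> bb z -> skew_defect v w z = 0.
Proof.
move=> hv bw bz; have [kw kw1] := bw; have [kz kz1] := bz.
have kv := hh_sub H_lie hv; have [_ bot_top _ _ _] := ad.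
have bv : bb v := line_hyp (bot_line ad hv).
have [c [pc c0 vc Hc]] := hh_curve H_lie hv.
have fR := findimR (R := R).
have sA x j : kk x -> smooth_at (fun s : R => kap (Ad mK (c s) x) 0 j) 0 /\
    'D_(1 : R) (fun s : R => kap (Ad mK (c s) x) 0 j) 0 = kap (br v x) 0 j.
  move=> kx; have [s1 s2] := derive_Ad K_lie (1 : R) fR c0 pc kx (cfunK_smooth proj_submersion fu j).
  have E1 : (fun s : R => kap (Ad mK (c s) x) 0 j) = fun s => Ad mK (c s) x (cfun fu j \o pi).
    by apply/funext => s; apply: (kap_cfun proj_submersion fu); exact: (Ad_tangent K_lie).
  rewrite E1; split=> //; rewrite s2 vc (kap_cfun proj_submersion fu)//.
  exact: (lie_bracket_tangent K_lie).
have AE s : eta (kap (Ad mK (c s) w)) (kap (Ad mK (c s) z)) = eta (kap w) (kap z).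
  have [qQ /(_ _ (Hc s))[_ B1 F1 _]] := origin_AdH K_lie H_lie proj_submersion iP.
  have gP := inv_GN iP; have QE := origin_quadrupleE K_lie H_lie proj_submersion gP Pu.
  rewrite QE in B1 F1; have Bw := B1 _ bw; have Bz := B1 _ bz.
  by have := F1 _ _ bw bz; rewrite (Qof_form ad Bw Bz) (Qof_form ad bw bz).
have kA s x : bb x -> kperp (kap (Ad mK (c s) x)).
  move=> bx; have [qQ /(_ _ (Hc s))[_ B1 F1 _]] := origin_AdH K_lie H_lie proj_submersion iP.
  have gP := inv_GN iP; have QE := origin_quadrupleE K_lie H_lie proj_submersion gP Pu.
  by rewrite QE in B1; have [] := B1 _ bx.
pose F i (s : R) := kap (Ad mK (c s) w) 0 (mx2 i); pose F' i (s : R) := kap (Ad mK (c s) z) 0 (mx2 i).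
have dF i : differentiable (F i) 0 by have [/smooth_at_diff] := sA w (mx2 i) kw.
have dF' i : differentiable (F' i) 0 by have [/smooth_at_diff] := sA z (mx2 i) kz.
have SE : \sum_i (F i * F' i) = cst (eta (kap w) (kap z)).
  by apply/funext => s; rewrite fct_sumE -(AE s) eta_kperp//; exact: kA.
have : 'D_(1 : R) (\sum_i (F i * F' i)) 0 = 0 by rewrite SE derive_cst.
rewrite derive_sum; last by move=> i; apply/diff_derivable/differentiableM.
have Ad1x x : kk x -> Ad mK (c 0) x = x by move=> kx; rewrite c0 Ad1.
have Di i : 'D_(1 : R) (F i * F' i) 0 = kap w 0 (mx2 i) * kap (br v z) 0 (mx2 i) +
    kap (br v w) 0 (mx2 i) * kap z 0 (mx2 i).
  rewrite deriveM; [|exact: diff_derivable..].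
  have [_ ->] := sA w (mx2 i) kw; have [_ ->] := sA z (mx2 i) kz.
  rewrite /F /F' !Ad1x//; congr (_ + _); exact: mulrC.
rewrite (eq_bigr _ (fun i _ => Di i)) big_split /= => S0.
have [_ kb1] := bs bv bw; have [_ kb2] := bs bv bz.
by rewrite /skew_defect (eta_kperp kb1 kz1) (eta_kperp kw1 kb2) addrC.
Qed.

Lemma br_kap_lin v (t : R) w w' : kk v -> kk w -> kk w' ->
  kap (br v (t *: w + w')) = t *: kap (br v w) + kap (br v w').
Proof.
move=> kv kw kw'; rewrite (lie_bracketDr K_lie)//; have [_ _ L _ _] := ad.
by rewrite L//; exact: (lie_bracket_tangent K_lie).
Qed.

Lemma br_kap_linl (t : R) v v' w : kk v -> kk v' -> kk w ->
  kap (br (t *: v + v') w) = t *: kap (br v w) + kap (br v' w).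
Proof.
move=> kv kw kw'; rewrite (lie_bracketDl K_lie)//; have [_ _ L _ _] := ad.
by rewrite L//; exact: (lie_bracket_tangent K_lie).
Qed.

Section WithField.
Context {Nq : homspace H -> quadruple V} (nq : null_quadruple mM P Nq)
  {U0 : set (homspace H)} {X : homspace H -> V}.
Hypothesis oU0 : mopen mM U0.
Hypothesis U0o : U0 o.
Hypothesis iX : infinitesimal_automorphism mM P U0 X.
Hypothesis Xl : forall y, U0 y -> X y <> 0 /\ qline (Nq y) (X y).
Context {r0 : R} {g : E -> K} {M : E -> E -> E} {v0 : tvec R K} {th : E -> E -> tvec R K}
  (cd : coord_data mK mM (u := u) (1%g : K) r0 g M v0 th).
Local Notation G := (fun t => pi (g t)).
Local Notation FR t := (dL (g t) o \o u).

(** In the straightened coordinates the flow is translation along k, and it carries the origin to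
    the points [rho k] of the axis. Preserving [P], it maps the frame [u] to the frame there up to
    an element [A] of GN. Modulo multiples of k, [A] coincides with [M (rho k)], and such multiples
    are invisible to eta on k^perp. *)
Lemma M_isometry_axis b b' : kperp b -> kperp b' ->
  \forall rho \near (0 : R), eta (M (rho *: ek) b) (M (rho *: ek) b') = eta b b'.
Proof.
move=> kb kb'; have r00 : `|0 : E| < r0 by rewrite normr0; exact: (cd_rad cd).
have gP := inv_GN iP; have G0 : G 0 = o by rewrite (cd_g0 cd).
have PF t : P (G t) (FR t) := inv_FR K_lie proj_submersion iP Pu (g t).
have nU : nbhs (0 : E) [set t | U0 (G t)].
  by apply: (plot_mopen (cd_plot cd r00) oU0); rewrite G0.
have [D0 [U [Gi [lc D00 D0A]]]] := G_coord K_lie proj_submersion fu cd nU.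
have [oD oU HO HU sG] := lc.
(* Since [X] lies in the line field, it is the k-velocity times this component, which is smooth and
   never zero. *)
pose h (t : E) : R := X (G t) (fun x => Gi x 0 0).
have XE t : D0 t -> X (G t) = vel mM G t (h t *: ek).
  move=> Dt; have [Ut tr] := D0A _ Dt; have [_] := Xl Ut.
  rewrite (null_line nq (PF t)) => -[c _ cE].
  have M00 : M t 0 = 0.
    exact: (is_linear0 (cd_lin cd tr)).
  have cE' : X (G t) = vel mM G t (c *: ek).
    rewrite -cE (cd_vel cd)//= -[c *: ek in RHS]addr0 (cd_lin cd tr) (cd_ek cd tr) M00 addr0//.
  suff -> : h t = c by [].
  by rewrite /h cE' (vel_local_coord lc)// !mxE eqxx mulr1.
have h0 t : D0 t -> h t != 0.
  move=> Dt; have [Ut tr] := D0A _ Dt; have [X0 _] := Xl Ut; apply/eqP => ht; apply: X0.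
  have [pt _ _] := HO _ Dt.
  by rewrite XE// ht scale0r (vel0 pt).
have sh t : D0 t -> smooth_at h t.
  move=> Dt; have [Ut tr] := D0A _ Dt; have [pt Ugt _] := HO _ Dt.
  have [tX sX] := (smooth_vfieldP X oU0).1 iX.1.
  exact: (smooth_near_plot pt (sX _ _ Ut (local_coord_near lc 0 Ugt))).
have /nbhs_ballP[r r_gt0 rD] : nbhs (0 : E) D0 by exact: (open_nbhs_nbhs (conj oD D00)).
have rD' t : `|t| < r -> D0 t by move=> tr; apply: rD; rewrite -ball_normE /= sub0r normrN.
have [q [V0 [[oV V00] [q0 qr] sq dq qs]]] := straighten r_gt0
  (fun t tr => conj (sh t (rD' t tr)) (h0 t (rD' t tr))).
have qD y : V0 y -> D0 (q y) by move=> /qr /rD'.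
pose G' (y : E) := G (q y).
have pG' y : V0 y -> plot mM G' y.
  move=> Vy; apply: (@plot_comp R _ _ mM _ _ q G); first exact: findim_rV.
    by have [] := sq _ Vy.
  by have [] := HO _ (qD _ Vy).
have velG' y b1 : V0 y -> vel mM G' y b1 = vel mM G (q y) ('D_b1 q y).
  move=> Vy; apply: (@vel_comp R _ _ mM _ _ q G); first by have [] := sq _ Vy.
  by have [] := HO _ (qD _ Vy).
have XG' y : V0 y -> X (G' y) = vel mM G' y ek.
  by move=> Vy; rewrite velG'// dq// XE//; exact: qD.
have hq0 : h (q 0) != 0 by apply: h0; exact: qD.
have inj (c : E) : vel mM G' 0 c = 0 -> c = 0.
  rewrite velG'// => c0; have Dq := qD _ V00; have [pq _ _] := HO _ Dq.
  have Dc : 'D_c q 0 = 0 by apply: (vel_local_inj lc Dq); rewrite c0 (vel0 pq).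
  have [_ /(_ c)[k kE]] := sq _ V00; rewrite Dc in kE.
  have cE : c = (- k) *: ek by apply/eqP; rewrite scaleNr -addr_eq0 -kE.
  have D0q : 'D_(0 : E) q 0 = 0.
    have [/smooth_at_diff dq0 _] := sq _ V00.
    exact: (is_linear0 (derive_lin dq0)).
  have : (- k) *: 'D_ek q 0 = 0.
    have [/smooth_at_diff dq0 _] := sq _ V00.
    by have := derive_lin dq0 (- k) ek 0; rewrite addr0 D0q addr0 -cE Dc.
  rewrite dq// scalerA => /rowP/(_ 0); rewrite !mxE eqxx mulr1 => /eqP.
  by rewrite mulf_eq0 (negPf hq0) orbF => /eqP k0; rewrite cE k0 scale0r.
have [D1 [U1 [Gj [[[oD1 D10] D1V] oU1 HO1 HU1 sG1]]]] :=
  inverse_plot (pG' _ V00) inj (open_nbhs_nbhs (conj oV V00)).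
have /nbhs_ballP[e2 e2_gt0 e2D] : nbhs (0 : E) D1 by exact: (open_nbhs_nbhs (conj oD1 D10)).
(* Half of the radius: the starting point and the time are both below [e], so their sum remains in
   the domain of the coordinates. *)
pose e := e2 / 2; have e_gt0 : 0 < e by rewrite divr_gt0.
have eD y s : `|y| < e -> `|s| < e -> D1 (y + s *: ek).
  move=> ye se; apply: e2D; rewrite -ball_normE /= sub0r normrN.
  apply: le_lt_trans (ler_normD _ _) _; rewrite normrZ.
  have -> : e2 = e + e by rewrite /e -splitr.
  apply: ltrD => //; apply: le_lt_trans se; rewrite ler_piMr//.
  by apply: rV_normP => // j; rewrite ekE; case: (j == 0); rewrite ?normr1 ?normr0.
pose W := [set x | U1 x /\ `|Gj x| < e].
pose Phi (s : R) x := G' (Gj x + s *: ek).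
have oW : mopen mM W.
  move=> c ac; rewrite openE => y [cy [Uy Gy]].
  have pc := plot_cpsi ac cy; have sc := sG1 _ _ _ pc Uy.
  have n1 := plot_mopen pc oU1 Uy.
  have n2 : \forall z \near y, cimg c z by apply: open_nbhs_nbhs; split=> //; exact: (chart_img_open ac).
  have n3 := smooth_at_cont sc (near_norm_lt Gy).
  by apply: filterS3 n1 n2 n3.
have sPhi (c : 'rV[R]_m.+2 -> homspace H) (s : R) (z : E) : plot mM c z -> `|s| < e -> W (c z) ->
    plot mM (fun p : R * E => Phi p.1 (c p.2)) (s, z).
  move=> pc se [Uz Gz]; have fRE : findim (R * E)%type.
    by apply: findim_prod; [exact: findimR|exact: findim_rV].
  apply: (@plot_comp R _ _ mM _ _ (fun p : R * E => Gj (c p.2) + p.1 *: ek) G').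
  - exact: findim_rV.
  - apply: smooth_at_add.
      apply: (@smooth_at_comp R _ _ _ (snd : R * E -> E) (fun z => Gj (c z))); first exact: findim_rV.
        exact: smooth_at_snd.
      exact: sG1.
    by apply: smooth_at_scale; [exact: smooth_at_fst|exact: smooth_at_cst].
  - by apply: pG'; apply: D1V; exact: eD.
have PhiU s x : `|s| < e -> W x -> U0 (Phi s x).
  by move=> se [Ux Gx]; have [] := D0A _ (qD _ (D1V _ (eD _ _ Gx se))).
have lf : local_flow mM U0 X e W Phi.
  split; first split=> //.
    move=> x [Ux Gx]; have := PhiU 0 x; rewrite normr0 => /(_ e_gt0 (conj Ux Gx)).
    by rewrite /Phi scale0r addr0; have [_ ->] := HU1 _ Ux.
  split.
  - by move=> x [Ux _]; rewrite /Phi scale0r addr0; have [_ ->] := HU1 _ Ux.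
  - by move=> s x se Wx; exact: PhiU.
  - move=> s x f se [Ux Gx] sf; have D1z := eD _ _ Gx se; have Vz := D1V _ D1z.
    have sfG : smooth_at (fun y => f (G' y)) (Gj x + s *: ek) by exact: (smooth_near_plot (pG' _ Vz) sf).
    rewrite /Phi XG'// velE//; rewrite -[Gj x + _]addrC in sfG *.
    have <- := @derive_line R _ _ (fun y => f (G' y)) (Gj x) ek s.
    rewrite (_ : (fun s => f (G' (Gj x + s *: ek))) = fun s : R => f (G' (s *: ek + Gj x))); last first.
      by apply/funext => s'; rewrite addrC.
    apply: derivableP; apply: (@derivable_line R _ _ (fun y => f (G' y)) (Gj x) ek s).2.
    exact/diff_derivable/smooth_at_diff.
  - move=> c c' ac ac' F D.
    have pD p : D p -> plot mM F p.
      by move: p => [s z] [/= se cz Wz dz]; apply: sPhi => //; exact: plot_cpsi.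
    split.
      rewrite openE => -[s z] Dp; have [/= se cz Wz dz] := Dp.
      have [np _] := plot_chart (pD _ Dp) ac' dz.
      have ns : \forall p \near (s, z), `|p.1| < e.
        exact: (smooth_at_cont (smooth_at_fst (s, z)) (near_abs_lt se)).
      have nW : \forall y \near z, cimg c y /\ W (cpsi c y) by exact: (open_nbhs_nbhs (conj (oW c ac) (conj cz Wz))).
      have nW' := smooth_at_cont (smooth_at_snd (s, z)) nW.
      by apply: filterS3 np ns nW' => p dp sp [cp Wp].
    by apply: smooth_atP => p Dp; have [_ _ _ dp] := Dp; have [_] := plot_chart (pD _ Dp) ac' dp.
have G'0 : G' 0 = o by rewrite /G' q0.
have [_ U10 Gj0] := HO1 _ D10; rewrite G'0 in U10 Gj0.
have Wo : W o by split=> //; rewrite Gj0 normr0.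
apply: filterS (qs e e_gt0) => rho [s [se Vs qE]].
have PhiE : Phi s o = G (rho *: ek) by rewrite /Phi Gj0 add0r /G' qE.
have Pp := iX.2 _ _ _ lf s o u se Wo Pu; rewrite PhiE in Pp.
have [A GA EA] := orbit_eq gP (PF (rho *: ek)) Pp.
have Drho : D0 (rho *: ek) by rewrite -qE; exact: qD.
have [_ rr] := D0A _ Drho.
have [fl fi ft] := inv_frame iP (PF (rho *: ek)).
have [ul ui ut] := fu.
have FR0 c : FR 0 c = u c.
  rewrite /= (cd_g0 cd) (push_ltrans1 (mM := mM))//; by rewrite -ut; exists c.
have ms := flow_msmooth lf se Wo.
(* The differential of [q] adds to [c] a multiple of k, [c0] at the start and [c1] at the end of the
   flow line, while the translation itself has identity differential. *)
have key c : exists c0 c1, A (c + c0 *: ek) = M (rho *: ek) c + c1 *: ek.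
  have [_ /(_ c)[c0 c0E]] := sq _ V00; have [_ /(_ c)[c1 c1E]] := sq _ Vs.
  exists c0, c1; apply: fi.
  have vc : u (c + c0 *: ek) = vel mM G' 0 c.
    rewrite velG'// c0E q0 (cd_vel cd)// (cd_M0 cd) -/(FR 0 (c + c0 *: ek)); exact: (esym (FR0 _)).
  have E1 : push mM (Phi s) o (u (c + c0 *: ek)) = vel mM G' (s *: ek) c.
    rewrite vc (@push_vel R _ _ _ _ mM mM (Phi s) _ G' 0 c o G'0 ms).
    have pV := pG' _ Vs.
    have nD : \forall z \near (0 : E), D1 z by exact: (open_nbhs_nbhs (conj oD1 D10)).
    have -> : vel mM (fun z => Phi s (G' z)) 0 c = vel mM (fun z => G' (z + s *: ek)) 0 c.
      by apply: eq_vel; apply: filterS nD => z Dz; rewrite /Phi; have [_ _ ->] := HO1 _ Dz.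
    have ssh : smooth_at (fun z : E => z + s *: ek) 0.
      by apply: smooth_at_add; [exact: smooth_at_id|exact: smooth_at_cst].
    have pV0 : plot mM G' (0 + s *: ek) by rewrite add0r.
    rewrite (@vel_comp R _ _ mM _ _ (fun z : E => z + s *: ek) G' 0 c ssh pV0) add0r.
    by have := @derive_shift_arg R _ _ id (s *: ek) 0 c; rewrite derive_id => ->.
  have E2 : FR (rho *: ek) (A (c + c0 *: ek)) = push mM (Phi s) o (u (c + c0 *: ek)).
    exact: (esym (congr1 (fun f => f (c + c0 *: ek)) EA)).
  rewrite E2 E1 velG'// c1E qE (cd_vel cd)//; congr (FR (rho *: ek) _).
  by rewrite addrC (cd_lin cd rr) (cd_ek cd rr) addrC.
have eta_kk c c' w w' : kperp w -> kperp w' -> eta (w + c *: ek) (w' + c' *: ek) = eta w w'.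
  move=> kw kw'; rewrite [w + _]addrC [w' + _]addrC etaDl !etaDr !(etaC w).
  have /= -> : eta ek ek = 0 := kperp_ek.
  rewrite /kperp /= in kw kw'.
  by rewrite kw kw' !(mulr0, add0r).
have kpl w c : kperp w -> kperp (w + c *: ek).
  by move=> kw; rewrite addrC; apply: kperp_lin => //; exact: kperp_ek.
have [c0 [c1 cE]] := key b; have [c0' [c1' cE']] := key b'.
have [_ _ _ A2 _] := GA.
have := A2 _ _ (kpl _ c0 kb) (kpl _ c0' kb'); rewrite cE cE' !eta_kk//; exact: (M_kperp cd bs).
Qed.

(** The Gram form is constant on the k-axis near 0, so its k-derivative, which is minus the defect,
    vanishes at 0. *)
Lemma skew_v0 b b' : kperp b -> kperp b' -> skew_defect v0 (th 0 b) (th 0 b') = 0.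
Proof.
move=> kb kb'; have r00 : `|0 : E| < r0 by rewrite normr0; exact: (cd_rad cd).
have [dF DE] := M_form_derive cd bs r00 kb kb'.
have nr : \forall rho \near (0 : R), `|rho *: ek| < r0.
  have n0 : nbhs ((0 : R) *: ek) [set z : E | `|z| < r0] by rewrite scale0r; exact: near_norm_lt.
  exact: (smooth_at_cont (smooth_line0 ek (0 : R)) n0).
have : 'D_ek (M_form (M := M) b b') 0 = 0.
  have := @derive_line R _ _ (M_form (M := M) b b') 0 ek 0; rewrite scale0r add0r => <-.
  rewrite (near_eq_derive (g := cst (eta b b'))) ?derive_cst//.
  apply: filterS2 nr (M_isometry_axis kb kb') => rho rr <-.
  by rewrite addr0 (M_formE cd bs).
by rewrite DE => /eqP; rewrite oppr_eq0 addrC => /eqP.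
Qed.

(* An element of aa is a multiple of v0 modulo hh: skewness for v0 comes from the
   flow of the field, and for hh from the Ad(H)-invariance of the inner product. *)
Lemma skew_from_field v w z : aa v -> bb w -> bb z ->
  eta (kap (br v w)) (kap z) = - eta (kap w) (kap (br v z)).
Proof.
move=> [kv [c vc]] bw bz; have [kw kpw] := bw; have [kz kpz] := bz.
have r00 : `|0 : E| < r0 by rewrite normr0; exact: (cd_rad cd).
have [kv0 v0k] := cd_v0 cd; have tk := tangent_subspace mK (1%g : K).
have v0b : bb v0 := line_hyp (v0_aa cd).
(* The vector [th 0 (kap w')] has the same image as [w'] under [kap]; [skew_v0] is about vectors of
   this form, and the difference lies in [hh]. *)
have key w' : bb w' -> let w1 := th 0 (kap w') in [/\ bb w1, kk w1, kap w1 = kap w' & hh (w' - w1)].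
  move=> [kw' kpw'] w1; have [kw1 w1E] := cd_th cd (kap w') r00.
  have e1 : kap w1 = kap w' by rewrite -w1E (cd_M0 cd).
  split=> //; first by split=> //; rewrite e1.
  by apply/(ad_eq ad) => //; rewrite e1.
have hbb x : hh x -> bb x by move=> hx; exact: (line_hyp (bot_line ad hx)).
have hk x : hh x -> kap x = 0.
  by move=> hx; have [_ bt _ Kr _] := ad; apply/Kr => //; exact: bt.
(* The bracket with [x] in [hh] is handled by exchanging roles: [skew_hh] for [x] and [v0] applies,
   and its second term vanishes because [kap v0] is k, orthogonal to k^perp. *)
have hz x y : hh x -> bb y -> eta (kap (br v0 x)) (kap y) = 0.
  move=> hx [ky kpy]; have kx := hh_sub H_lie hx; have by' : bb y by [].
  have := skew_hh hx v0b by'; rewrite /skew_defect v0k.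
  have [_ kb] := bs (hbb _ hx) by'; rewrite (_ : eta ek _ = 0)//.
  rewrite addr0 => e0; rewrite lie_bracketC.
  have -> : kap (- br x v0) = - kap (br x v0).
    by have [_ _ L _ _] := ad; rewrite -scaleN1r (adZ ad) ?scaleN1r//; exact: (lie_bracket_tangent K_lie).
  by rewrite -scaleN1r etaZl e0 mulr0.
have s0 : skew_defect v0 w z = 0.
  have [bw1 kw1 ew1 hw1] := key _ bw; have [bz1 kz1 ez1 hz1] := key _ bz.
  set w1 := th 0 (kap w) in bw1 kw1 ew1 hw1; set z1 := th 0 (kap z) in bz1 kz1 ez1 hz1.
  have brE x x1 y : kk x1 -> kk x -> hh (x - x1) -> bb y ->
      eta (kap (br v0 x)) (kap y) = eta (kap (br v0 x1)) (kap y).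
    move=> kx1 kx hx by'; have -> : x = 1 *: x1 + (x - x1) by rewrite scale1r addrC subrK.
    rewrite br_kap_lin//; last exact: (subB tk).
    by rewrite etaDl mul1r (hz (x - x1))// addr0.
  have := skew_v0 kpw kpz; rewrite -/w1 -/z1 /skew_defect ez1 ew1 => <-.
  by rewrite (brE w w1 z)// !(etaC (kap w)) (brE z z1 w).
have vE : v = c *: v0 + (v - c *: v0) by rewrite addrC subrK.
have hv : hh (v - c *: v0).
  apply/(ad_eq ad) => //; first exact: (subZ _ tk).
  by rewrite (adZ ad)// v0k vc.
have kv' : kk (v - c *: v0) by exact: (hh_sub H_lie).
have := skew_hh hv bw bz; rewrite /skew_defect => e2.
rewrite /skew_defect in s0.
have -> : br v = br (c *: v0 + (v - c *: v0)) by rewrite -vE.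
rewrite !br_kap_linl// etaDl etaDr; move: s0 e2.
set a1 := eta _ _; set a2 := eta _ _; set a3 := eta _ _; set a4 := eta _ _.
move=> s0 e2; apply/eqP; rewrite -subr_eq0 opprK; apply/eqP.
have -> : c * a1 + a3 + (c * a2 + a4) = c * (a1 + a2) + (a3 + a4) by ring.
by rewrite s0 e2 mulr0 addr0.
Qed.

End WithField.
End SkewFromKundt.

Theorem theorem1 (R : realType) (N d m : nat) (K : groupType)
    (mK : manifold R N K) (H : set K) (mH : manifold R d {a : K | H a})
    (mM : manifold R m.+2 (homspace H))
    (K_lie : lie_group mK)
    (H_lie : lie_subgroup mK mH)
    (H_closed : mopen mK (~` H)%classic)
    (* mM is the quotient manifold structure of K/H *)
    (proj_submersion : submersion mK mM (@hproj K H))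
    (K_effective : effective H) :
  exists Phi : (homspace H -> set ('rV[R]_m.+2 -> tvec R (homspace H))) ->
               quadruple (tvec R K),
    [/\ forall P Q, invariant_GN mM P ->
          (restricts_to mK mH mM P Q <-> Q = Phi P),
        set_bij [set P | invariant_GN mM P]%classic
                [set Q | AdH_quadruple mK mH Q]%classic Phi &
        forall P, invariant_GN mM P ->
          (Kundt_structure mM P <->
           hyp_subalgebra mK (Phi P) /\ line_skew mK (Phi P))].
Proof.
exists (origin_quadruple mK mH mM); split.
- by move=> P Q [gP _]; exact: (origin_quadrupleP K_lie H_lie proj_submersion Q gP).
- split.
  + by move=> P iP; exact: (origin_AdH K_lie H_lie proj_submersion iP).
  + move=> P P' /set_mem iP /set_mem iP'.
    exact: (origin_inj K_lie H_lie proj_submersion iP iP').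
  + move=> Q AQ; have [P iP <-] := origin_surj K_lie H_lie proj_submersion AQ.
    by exists P.
move=> P iP; have gP := inv_GN iP; have Pu := origin_frame gP.
have fu := inv_frame iP Pu; have ad := dpi_adapted K_lie H_lie proj_submersion fu.
have EP : origin_quadruple mK mH mM P = Qof _ _ _ := erefl.
split=> [[_ [Nq nq [itg fields]]]|[bs ls]].
  have bs := bb_subalgebra K_lie H_lie proj_submersion iP Pu nq itg.
  split; first exact: bs.
  move=> a v w La Bv Bw.
  have [U0 [X [oU0 U0o iX Xl]]] := fields (hproj H 1%g).
  have [r0 [g [M [v0 [th cd]]]]] := product_coordinates K_lie H_lie proj_submersion fu 1%g.
  have sk := skew_from_field K_lie H_lie proj_submersion iP Pu bs nq oU0 U0o iX Xl cd La Bv Bw.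
  (* The form can be computed through [kap] only on vectors of the hyperplane, so the brackets must
     be known to lie there: the subalgebra condition enters before skewness can be read off. *)
  have Ba := line_hyp La; have [Bav Baw] := (bs _ _ Ba Bv, bs _ _ Ba Bw).
  by rewrite [LHS](Qof_form ad Bav Bw) [X in - X](Qof_form ad Bv Baw).
apply: (Kundt_of_conditions K_lie H_lie proj_submersion iP Pu) => [|v w z Lv Bw Bz]; first exact: bs.
have Bv := line_hyp Lv; have [Bvw Bvz] := (bs _ _ Bv Bw, bs _ _ Bv Bz).
have := ls v w z Lv Bw Bz.
by rewrite [X in X = _](Qof_form ad Bvw Bz) [X in - X](Qof_form ad Bw Bvz).
Qed.
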